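(* $\mathrm{REC}\subseteq\mathrm{TUR}$; that is, every recursive class function is Turing computable (computed by a set Turing machine). (Together with $\mathrm{TUR}\subseteq\mathrm{REC}$ this is the equality $\mathrm{TUR}=\mathrm{REC}$.)
   Context: Work in ZFC. $ON$ is the class of ordinals, ${}^{<\omega}ON$ the class of finite sequences of ordinals (indexed from $0$), $\langle\rangle$ the empty sequence, $^\frown$ concatenation. Lexicographic order: $\eta\prec\nu$ iff $\eta$ is a proper initial segment of $\nu$, or $\eta(i)<\nu(i)$ at the first index $i$ where they differ. Class functions may be partial. **Codes.** A basic code is a set $X\subseteq{}^{<\omega}ON$ with $\langle\rangle\in X$, closed under initial segments, such that for each $\bar\alpha\in X$ the class $\{\alpha:\bar\alpha^\frown\alpha\in X\}$ is downward closed in $ON$, and with no infinite branch. Put $decode_X(\nu)=\{decode_X(\nu^\frown\alpha): \nu^\frown\alpha\in X\}$ (recursion on the well-founded tree $X$) and $Decode(X)=decode_X(\langle\rangle)$. **Markings.** The tape is $T=\omega\times{}^{<\omega}ON$; the cell $(n,\bar\alpha)$ is identified with the sequence $n^\frown\bar\alpha$. Marks are $0,1,2,3,4,0^\star,1^\star,2^\star,3^\star,4^\star,\star,\star\star$ ($0$ = blank). A marking is a class function $X$ from $T$ to marks such that the class of cells with mark $\ne0$ is a set. It is well formed with $n\ge1$ components if $X_i=\{\bar\alpha: X(i^\frown\bar\alpha)\neq0\}$ is a basic code for $i<n$ and empty for $i\ge n$; then $Decode(X)=(Decode(X_0),\ldots,Decode(X_{n-1}))$, a $1$-tuple being identified with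 its entry. **Machines.** A set Turing machine $M$ is a finite set of tuples $(\ell,k,k',mv,\ell')$ with $\ell\in\omega$, $\ell'\in\omega\cup\{H\}$ ($H$ is the halt state), $k,k'$ marks, $mv\in\{s,z,u,+,u+,j+,j-\}$, with at most one tuple for each $(\ell,k)$. Its run on a well formed marking $X$ is a sequence of configurations $(\alpha,\nu_\alpha,X_\alpha,\ell_\alpha)$ (time, head cell, marking, state), starting with $(0,0^\frown\langle\rangle,X,0)$. Successor step from $\gamma$ to $\gamma+1$: if $(\ell_\gamma,X_\gamma(\nu_\gamma),k',mv,\ell')\in M$, then $X_{\gamma+1}$ equals $X_\gamma$ except $X_{\gamma+1}(\nu_\gamma)=k'$, $\ell_{\gamma+1}=\ell'$, and if $\nu_\gamma=(\alpha_0,\ldots,\alpha_s)$ then $\nu_{\gamma+1}$ is: $\nu_\gamma$ for $s$; $(\alpha_0,\ldots,\alpha_s,0)$ for $z$; $(\alpha_0,\ldots,\alpha_{s-1})$ for $u$; $(\alpha_0,\ldots,\alpha_s+1)$ for $+$; $(\alpha_0,\ldots,\alpha_{s-1}+1)$ for $u+$; $(\alpha_0+1,\alpha_1,\ldots,\alpha_s)$ for $j+$; $(\alpha_0-1,\alpha_1,\ldots,\alpha_s)$ for $j-$, except that if $\alpha_0=0$ the machine halts (state $H$, head unmoved). If there is no applicable tuple or the move is not possible, the next configuration is undefined. At a limit $\beta$: $X_\beta$ is the pointwise limit (each cell's mark must be eventually constant below $\beta$); $\nu_\beta$ is the $\preceq$-least $\eta\in T$ such that $\nu_\gamma\preceq\eta$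 for cofinally many $\gamma<\beta$; $\ell_\beta$ is the least state occurring cofinally below $\beta$; if any of these does not exist, the configuration is undefined. The run stops at the first $\alpha^*$ with $\ell_{\alpha^*}=H$. $M(X)=Y$ means such $\alpha^*$ exists, $Y=X_{\alpha^*}$ is well formed, and $\nu_{\alpha^*}=0^\frown\langle\rangle$; otherwise $M(X)$ is undefined. **TUR.** For a set $x$ and a bijection $f$ of $trcl(x)$ (transitive closure) with an ordinal, the code of $x$ induced by $f$ is the basic code $X$ with labelling $t:X\to trcl(\{x\})$ such that $t(\langle\rangle)=x$ and, for $\nu\in X$, $\nu^\frown\alpha\in X$ iff $\alpha$ is less than the order type of $t(\nu)$ under the order given by $f$, in which case $t(\nu^\frown\alpha)$ is the $\alpha$-th element of $t(\nu)$ in that order. A canonical code of $(x_0,\ldots,x_{n-1})$ is a $\{0,1\}$-valued marking with $n$ components whose $i$-th component is the code of $x_i$ induced by some such $f_i$. For a machine $M$ and $n\ge1$, $F_M$ is the partial class function on $V^n$ with $F_M(\bar x)=y$ iff for every canonical code $\bar z$ of $\bar x$, $M(\bar z)$ is defined, has one component, and $Decode(M(\bar z))=y$. $\mathrm{TUR}$ is the collection of all such $F_M$; its elements are called Turing computable. **REC.** For a set $x$, $woo(x)$ is the set of bijections from $x$ onto an ordinal. $\mathrm{REC}$ is the smallest collection of (partial) class functions containing the initial functions $F(x)=0$; $P_{n,i}(x_1,\ldots,x_n)=x_i$ ($1\le i\le n$); $F(x,y)=x\cup\{y\}$; $C(x,y,u,v)=u$ if $x\in y$ and $=v$ otherwise;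 and closed under: (1) Composition: from $G_1,G_2,H$ of $n+1$, $n+m+1$, $m$ variables form $G_1(H(x_1,\ldots,x_m),y_1,\ldots,y_n)$ and $G_2(x_1,\ldots,x_m,H(x_1,\ldots,x_m),y_1,\ldots,y_n)$. (2) Recursion: from $G$ of $n+2$ variables form $F(x_1,\ldots,x_n,z)=G(\bigcup\{F(x_1,\ldots,x_n,u): u\in z\},x_1,\ldots,x_n,z)$ (defined when all $F(x_1,\ldots,x_n,u)$, $u\in z$, and the value of $G$ are). (3) $\mu$-operator: from $G$ of $n+1$ variables form $F$ with $F(x_1,\ldots,x_n)=\alpha$ ($\alpha$ an ordinal) iff $G(x_1,\ldots,x_n,\alpha)=0$ and for all $\beta<\alpha$, $G(x_1,\ldots,x_n,\beta)$ is defined and $\ne0$; undefined if there is no such $\alpha$. (4) Random well orderings by ordinals: if $G$ has $2n$ variables and for all $x_1,\ldots,x_n,y$ the statement ''for all $f_i\in woo(x_i)$ ($i\le n$), $G(x_1,\ldots,x_n,f_1,\ldots,f_n)=y$'' holds iff ''there exist $f_i\in woo(x_i)$ ($i\le n$) with $G(x_1,\ldots,x_n,f_1,\ldots,f_n)=y$'' holds, form $F$ with $F(x_1,\ldots,x_n)=y$ iff there exist $f_i\in woo(x_i)$ with $G(x_1,\ldots,x_n,f_1,\ldots,f_n)=y$. *)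

(* Defs.v *)
From Stdlib Require List.
From mathcomp Require Import all_boot.

Set Implicit Arguments.
Unset Strict Implicit.
Unset Printing Implicit Defensive.

(* Classes are predicates on the carrier, so the axiom of replacement (which,
   stated for partial relations, subsumes separation) ranges over all of
   them. *)
Record zfc_universe := ZfcUniverse {
  carrier :> Type;
  elem : carrier -> carrier -> Prop;
  empty : carrier;
  upair : carrier -> carrier -> carrier;
  union : carrier -> carrier;
  power : carrier -> carrier;
  extensionality : forall x y, (forall z, elem z x <-> elem z y) -> x = y;
  foundation : forall x, (exists y, elem y x) ->
    exists y, elem y x /\ forall z, elem z y -> ~ elem z x;
  emptyP : forall z, ~ elem z empty;
  upairP : forall x y z, elem z (upair x y) <-> z = x \/ z = y;
  unionP : forall x z, elem z (union x) <-> exists y, elem z y /\ elem y x;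
  powerP : forall x z, elem z (power x) <-> forall w, elem w z -> elem w x;
  infinity : exists x, elem empty x /\
    forall y, elem y x -> elem (union (upair y (upair y y))) x;
  replacement : forall (a : carrier) (R : carrier -> carrier -> Prop),
    (forall x y z, elem x a -> R x y -> R x z -> y = z) ->
    exists b, forall y, elem y b <-> exists x, elem x a /\ R x y;
  choice_axiom : forall a,
    (forall x, elem x a -> exists z, elem z x) ->
    (forall x y z, elem x a -> elem y a -> elem z x -> elem z y -> x = y) ->
    exists c, forall x, elem x a -> exists! z, elem z x /\ elem z c
}.

Arguments elem {z} _ _ : rename.
Arguments empty {z} : rename.
Notation "x ∈ y" := (elem x y) (at level 70, no associativity).

Section Sets.
Variable U : zfc_universe.
Implicit Types x y z f p : U.

Definition adjoin x y : U := union (upair x (upair y y)).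
Definition kpair x y : U := upair (upair x x) (upair x y).

Definition transitive_set x : Prop := forall y z, z ∈ y -> y ∈ x -> z ∈ x.

Definition is_trcl x (t : U) : Prop :=
  [/\ transitive_set t, (forall y, y ∈ x -> y ∈ t) &
      forall s : U, transitive_set s -> (forall y, y ∈ x -> y ∈ s) ->
        forall y, y ∈ t -> y ∈ s].

(* Well-foundedness of membership on [x] comes from foundation. *)
Definition ordinal x : Prop :=
  transitive_set x /\ forall y z, y ∈ x -> z ∈ x -> [\/ y ∈ z, y = z | z ∈ y].

Definition ON : Type := {x : U | ordinal x}.
Implicit Types a b : ON.

Definition olt a b : Prop := sval a ∈ sval b.
Definition ole a b : Prop := olt a b \/ a = b.

Lemma ordinal_empty : ordinal (@empty U).
Proof. by split=> [y z _ /emptyP|y z /emptyP]. Qed.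

Lemma adjoinP x y z : z ∈ adjoin x y <-> z ∈ x \/ z = y.
Proof.
split=> [/unionP[w [zw /upairP[wx|wy]]]|[zx|->]].
- by left; rewrite -wx.
- by right; move: zw; rewrite wy => /upairP[].
- by apply/unionP; exists x; split=> //; apply/upairP; left.
- by apply/unionP; exists (upair y y); split; apply/upairP; [left|right].
Qed.

Lemma ordinal_succ x : ordinal x -> ordinal (adjoin x x).
Proof.
case=> xtr xtot; split=> [y z zy|y z] /adjoinP.
- by case=> [yx|yx]; apply/adjoinP; left; [apply: xtr yx|rewrite -yx].
- case=> [yx|->] /adjoinP[zx|->]; first exact: xtot.
  + by constructor 1.
  + by constructor 3.
  + by constructor 2.
Qed.

Definition ozero : ON := exist _ _ ordinal_empty.
Definition osucc a : ON := exist _ _ (ordinal_succ (svalP a)).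
Definition onat (n : nat) : ON := iter n osucc ozero.
Definition olimit a : Prop :=
  olt ozero a /\ forall b, olt b a -> olt (osucc b) a.

(* [f] is a bijection from [x] onto an ordinal. *)
Definition woo x f : Prop := exists a,
  [/\ forall p, p ∈ f -> exists y z, [/\ y ∈ x, z ∈ sval a & p = kpair y z],
      forall y, y ∈ x -> exists! z, z ∈ sval a /\ kpair y z ∈ f &
      forall z, z ∈ sval a -> exists! y, y ∈ x /\ kpair y z ∈ f].

(* A class of objects that are not themselves elements of [U], such as finite
   sequences of ordinals, is a set when it injects into an element of [U]. *)
Definition is_set (T : Type) (P : T -> Prop) : Prop :=
  exists (s : U) (e : T -> U),
    (forall t, P t -> e t ∈ s) /\
    (forall t t', P t -> P t' -> e t = e t' -> t = t').

(* Strict lexicographic order on finite sequences of ordinals. *)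
Definition lex (s t : seq ON) : Prop :=
  (exists a u, t = s ++ a :: u) \/
  (exists r a b s' t', [/\ s = r ++ a :: s', t = r ++ b :: t' & olt a b]).
Definition lexe (s t : seq ON) : Prop := lex s t \/ s = t.

Definition basic_code (X : seq ON -> Prop) : Prop :=
  [/\ is_set X,
      X [::],
      forall s t, X (s ++ t) -> X s,
      forall s a b, X (rcons s a) -> olt b a -> X (rcons s b) &
      ~ exists h : nat -> ON, forall n, X (mkseq h n)].

Definition Decode (X : seq ON -> Prop) (y : U) : Prop :=
  exists d : seq ON -> U,
    (forall s, X s ->
       forall z, z ∈ d s <-> exists a, X (rcons s a) /\ z = d (rcons s a)) /\
    d [::] = y.

(* [e] lists the elements of [x] in the increasing order given by [f], in
   order type [a]. *)
Definition enumerates f x a (e : ON -> U) : Prop :=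
  [/\ forall b, olt b a -> e b ∈ x,
      forall y, y ∈ x -> exists b, olt b a /\ e b = y &
      forall b c, olt b c -> olt c a ->
        exists u v, [/\ kpair (e b) u ∈ f, kpair (e c) v ∈ f & u ∈ v]].

Definition induced_code x f (X : seq ON -> Prop) : Prop :=
  basic_code X /\
  exists t : seq ON -> U,
    t [::] = x /\
    forall s, X s -> exists a e,
      enumerates f (t s) a e /\
      forall b, (X (rcons s b) <-> olt b a) /\
                (olt b a -> t (rcons s b) = e b).

End Sets.

Inductive mark :=
  | mk0 | mk1 | mk2 | mk3 | mk4
  | mk0star | mk1star | mk2star | mk3star | mk4star
  | mkstar | mkstarstar.

(* The moves s, z, u, +, u+, j+, j-, in this order. *)
Inductive direction :=
  | mvS | mvZ | mvU | mvPlus | mvUPlus | mvJPlus | mvJMinus.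

(* [None] is the halt state. *)
Definition state := option nat.

Record instruction := Instruction {
  i_source : nat;
  i_read : mark;
  i_write : mark;
  i_move : direction;
  i_target : state
}.

Record machine := Machine {
  program :> list instruction;
  deterministic : forall i j, List.In i program -> List.In j program ->
    i_source i = i_source j -> i_read i = i_read j -> i = j
}.

Section Machines.
Variable U : zfc_universe.
Local Notation ON := (ON U).

Definition cell : Type := (nat * seq ON)%type.
Definition cell_seq (c : cell) : seq ON := onat U c.1 :: c.2.
Definition origin : cell := (0, [::]).

Definition tape := cell -> mark.
Implicit Types X Y : tape.

Definition component X (i : nat) : seq ON -> Prop :=
  fun s => X (i, s) <> mk0.

Definition well_formed (n : nat) X : Prop :=
  [/\ is_set U (fun c => X c <> mk0),
      0 < n,
      forall i, i < n -> basic_code (component X i) &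
      forall i, n <= i -> forall s, ~ component X i s].

Inductive moves : direction -> seq ON -> seq ON -> Prop :=
  | moves_s s : moves mvS s s
  | moves_z s : moves mvZ s (rcons s (ozero U))
  | moves_u s a : moves mvU (rcons s a) s
  | moves_plus s a : moves mvPlus (rcons s a) (rcons s (osucc a))
  | moves_uplus s a b :
      moves mvUPlus (rcons (rcons s a) b) (rcons s (osucc a))
  | moves_jplus a s : moves mvJPlus (a :: s) (osucc a :: s)
  | moves_jminus a s : moves mvJMinus (osucc a :: s) (a :: s).

Record config := Config {
  c_head : cell;
  c_tape : tape;
  c_state : state
}.

Definition initial X : config := Config origin X (Some 0).

(* A move off the tape, e.g. u at a cell (n, [::]), is not possible because no
   cell has the resulting sequence.  A halting j- still writes its mark. *)
Definition step (M : machine) (c c' : config) : Prop :=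
  exists i : instruction,
    [/\ List.In i M,
        c_state c = Some (i_source i) /\ c_tape c (c_head c) = i_read i,
        c_tape c' (c_head c) = i_write i,
        forall d, d <> c_head c -> c_tape c' d = c_tape c d &
        (i_move i = mvJMinus /\ (c_head c).1 = 0 /\
           c_head c' = c_head c /\ c_state c' = None) \/
        (moves (i_move i) (cell_seq (c_head c)) (cell_seq (c_head c')) /\
           c_state c' = i_target i)].

Definition cofinally (b : ON) (P : ON -> Prop) : Prop :=
  forall a, olt a b -> exists d, [/\ ole a d, olt d b & P d].

Definition limit_config (run : ON -> config) (b : ON) (c : config) : Prop :=
  [/\ forall d, exists a, olt a b /\
        forall g, ole a g -> olt g b -> c_tape (run g) d = c_tape c d,
      let below (e : cell) := cofinally b (fun g =>
        lexe (cell_seq (c_head (run g))) (cell_seq e)) in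
      below (c_head c) /\
      forall e, below e -> lexe (cell_seq (c_head c)) (cell_seq e) &
      let recurs (l : nat) := cofinally b (fun g =>
        c_state (run g) = Some l) in
      exists l, [/\ c_state c = Some l, recurs l &
                    forall l', recurs l' -> l <= l']].

(* The values of [run] at times [<= a] are the configurations of the run of [M]
   on [X]; the other values are irrelevant. *)
Definition is_run (M : machine) X (a : ON) (run : ON -> config) : Prop :=
  [/\ run (ozero U) = initial X,
      forall b, olt b a -> step M (run b) (run (osucc b)) &
      forall b, ole b a -> olimit b -> limit_config run b (run b)].

(* M(X) = Y.  There is no step from the halt state, so [a] is the first halting
   time. *)
Definition outputs (M : machine) X Y : Prop :=
  exists a run,
    [/\ is_run M X a run,
        c_state (run a) = None,
        c_tape (run a) = Y,
        c_head (run a) = origin &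
        exists m, well_formed m Y].

Definition canonical_code n (x : n.-tuple U) (X : tape) : Prop :=
  [/\ well_formed n X,
      forall c, X c = mk0 \/ X c = mk1 &
      forall i : 'I_n, exists t f,
        [/\ is_trcl (tnth x i) t, woo t f &
            induced_code (tnth x i) f (component X i)]].

(* Partial class functions of [n] variables; [None] is "undefined". *)
Definition classfun (n : nat) : Type := n.-tuple U -> option U.

(* F_M(x) = y *)
Definition machine_value (M : machine) n (x : n.-tuple U) (y : U) : Prop :=
  forall X, canonical_code x X ->
    exists Y, [/\ outputs M X Y, well_formed 1 Y & Decode (component Y 0) y].

Definition TUR n (F : classfun n) : Prop :=
  0 < n /\
  exists M, forall x y, F x = Some y <-> machine_value M x y.

Definition all_woo n (x f : n.-tuple U) : Prop :=
  forall i, woo (tnth x i) (tnth f i).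

(* The class function produced by each rule is specified by its graph. *)
Inductive REC : forall n, classfun n -> Prop :=
  | REC_zero (F : classfun 1) :
      (forall x, F x = Some empty) -> REC F
  | REC_proj n (i : 'I_n) (F : classfun n) :
      (forall x, F x = Some (tnth x i)) -> REC F
  | REC_adjoin (F : classfun 2) :
      (forall x y, F [tuple x; y] = Some (adjoin x y)) -> REC F
  | REC_cond (F : classfun 4) :
      (forall x y u v, x ∈ y -> F [tuple x; y; u; v] = Some u) ->
      (forall x y u v, ~ x ∈ y -> F [tuple x; y; u; v] = Some v) ->
      REC F
  | REC_comp1 m n (G : classfun n.+1) (H : classfun m) (F : classfun (m + n)) :
      REC G -> REC H ->
      (forall (x : m.-tuple U) (y : n.-tuple U) z,
         F [tuple of x ++ y] = Some z <->
         exists h, H x = Some h /\ G [tuple of h :: y] = Some z) ->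
      REC F
  | REC_comp2 m n (G : classfun (m + n.+1)) (H : classfun m)
      (F : classfun (m + n)) :
      REC G -> REC H ->
      (forall (x : m.-tuple U) (y : n.-tuple U) z,
         F [tuple of x ++ y] = Some z <->
         exists h, H x = Some h /\ G [tuple of x ++ h :: y] = Some z) ->
      REC F
  | REC_rec n (G : classfun n.+2) (F : classfun n.+1) :
      REC G ->
      (forall (x : n.-tuple U) z y,
         F [tuple of rcons x z] = Some y <->
         exists w,
           [/\ forall u, u ∈ z -> exists v, F [tuple of rcons x u] = Some v,
               forall p, p ∈ w <-> exists u v,
                 [/\ u ∈ z, F [tuple of rcons x u] = Some v & p ∈ v] &
               G [tuple of w :: rcons x z] = Some y]) ->
      REC F
  | REC_mu n (G : classfun n.+1) (F : classfun n) :
      REC G ->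
      (forall (x : n.-tuple U) y,
         F x = Some y <->
         exists a : ON,
           [/\ y = sval a,
               G [tuple of rcons x (sval a)] = Some empty &
               forall b : ON, olt b a -> exists v,
                 G [tuple of rcons x (sval b)] = Some v /\ v <> empty]) ->
      REC F
  | REC_woo n (G : classfun (n + n)) (F : classfun n) :
      REC G ->
      (forall (x : n.-tuple U) y,
         (forall f : n.-tuple U, all_woo x f -> G [tuple of x ++ f] = Some y)
         <->
         (exists f : n.-tuple U, all_woo x f /\ G [tuple of x ++ f] = Some y)) ->
      (forall (x : n.-tuple U) y,
         F x = Some y <->
         exists f : n.-tuple U, all_woo x f /\ G [tuple of x ++ f] = Some y) ->
      REC F.

End Machines.

(* Main.v *)
(* REC is compiled into a small imperative language whose programs become set Turing
   machines.  Programs work on ordinal registers and on tables of bits indexed by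
   ordinals, kept in the components above the arguments.  Cells must converge at limit
   stages: table bits are only ever set, and a bit of a register is a growing history
   of marks whose last entry is the current value (false at limit lengths).
   Sets live in a heap whose table 0 lists the elements of each row; hash-consing
   gives equal sets equal canonical rows.  The input codes are read, and the value is
   written as a tree, by depth-first traversals; then the auxiliary components are
   erased.  A random well ordering is read off from the order in which the heap
   created the elements.
   Where F is undefined the machine does not halt; since every tuple has a canonical
   code, F_M is undefined as well. *)
From Stdlib Require Import ClassicalEpsilon FunctionalExtensionality PropExtensionality.
From Stdlib Require List.
From mathcomp Require Import all_boot zify.
Require Import Defs.

Set Implicit Arguments.
Unset Strict Implicit.
Unset Printing Implicit Defensive.

Notation lem := excluded_middle_informative.
Notation cid := constructive_indefinite_description.
Notation funext := functional_extensionality.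
Notation propext := propositional_extensionality.

(** The limit rules shape the design. A loop survives limit stages only if its head state has the
    least number in the loop and no iteration moves the head below the cell where it started.
    Commands on the memory therefore start and end at the origin, the least cell, and a position
    inside a tree is recorded by marks rather than by the head. A register that is reset cofinally
    often still needs a value at the limit. A register of value v is stored as the set of rows below
    v, and a reset rewrites all these rows; the bits that survive at the limit then form an initial
    segment, although an unknown one. Whatever must persist through limits is kept in registers that
    only grow or in tables, or is searched for again. Rows that carry a set are frozen once
    complete, so that the heap invariant passes to limits. The length of a run is not known in
    advance: the rule for loops builds a chain of configurations along the ordinals, and an endless
    loop is a chain along all of them. *)

Lemma predext (T : Type) (P Q : T -> Prop) : (forall x, P x <-> Q x) -> P = Q.
Proof. by move=> h; apply: funext => x; apply: propext. Qed.

Lemma neg_all (T : Type) (P : T -> Prop) : ~ (forall x, P x) -> exists x, ~ P x.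
Proof. by move=> h; apply: NNPP => h'; apply: h => x; apply: NNPP => hx; apply: h'; exists x. Qed.

Lemma ifT (P : Prop) (T : Type) (x y : T) : P -> (if lem P then x else y) = x.
Proof. by move=> p; case: (lem P). Qed.

Lemma ifF (P : Prop) (T : Type) (x y : T) : ~ P -> (if lem P then x else y) = y.
Proof. by move=> p; case: (lem P). Qed.

(** * Ordinals of the universe: suprema, recursion and iteration *)

Section Ordinals.
Variable U : zfc_universe.
Local Notation ON := (ON U).
Implicit Types (a b c : ON) (x y z : U).

Lemma on_eq a b : sval a = sval b -> a = b.
Proof. by case: a b => [x hx] [y hy] /= e; subst y; congr exist; apply: proof_irrelevance. Qed.

Lemma separation x (P : U -> Prop) : exists y, forall z, z ∈ y <-> z ∈ x /\ P z.
Proof.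
have [|y hy] := @replacement U x (fun u v => u = v /\ P u).
  by move=> u v w _ [<- _] [<-].
exists y => z; rewrite hy; split=> [[u [ux [<- pu]]]|[zx pz]] //.
by exists z.
Qed.

(** Foundation rules out the membership cycles of length two and three left over by trichotomy on
    [x]. *)
Lemma ordinal_elem x y : ordinal x -> y ∈ x -> ordinal y.
Proof.
move=> [tx lx] yx; split=> [u v vu uy|u v uy vy].
- have ux := tx _ _ uy yx; have vx := tx _ _ vu ux.
  case: (lx v y vx yx) => // [e|yv].
    have [|w [ws h]] := @foundation U (upair u v); first by exists u; apply/upairP; left.
    case/upairP: (ws) => e'; subst w; apply: False_ind.
      by apply: (h v) => //; apply/upairP; right.
    by apply: (h u); [rewrite e|apply/upairP; left].
  have hs : exists s : U, forall w, w ∈ s <-> [\/ w = u, w = v | w = y].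
    exists (adjoin (upair u v) y) => w; rewrite adjoinP upairP.
    by split=> [[[]|]|[]]; intuition; [constructor 1|constructor 2|constructor 3].
  case: hs => s hs.
  have [|w [ws h]] := @foundation U s; first by exists u; apply/hs; constructor 1.
  case/hs: (ws) => e; subst w; apply: False_ind.
  + by apply: (h v) => //; apply/hs; constructor 2.
  + by apply: (h y) => //; apply/hs; constructor 3.
  + by apply: (h u) => //; apply/hs; constructor 1.
- by apply: lx; [apply: tx uy yx|apply: tx vy yx].
Qed.

Definition omk x (h : ordinal x) : ON := exist _ x h.

Lemma olt_mem a x (h : x ∈ sval a) : exists b, sval b = x /\ olt b a.
Proof. by exists (omk (ordinal_elem (svalP a) h)). Qed.

Lemma olt_trans a b c : olt a b -> olt b c -> olt a c.
Proof. by move=> ab bc; case: (svalP c) => t _; apply: t ab bc. Qed.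

Lemma least (P : ON -> Prop) a : P a -> exists b, P b /\ forall c, olt c b -> ~ P c.
Proof.
move=> pa; have [s hs] := separation (sval a) (fun z => exists b, sval b = z /\ P b).
case: (classic (exists z, z ∈ s)) => [/foundation[z [/hs[za [b [e pb]]] h]]|n].
  exists b; split=> // c cb pc; apply: (h (sval c)); first by rewrite -e.
  by apply/hs; split; [rewrite -e in za; apply: (olt_trans cb za)|exists c].
exists a; split=> // c ca pc; apply: n; exists (sval c); apply/hs; split=> //.
by exists c.
Qed.

Lemma olt_wf : well_founded (@olt U).
Proof.
move=> a; apply: NNPP => na; have [b [nb h]] := @least (fun a => ~ Acc (@olt U) a) a na.
by apply: nb; constructor => c cb; apply: NNPP; apply: h.
Qed.

Lemma olt_ind (P : ON -> Prop) : (forall a, (forall b, olt b a -> P b) -> P a) -> forall a : ON, P a.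
Proof. by move=> h; apply: well_founded_ind olt_wf _ h. Qed.

Lemma olt_irr a : ~ olt a a.
Proof. by move: a; apply: olt_ind => a ih aa; exact: (ih _ aa aa). Qed.

Lemma olt_asym a b : olt a b -> ~ olt b a.
Proof. by move=> ab ba; apply: (@olt_irr a); apply: olt_trans ab ba. Qed.

Lemma on_ext a b : (forall c, olt c a <-> olt c b) -> a = b.
Proof.
move=> h; apply: on_eq; apply: extensionality => z.
by split=> /olt_mem[c [<- hc]]; apply/h.
Qed.

Lemma olt_total a b : [\/ olt a b, a = b | olt b a].
Proof.
elim/olt_ind: a b => a iha; elim/olt_ind => b ihb.
case: (classic (olt a b)) => [|nab]; first by constructor 1.
case: (classic (olt b a)) => [|nba]; first by constructor 3.
constructor 2; apply: on_ext => c; split=> hc.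
  by case: (iha c hc b) => // [e|bc]; [case: nba; rewrite -e|case: nba; apply: olt_trans bc hc].
case: (ihb c hc) => [ac|e|//]; last by case: nab; rewrite e.
by case: nab; apply: olt_trans ac hc.
Qed.

Lemma ole_refl a : ole a a. Proof. by right. Qed.
Hint Resolve ole_refl : core.

Lemma oltW a b : olt a b -> ole a b. Proof. by left. Qed.

Lemma ole_lt_trans a b c : ole a b -> olt b c -> olt a c.
Proof. by case=> [ab|->] //; apply: olt_trans. Qed.

Lemma olt_le_trans a b c : olt a b -> ole b c -> olt a c.
Proof. by move=> ab [bc|<-] //; apply: olt_trans ab bc. Qed.

Lemma ole_trans a b c : ole a b -> ole b c -> ole a c.
Proof. by move=> ab [bc|<-] //; left; apply: ole_lt_trans ab bc. Qed.

Lemma ole_anti a b : ole a b -> ole b a -> a = b.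
Proof. by case=> [ab|//] [ba|//]; case: (olt_asym ab). Qed.

Lemma oltNge a b : ~ olt a b <-> ole b a.
Proof.
split=> [n|[ba|->]]; [|exact: olt_asym|exact: olt_irr].
by case: (olt_total a b) => [//|->|]; [|left].
Qed.

Lemma ole_olt a b : ole a b \/ olt b a.
Proof. by case: (classic (olt b a)) => [|/oltNge]; [right|left]. Qed.

Lemma olt_neq a b : olt a b -> a <> b.
Proof. by move=> h e; move: h; rewrite e; apply: olt_irr. Qed.

Lemma oltS a b : olt a (osucc b) <-> ole a b.
Proof.
split=> [/adjoinP[h|h]|[h|->]]; [by left|by right; apply: on_eq| |].
- by apply/adjoinP; left.
- by apply/adjoinP; right.
Qed.

Lemma olt_succ a : olt a (osucc a). Proof. by apply/oltS. Qed.
Hint Resolve olt_succ : core.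

Lemma oleS a b : ole (osucc a) b <-> olt a b.
Proof.
split=> [h|h]; first exact: olt_le_trans (olt_succ a) h.
by apply/oltNge => /oltS h'; apply: (@olt_irr a); apply: olt_le_trans h h'.
Qed.

Lemma oltSS a b : olt (osucc a) (osucc b) <-> olt a b.
Proof. by rewrite oltS oleS. Qed.

Lemma osucc_inj a b : osucc a = osucc b -> a = b.
Proof.
move=> e; apply: ole_anti; apply/oltS; [rewrite -e|rewrite e]; exact: olt_succ.
Qed.

Lemma olt0 a : ~ olt a (ozero U). Proof. exact: emptyP. Qed.

Lemma ole0 a : ole (ozero U) a.
Proof. by apply/oltNge; apply: olt0. Qed.
Hint Resolve ole0 : core.

Lemma ole0E a : ole a (ozero U) -> a = ozero U.
Proof. by move=> h; apply: ole_anti. Qed.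

Lemma on_cases a : [\/ a = ozero U, exists b, a = osucc b | olimit a].
Proof.
case: (ole0 a) => [h|->]; last by constructor 1.
case: (classic (exists b, a = osucc b)) => [|n]; first by constructor 2.
constructor 3; split=> // b ba; case: (ole_olt a (osucc b)) => // h1.
by case: n; exists b; apply: ole_anti => //; apply/oleS.
Qed.

Lemma limit_nS a : ~ olimit (osucc a).
Proof. by move=> [_ /(_ a (olt_succ a))]; apply: olt_irr. Qed.

Lemma limit_n0 : ~ olimit (ozero U).
Proof. by case=> /olt_irr. Qed.

Lemma on_ind (P : ON -> Prop) : P (ozero U) -> (forall a, P a -> P (osucc a)) ->
  (forall l, olimit l -> (forall b, olt b l -> P b) -> P l) -> forall a, P a.
Proof.
move=> h0 hS hl; elim/olt_ind => a ih.
case: (on_cases a) => [->//|[b e]|h]; last exact: hl.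
by subst a; apply: hS; apply: ih.
Qed.

Definition is_lub (P : ON -> Prop) s :=
  (forall b, P b -> ole b s) /\ forall t, (forall b, P b -> ole b t) -> ole s t.

Lemma lub_uniq P s t : is_lub P s -> is_lub P t -> s = t.
Proof. by move=> [h1 h2] [h3 h4]; apply: ole_anti; [apply: h2|apply: h4]. Qed.

(** By replacement the values form a set of ordinals, and its union is an ordinal above all of them.
    The relation may be partial. *)
Lemma bounded_rel a (R : ON -> ON -> Prop) :
  (forall b c d, olt b a -> R b c -> R b d -> c = d) ->
  exists s, forall b c, olt b a -> R b c -> ole c s.
Proof.
move=> fR.
have [|u hu] := @replacement U (sval a) (fun x y => exists b c, [/\ sval b = x, sval c = y & R b c]).
  move=> x y z xa [b [c [eb ec rb]]] [b' [c' [eb' ec' rb']]].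
  have e : b = b' by apply: on_eq; rewrite eb eb'.
  subst b' x; rewrite -ec -ec'; congr (sval _); exact: fR rb rb'.
have hU : forall y, y ∈ u -> ordinal y.
  by move=> y /hu[x [_ [b [c [_ <- _]]]]]; apply: svalP.
have oU : ordinal (union u).
  split=> [y z zy /unionP[w [yw wu]]|y z /unionP[w [yw wu]] /unionP[w' [zw' wu']]].
    apply/unionP; exists w; split=> //.
    by case: (hU w wu) => t _; apply: t zy yw.
  have oy := ordinal_elem (hU _ wu) yw; have oz := ordinal_elem (hU _ wu') zw'.
  case: (olt_total (omk oy) (omk oz)) => h; [constructor 1|constructor 2|constructor 3] => //.
  by have := f_equal sval h.
exists (omk oU) => b c ba rbc; apply/oltNge => h.
apply: (@olt_irr (omk oU)); apply/unionP; exists (sval c); split=> //.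
by apply/hu; exists (sval b); split=> //; exists b, c.
Qed.

Lemma lub_ex (P : ON -> Prop) r : (forall b, P b -> ole b r) -> exists s, is_lub P s.
Proof.
move=> /(least (P := fun s => forall b, P b -> ole b s))[t [ht hm]].
by exists t; split=> // u hu; apply/oltNge => /hm.
Qed.

Lemma sup_ex a (f : ON -> ON) : exists s, is_lub (fun c => exists b, olt b a /\ c = f b) s.
Proof.
have [|s hs] := @bounded_rel a (fun b c => c = f b); first by move=> b c d _ -> ->.
by apply: (@lub_ex _ s) => c [b [ba e]]; apply: hs ba e.
Qed.

Definition sup a f : ON := epsilon (inhabits (ozero U)) (is_lub (fun c => exists b, olt b a /\ c = f b)).

Lemma supP a f : is_lub (fun c => exists b, olt b a /\ c = f b) (sup a f).
Proof. exact: epsilon_spec (sup_ex a f). Qed.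

Lemma le_sup a f b : olt b a -> ole (f b) (sup a f).
Proof. by move=> h; case: (supP a f) => + _; apply; exists b. Qed.

Lemma sup_le a f s : (forall b, olt b a -> ole (f b) s) -> ole (sup a f) s.
Proof. by move=> h; case: (supP a f) => _; apply=> c [b [ba ->]]; apply: h. Qed.

Lemma lt_sup a f c : olt c (sup a f) -> exists b, olt b a /\ olt c (f b).
Proof.
move=> h; apply: NNPP => n; apply: (@olt_irr c); apply: (olt_le_trans h).
apply: sup_le => b ba; apply/oltNge => h'; apply: n; by exists b.
Qed.

Lemma eq_sup a f g : (forall b, olt b a -> f b = g b) -> sup a f = sup a g.
Proof.
move=> h; apply: ole_anti; apply: sup_le => b ba; first by rewrite h //; apply: le_sup.
by rewrite -h //; apply: le_sup.
Qed.

Lemma sup_id l : olimit l -> sup l id = l.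
Proof.
move=> [_ hl]; apply: ole_anti; first by apply: sup_le => b /oltW.
apply/oltNge => h; have := le_sup id (hl _ h); rewrite oleS; exact: olt_irr.
Qed.

Lemma sup_lub a f s : is_lub (fun c => exists b, olt b a /\ c = f b) s -> s = sup a f.
Proof. by move=> h; apply: lub_uniq h (supP a f). Qed.

(** Burali-Forti: replacement along the inverse of an injective [f] would collect all ordinals into
    a set. *)
Lemma no_inj x (f : ON -> U) : (forall a, f a ∈ x) -> ~ (forall a b, f a = f b -> a = b).
Proof.
move=> fx fi.
have [|u hu] := @replacement U x (fun y z => exists a, f a = y /\ sval a = z).
  by move=> y z w _ [a [ea <-]] [b [eb <-]]; rewrite (fi a b) // ea eb.
have au a : sval a ∈ u by apply/hu; exists (f a); split=> //; exists a.
have ou : ordinal u.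
  split=> [y z zy /hu[w [_ [a [_ ea]]]]|y z /hu[w [_ [a [_ <-]]]] /hu[w' [_ [b [_ <-]]]]].
    rewrite -ea in zy; by have [b [<- _]] := olt_mem zy.
  by case: (olt_total a b) => [h|->|h]; [constructor 1|constructor 2|constructor 3].
exact: (@olt_irr (omk ou) (au (omk ou))).
Qed.

(** Recursion in which a step is a relation that may have no solution; the conclusion speaks only of
    stages where one exists. By the first hypothesis [P a] reads [f] only below [a], so the default
    [s0] used elsewhere does no harm. *)
Lemma wf_rec (S : Type) (s0 : S) (P : ON -> (ON -> S) -> S -> Prop) :
  (forall a f g s, (forall b, olt b a -> f b = g b) -> P a f s -> P a g s) ->
  exists f : ON -> S, forall a, (exists s, P a f s) -> P a f (f a).
Proof.
move=> ext.
pose F a (r : forall b, olt b a -> S) : S :=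
  epsilon (inhabits s0) (P a (fun b => match lem (olt b a) with
    left h => r b h | _ => s0 end)).
pose f := Fix olt_wf (fun _ => S) F.
have fE a : f a = epsilon (inhabits s0) (P a (fun b => if lem (olt b a) then f b else s0)).
  rewrite {1}/f Fix_eq; last first.
    move=> b r r' h; rewrite /F; congr epsilon; congr P.
    by apply: funext => c; case: lem.
  rewrite /F; congr epsilon; congr P.
  by apply: funext => c; case: lem.
exists f => a [s hs].
have e b : olt b a -> f b = (if lem (olt b a) then f b else s0).
  by case: lem.
rewrite (fE a); apply: (ext a (fun b => if lem (olt b a) then f b else s0)).
  by move=> b h; rewrite -e.
apply: epsilon_spec; exists s; exact: ext e hs.
Qed.

(** Dependent choice along the ordinals: the ability to prolong a chain at successors and limits is
    turned into one whole chain. [dom] is an initial segment, in the uses either the ordinals up to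
    a bound or all of [ON], so that terminating and endless loops are treated together. *)
Lemma tchain (S : Type) (E : S -> S -> Prop) (I : ON -> S -> Prop) (dom : ON -> Prop) (s0 : S) :
  (forall r s t, E r s -> E s t -> E r t) ->
  (forall a b, ole a b -> dom b -> dom a) ->
  I (ozero U) s0 ->
  (forall b s, dom (osucc b) -> I b s -> exists s', E s s' /\ I (osucc b) s') ->
  (forall l f, dom l -> olimit l -> (forall b, olt b l -> I b (f b)) ->
     (forall b c, olt b c -> olt c l -> E (f b) (f c)) ->
     exists s', (forall b, olt b l -> E (f b) s') /\ I l s') ->
  exists f : ON -> S, [/\ f (ozero U) = s0, forall b, dom b -> I b (f b) &
    forall b c, olt b c -> dom c -> E (f b) (f c)].
Proof.
move=> tr dn h0 hS hl.
have [|f hf] := @wf_rec S s0 (fun a f s => [/\ I a s, forall b, olt b a -> E (f b) s & a = ozero U -> s = s0]).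
  by move=> a f g s e [h1 h2 h3]; split=> // b ba; rewrite -e //; apply: h2.
have main a : dom a -> [/\ I a (f a), forall b, olt b a -> E (f b) (f a) & a = ozero U -> f a = s0].
  elim/olt_ind: a => a ih da; apply: hf.
  have ih' b : olt b a -> [/\ I b (f b), forall c, olt c b -> E (f c) (f b) & b = ozero U -> f b = s0].
    by move=> ba; apply: ih => //; apply: dn da; left.
  case: (on_cases a) => [e|[b e]|la].
  - by exists s0; split=> //; [rewrite e|move=> b; rewrite e => /olt0].
  - subst a; have [ib eb _] := ih' b (olt_succ b).
    have [s [es Is]] := hS _ _ da ib; exists s; split=> //.
      by move=> c /oltS[cb|->] //; apply: tr es; apply: eb.
    by move=> e; have := olt_succ b; rewrite e => /olt0.
  - have [||s [es Is]] := hl a f da la; first by move=> b /ih'[].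
      by move=> b c bc ca; case: (ih' c ca) => _ + _; apply.
    by exists s; split=> // e; subst a; case: (limit_n0 la).
exists f; split.
- case: (classic (dom (ozero U))) => [/main[_ _]|n]; first exact.
  have [|_ _] := hf (ozero U); last exact.
  by exists s0; split=> // b /olt0.
- by move=> b /main[].
- by move=> b c bc /main[_ + _]; apply.
Qed.

Lemma iter_ex (x0 : ON) (g : ON -> ON -> ON) : exists f : ON -> ON,
  [/\ f (ozero U) = x0, forall b, f (osucc b) = g b (f b) & forall l, olimit l -> f l = sup l f].
Proof.
have [|f hf] := @wf_rec ON x0 (fun a f s => [/\ a = ozero U -> s = x0,
   forall b, a = osucc b -> s = g b (f b) & olimit a -> s = sup a f]).
  move=> a f h s e [h1 h2 h3]; split=> // [b ab|la]; last by rewrite h3 //; apply: eq_sup.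
  by rewrite -e ?ab //; apply: h2.
exists f; split.
- have [|+ _ _] := hf (ozero U); last exact.
  exists x0; split=> //; last by move=> /limit_n0.
  by move=> b e; have := olt_succ b; rewrite -e => /olt0.
- move=> b; have [|_ + _] := hf (osucc b); last exact.
  exists (g b (f b)); split=> [e|c /osucc_inj ->|/limit_nS] //.
  by have := olt_succ b; rewrite e => /olt0.
- move=> l ll; have [|_ _] := hf l; last exact.
  exists (sup l f); split=> // [e|b e]; first by rewrite e in ll; case: (limit_n0 ll).
  by rewrite e in ll; case: (limit_nS ll).
Qed.

(** Iteration with suprema at limits. Sums, the pairing function and order types are instances. *)
Definition titer (x0 : ON) (g : ON -> ON -> ON) : ON -> ON := proj1_sig (cid _ (iter_ex x0 g)).

Lemma titer0 (x0 : ON) g : titer x0 g (ozero U) = x0.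
Proof. by case: (proj2_sig (cid _ (iter_ex x0 g))). Qed.
Lemma titerS (x0 : ON) g b : titer x0 g (osucc b) = g b (titer x0 g b).
Proof. by case: (proj2_sig (cid _ (iter_ex x0 g))) => _ + _; apply. Qed.
Lemma titerL (x0 : ON) g l : olimit l -> titer x0 g l = sup l (titer x0 g).
Proof. by case: (proj2_sig (cid _ (iter_ex x0 g))) => _ _; apply. Qed.

Lemma titer_mono (x0 : ON) g : (forall b (x : ON), ole x (g b x)) ->
  forall a b, ole a b -> ole (titer x0 g a) (titer x0 g b).
Proof.
move=> hg a b; elim/on_ind: b => [|b ih|l ll ih].
- by move=> /ole0E ->.
- case=> [/oltS /ih h|->] //; rewrite titerS; exact: ole_trans h (hg _ _).
- by case=> [h|->] //; rewrite (titerL _ _ ll); apply: le_sup.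
Qed.

Lemma titer_smono (x0 : ON) g : (forall b (x : ON), olt x (g b x)) ->
  forall a b, olt a b -> olt (titer x0 g a) (titer x0 g b).
Proof.
move=> hg a b ab; apply: (@olt_le_trans _ (titer x0 g (osucc a))); first by rewrite titerS.
by apply: titer_mono; [move=> *; left|apply/oleS].
Qed.

Lemma smono_ge (f : ON -> ON) : (forall a b, olt a b -> olt (f a) (f b)) -> forall a, ole a (f a).
Proof.
move=> h; elim/olt_ind => a ih; apply/oltNge => fa.
by apply: (@olt_irr (f (f a))); apply: (olt_le_trans (h _ _ fa)); apply: ih.
Qed.

(** Induction on the room left below the bound [N]. Applied to the rank of the mark in a cell, this
    gives the convergence of tapes. *)
Lemma nat_stab l (f : ON -> nat) N : olimit l ->
  (forall a b, olt a b -> olt b l -> f a <= f b) -> (forall a, f a <= N) ->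
  exists a, olt a l /\ forall b, ole a b -> olt b l -> f b = f a.
Proof.
move=> [l0 hl] mono bd.
suff: forall k, (exists a, olt a l /\ N - f a <= k) -> exists a, olt a l /\ forall b, ole a b -> olt b l -> f b = f a.
  by move=> /(_ N); apply; exists (ozero U); split=> //; lia.
elim=> [|k ih] [a [al ha]].
  exists a; split=> // b [ab|<-] // bl; have := mono _ _ ab bl; have := bd b; have := bd a; lia.
case: (classic (forall b, ole a b -> olt b l -> f b = f a)) => [|/neg_all[b hb]]; first by exists a.
have [ab [bl fb]] : ole a b /\ olt b l /\ f b <> f a.
  by split; [apply: NNPP|split; [apply: NNPP|]] => n; apply: hb.
apply: ih; exists b; split=> //.
by case: ab => [ab|e]; [have := mono _ _ ab bl; have := bd b; lia|rewrite e in fb].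
Qed.

End Ordinals.

#[global] Hint Resolve ole_refl olt_succ ole0 : core.

(** * Lexicographic order of cells, and the moves *)

Section Lex.
Variable U : zfc_universe.
Local Notation ON := (ON U).
Local Notation cell := (cell U).

(** The order [lexe] by recursion on the sequences, which is easier to compute with. *)
Fixpoint lexr (s t : seq ON) : Prop :=
  match s, t with
  | [::], _ => True
  | _ :: _, [::] => False
  | x :: s', y :: t' => olt x y \/ x = y /\ lexr s' t'
  end.

Lemma lexr_refl s : lexr s s.
Proof. by elim: s => //= x s ih; right. Qed.

Lemma lexr_cat s t : lexr s (s ++ t).
Proof. by elim: s => //= x s ih; right. Qed.

Lemma lexeP s t : lexe s t <-> lexr s t.
Proof.
split=> [[[[a [u ->]]|[r [a [b [s' [t' [-> -> ab]]]]]]]|->]|].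
- exact: lexr_cat.
- by elim: r => [|x r ih] /=; [left|right].
- exact: lexr_refl.
elim: s t => [|x s ih] [|y t] //=; first by right.
- by left; left; exists y, t.
case=> [xy|[<- /ih[[[a [u ->]]|[r [a [b [s' [t' [-> -> ab]]]]]]]|->]]].
- by left; right; exists [::], x, y, s, t.
- by left; left; exists a, u.
- by left; right; exists (x :: r), a, b, s', t'.
- by right.
Qed.

Lemma lexr_trans s t u : lexr s t -> lexr t u -> lexr s u.
Proof.
elim: s t u => [|x s ih] [|y t] [|z u] //= [xy|[-> st]] [yz|[<- tu]].
- by left; apply: olt_trans xy yz.
- by left.
- by left.
- by right; split=> //; apply: ih tu.
Qed.

Lemma lexr_anti s t : lexr s t -> lexr t s -> s = t.
Proof.
elim: s t => [|x s ih] [|y t] //= [xy|[-> st]] [yx|[e ts]] //.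
- by case: (olt_asym xy).
- by rewrite e in xy; case: (olt_irr xy).
- by case: (olt_irr yx).
- by rewrite (ih t).
Qed.

Lemma lexr_rcons s a b : ole a b -> lexr (rcons s a) (rcons s b).
Proof. by move=> ab; elim: s => [|x s ih] /=; [case: ab => [|->]; [left|right]|right]. Qed.

(** [rcons s l] is the supremum of the [rcons s b] with [b] below [l]: this is where a head that
    moves along siblings arrives at a limit. *)
Lemma lexr_lub s l t : olimit l -> (forall b, olt b l -> lexr (rcons s b) t) -> lexr (rcons s l) t.
Proof.
move=> [l0 hl]; elim: s t => [|x s ih] [|y t] /= h; try exact: (h _ l0).
  case: (olt_total l y) => [|->|yl]; [by left|by right|].
  have {h} [h|[h _]] := h _ (hl _ yl); first by case: (@olt_irr _ y); apply: olt_trans h.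
  by case: (@olt_irr _ y); rewrite -{2}h.
case: (h _ l0) => [xy|[xy _]]; first by left.
right; split=> //; apply: ih => b bl.
by case: (h _ bl) => [xy'|[_]] //; rewrite xy in xy'; case: (olt_irr xy').
Qed.

Lemma olt_onat n m : olt (onat U n) (onat U m) <-> n < m.
Proof.
have mono k : forall i, i < k -> olt (onat U i) (onat U k).
  elim: k => // k ih i; rewrite ltnS leq_eqVlt => /orP[/eqP->|/ih h] /=; first exact: olt_succ.
  by apply: olt_trans h _; apply: olt_succ.
split=> [h|]; last exact: mono.
rewrite ltnNge; apply/negP; rewrite leq_eqVlt => /orP[/eqP e|/mono h']; last exact: olt_asym h h'.
by rewrite e in h; exact: olt_irr h.
Qed.

Lemma onat_inj n m : onat U n = onat U m -> n = m.
Proof.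
move=> e; case: (ltngtP n m) => // h; have := proj2 (olt_onat _ _) h; rewrite e => h'.
  by case: (olt_irr h').
by case: (olt_irr h').
Qed.

Definition cle (e e' : cell) := lexe (cell_seq e) (cell_seq e').

Lemma cleE c s c' s' : cle (c, s) (c', s') <-> c < c' \/ c = c' /\ lexr s s'.
Proof.
rewrite /cle lexeP /= olt_onat.
by split=> [[|[/onat_inj]]|[|[->]]]; [left|right|left|right].
Qed.

Lemma cle_refl e : cle e e. Proof. by right. Qed.

Lemma cle_trans e1 e2 e3 : cle e1 e2 -> cle e2 e3 -> cle e1 e3.
Proof. by rewrite /cle !lexeP; apply: lexr_trans. Qed.

Lemma cell_seq_inj : injective (@cell_seq U).
Proof. by case=> c s [c' s'] [/onat_inj -> ->]. Qed.

Lemma cle_anti e1 e2 : cle e1 e2 -> cle e2 e1 -> e1 = e2.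
Proof. by rewrite /cle !lexeP => h h'; apply: cell_seq_inj; apply: lexr_anti. Qed.

Lemma cle_origin e : cle (origin U) e.
Proof. by case: e => c s; apply/cleE; case: c => [|c]; [right|left]. Qed.

Lemma cle_root c s : cle (c, [::]) (c, s).
Proof. by apply/cleE; right. Qed.

Lemma cle_add c s k : cle (c, s) (c + k, s).
Proof.
by apply/cleE; case: k => [|k]; [right; rewrite addn0; split=> //; apply: lexr_refl|left; lia].
Qed.

Lemma cle_cat c s t : cle (c, s) (c, s ++ t).
Proof. by apply/cleE; right; split=> //; apply: lexr_cat. Qed.

Lemma cle_rcons c s a b : ole a b -> cle (c, rcons s a) (c, rcons s b).
Proof. by move=> ab; apply/cleE; right; split=> //; apply: lexr_rcons. Qed.

Lemma cle_lub c s l e : olimit l -> (forall b, olt b l -> cle (c, rcons s b) e) -> cle (c, rcons s l) e.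
Proof.
move=> ll; case: e => c' t h; apply/cleE.
have /cleE[|[e _]] := h _ (proj1 ll); first by left.
right; split=> //; apply: lexr_lub => // b /h /cleE[|[]] //; lia.
Qed.

Lemma moves_inv mv (s t : seq ON) : moves mv s t -> match mv with
  | mvS => t = s
  | mvZ => t = rcons s (ozero U)
  | mvU => exists a, s = rcons t a
  | mvPlus => exists r a, s = rcons r a /\ t = rcons r (osucc a)
  | mvUPlus => exists r a b, s = rcons (rcons r a) b /\ t = rcons r (osucc a)
  | mvJPlus => exists a r, s = a :: r /\ t = osucc a :: r
  | mvJMinus => exists a r, s = osucc a :: r /\ t = a :: r
  end.
Proof.
case=> // {s t} [s a|s a|s a b|a s|a s].
- by exists a.
- by exists s, a.
- by exists s, a, b.
- by exists a, s.
- by exists a, s.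
Qed.

Lemma moves_det mv (s t t' : seq ON) : moves mv s t -> moves mv s t' -> t = t'.
Proof.
move=> /moves_inv h /moves_inv; case: mv h.
- by move=> -> ->.
- by move=> -> ->.
- by move=> [a ->] [b /rcons_inj[]].
- by move=> [r [a [-> ->]]] [r' [b [/rcons_inj[-> ->] ->]]].
- by move=> [r [a [b [-> ->]]]] [r' [a' [b' [/rcons_inj[/rcons_inj[-> ->] _] ->]]]].
- by move=> [a [r [-> ->]]] [a' [r' [[-> ->] ->]]].
- by move=> [a [r [-> ->]]] [a' [r' [e ->]]]; case: e (e) => _ -> e; congr cons; apply: osucc_inj; case: e => e; apply: on_eq.
Qed.

End Lex.
#[global] Hint Resolve cle_refl cle_origin : core.

(** * Determinism of runs and their limit stages *)

Section Runs.
Variables (U : zfc_universe) (M : machine) (X0 : tape U).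
Local Notation ON := (ON U).
Local Notation cell := (cell U).
Local Notation tape := (tape U).
Local Notation config := (config U).
Implicit Types (c d : config).

Lemma config_eq c c' : c_head c = c_head c' -> c_tape c =1 c_tape c' -> c_state c = c_state c' -> c = c'.
Proof.
by case: c c' => [h X s] [h' X' s'] /= -> /funext -> ->.
Qed.

Lemma step_det c d d' : step M c d -> step M c d' -> d = d'.
Proof.
move=> [i [iM [es er] ew eo hc]] [j [jM [es' er'] ew' eo' hc']].
have e : i = j by apply: (deterministic iM jM); [move: es; rewrite es' => -[]|rewrite -er].
subst j.
(* An ordinary j- move never starts in component 0, so halting and moving exclude each other. *)
have nojm s : (c_head c).1 = 0 -> ~ moves mvJMinus (cell_seq (c_head c)) s.
  move=> c0 /moves_inv[a [r [e _]]]; have := f_equal (head (osucc a)) e.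
  by rewrite /= c0 => e'; have := olt_succ a; rewrite -e' => /olt0.
have [eh es2] : c_head d = c_head d' /\ c_state d = c_state d'.
  case: hc => [[mi [c0 [-> ->]]]|[mv ->]]; case: hc' => [[mi' [c0' [-> ->]]]|[mv' ->]] //.
  - by rewrite mi in mv'; case: (nojm _ c0 mv').
  - by rewrite mi' in mv; case: (nojm _ c0' mv).
  - by split=> //; apply: cell_seq_inj; apply: moves_det mv mv'.
apply: config_eq => // x; case: (classic (x = c_head c)) => [->|n]; last by rewrite eo // eo'.
by rewrite ew ew'.
Qed.

Lemma limit_det (run : ON -> config) b c c' : olt (ozero U) b -> limit_config run b c -> limit_config run b c' -> c = c'.
Proof.
move=> b0 [h1 [h2 h3] [l [h4 h5 h6]]] [h1' [h2' h3'] [l' [h4' h5' h6']]].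
apply: config_eq.
- by apply: cle_anti; [apply: h3|apply: h3'].
- move=> x; have [a [ab ha]] := h1 x; have [a' [ab' ha']] := h1' x.
  case: (ole_olt a a') => h; first by rewrite -(ha a') // (ha' a').
  by rewrite -(ha a) // (ha' a) //; left.
- by rewrite h4 h4'; congr Some; apply/eqP; rewrite eqn_leq h6 // h6'.
Qed.

Lemma cofinally_ext b (P Q : ON -> Prop) : (forall g, olt g b -> P g -> Q g) -> cofinally b P -> cofinally b Q.
Proof. by move=> h cP a /cP[d [ad db pd]]; exists d; split=> //; apply: h. Qed.

Lemma limit_ext (run run' : ON -> config) b c : (forall g, olt g b -> run g = run' g) ->
  limit_config run b c -> limit_config run' b c.
Proof.
move=> e [h1 [h2 h3] [l [h4 h5 h6]]]; split.
- move=> x; have [a [ab ha]] := h1 x; exists a; split=> // g ag gb; by rewrite -e // ha.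
- split; first by apply: cofinally_ext h2 => g gb; rewrite e.
  by move=> f hf; apply: h3; apply: cofinally_ext hf => g gb; rewrite e.
- exists l; split=> //; first by apply: cofinally_ext h5 => g gb; rewrite e.
  by move=> l' hl; apply: h6; apply: cofinally_ext hl => g gb; rewrite e.
Qed.

Lemma run_det a a' run run' b : is_run M X0 a run -> is_run M X0 a' run' -> ole b a -> ole b a' -> run b = run' b.
Proof.
move=> [z s l] [z' s' l']; move: b; apply: on_ind => [|b ih|b lb ih] ba ba'.
- by rewrite z z'.
- move/oleS: ba => ba; move/oleS: ba' => ba'.
  by apply: (@step_det (run b)); [apply: s|rewrite ih; [apply: s'|left|left]].
- apply: (@limit_det run b); [by case: lb|exact: l|].
  apply: (@limit_ext run') (l' b ba' lb) => g gb; symmetry.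
  by apply: ih => //; left; [apply: olt_le_trans ba|apply: olt_le_trans ba'].
Qed.

(** By [conf_det] the configuration at time [a] does not depend on the chosen run, so runs of any
    length can be used and prolonged. *)
Definition Conf a c := exists run, is_run M X0 a run /\ run a = c.

Lemma conf_det a c c' : Conf a c -> Conf a c' -> c = c'.
Proof. by move=> [r [h <-]] [r' [h' <-]]; apply: run_det h h' _ _. Qed.

Lemma is_run_le a b run : is_run M X0 a run -> ole b a -> is_run M X0 b run.
Proof.
move=> [z s l] ba; split=> // c h; first by apply: s; apply: olt_le_trans ba.
by apply: l; apply: ole_trans ba.
Qed.

Lemma conf_le a b c : Conf a c -> ole b a -> exists c', Conf b c'.
Proof. by move=> [r [h _]] ba; exists (r b), r; split=> //; apply: is_run_le ba. Qed.

Lemma conf0 : Conf (ozero U) (initial X0).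
Proof.
exists (fun _ => initial X0); split=> //; split=> // b; first by move=> /olt0.
by move=> /ole0E -> /limit_n0.
Qed.

Lemma confS a c c' : Conf a c -> step M c c' -> Conf (osucc a) c'.
Proof.
move=> [r [[z s l] e]] st.
pose r' g := if lem (g = osucc a) then c' else r g.
have e' g : ole g a -> r' g = r g.
  by move=> ga; rewrite /r' ifF // => eg; move: ga; rewrite eg => /oleS/olt_irr.
have rS : r' (osucc a) = c' by rewrite /r' ifT.
exists r'; split=> //; split; first by rewrite e'.
- move=> b /oltS[ba|->]; first by rewrite !e'; [apply: s|apply/oleS|left].
  by rewrite rS e' // e.
- move=> b ba lb; have ba' : ole b a.
    by case: ba => [/oltS|e2] //; rewrite e2 in lb; case: (limit_nS lb).
  rewrite e' //; apply: (@limit_ext r); last exact: l.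
  by move=> g gb; rewrite e' //; left; apply: olt_le_trans ba'.
Qed.

Definition the_run : ON -> config := fun g => epsilon (inhabits (initial X0)) (Conf g).

Lemma the_runE g c : Conf g c -> the_run g = c.
Proof. by move=> h; apply: (conf_det _ h); apply: (epsilon_spec (inhabits (initial X0)) (Conf g)); exists c. Qed.

(** The runs up to times below [l] agree with one another; [the_run] glues them together and [c] is
    put on top. *)
Lemma confL l c : olimit l -> (forall a, olt a l -> exists c, Conf a c) -> limit_config the_run l c -> Conf l c.
Proof.
move=> ll hc hl.
pose r g := if lem (g = l) then c else the_run g.
have e g : olt g l -> r g = the_run g.
  by move=> gl; rewrite /r ifF // => eg; move: gl; rewrite eg => /olt_irr.
have c2 g : olt g l -> Conf g (the_run g).
  by move=> /hc[d h]; rewrite (the_runE h).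
exists r; split; last by rewrite /r ifT.
split.
- rewrite e; [exact: the_runE conf0|by case: ll].
- move=> b bl; have sbl := proj2 ll _ bl; rewrite !e //.
  have [s [hs es]] := c2 _ sbl; rewrite -es.
  have <- : s b = the_run b by symmetry; apply: the_runE; exists s; split=> //; apply: is_run_le hs _; left.
  by case: hs => _ + _; apply.
- move=> b [bl|->] lb; last first.
    have -> : r l = c by rewrite /r ifT.
    by apply: (limit_ext _ hl) => g gl; rewrite e.
  rewrite e //; have [s [hs es]] := c2 _ bl; rewrite -es.
  apply: (@limit_ext s); last by case: hs => _ _; apply.
  move=> g gb; rewrite e; last exact: olt_trans bl.
  by symmetry; apply: the_runE; exists s; split=> //; apply: is_run_le hs _; left.
Qed.

(* [o] ranks the marks; along a computation ranks only grow, so that tapes converge. *)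
Definition tle (o : mark -> nat) X X' := forall d : cell, o (X d) <= o (X' d).

Lemma tle_refl o X : tle o X X. Proof. by move=> d. Qed.
Lemma tle_trans o X (Y Z : tape) : tle o X Y -> tle o Y Z -> tle o X Z.
Proof. by move=> h h' d; apply: leq_trans (h d) (h' d). Qed.

(** What the limit rules need to know of a stretch of the run: a lower bound for the states, one for
    the heads, and tapes squeezed between [X] and [X'], so that a cell on which these two agree is
    constant meanwhile. *)
Definition seg o n (lb : cell) a a' X X' := tle o X X' /\
  forall g, ole a g -> olt g a' -> exists d, [/\ Conf g d, exists l, c_state d = Some l /\ n <= l,
    cle lb (c_head d), tle o X (c_tape d) & tle o (c_tape d) X'].

Lemma seg_refl o n lb a X : seg o n lb a a X X.
Proof. by split=> [d|g h /(ole_lt_trans h) /olt_irr]. Qed.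

Lemma seg_trans o n lb lb' a b (c : ON) X Y (Z : tape) : cle lb lb' ->
  seg o n lb a b X Y -> seg o n lb' b c Y Z -> seg o n lb a c X Z.
Proof.
move=> hlb [h1 h2] [h3 h4]; split; first exact: tle_trans h1 h3.
move=> g ag gc; case: (ole_olt b g) => [bg|gb].
  have [d [k1 k2 k3 k4 k5]] := h4 g bg gc; exists d; split=> //.
    exact: cle_trans hlb k3.
  exact: tle_trans h1 k4.
have [d [k1 k2 k3 k4 k5]] := h2 g ag gb; exists d; split=> //.
exact: tle_trans k5 h3.
Qed.

Lemma seg_weak o n n' lb lb' a b X Y : n' <= n -> cle lb' lb -> seg o n lb a b X Y -> seg o n' lb' a b X Y.
Proof.
move=> nn hlb [h1 h2]; split=> // g ag gb; have [d [k1 [l [k2 k6]] k3 k4 k5]] := h2 g ag gb.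
by exists d; split=> //; [exists l; split=> //; lia|apply: cle_trans hlb k3].
Qed.

Definition limtape (l : ON) (Xs : ON -> tape) X :=
  forall d : cell, exists g, olt g l /\ forall g', ole g g' -> olt g' l -> Xs g' d = X d.

Lemma limtape_ex o l Xs : injective o -> (exists N, forall k, o k <= N) -> olimit l ->
  (forall b (c : ON), olt b c -> olt c l -> tle o (Xs b) (Xs c)) -> exists X, limtape l Xs X.
Proof.
move=> oi [N oN] ll h.
exists (fun d : cell => epsilon (inhabits mk0) (fun k => exists g, olt g l /\ forall g', ole g g' -> olt g' l -> Xs g' d = k)).
move=> d; apply: (epsilon_spec (inhabits mk0) (fun k => exists g, olt g l /\ forall g', ole g g' -> olt g' l -> Xs g' d = k)).
have [|g [gl hg]] := @nat_stab U l (fun g => o (Xs g d)) N ll _ (fun a => oN _).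
  by move=> b c bc cl; apply: h.
by exists (Xs g d), g; split=> // g' gg g'l; apply: oi; apply: hg.
Qed.

Lemma limtape_tle o l Xs X : (forall b (c : ON), olt b c -> olt c l -> tle o (Xs b) (Xs c)) -> limtape l Xs X ->
  forall b, olt b l -> tle o (Xs b) X.
Proof.
move=> h hX b bl d; have [g [gl hg]] := hX d.
case: (ole_olt g b) => gb; first by rewrite hg.
by rewrite -(hg g) //; apply: h gb gl d.
Qed.

(** At the times [ts b] the state is [n] and in between it is never smaller, so [n] is the limit
    state. From [ts b] on the heads stay above [hs b], so the limit head is the supremum of the
    [hs b]. The tapes are squeezed between the [Xs b]. *)
Lemma chain_limit o n k (ts : ON -> ON) (hs : ON -> cell) (Xs : ON -> tape) hl Xl :
  injective o -> olimit k ->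
  (forall b, olt b k -> Conf (ts b) (Config (hs b) (Xs b) (Some n))) ->
  (forall b (c : ON), olt b c -> olt c k -> seg o n (hs b) (ts b) (ts c) (Xs b) (Xs c)) ->
  (forall b (c : ON), olt b c -> olt c k -> ole (ts b) (ts c)) ->
  (forall b (c : ON), olt b c -> olt c k -> cle (hs b) (hs c)) ->
  (forall b, olt b k -> cle (hs b) hl) ->
  (forall e, (forall b, olt b k -> cle (hs b) e) -> cle hl e) ->
  limtape k Xs Xl ->
  let t := sup k ts in
  Conf t (Config hl Xl (Some n)) /\ forall b, olt b k -> seg o n (hs b) (ts b) t (Xs b) Xl.
Proof.
move=> oi lk hC hseg hts hhs hub hlub hX t.
have tX : forall b, olt b k -> tle o (Xs b) Xl.
  by apply: limtape_tle hX => b c bc ck; case: (hseg b c bc ck).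
(* The times may become stationary, since an index of the chain need not cost a step. Everything is
   then constant from there on and no limit of the run is taken. *)
case: (classic (exists b, olt b k /\ ts b = t)) => [[b [bk eb]]|nb].
  have stay (c : ON) : ole b c -> olt c k -> [/\ ts c = t, hs c = hs b & Xs c = Xs b].
    move=> bc ck; have e : ts c = t.
      apply: ole_anti; first exact: le_sup.
      by case: bc => [bc|<-]; [rewrite -eb; apply: hts|rewrite eb].
    have := hC _ ck; rewrite e -eb => /conf_det /(_ (hC _ bk))[-> ->]; split=> //.
  have eX : Xl = Xs b.
    apply: funext => d; have [g [gk hg]] := hX d.
    case: (ole_olt b g) => h; first by rewrite -(hg g) //; case: (stay _ h gk) => _ _ ->.
    by rewrite -(hg b) //; left.
  have eh : hl = hs b.
    apply: cle_anti; last exact: hub.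
    apply: hlub => c ck; case: (ole_olt b c) => h; last exact: hhs.
    by case: (stay _ h ck) => _ -> _; apply: cle_refl.
  rewrite eX eh; split; first by rewrite -eb; apply: hC.
  move=> c ck; case: (ole_olt b c) => h; last by rewrite -eb; apply: hseg.
  by case: (stay _ h ck) => -> -> ->; apply: seg_refl.
have tlt b : olt b k -> olt (ts b) t.
  by move=> bk; case: (le_sup ts bk) => // e; case: nb; exists b.
have lt : olimit t.
  split; first by apply: ole_lt_trans (ole0 _) (tlt _ (proj1 lk)).
  by move=> g /lt_sup[b [bk gb]]; apply: ole_lt_trans (tlt _ bk); apply/oleS.
have up b g : olt b k -> ole (ts b) g -> olt g t -> exists c : ON, [/\ olt b c, olt c k & olt g (ts c)].
  move=> bk bg /lt_sup[c [ck gc]]; exists c; split=> //.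
  apply: NNPP => /oltNge[cb|e]; last by subst c; apply: (@olt_irr _ g); apply: olt_le_trans bg.
  by apply: (@olt_irr _ g); apply: (olt_le_trans gc); apply: ole_trans bg; apply: hts.
have segt b : olt b k -> seg o n (hs b) (ts b) t (Xs b) Xl.
  move=> bk; split=> [|g bg gt]; first exact: tX.
  have [c [bc ck gc]] := up _ _ bk bg gt; have [h1 h2] := hseg _ _ bc ck.
  have [d [k1 k2 k3 k4 k5]] := h2 g bg gc; exists d; split=> //.
  by apply: tle_trans k5 _; apply: tX.
split=> //; have cf g : olt g t -> exists d, Conf g d.
  move=> /lt_sup[b [bk gb]]; apply: (conf_le (hC _ bk)); by left.
apply: confL => //; split=> /=.
- move=> d; have [g [gk hg]] := hX d; exists (ts g); split; first exact: tlt.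
  move=> u gu ut; have [c [gc ck uc]] := up _ _ gk gu ut.
  have [_ /(_ u gu uc)[e [k1 k2 k3 k4 k5]]] := hseg _ _ gc ck.
  rewrite (the_runE k1); apply: oi; apply/eqP; rewrite eqn_leq.
  by rewrite -{1}(hg c) ?k5 -?(hg g) ?k4 //; left.
- split=> [a /lt_sup[b [bk ab]]|e he].
    exists (ts b); split; [by left|exact: tlt|rewrite (the_runE (hC _ bk)); exact: hub].
  apply: hlub => b bk; have [g [bg gt hg]] := he _ (tlt _ bk).
  have [_ /(_ g bg gt)[d [k1 k2 k3 k4 k5]]] := segt _ bk.
  by rewrite (the_runE k1) in hg; apply: cle_trans k3 hg.
- exists n; split=> // [a /lt_sup[b [bk ab]]|l' hl'].
    by exists (ts b); split; [left|exact: tlt|rewrite (the_runE (hC _ bk))].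
  have [g [bg gt hg]] := hl' _ (tlt _ (proj1 lk)).
  have [_ /(_ g bg gt)[d [k1 [l [k2 k6]] k3 k4 k5]]] := segt _ (proj1 lk).
  by rewrite (the_runE k1) k2 in hg; case: hg => <-.
Qed.

(** This covers endless runs as well as runs that get stuck. *)
Definition never a := forall a' c, ole a a' -> Conf a' c -> c_state c <> None.

Lemma never_seg o n lb a b X Y : seg o n lb a b X Y -> never b -> never a.
Proof.
move=> [_ h] nb a' c aa' hc; case: (ole_olt b a') => [h'|h']; first exact: nb hc.
by have [d [/conf_det /(_ hc) <- [l [-> _]] _ _ _]] := h _ aa' h'.
Qed.

End Runs.

(** * Commands and their compilation into instructions *)

(* [Act f]: read [k], write, move and return an outcome according to [f k].
   [Bind c c0 c1 c2] continues with [c0], [c1] or [c2] when the outcome of [c]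
   is 0, 1 or at least 2.  [Loop c] repeats [c] as long as its outcome is 0 and
   returns the predecessor of the first other outcome. *)
Inductive cmd :=
  | Ret (v : nat)
  | Act (f : mark -> mark * direction * nat)
  | Bind (c c0 c1 c2 : cmd)
  | Loop (c : cmd).

Definition pick (c0 c1 c2 : cmd) v := match v with 0 => c0 | 1 => c1 | _ => c2 end.

Fixpoint csize c := match c with
  | Ret _ => 0
  | Act _ => 1
  | Bind c c0 c1 c2 => csize c + csize c0 + csize c1 + csize c2
  | Loop c => (csize c).+1
  end.

(** The state in which a copy of [c] numbered from [n] starts when outcome [v] is to lead to state
    [ex v]. [Ret] takes no time, so its entry is already the exit. *)
Fixpoint entry c n (ex : nat -> state) : state := match c with
  | Ret v => ex v
  | Act _ => Some n
  | Bind c c0 c1 c2 => entry c n (fun v => match v with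
      | 0 => entry c0 (n + csize c) ex
      | 1 => entry c1 (n + csize c + csize c0) ex
      | _ => entry c2 (n + csize c + csize c0 + csize c1) ex end)
  | Loop _ => Some n
  end.

Definition bind_exit (c c0 c1 c2 : cmd) n ex v := match v with
  | 0 => entry c0 (n + csize c) ex
  | 1 => entry c1 (n + csize c + csize c0) ex
  | _ => entry c2 (n + csize c + csize c0 + csize c1) ex end.

Definition loop_exit n (ex : nat -> state) v := if v is v'.+1 then ex v' else Some n.

Definition all_marks : list mark :=
  [:: mk0; mk1; mk2; mk3; mk4; mk0star; mk1star; mk2star; mk3star; mk4star; mkstar; mkstarstar].

Definition ins n k (r : mark * direction * state) := Instruction n k r.1.1 r.1.2 r.2.

(* The head of a loop is numbered below its body, so that the limit rule for
   states leads back to it. *)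
Fixpoint code c n ex : list instruction := match c with
  | Ret _ => [::]
  | Act f => List.map (fun k => ins n k ((f k).1, ex (f k).2)) all_marks
  | Bind c c0 c1 c2 => code c n (bind_exit c c0 c1 c2 n ex)
      ++ code c0 (n + csize c) ex ++ code c1 (n + csize c + csize c0) ex
      ++ code c2 (n + csize c + csize c0 + csize c1) ex
  | Loop c => List.map (fun k => ins n k (k, mvS, entry c n.+1 (loop_exit n ex))) all_marks
      ++ code c n.+1 (loop_exit n ex)
  end.

(** Correctness is proved for every machine that contains the instructions of [c], so that
    subcommands can be treated inside the whole program. *)
Fixpoint emb (M : list instruction) c n ex : Prop := match c with
  | Ret _ => True
  | Act f => forall k, List.In (ins n k ((f k).1, ex (f k).2)) M
  | Bind c c0 c1 c2 => [/\ emb M c n (bind_exit c c0 c1 c2 n ex),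
      emb M c0 (n + csize c) ex, emb M c1 (n + csize c + csize c0) ex &
      emb M c2 (n + csize c + csize c0 + csize c1) ex]
  | Loop c => (forall k, List.In (ins n k (k, mvS, entry c n.+1 (loop_exit n ex))) M) /\
      emb M c n.+1 (loop_exit n ex)
  end.

Lemma all_marksP k : List.In k all_marks.
Proof. by case: k => /=; tauto. Qed.

Lemma in_app (T : Type) (x : T) s t : List.In x (s ++ t) <-> List.In x s \/ List.In x t.
Proof. exact: List.in_app_iff. Qed.

Lemma code_emb M c n ex : (forall i, List.In i (code c n ex) -> List.In i M) -> emb M c n ex.
Proof.
elim: c n ex => [v|f|c ih c0 ih0 c1 ih1 c2 ih2|c ih] n ex h.
- by [].
- move=> k; apply: h; apply: (List.in_map (fun k => ins n k ((f k).1, ex (f k).2)) all_marks k).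
  exact: all_marksP.
- by split; [apply: ih|apply: ih0|apply: ih1|apply: ih2] => i hi; apply: h;
    rewrite [code _ _ _]/= !in_app; tauto.
- split=> [k|]; last by apply: ih => i hi; apply: h; apply/in_app; right.
  apply: h; apply/in_app; left.
  by apply: (List.in_map (fun k => ins n k (k, mvS, _)) all_marks k); apply: all_marksP.
Qed.

Lemma in_rows i n g : List.In i (List.map (fun k => ins n k (g k)) all_marks) -> exists k, i = ins n k (g k).
Proof. by case/List.in_map_iff => k [<- _]; exists k. Qed.

Lemma code_src c n ex i : List.In i (code c n ex) -> n <= i_source i < n + csize c.
Proof.
elim: c n ex => [v|f|c ih c0 ih0 c1 ih1 c2 ih2|c ih] n ex h; first by [].
- by case: (@in_rows _ _ (fun k => ((f k).1, ex (f k).2)) h) => k -> /=; lia.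
- move: h; rewrite [code _ _ _]/= !in_app => -[/ih|[/ih0|[/ih1|/ih2]]] /=; lia.
- by case/in_app: h => [/in_rows[k ->]|/ih] /=; lia.
Qed.

(** Distinct subcommands occupy disjoint intervals of states, by [code_src]. *)
Lemma code_det c n ex i j : List.In i (code c n ex) -> List.In j (code c n ex) ->
  i_source i = i_source j -> i_read i = i_read j -> i = j.
Proof.
elim: c n ex => [v|f|c ih c0 ih0 c1 ih1 c2 ih2|c ih] n ex h h'; first by [].
- by case: (@in_rows _ _ (fun k => ((f k).1, ex (f k).2)) h) => k ->;
    case: (@in_rows _ _ (fun k => ((f k).1, ex (f k).2)) h') => k' -> /= _ ->.
- move: h h'; rewrite [code _ _ _]/= !in_app => h h' es er.
  by move: h h' => [h|[h|[h|h]]] [h'|[h'|[h'|h']]];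
    first [exact: ih h h' es er|exact: ih0 h h' es er|exact: ih1 h h' es er|exact: ih2 h h' es er
          |have := code_src h; have := code_src h'; rewrite es; clear; lia].
- move=> es er; case/in_app: h => h; case/in_app: h' => h'; last exact: ih h h' es er.
  + by move: er; case: (in_rows h) => k ->; case: (in_rows h') => k' -> /= ->.
  + by have := code_src h'; rewrite -es; case: (in_rows h) => k -> /=; lia.
  + by have := code_src h; rewrite es; case: (in_rows h') => k -> /=; lia.
Qed.

Definition compile c : machine := Machine (@code_det c 0 (fun _ => None)).

(** * Execution of commands and transfinite loops *)

Section Exec.
Variables (U : zfc_universe) (M : machine) (X0 : tape U).
Local Notation ON := (ON U).
Local Notation cell := (cell U).
Local Notation tape := (tape U).
Local Notation Conf := (Conf M X0).
Local Notation seg := (seg M X0).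
Local Notation never := (never M X0).

Definition upd X h k : tape := fun d => if lem (d = h) then k else X d.

Lemma upd_eq X h k : upd X h k h = k.
Proof. by rewrite /upd ifT. Qed.

Lemma upd_neq X h k d : d <> h -> upd X h k d = X d.
Proof. by move=> n; rewrite /upd ifF. Qed.

Lemma upd_id X h : upd X h (X h) = X.
Proof.
apply: funext => d.
by case: (classic (d = h)) => [->|n]; rewrite ?upd_eq ?upd_neq.
Qed.

Lemma upd_idE X h k : X h = k -> upd X h k = X.
Proof. by move=> <-; apply: upd_id. Qed.

(* From head [h] and tape [X], [c] either never halts while [D] holds, or it
   terminates in [Q]; meanwhile the head stays lexicographically above [lb]
   and the marks grow along [o]. *)
Definition exec o lb c h X (Q : nat -> cell -> tape -> Prop) (D : Prop) :=
  forall n ex, emb M c n ex -> forall a, Conf a (Config h X (entry c n ex)) ->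
  (D /\ never a) \/ exists a' v h' X',
    [/\ ole a a', Conf a' (Config h' X' (ex v)), seg o n lb a a' X X' & Q v h' X'].

(** The analogue of [exec] for whole iterations, from the head of a loop back to it. [st] asks for
    positive duration, from which it follows that an endless loop exhausts all times. *)
Definition reach (st : bool) o lb c h X (P : cell -> tape -> Prop) (D : Prop) :=
  forall n ex, emb M (Loop c) n ex -> forall a, Conf a (Config h X (Some n)) ->
  (D /\ never a) \/ exists a' h' X',
    [/\ if st then olt a a' else ole a a', Conf a' (Config h' X' (Some n)), seg o n lb a a' X X' & P h' X'].

Lemma exec_ret o lb v h X Q D : Q v h X -> exec o lb (Ret v) h X Q D.
Proof. by move=> q n ex _ a ca; right; exists a, v, h, X; split=> //; apply: seg_refl. Qed.

Lemma conf_step a n h X k k' mv st h' : List.In (ins n k (k', mv, st)) M -> X h = k ->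
  moves mv (cell_seq h) (cell_seq h') -> Conf a (Config h X (Some n)) ->
  Conf (osucc a) (Config h' (upd X h k') st).
Proof.
move=> hi hk mvs ca; apply: (confS ca); exists (ins n k (k', mv, st)); split=> //=.
- by rewrite upd_eq.
- by move=> d dh; rewrite upd_neq.
- by right.
Qed.

Lemma seg_step o n lb a h X X' : cle lb h -> tle o X X' -> Conf a (Config h X (Some n)) ->
  seg o n lb a (osucc a) X X'.
Proof.
move=> hlb hX ca; split=> // g ag /oltS ga; have e : g = a by apply: ole_anti.
subst g; exists (Config h X (Some n)); split=> //; by exists n.
Qed.

Lemma exec_act o lb f h X Q D k mv v h' : f (X h) = (k, mv, v) ->
  moves mv (cell_seq h) (cell_seq h') -> o (X h) <= o k -> cle lb h ->
  Q v h' (upd X h k) -> exec o lb (Act f) h X Q D.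
Proof.
move=> ef mvs ok hlb q n ex /= em a ca; right.
have ca' : Conf (osucc a) (Config h' (upd X h k) (ex v)).
  by have := em (X h); rewrite ef => em'; apply: (conf_step em').
exists (osucc a), v, h', (upd X h k); split=> //; first by left.
apply: (seg_step hlb _ ca) => d.
by case: (classic (d = h)) => [->|nd]; rewrite ?upd_eq ?upd_neq.
Qed.

Lemma exec_bind o lb c c0 c1 c2 h X Q1 Q D : exec o lb c h X Q1 D ->
  (forall v h1 X1, tle o X X1 -> Q1 v h1 X1 -> exec o lb (pick c0 c1 c2 v) h1 X1 Q D) ->
  exec o lb (Bind c c0 c1 c2) h X Q D.
Proof.
move=> hc hg n ex /= [em em0 em1 em2] a ca.
case: (hc n _ em a ca) => [|[a1 [v [h1 [X1 [aa1 ca1 s1 q1]]]]]]; first by left.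
(* All continuations are numbered from [n] on, which keeps the lower bound for the states. *)
have [m [nm [em3 ca3]]] : exists m, n <= m /\ emb M (pick c0 c1 c2 v) m ex /\
    Conf a1 (Config h1 X1 (entry (pick c0 c1 c2 v) m ex)).
  case: v {q1} ca1 => [|[|v]] ca1 /=; [exists (n + csize c)|exists (n + csize c + csize c0)|
    exists (n + csize c + csize c0 + csize c1)]; split=> //; lia.
case: (hg v h1 X1 (proj1 s1) q1 m ex em3 a1 ca3) => [[d nv]|[a2 [w [h2 [X2 [a12 ca2 s2 q2]]]]]].
  by left; split=> //; apply: never_seg s1 nv.
right; exists a2, w, h2, X2; split=> //; first exact: ole_trans aa1 a12.
apply: seg_trans s1 _; first exact: cle_refl.
by apply: seg_weak s2 => //; apply: cle_refl.
Qed.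

Lemma exec_weak o lb lb' c h X (Q Q' : nat -> cell -> tape -> Prop) (D D' : Prop) :
  exec o lb c h X Q D -> cle lb' lb -> (D -> D') ->
  (forall v h' X', tle o X X' -> Q v h' X' -> Q' v h' X') -> exec o lb' c h X Q' D'.
Proof.
move=> hc hlb hD hQ n ex em a ca.
case: (hc n ex em a ca) => [[d nv]|[a1 [v [h1 [X1 [aa1 ca1 s1 q1]]]]]]; first by left; split; auto.
right; exists a1, v, h1, X1; split=> //; last by apply: hQ => //; case: s1.
exact: seg_weak s1.
Qed.

Lemma reach_refl o lb c h X (P : cell -> tape -> Prop) D : P h X -> reach false o lb c h X P D.
Proof. by move=> p n ex em a ca; right; exists a, h, X; split=> //; apply: seg_refl. Qed.

Lemma reach_trans st o lb c h X (P P' : cell -> tape -> Prop) D : reach st o lb c h X P' D ->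
  (forall h1 X1, tle o X X1 -> P' h1 X1 -> reach false o lb c h1 X1 P D) -> reach st o lb c h X P D.
Proof.
move=> r1 r2 n ex em a ca.
case: (r1 n ex em a ca) => [|[a1 [h1 [X1 [aa1 ca1 s1 q1]]]]]; first by left.
case: (r2 h1 X1 (proj1 s1) q1 n ex em a1 ca1) => [[d nv]|[a2 [h2 [X2 [a12 ca2 s2 q2]]]]].
  by left; split=> //; apply: never_seg s1 nv.
right; exists a2, h2, X2; split=> //.
  by case: st aa1 {r1} => aa1; [apply: olt_le_trans a12|apply: ole_trans a12].
by apply: seg_trans s1 s2; apply: cle_refl.
Qed.

Lemma reach_weak (st st' : bool) o lb lb' c h X (P P' : cell -> tape -> Prop) (D D' : Prop) :
  reach st o lb c h X P D -> cle lb' lb -> (D -> D') -> (st' -> st) ->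
  (forall h' X', tle o X X' -> P h' X' -> P' h' X') -> reach st' o lb' c h X P' D'.
Proof.
move=> hc hlb hD hst hQ n ex em a ca.
case: (hc n ex em a ca) => [[d nv]|[a1 [h1 [X1 [aa1 ca1 s1 q1]]]]]; first by left; split; auto.
right; exists a1, h1, X1; split=> //.
- by case: st' hst => hst; [rewrite hst in aa1|case: st aa1 {hst hc} => //; left].
- exact: seg_weak s1.
- by apply: hQ => //; case: s1.
Qed.

(** The instruction at the head of the loop takes a step of its own, hence the strict progress even
    if the body takes no time. *)
Lemma reach_iter o lb c h X P D : cle lb h ->
  exec o lb c h X (fun v h' X' => v = 0 /\ P h' X') D -> reach true o lb c h X P D.
Proof.
move=> hlb hc n ex /= [em1 em2] a ca.
have ca' : Conf (osucc a) (Config h X (entry c n.+1 (loop_exit n ex))).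
  have := conf_step (em1 (X h)) erefl (moves_s (cell_seq h)) ca; by rewrite upd_id.
have s0 : seg o n lb a (osucc a) X X by apply: seg_step ca => //; apply: tle_refl.
case: (hc _ _ em2 _ ca') => [[d nv]|[a1 [v [h1 [X1 [aa1 ca1 s1 [e q1]]]]]]].
  by left; split=> //; apply: never_seg s0 nv.
subst v; right; exists a1, h1, X1; split=> //; first exact/oleS.
by apply: seg_trans s0 _; [apply: cle_refl|apply: seg_weak s1 => //; apply: cle_refl].
Qed.

Lemma exec_loop o lb c h X Q D :
  reach false o lb c h X (fun h' X' => cle lb h' /\
    exec o lb c h' X' (fun v h'' X'' => 0 < v /\ Q v.-1 h'' X'') D) D ->
  exec o lb (Loop c) h X Q D.
Proof.
move=> r n ex em a ca.
case: (r n ex em a ca) => [|[a1 [h1 [X1 [aa1 ca1 s1 [hlb hc]]]]]]; first by left.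
case: (em) => em1 em2.
have ca' : Conf (osucc a1) (Config h1 X1 (entry c n.+1 (loop_exit n ex))).
  have := conf_step (em1 (X1 h1)) erefl (moves_s (cell_seq h1)) ca1; by rewrite upd_id.
have s0 : seg o n lb a1 (osucc a1) X1 X1 by apply: seg_step ca1 => //; apply: tle_refl.
have s01 := seg_trans (cle_refl lb) s1 s0.
case: (hc _ _ em2 _ ca') => [[d nv]|[a2 [v [h2 [X2 [a12 ca2 s2 [v0 q2]]]]]]].
  by left; split=> //; apply: never_seg s01 nv.
right; exists a2, v.-1, h2, X2; split=> //.
- apply: ole_trans aa1 _; left; exact/oleS.
- by case: v v0 ca2 {q2}.
- by apply: seg_trans s01 _; [apply: cle_refl|apply: seg_weak s2 => //; apply: cle_refl].
Qed.

Definition rank_ok (o : mark -> nat) := injective o /\ exists N, forall k, o k <= N.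

(** Each index carries a tape and a ghost value in [G] subject to the invariant [I]; [E] relates any
    two stages and is available in the limit step. Either the run never halts and [D] holds, or the
    chain extends through all of [dom], with limit stages supplied by [chain_limit]. *)
Lemma chain_ex (G : Type) st o lb c (hs : ON -> cell) (I : ON -> G -> tape -> Prop)
    (E : G -> tape -> G -> tape -> Prop) (dom : ON -> Prop) g0 X D n ex a :
  rank_ok o ->
  (forall g X g' X' g'' X'', E g X g' X' -> E g' X' g'' X'' -> E g X g'' X'') ->
  (forall b b', ole b b' -> dom b' -> dom b) ->
  cle lb (hs (ozero U)) ->
  (forall b b', ole b b' -> dom b' -> cle (hs b) (hs b')) ->
  (forall l e, dom l -> olimit l -> (forall b, olt b l -> cle (hs b) e) -> cle (hs l) e) ->
  I (ozero U) g0 X ->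
  (forall b g X, dom (osucc b) -> I b g X -> reach st o (hs b) c (hs b) X
     (fun h' X' => h' = hs (osucc b) /\ exists g', I (osucc b) g' X' /\ E g X g' X') D) ->
  (forall l gs Xs Xl, dom l -> olimit l -> (forall b, olt b l -> I b (gs b) (Xs b)) ->
     (forall b b', olt b b' -> olt b' l -> tle o (Xs b) (Xs b') /\ E (gs b) (Xs b) (gs b') (Xs b')) ->
     limtape l Xs Xl -> (forall b, olt b l -> tle o (Xs b) Xl) ->
     exists gl, I l gl Xl /\ forall b, olt b l -> E (gs b) (Xs b) gl Xl) ->
  emb M (Loop c) n ex -> Conf a (Config (hs (ozero U)) X (Some n)) ->
  (D /\ never a) \/ exists (ts : ON -> ON) (gs : ON -> G) (Xs : ON -> tape),
    [/\ ts (ozero U) = a,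
        gs (ozero U) = g0 /\ Xs (ozero U) = X,
        forall b, dom b -> [/\ Conf (ts b) (Config (hs b) (Xs b) (Some n)), ole a (ts b),
          seg o n lb a (ts b) X (Xs b) & I b (gs b) (Xs b)] &
        forall b b', olt b b' -> dom b' ->
          (if st then olt (ts b) (ts b') else ole (ts b) (ts b')) /\ E (gs b) (Xs b) (gs b') (Xs b')].
Proof.
move=> [oi ob] Etr dn h0 hm hl i0 istep ilim em ca.
(* With divergence excluded at the outset every single iteration terminates, because [never]
   propagates back along the chain. *)
case: (classic (D /\ never a)) => nD; [by left|right].
pose S := (cell * ON * G * tape)%type.
pose lt2 a b := if st then olt a b else @ole U a b.
have lt2_le x y : lt2 x y -> ole x y by rewrite /lt2; case: (st) => // h; left.
pose E' (s s' : S) := [/\ seg o n s.1.1.1 s.1.1.2 s'.1.1.2 s.2 s'.2, lt2 s.1.1.2 s'.1.1.2,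
   E s.1.2 s.2 s'.1.2 s'.2 & cle s.1.1.1 s'.1.1.1].
pose I' b (s : S) := [/\ s.1.1.1 = hs b, Conf s.1.1.2 (Config (hs b) s.2 (Some n)),
   seg o n lb a s.1.1.2 X s.2, ole a s.1.1.2 & I b s.1.2 s.2].
have [||||f [f0 fI fE]] := @tchain U S E' I' dom (hs (ozero U), a, g0, X) _ dn.
- move=> r s t [s1 l1 e1 c1] [s2 l2 e2 c2]; split.
  + exact: seg_trans s1 s2.
  + by move: l1 l2; rewrite /lt2; case: (st) => h h'; [apply: olt_trans h h'|apply: ole_trans h h'].
  + exact: Etr e1 e2.
  + exact: cle_trans c1 c2.
- by split=> //; apply: seg_refl.
- move=> b [[[h t] g] Y] ds [/= e ct sa at_ ib]; subst h.
  case: (istep b g Y ds ib n ex em t ct) => [[d nv]|[t' [h' [Y' [tt' ct' s' [eh [g' [ib' eg]]]]]]]].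
    by case: nD; split=> //; apply: never_seg sa nv.
  subst h'; have lbh : cle lb (hs b).
    apply: cle_trans h0 (hm _ _ (ole0 b) _); apply: dn ds; by left.
  exists (hs (osucc b), t', g', Y'); split; split=> //=.
  + by apply: hm => //; left.
  + by apply: seg_trans sa s'.
  + apply: ole_trans at_ _; exact: lt2_le.
- move=> l f dl ll fI fE.
  have fI' b : olt b l -> I' b (f b) by apply: fI.
  have [|Xl hX] := @limtape_ex U o l (fun b => (f b).2) oi ob ll.
    by move=> b b' bb' b'l; case: (fE b b' bb' b'l) => -[].
  have tX := limtape_tle (fun b b' bb' b'l => let: And4 (conj s _) _ _ _ := fE b b' bb' b'l in s) hX.
  have [||gl [igl egl]] := ilim l (fun b => (f b).1.2) (fun b => (f b).2) Xl dl ll _ _ hX tX.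
  + by move=> b /fI'[].
  + by move=> b b' bb' b'l; case: (fE b b' bb' b'l) => -[? _] _ ? _.
  have dlt b : olt b l -> dom b by move=> bl; apply: dn dl; left.
  have [|||||||ct st'] := @chain_limit U M X0 o n l (fun b => (f b).1.1.2) hs (fun b => (f b).2) (hs l) Xl oi ll.
  + by move=> b /fI'[].
  + move=> b b' bb' b'l; case: (fE b b' bb' b'l) => s _ _ _.
    by case: (fI' b (olt_trans bb' b'l)) => <-.
  + by move=> b b' bb' b'l; case: (fE b b' bb' b'l) => _ /lt2_le.
  + by move=> b b' bb' b'l; apply: hm; [left|apply: dlt].
  + by move=> b bl; apply: hm; [left|].
  + by move=> e; apply: hl.
  + exact: hX.
  set t := sup _ _ in ct st'.
  exists (hs l, t, gl, Xl); split=> [b bl|].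
    split=> /=; last by case: (fI' b bl) => -> _ _ _ _; apply: hm => //; left.
    * by case: (fI' b bl) => -> _ _ _ _; apply: st'.
    * have sl := proj2 ll _ bl; have := le_sup (fun b => (f b).1.1.2) sl; rewrite -/t.
      case: (fE b (osucc b) (olt_succ b) sl) => _ + _ _; rewrite /lt2.
      by case: (st) => h h'; [apply: olt_le_trans h h'|apply: ole_trans h h'].
    * exact: egl.
  case: (fI' _ (proj1 ll)) => /= e1 _ s1 a1 _.
  split=> //=; last by apply: ole_trans a1 _; apply: (le_sup (fun b => (f b).1.1.2)); case: ll.
  by apply: seg_trans s1 (st' _ (proj1 ll)).
exists (fun b => (f b).1.1.2), (fun b => (f b).1.2), (fun b => (f b).2); split.
- by rewrite f0.
- by rewrite f0.
- by move=> b /fI[].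
- by move=> b b' bb' /(fE b b' bb')[].
Qed.

Lemma reach_tf (G : Type) o lb c (hs : ON -> cell) (I : ON -> G -> tape -> Prop)
    (E : G -> tape -> G -> tape -> Prop) de g0 X D :
  rank_ok o ->
  (forall g X, E g X g X) ->
  (forall g X g' X' g'' X'', E g X g' X' -> E g' X' g'' X'' -> E g X g'' X'') ->
  cle lb (hs (ozero U)) ->
  (forall b b', ole b b' -> ole b' de -> cle (hs b) (hs b')) ->
  (forall l e, ole l de -> olimit l -> (forall b, olt b l -> cle (hs b) e) -> cle (hs l) e) ->
  I (ozero U) g0 X ->
  (forall b g X, olt b de -> I b g X -> reach false o (hs b) c (hs b) X
     (fun h' X' => h' = hs (osucc b) /\ exists g', I (osucc b) g' X' /\ E g X g' X') D) ->
  (forall l gs Xs Xl, ole l de -> olimit l -> (forall b, olt b l -> I b (gs b) (Xs b)) ->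
     (forall b b', olt b b' -> olt b' l -> tle o (Xs b) (Xs b') /\ E (gs b) (Xs b) (gs b') (Xs b')) ->
     limtape l Xs Xl -> (forall b, olt b l -> tle o (Xs b) Xl) ->
     exists gl, I l gl Xl /\ forall b, olt b l -> E (gs b) (Xs b) gl Xl) ->
  reach false o lb c (hs (ozero U)) X (fun h' X' => h' = hs de /\ exists g, I de g X' /\ E g0 X g X') D.
Proof.
move=> oo Er Et h0 hm hl i0 istep ilim n ex em a ca.
case: (@chain_ex G false o lb c hs I E (fun b => ole b de) g0 X D n ex a) => //.
- by move=> b b' bb' /(ole_trans bb').
- by move=> b g Y /oleS; apply: istep.
- by left.
move=> [ts [gs [Xs [t0 [eg0 eX0] h1 h2]]]]; right.
have [c1 c2 c3 c4] := h1 de (ole_refl de).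
exists (ts de), (hs de), (Xs de); split=> //; split=> //; exists (gs de); split=> //.
case: (ole0 de) => [lt|e]; last by rewrite -e eg0 eX0.
by rewrite -eg0 -eX0; case: (h2 _ _ lt (ole_refl de)).
Qed.

(** The times of a strict chain satisfy [ole b (ts b)]. Hence the segment up to stage [osucc a']
    covers any given time [a'], and no state in a segment is the halting one. *)
Lemma reach_never (G : Type) o lb c h (I : ON -> G -> tape -> Prop)
    (E : G -> tape -> G -> tape -> Prop) g0 X (D : Prop) Q :
  rank_ok o -> D ->
  (forall g X g' X' g'' X'', E g X g' X' -> E g' X' g'' X'' -> E g X g'' X'') ->
  cle lb h ->
  I (ozero U) g0 X ->
  (forall b g X, I b g X -> reach true o h c h X
     (fun h' X' => h' = h /\ exists g', I (osucc b) g' X' /\ E g X g' X') D) ->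
  (forall l gs Xs Xl, olimit l -> (forall b, olt b l -> I b (gs b) (Xs b)) ->
     (forall b b', olt b b' -> olt b' l -> tle o (Xs b) (Xs b') /\ E (gs b) (Xs b) (gs b') (Xs b')) ->
     limtape l Xs Xl -> (forall b, olt b l -> tle o (Xs b) Xl) ->
     exists gl, I l gl Xl /\ forall b, olt b l -> E (gs b) (Xs b) gl Xl) ->
  exec o lb (Loop c) h X Q D.
Proof.
move=> oo hD Et h0 i0 istep ilim n ex em a ca; left; split=> //.
case: (@chain_ex G true o lb c (fun _ => h) I E (fun b => True) g0 X D n ex a) => //.
- by move=> l e _ [l0 _] h2; apply: h2 l0.
- by move=> b g Y _; apply: istep.
- by move=> l gs Xs Xl _; apply: ilim.
- by case.
move=> [ts [gs [Xs [t0 _ h1 h2]]]] a' c' aa' ca' ec.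
have mono b b' : olt b b' -> olt (ts b) (ts b') by move=> bb'; case: (h2 b b' bb' Logic.I).
have [_ _ [_ s] _] := h1 (osucc a') Logic.I.
have lt : olt a' (ts (osucc a')) by apply: olt_le_trans (olt_succ a') (smono_ge mono _).
have [d [/conf_det/(_ ca') e [m [k1 _]] _ _ _]] := s a' aa' lt.
by rewrite e ec in k1.
Qed.

End Exec.

Arguments exec_bind {U M X0 o lb c c0 c1 c2 h X Q1 Q D}.
Arguments exec_act {U M X0 o lb f h X Q D k mv v h'} _ _ _ _ _.
Arguments exec_ret {U M X0 o lb v h X Q D}.
Arguments exec_weak {U M X0 o lb lb' c h X Q Q' D D'}.
Arguments reach_weak {U M X0 st st' o lb lb' c h X P P' D D'}.
Arguments reach_trans {U M X0 st o lb c h X P P' D}.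

(** * Bits with histories, and sweeps over rows *)

(** The order in which marks may replace one another: a blank is filled with 1 or 2, a tree node
    passes through 2 and 3, a root through [mk4] and [mk0star]. Erasing lowers the marks and uses
    the reversed rank [rkd]. *)
Definition rk (k : mark) : nat := match k with
  | mk0 => 0 | mk1 => 1 | mk2 => 2 | mk3 => 3 | mk4 => 4 | mk0star => 5 | mk1star => 6
  | mk2star => 7 | mk3star => 8 | mk4star => 9 | mkstar => 10 | mkstarstar => 11 end.
Definition rkd k := 11 - rk k.

Lemma rk_ok : rank_ok rk.
Proof. by split; [case; case|exists 11; case]. Qed.
Lemma rkd_ok : rank_ok rkd.
Proof. by split; [case; case|exists 11; case]. Qed.

Definition b2 (P : Prop) : nat := if lem P then 1 else 0.
Lemma b2_iff (P Q : Prop) : (P <-> Q) -> b2 P = b2 Q. Proof. by move=> h; congr b2; apply: propext. Qed.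
Lemma b2T (P : Prop) : P -> b2 P = 1. Proof. exact: ifT. Qed.
Lemma b2F (P : Prop) : ~ P -> b2 P = 0. Proof. exact: ifF. Qed.

Definition mv1 mv := Act (fun k => (k, mv, 0)).
Definition seqc c d := Bind c d d d.
Fixpoint jmp mv k := if k is k'.+1 then seqc (mv1 mv) (jmp mv k') else Ret 0.

(** The head walks along a history to its first blank cell, and the mark read just before is the
    bit. If an iteration already starts at a blank, the length is zero or a limit and the bit counts
    as false. Outcomes 1 and 2 leave the loop as 0 and 1. *)
Definition probe_body := Bind
  (Act (fun k => match k with mk0 => (mk0, mvS, 2) | mk1 => (mk1, mvPlus, 0) | k => (k, mvPlus, 1) end))
  (Act (fun k => (k, mvS, if k is mk0 then 1 else 0)))
  (Act (fun k => (k, mvS, if k is mk0 then 2 else 0)))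
  (Ret 1).
Definition probe := seqc (mv1 mvZ) (Loop probe_body).

Definition at_comp k d := seqc (jmp mvJPlus k)
  (Bind d (seqc (jmp mvJMinus k) (Ret 0)) (seqc (jmp mvJMinus k) (Ret 1)) (seqc (jmp mvJMinus k) (Ret 2))).

Definition readbit := Bind probe (seqc (mv1 mvU) (Ret 0)) (seqc (mv1 mvU) (Ret 1)) (Ret 0).
Definition flipbit := Bind probe (Act (fun _ => (mk2, mvU, 0))) (Act (fun _ => (mk1, mvU, 0))) (Ret 0).
Definition readtab := Act (fun k => (k, mvS, if k is mk2 then 1 else 0)).
Definition settab := Act (fun _ => (mk2, mvS, 0)).

(** The row cell is made nonblank in all components at once, so that the nonblank cells of each
    component keep forming a tree, as the erasure requires. *)
Fixpoint touches k := if k is k'.+1 then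
  seqc (Act (fun k => (if k is mk0 then mk1 else k, mvJPlus, 0))) (touches k') else Ret 0.
Definition touch k := seqc (touches k) (seqc (jmp mvJMinus k) (Ret 0)).

(** Rows are visited upwards from 0 while [cond] yields 1. A register of value v has its true bits
    in the rows below v, so a sweep conditioned on it stops at row v. The outcomes of [fin] are
    shifted by one because outcome 0 would continue the loop. *)
Definition sweep_row k cond act fin := seqc (touch k) (Bind cond
  (Bind fin (Ret 1) (Ret 2) (Ret 3)) (seqc act (mv1 mvPlus)) (Ret 1)).
Definition sweep b k cond act fin := seqc (jmp mvJPlus b) (seqc (mv1 mvZ)
  (Bind (Loop (sweep_row k cond act fin))
     (seqc (mv1 mvU) (seqc (jmp mvJMinus b) (Ret 0)))
     (seqc (mv1 mvU) (seqc (jmp mvJMinus b) (Ret 1)))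
     (seqc (mv1 mvU) (seqc (jmp mvJMinus b) (Ret 2))))).

Section Rows.
Variables (U : zfc_universe) (M : machine) (X0 : tape U).
Local Notation ON := (ON U).
Local Notation cell := (cell U).
Local Notation tape := (tape U).
Local Notation exec := (@exec U M X0).
Local Notation reach := (@reach U M X0).
Implicit Types (X : tape).

Lemma exec_mv1 o lb mv h h' X (Q : nat -> cell -> tape -> Prop) D :
  moves mv (cell_seq h) (cell_seq h') -> cle lb h -> Q 0 h' X ->
  exec o lb (mv1 mv) h X Q D.
Proof. by move=> mvs hlb q; apply: (exec_act (k := X h) (mv := mv) (v := 0) (h' := h')) => //; rewrite upd_id. Qed.

Arguments exec_mv1 {o lb mv h h' X Q D}.

Lemma exec_seq o lb (c d : cmd) h X (Q1 Q : nat -> cell -> tape -> Prop) D : exec o lb c h X Q1 D ->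
  (forall v h1 X1, tle o X X1 -> Q1 v h1 X1 -> exec o lb d h1 X1 Q D) -> exec o lb (seqc c d) h X Q D.
Proof.
move=> hc hd; apply: exec_bind hc _ => v h1 X1 t q; have := hd v h1 X1 t q.
by case: v {q} => [|[|v]].
Qed.

Lemma exec_seq_mv o lb mv d h h' X (Q : nat -> cell -> tape -> Prop) D :
  moves mv (cell_seq h) (cell_seq h') -> cle lb h -> exec o lb d h' X Q D ->
  exec o lb (seqc (mv1 mv) d) h X Q D.
Proof.
move=> mvs hlb hd; apply: (exec_seq (Q1 := fun _ h1 X1 => h1 = h' /\ X1 = X)).
  exact: (exec_mv1 mvs).
by move=> v h1 X1 _ [-> ->].
Qed.

Lemma exec_jmpS o lb k d c s X (Q : nat -> cell -> tape -> Prop) D : cle lb (c, s) ->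
  exec o lb d (c + k, s) X Q D -> exec o lb (seqc (jmp mvJPlus k) d) (c, s) X Q D.
Proof.
move=> hlb hd; apply: (exec_seq (Q1 := fun _ h1 X1 => h1 = (c + k, s) /\ X1 = X)); last first.
  by move=> v h1 X1 _ [-> ->].
elim: k c hlb {hd} => [|k ih] c hlb /=; first by apply: exec_ret; rewrite addn0.
apply: (exec_seq_mv (h' := (c.+1, s))) => //; first exact: (moves_jplus (onat U c) s).
rewrite -addSnnS; apply: ih; apply: cle_trans hlb _; rewrite -addn1; exact: cle_add.
Qed.

Lemma exec_jmpM o lb k d c s X (Q : nat -> cell -> tape -> Prop) D : cle lb (c, s) ->
  exec o lb d (c, s) X Q D -> exec o lb (seqc (jmp mvJMinus k) d) (c + k, s) X Q D.
Proof.
move=> hlb hd; apply: (exec_seq (Q1 := fun _ h1 X1 => h1 = (c, s) /\ X1 = X)); last first.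
  by move=> v h1 X1 _ [-> ->].
elim: k {hd} => [|k ih] /=; first by apply: exec_ret; rewrite addn0.
apply: (exec_seq_mv (h' := (c + k, s))) => //; last by apply: cle_trans hlb _; apply: cle_add.
by rewrite addnS; exact: (moves_jminus (onat U (c + k)) s).
Qed.

Lemma exec_at o lb k d c s X X' v (Q : nat -> cell -> tape -> Prop) D : cle lb (c, s) -> v < 3 ->
  exec o lb d (c + k, s) X (fun v' h' X1 => [/\ v' = v, h' = (c + k, s) & X1 = X']) D ->
  Q v (c, s) X' ->
  exec o lb (at_comp k d) (c, s) X Q D.
Proof.
move=> hlb v3 hd q; apply: exec_jmpS => //; apply: exec_bind hd _ => v' h1 X1 _ [-> -> ->].
by case: v v3 q => [|[|[|v]]] //= _ q; apply: exec_jmpM => //; apply: exec_ret.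
Qed.

(* The history of row [a] in component [c] has length [L]; the current value
   of the bit is its last entry, and false at limit lengths. *)
Definition hist X c a L := (forall t, X (c, [:: a; t]) <> mk0 <-> olt t L) /\
  forall t, olt t L -> X (c, [:: a; t]) = mk1 \/ X (c, [:: a; t]) = mk2.
Definition bit X c a := exists t, X (c, [:: a; t]) = mk2 /\ X (c, [:: a; osucc t]) = mk0.

Lemma hist_blank X c a L t : hist X c a L -> ole L t -> X (c, [:: a; t]) = mk0.
Proof. by move=> [h _] Lt; apply: NNPP => /h; apply/oltNge. Qed.

Lemma exec_probe lb c a L X (Q : nat -> cell -> tape -> Prop) D : hist X c a L -> cle lb (c, [:: a]) ->
  Q (b2 (bit X c a)) (c, [:: a; L]) X -> exec rk lb probe (c, [:: a]) X Q D.
Proof.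
move=> hL hlb q; apply: (exec_seq_mv (h' := (c, [:: a; ozero U]))) => //.
  exact: (moves_z [:: onat U c; a]).
have lbt t : cle lb (c, [:: a; t]) by apply: cle_trans hlb _; apply: (cle_cat _ [:: a]).
apply: exec_loop.
(* [de] is where the last iteration of the walk starts: the predecessor of [L], or [L] itself if [L]
   is zero or a limit. *)
have [de [deL hde]] : exists de, (forall b, olt b de -> olt (osucc b) L) /\
    (L = osucc de \/ (L = de /\ ~ bit X c a)).
  case: (on_cases L) => [e|[L' e]|lL].
  - exists L; split; first by move=> b; rewrite e => /olt0.
    right; split=> // -[t [t2 _]]; have /(proj1 hL t) : X (c, [:: a; t]) <> mk0 by rewrite t2.
    by rewrite e => /olt0.
  - by exists L'; split=> [b|]; [rewrite e oltSS|left].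
  - exists L; split; first by move=> b; case: lL => _; apply.
    right; split=> // -[t [t2 ts]]; have /(proj1 hL t) tL : X (c, [:: a; t]) <> mk0 by rewrite t2.
    by have /(proj1 hL (osucc t)) : olt (osucc t) L by case: lL => _; apply.
have R : reach false rk lb probe_body (c, [:: a; ozero U]) X
    (fun h' X' => h' = (c, [:: a; de]) /\ exists g : unit, X' = X /\ True) D.
  apply: (@reach_tf _ _ _ unit rk lb probe_body (fun b => (c, [:: a; b])) (fun _ _ X' => X' = X) (fun _ _ _ _ => True) de tt X D) => //.
  - exact: rk_ok.
  - by move=> b b' bb' _; apply: (cle_rcons c [:: a]).
  - by move=> l e _ ll h; apply: (@cle_lub _ c [:: a]).
  - move=> b _ Y bde ->; have sbL := deL _ bde; have bL := olt_trans (olt_succ b) sbL.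
    apply: (@reach_weak _ _ _ true _ _ (c, [:: a; b]) _ _ _ _ (fun h' X' => h' = (c, [:: a; osucc b]) /\ X' = X) _ D D) => //.
      apply: reach_iter; first exact: cle_refl.
      have nb : X (c, [:: a; osucc b]) <> mk0 by apply/(proj1 hL).
      apply: (exec_bind (Q1 := fun v h1 X1 => [/\ h1 = (c, [:: a; osucc b]), X1 = X & v = 0 \/ v = 1])).
        have [v1|v2] := proj2 hL b bL.
          apply: (exec_act (k := mk1) (mv := mvPlus) (v := 0) (h' := (c, [:: a; osucc b]))); rewrite ?v1 //.
          + exact: (moves_plus [:: onat U c; a] b).
          + by split=> //; [rewrite upd_idE //|left].
        apply: (exec_act (k := mk2) (mv := mvPlus) (v := 1) (h' := (c, [:: a; osucc b]))); rewrite ?v2 //.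
        + exact: (moves_plus [:: onat U c; a] b).
        + by split=> //; [rewrite upd_idE //|right].
      move=> v h1 X1 _ [-> -> [->|->]] /=.
        apply: (exec_act (k := X (c, [:: a; osucc b])) (mv := mvS) (v := 0) (h' := (c, [:: a; osucc b]))) => //.
        + by case: (X (c, [:: a; osucc b])) nb.
        + exact: moves_s.
        + by apply: (cle_rcons c [:: a]); left.
        + by rewrite upd_id.
      apply: (exec_act (k := X (c, [:: a; osucc b])) (mv := mvS) (v := 0) (h' := (c, [:: a; osucc b]))) => //.
      + by case: (X (c, [:: a; osucc b])) nb.
      + exact: moves_s.
      + by apply: (cle_rcons c [:: a]); left.
      + by rewrite upd_id.
    by move=> h' X' _ [-> ->]; split=> //; exists tt.
  - move=> l gs Xs Xl _ ll hI _ hX _; exists tt; split=> //.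
    apply: funext => d; have [g [gl hg]] := hX d.
    by rewrite -(hg g) // (hI g).
apply: (reach_weak R) => //.
move=> h' Y _ [-> [_ [-> _]]]; split=> //.
  case: hde => [e|[e nb]].
    have dL : olt de L by rewrite e.
    have eS : X (c, [:: a; osucc de]) = mk0 by apply: (hist_blank hL); rewrite e.
    have bE : bit X c a <-> X (c, [:: a; de]) = mk2.
      split=> [[t [t2 ts]]|h]; last by exists de.
      suff -> : de = t by [].
      have tL : olt t L by apply/(proj1 hL t); rewrite t2.
      apply: ole_anti; last by apply/oltS; rewrite -e.
      apply/oltNge => n.
      have /(proj1 hL (osucc t)) : olt (osucc t) L by rewrite e; apply/oltS; apply/oleS.
      by rewrite ts.
    have e2 : b2 (bit X c a) = if X (c, [:: a; de]) is mk2 then 1 else 0.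
      case: (classic (bit X c a)) => h; first by rewrite b2T //; move/bE: h => ->.
      by rewrite b2F //; case E : (X (c, [:: a; de])) => //; case: h; apply/bE.
    apply: (exec_bind (Q1 := fun v h1 X1 => [/\ h1 = (c, [:: a; L]), X1 = X & v = b2 (bit X c a)])).
      have [v1|v2] := proj2 hL de dL.
        apply: (exec_act (k := mk1) (mv := mvPlus) (v := 0) (h' := (c, [:: a; L]))); rewrite ?v1 //.
          by rewrite e; exact: (moves_plus [:: onat U c; a] de).
        by split=> //; [rewrite upd_idE //|rewrite e2 v1].
      apply: (exec_act (k := mk2) (mv := mvPlus) (v := 1) (h' := (c, [:: a; L]))); rewrite ?v2 //.
        by rewrite e; exact: (moves_plus [:: onat U c; a] de).
      by split=> //; [rewrite upd_idE //|rewrite e2 v2].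
    move=> v h1 X1 _ [-> -> ev].
    have v01 : v = 0 \/ v = 1 by rewrite ev e2; case: (X (c, [:: a; de])); auto.
    rewrite -e in eS; case: v01 ev => -> ev /=.
      by apply: (exec_act (k := mk0) (mv := mvS) (v := 1) (h' := (c, [:: a; L]))); rewrite ?eS //;
        [exact: moves_s|split=> //; rewrite /= upd_idE // ev].
    by apply: (exec_act (k := mk0) (mv := mvS) (v := 2) (h' := (c, [:: a; L]))); rewrite ?eS //;
        [exact: moves_s|split=> //; rewrite /= upd_idE // ev].
  rewrite -e; have eS : X (c, [:: a; L]) = mk0 by apply: (hist_blank hL).
  rewrite (b2F nb) in q.
  apply: (exec_bind (Q1 := fun v h1 X1 => [/\ h1 = (c, [:: a; L]), X1 = X & v = 2])).
    by apply: (exec_act (k := mk0) (mv := mvS) (v := 2) (h' := (c, [:: a; L]))); rewrite ?eS //;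
      [exact: moves_s|rewrite upd_idE //].
  by move=> v h1 X1 _ [-> -> ->] /=; apply: exec_ret.
Qed.

Arguments exec_probe {lb c a L X Q D}.

Lemma exec_readbit lb c a L X (Q : nat -> cell -> tape -> Prop) D : hist X c a L -> cle lb (c, [:: a]) ->
  Q (b2 (bit X c a)) (c, [:: a]) X -> exec rk lb readbit (c, [:: a]) X Q D.
Proof.
move=> hL hlb q.
apply: (exec_bind (Q1 := fun v h1 X1 => [/\ h1 = (c, [:: a; L]), X1 = X & v = b2 (bit X c a)])).
  exact: (exec_probe hL).
move=> v h1 X1 _ [-> -> ->]; case: (classic (bit X c a)) q => hb; rewrite ?(b2T hb) ?(b2F hb) => q /=;
(apply: (exec_seq_mv (h' := (c, [:: a])));
 [exact: (moves_u [:: onat U c; a])|by apply: cle_trans hlb _; apply: (cle_cat _ [:: a])|exact: exec_ret]).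
Qed.

Lemma exec_flipbit lb c a L X (Q : nat -> cell -> tape -> Prop) D : hist X c a L -> cle lb (c, [:: a]) ->
  (forall k, k = (if lem (bit X c a) then mk1 else mk2) ->
     Q 0 (c, [:: a]) (upd X (c, [:: a; L]) k)) -> exec rk lb flipbit (c, [:: a]) X Q D.
Proof.
move=> hL hlb q.
apply: (exec_bind (Q1 := fun v h1 X1 => [/\ h1 = (c, [:: a; L]), X1 = X & v = b2 (bit X c a)])).
  exact: (exec_probe hL).
have lbL : cle lb (c, [:: a; L]) by apply: cle_trans hlb _; apply: (cle_cat _ [:: a]).
move=> v h1 X1 _ [-> -> ->]; have q' := q _ erefl; case: (classic (bit X c a)) => hb.
  rewrite (ifT _ _ hb) in q'; rewrite (b2T hb) /=.
  apply: (exec_act (k := mk1) (mv := mvU) (v := 0) (h' := (c, [:: a]))) => //.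
    exact: (moves_u [:: onat U c; a]).
  by rewrite (hist_blank hL).
rewrite (ifF _ _ hb) in q'; rewrite (b2F hb) /=.
apply: (exec_act (k := mk2) (mv := mvU) (v := 0) (h' := (c, [:: a]))) => //.
  exact: (moves_u [:: onat U c; a]).
by rewrite (hist_blank hL).
Qed.

Definition touched X c k a : tape := fun d =>
  if lem (d.2 = [:: a] /\ c <= d.1 < c + k /\ X d = mk0) then mk1 else X d.

Lemma exec_touch lb c k a X (Q : nat -> cell -> tape -> Prop) D : cle lb (c, [:: a]) ->
  Q 0 (c, [:: a]) (touched X c k a) -> exec rk lb (touch k) (c, [:: a]) X Q D.
Proof.
move=> hlb q; apply: (exec_seq (Q1 := fun _ h1 X1 => h1 = (c + k, [:: a]) /\ X1 = touched X c k a)); last first.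
  by move=> v h1 X1 _ [-> ->]; apply: exec_jmpM => //; apply: exec_ret.
elim: k c X hlb {q} => [|k ih] c X hlb /=.
  apply: exec_ret; rewrite addn0; split=> //; apply: funext => d.
  by rewrite /touched ifF // => -[_ [h _]]; lia.
have e1 : touched (upd X (c, [:: a]) (if X (c, [:: a]) is mk0 then mk1 else X (c, [:: a]))) c.+1 k a = touched X c k.+1 a.
  apply: funext => -[c' s]; rewrite /touched.
  case: (classic ((c', s) = (c, [:: a]))) => [[-> ->]|n].
    rewrite upd_eq ifF; last by move=> /= [_ [h _]]; lia.
    case E : (X (c, [:: a])); try by rewrite ifF // => -[_ []].
    by rewrite ifT //=; split=> //; split=> //; lia.
  rewrite upd_neq //; case: (classic (s = [:: a] /\ c.+1 <= c' < c.+1 + k /\ X (c', s) = mk0)) => h.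
    by rewrite !ifT //=; case: h => -> [h1 h2]; split=> //; split=> //; lia.
  rewrite !ifF //= => -[h1 [h2 h3]]; apply: h; split=> //; split=> //.
  suff: c' <> c by lia.
  by move=> e; apply: n; rewrite e h1.
apply: (exec_seq (Q1 := fun _ h1 X1 => h1 = (c.+1, [:: a]) /\ X1 = upd X (c, [:: a]) (if X (c, [:: a]) is mk0 then mk1 else X (c, [:: a])))).
  apply: (exec_act (k := if X (c, [:: a]) is mk0 then mk1 else X (c, [:: a])) (mv := mvJPlus) (v := 0) (h' := (c.+1, [:: a]))) => //.
    exact: (moves_jplus (onat U c) [:: a]).
  by case: (X (c, [:: a])).
move=> v h1 X1 _ [-> ->]; rewrite -e1 -addSnnS; apply: ih.
by apply: cle_trans hlb _; rewrite -addn1; apply: cle_add.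
Qed.

End Rows.

Arguments exec_mv1 {U M X0 o lb mv h h' X Q D}.
Arguments exec_seq {U M X0 o lb c d h X Q1 Q D}.
Arguments exec_seq_mv {U M X0 o lb mv d h h' X Q D}.
Arguments exec_jmpS {U M X0 o lb k d c s X Q D}.
Arguments exec_jmpM {U M X0 o lb k d c s X Q D}.
Arguments exec_at {U M X0 o lb k d c s X X' v Q D}.
Arguments exec_probe {U M X0 lb c a L X Q D}.
Arguments exec_readbit {U M X0 lb c a L X Q D}.
Arguments exec_flipbit {U M X0 lb c a L X Q D}.
Arguments exec_touch {U M X0 lb c k a X Q D}.

(** * A pairing function that counting loops can compute *)

Section Pairing.
Variable U : zfc_universe.
Local Notation ON := (ON U).

(** [ad a j] is a plus twice j, and [rs i] is the sum of the block lengths 2(k+1) over k below i.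
    Pairs with maximum i are placed in the block that starts at [rs i], with two places for each
    smaller coordinate j: the first for (j, i), the second for (i, j). Each of these functions is an
    iteration of increments. *)
Definition ad a j : ON := titer a (fun _ x => osucc (osucc x)) j.
Definition rs i : ON := titer (ozero U) (fun i x => osucc (osucc (ad x i))) i.
Definition tr j i := ad (rs i) j.
Definition pr a b : ON := if lem (ole a b) then tr a b else osucc (tr b a).

Lemma ad_smono a i j : olt i j -> olt (ad a i) (ad a j).
Proof. by apply: titer_smono => _ x; apply: olt_trans (olt_succ x) _. Qed.
Lemma ad_mono a i j : ole i j -> ole (ad a i) (ad a j).
Proof. by case=> [h|->]; [left; apply: ad_smono|]. Qed.
Lemma ad0 a : ad a (ozero U) = a. Proof. exact: titer0. Qed.
Lemma adS a j : ad a (osucc j) = osucc (osucc (ad a j)). Proof. exact: titerS. Qed.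
Lemma ad_ge a j : ole a (ad a j).
Proof. by rewrite -{1}(ad0 a); apply: ad_mono. Qed.
Lemma rs_smono i j : olt i j -> olt (rs i) (rs j).
Proof.
apply: titer_smono => k x; apply: ole_lt_trans (ad_ge x k) _.
by apply: olt_trans (olt_succ _) _.
Qed.

Lemma tr_lt j i j' i' : ole j i -> (olt i i' \/ i = i' /\ olt j j') -> olt (osucc (tr j i)) (tr j' i').
Proof.
move=> ji [ii'|[<- jj']].
  apply: (@olt_le_trans _ _ (rs (osucc i))).
    rewrite /rs titerS oltSS oltS; exact: ad_mono.
  apply: (@ole_trans _ _ (rs i')); last exact: ad_ge.
  have /oleS[h|->] := ii'; [left; exact: rs_smono|by right].
apply: (@olt_le_trans _ _ (tr (osucc j) i)); first by rewrite /tr adS; apply: olt_succ.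
by apply: ad_mono; apply/oleS.
Qed.

Lemma tr_inj j i j' i' (e e' : bool) : ole j i -> ole j' i' ->
  (if e then osucc (tr j i) else tr j i) = (if e' then osucc (tr j' i') else tr j' i') ->
  [/\ j = j', i = i' & e = e'].
Proof.
move=> ji ji' E.
have nlt k l k' l' (f f' : bool) : ole k l -> (olt l l' \/ l = l' /\ olt k k') ->
    (if f then osucc (tr k l) else tr k l) <> (if f' then osucc (tr k' l') else tr k' l').
  move=> kl h; apply: olt_neq; apply: (@ole_lt_trans _ _ (osucc (tr k l))).
    by case: f; [right|left].
  apply: (olt_le_trans (tr_lt kl h)).
  by case: f'; [left|right].
case: (olt_total i i') => [h|ei|h].
- exact: False_ind (nlt _ _ _ _ e e' ji (or_introl h) E).
- case: (olt_total j j') => [h|ej|h].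
  + exact: False_ind (nlt _ _ _ _ e e' ji (or_intror (conj ei h)) E).
  + subst; split=> //; case: e e' E => [] [] // E.
      by case: (olt_neq (olt_succ (tr j' i'))).
    by case: (olt_neq (olt_succ (tr j' i'))).
  + exact: False_ind (nlt _ _ _ _ e' e ji' (or_intror (conj (esym ei) h)) (esym E)).
- exact: False_ind (nlt _ _ _ _ e' e ji' (or_introl h) (esym E)).
Qed.

Lemma pr_le a b : ole a b -> pr a b = tr a b. Proof. exact: ifT. Qed.
Lemma pr_gt a b : olt b a -> pr a b = osucc (tr b a).
Proof. by move=> h; apply: ifF => hab; apply: (olt_irr (ole_lt_trans hab h)). Qed.

Lemma pr_inj a b a' b' : pr a b = pr a' b' -> a = a' /\ b = b'.
Proof.
case: (ole_olt a b) => h; case: (ole_olt a' b') => h'; rewrite ?(pr_le h) ?(pr_le h') ?(pr_gt h) ?(pr_gt h').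
- by case/(@tr_inj _ _ _ _ false false).
- by case/(@tr_inj _ _ _ _ false true) => //; left.
- by case/(@tr_inj _ _ _ _ true false) => //; left.
- by move=> e; case: (@tr_inj b a b' a' true true) => //; left.
Qed.

End Pairing.

(** * Layout of registers and tables on the tape *)

Section Raw.
Variables (U : zfc_universe) (M : machine) (X0 : tape U) (B KK : nat).
Local Notation ON := (ON U).
Local Notation cell := (cell U).
Local Notation tape := (tape U).
Local Notation K := (KK.*2).
Implicit Types (X Y : tape).

Definition rc r := B + r.*2.
Definition tc t := B + t.*2.+1.

(** [u] is the number of rows touched so far, [rb] and [tb] are the bits of registers and tables,
    [tr] the marks of the tree components below [B]. The stars at the roots of components [B] and
    [B + K] are the sentinels at which the two erasing passes stop. *)
Record raw u rb tb tr X : Prop := Raw {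
  raw_trees : forall c s, c < B -> X (c, s) = tr c s;
  raw_base : X (B, [::]) = mkstar;
  raw_root : forall c, B < c < B + K -> X (c, [::]) = mk1;
  raw_sent : X (B + K, [::]) = mkstar;
  raw_hist : forall r a, r < KK -> exists L, hist X (rc r) a L /\ forall t, olt t L -> olt a u;
  raw_bit : forall r a, r < KK -> bit X (rc r) a <-> rb r a;
  raw_row : forall r a, r < KK -> (olt a u -> X (rc r, [:: a]) = mk1) /\ (X (rc r, [:: a]) <> mk0 -> olt a u);
  raw_tab : forall t a, t < KK -> [/\ olt a u -> X (tc t, [:: a]) = mk1 \/ X (tc t, [:: a]) = mk2,
      X (tc t, [:: a]) <> mk0 -> olt a u & X (tc t, [:: a]) = mk2 <-> tb t a];
  raw_blank : forall c s, B <= c -> X (c, s) <> mk0 ->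
    [\/ s = [::] /\ c <= B + K, exists a, s = [:: a] /\ c < B + K |
        exists a t r, [/\ s = [:: a; t], r < KK & c = rc r]] }.

Definition same X Y r a := forall t, X (rc r, [:: a; t]) = Y (rc r, [:: a; t]).

Lemma same_trans X Y Z r a : same X Y r a -> same Y Z r a -> same X Z r a.
Proof. by move=> h h' t; rewrite h. Qed.

Lemma same_bit X Y r a : same X Y r a -> bit X (rc r) a <-> bit Y (rc r) a.
Proof. by move=> h; split=> -[t [h1 h2]]; exists t; rewrite ?h // -?h. Qed.

Lemma same_mid X Y Z r a : tle rk X Y -> tle rk Y Z -> same X Z r a -> same X Y r a.
Proof.
move=> h h' s t; apply: (proj1 rk_ok); apply/eqP; rewrite eqn_leq h /=.
by rewrite s; apply: h'.
Qed.

Lemma raw_eqv u rb rb' tb tb' tr tr' X : raw u rb tb tr X -> (forall r a, r < KK -> rb r a <-> rb' r a) ->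
  (forall t a, t < KK -> tb t a <-> tb' t a) -> (forall c s, c < B -> tr c s = tr' c s) -> raw u rb' tb' tr' X.
Proof.
case=> h1 h2 h3 h4 h5 h6 h7 h8 h9 e e' e2; constructor=> // [c s cB|r a rK|t a tK].
- by rewrite h1 // e2.
- by rewrite h6 // e.
by case: (h8 t a tK) => k1 k2 k3; split=> //; rewrite k3 e'.
Qed.

Lemma row_comp c : B <= c < B + K -> (exists2 r, r < KK & c = rc r) \/ (exists2 t, t < KK & c = tc t).
Proof.
move=> h; have := odd_double_half (c - B); case E : (odd _) => /= e; [right|left]; exists (c - B)./2;
rewrite /rc /tc; lia.
Qed.

Lemma raw_alive u rb tb tr X c a : raw u rb tb tr X -> B <= c < B + K -> X (c, [:: a]) <> mk0 <-> olt a u.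
Proof.
move=> hr /row_comp[[r rK ->]|[t tK ->]].
- case: (raw_row hr a rK) => h h'; split=> // /h ->; by [].
- by case: (raw_tab hr a tK) => h h' _; split=> // /h[->|->].
Qed.

Lemma raw_touch u rb tb tr X a : raw u rb tb tr X -> ole a u ->
  exists u', [/\ raw u' rb tb tr (touched X B K a), olt a u', ole u u' &
    forall r b, same X (touched X B K a) r b].
Proof.
move=> hr au.
have tE c s : s <> [:: a] \/ ~ (B <= c < B + K) -> touched X B K a (c, s) = X (c, s).
  by move=> h; rewrite /touched ifF // => -[/= h1 [h2 _]]; case: h.
have sm r b : same X (touched X B K a) r b by move=> t; rewrite tE //; left.
case: (classic (olt a u)) => au'.
  exists u; split=> //; have -> // : touched X B K a = X.
  apply: funext => -[c s]; rewrite /touched ifF // => -[/= -> [h e]].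
  by move/(raw_alive a hr): h => [_ /(_ au')].
have {au au'} e : a = u by case: au.
subst u; exists (osucc a); split=> //; last by left.
have tA c : B <= c < B + K -> touched X B K a (c, [:: a]) = mk1.
  move=> h; rewrite /touched ifT //=; split=> //; split=> //.
  by apply: NNPP => /(raw_alive a hr h)/olt_irr.
have hb r b : bit (touched X B K a) (rc r) b <-> bit X (rc r) b by rewrite (same_bit (sm r b)).
have rcK r : r < KK -> B <= rc r < B + K by rewrite /rc; lia.
have tcK r : r < KK -> B <= tc r < B + K by rewrite /tc; lia.
case: (hr) => h1 h2 h3 h4 h5 h6 h7 h8 h9; constructor.
- by move=> c s cB; rewrite tE ?h1 //; right; lia.
- by rewrite tE //; left.
- by move=> c hc; rewrite tE ?h3 //; left.
- by rewrite tE //; left.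
- move=> r b rK; have [L [hL hu]] := h5 r b rK; exists L; split.
    by split=> t; have := proj1 hL t; have := proj2 hL t; rewrite !(sm r b t).
  by move=> t /hu h; apply: olt_trans h _.
- by move=> r b rK; rewrite hb h6.
- move=> r b rK; case: (classic (b = a)) => [->|n]; first by rewrite tA ?rcK.
  rewrite tE; last by left=> -[].
  case: (h7 r b rK) => k k'; split=> [/oltS[//|//]|/k' h]; by apply: olt_trans h _.
- move=> t b tK; case: (classic (b = a)) => [->|n].
    rewrite tA ?tcK //; split=> //; first by left.
    split=> // htb; case: (h8 t a tK) => k1 k2 k3.
    by have e := proj2 k3 htb; case: (@olt_irr _ a); apply: k2; rewrite e.
  rewrite tE; last by left=> -[].
  case: (h8 t b tK) => k1 k2 k3; split=> // [/oltS[//|//]|/k2 h]; by apply: olt_trans h _.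
- move=> c s Bc; case: (classic (s = [:: a] /\ c < B + K)) => [[-> cK] _|n].
    by constructor 2; exists a.
  rewrite tE; first exact: h9.
  by case: (classic (s = [:: a])) => e; [right=> h; apply: n; split=> //; lia|left].
Qed.

(* A cell of the history of row [a] of register [r] has been filled. *)
Definition grow X Y r a := exists t, X (rc r, [:: a; t]) = mk0 /\ Y (rc r, [:: a; t]) <> mk0.

(** Flipping appends one mark to the history. The new length is a successor, so the mark just
    written is the last entry and hence the bit. *)
Lemma raw_flip u rb tb tr X r a L : raw u rb tb tr X -> r < KK -> olt a u -> hist X (rc r) a L ->
  let Y := upd X (rc r, [:: a; L]) (if lem (bit X (rc r) a) then mk1 else mk2) in
  [/\ raw u (fun r' a' => (r' = r /\ a' = a /\ ~ rb r a) \/ (~ (r' = r /\ a' = a) /\ rb r' a')) tb tr Y,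
      forall r' a', ~ (r' = r /\ a' = a) -> same X Y r' a' & grow X Y r a].
Proof.
move=> hr rK au hL; set k := (if _ then _ else _) => Y.
have YE c s : (c, s) <> (rc r, [:: a; L]) -> Y (c, s) = X (c, s) by move=> h; rewrite /Y upd_neq.
have k12 : k = mk1 \/ k = mk2 by rewrite /k; case: lem; auto.
have sm r' a' : ~ (r' = r /\ a' = a) -> same X Y r' a'.
  move=> n t; rewrite YE // => -[e1 e2 _]; apply: n; split=> //.
  by move: e1; rewrite /rc; lia.
have Xb : X (rc r, [:: a; L]) = mk0 by apply: (hist_blank hL).
have YL : Y (rc r, [:: a; L]) = k by rewrite /Y upd_eq.
have hY : hist Y (rc r) a (osucc L).
  split=> t; case: (classic (t = L)) => [->|n].
  - by rewrite YL; split=> // _; case: k12 => ->.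
  - rewrite YE; last by case.
    by rewrite (proj1 hL) oltS; split=> [h|[]] //; left.
  - by rewrite YL.
  - by rewrite YE; [move=> /oltS[/(proj2 hL)|]|case].
have bY : bit Y (rc r) a <-> ~ bit X (rc r) a.
  have -> : bit Y (rc r) a <-> k = mk2.
    split=> [[t [t2 ts]]|e].
      have -> : k = Y (rc r, [:: a; t]); last by [].
      have tL : olt t (osucc L) by apply/(proj1 hY); rewrite t2.
      have -> : t = L; last by rewrite YL.
      apply: ole_anti; first exact/oltS.
      apply/oltNge => h; have : olt (osucc t) (osucc L) by rewrite oltSS.
      by move/(proj1 hY); rewrite ts.
    by exists L; rewrite YL; split=> //; apply: (hist_blank hY).
  case: (classic (bit X (rc r) a)) => h.
    by rewrite /k ifT //; split.
  by rewrite /k ifF //; split.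
split=> //; last by exists L; rewrite Xb YL; split=> //; case: k12 => ->.
case: (hr) => h1 h2 h3 h4 h5 h6 h7 h8 h9; constructor.
- by move=> c s cB; rewrite YE ?h1 // => -[e _]; move: e; rewrite /rc; lia.
- by rewrite YE.
- by move=> c hc; rewrite YE ?h3.
- by rewrite YE.
- move=> r' b rK'; case: (classic (r' = r /\ b = a)) => [[-> ->]|n]; first by exists (osucc L).
  have [L' [hL' hu]] := h5 r' b rK'; exists L'; split=> //.
  by split=> t; have := proj1 hL' t; have := proj2 hL' t; rewrite !(sm r' b n t).
- move=> r' b rK'; case: (classic (r' = r /\ b = a)) => [[-> ->]|n].
    rewrite bY h6 //; split; first by left.
    by case=> [[_ []]|[[]]].
  rewrite -(same_bit (sm _ _ n)) h6 //; split; first by right.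
  by case=> [[e1 [e2 _]]|[]] //; case: n.
- by move=> r' b rK'; rewrite YE //; apply: h7.
- by move=> t b tK; rewrite YE //; apply: h8.
- move=> c s Bc; case: (classic ((c, s) = (rc r, [:: a; L]))) => [[-> ->] _|n].
    by constructor 3; exists a, L, r.
  by rewrite YE //; apply: h9.
Qed.

Lemma raw_set u rb tb tr X t a : raw u rb tb tr X -> t < KK -> olt a u ->
  let Y := upd X (tc t, [:: a]) mk2 in
  raw u rb (fun t' a' => tb t' a' \/ (t' = t /\ a' = a)) tr Y /\ forall r b, same X Y r b.
Proof.
move=> hr tK au Y.
have YE c s : (c, s) <> (tc t, [:: a]) -> Y (c, s) = X (c, s) by move=> h; rewrite /Y upd_neq.
have sm r b : same X Y r b by move=> t'; rewrite YE.
split=> //; case: (hr) => h1 h2 h3 h4 h5 h6 h7 h8 h9; constructor.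
- by move=> c s cB; rewrite YE ?h1 // => -[e _]; move: e; rewrite /tc; lia.
- by rewrite YE.
- by move=> c hc; rewrite YE ?h3.
- by rewrite YE.
- move=> r b rK; have [L [hL hu]] := h5 r b rK; exists L; split=> //.
  by split=> t'; have := proj1 hL t'; have := proj2 hL t'; rewrite !(sm r b t').
- by move=> r b rK; rewrite -(same_bit (sm r b)) h6.
- by move=> r b rK; rewrite YE; [apply: h7|move=> [e _]; move: e; rewrite /rc /tc; lia].
- move=> t' b tK'; case: (classic (t' = t /\ b = a)) => [[-> ->]|n].
    by rewrite /Y upd_eq; split=> //; [right|split=> // _; right].
  rewrite YE; last by move=> [e e2]; apply: n; split=> //; move: e; rewrite /tc; lia.
  case: (h8 t' b tK') => k1 k2 k3; split=> //; rewrite k3.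
  by split; [left|case].
- move=> c s Bc; case: (classic ((c, s) = (tc t, [:: a]))) => [[-> ->] _|n].
    by constructor 2; exists a; split=> //; rewrite /tc; lia.
  by rewrite YE //; apply: h9.
Qed.

(** The length of a history becomes the supremum of its lengths, and tables become unions. Register
    bits are left as whatever the limit tape shows: a row rewritten cofinally often has a history of
    limit length and reads false. *)
Lemma raw_limit l us rbs tbs trs (Ys : ON -> tape) Yl : olimit l ->
  (forall b, olt b l -> raw (us b) (rbs b) (tbs b) (trs b) (Ys b)) ->
  limtape l Ys Yl -> (forall b, olt b l -> tle rk (Ys b) Yl) ->
  raw (sup l us) (fun r a => bit Yl (rc r) a) (fun t a => exists b, olt b l /\ tbs b t a)
    (fun c s => Yl (c, s)) Yl.
Proof.
move=> ll hr hY hle.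
have nz d : Yl d <> mk0 -> exists b, olt b l /\ Ys b d = Yl d.
  by move=> _; have [b [bl h]] := hY d; exists b; split=> //; apply: h.
have up b d : olt b l -> Ys b d <> mk0 -> Yl d <> mk0.
  by move=> bl h e; have := hle b bl d; rewrite e; case: (Ys b d) h.
have ev d : exists b, olt b l /\ Yl d = Ys b d.
  by have [b [bl h]] := hY d; exists b; split=> //; rewrite h.
constructor=> //.
- by have [b [bl ->]] := ev (B, [::]); apply: raw_base (hr b bl).
- by move=> c hc; have [b [bl ->]] := ev (c, [::]); apply: raw_root (hr b bl) _ hc.
- by have [b [bl ->]] := ev (B + K, [::]); apply: raw_sent (hr b bl).
- move=> r a rK.
  pose Lf b := epsilon (inhabits (ozero U)) (fun L => hist (Ys b) (rc r) a L /\ forall t, olt t L -> olt a (us b)).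
  have LfP b : olt b l -> hist (Ys b) (rc r) a (Lf b) /\ forall t, olt t (Lf b) -> olt a (us b).
    move=> bl; exact: (epsilon_spec (inhabits (ozero U)) (fun L => hist (Ys b) (rc r) a L /\ forall t, olt t L -> olt a (us b)) (raw_hist (hr b bl) a rK)).
  exists (sup l Lf); split; last first.
    by move=> t /lt_sup[b [bl /(proj2 (LfP b bl)) h]]; apply: olt_le_trans h (le_sup us bl).
  have Yn t b : olt b l -> olt t (Lf b) -> Yl (rc r, [:: a; t]) <> mk0.
    by move=> bl tb; apply: (up b) => //; apply/(proj1 (proj1 (LfP b bl))).
  split=> t.
    split=> [n|/lt_sup[b [bl tb']]]; last exact: Yn tb'.
    have [b [bl e]] := nz _ n; apply: olt_le_trans (le_sup Lf bl).
    by apply/(proj1 (proj1 (LfP b bl))); rewrite e.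
  move=> /lt_sup[b [bl tb']]; have n := Yn t b bl tb'; have [b' [bl' e]] := nz _ n.
  rewrite -e; apply: (proj2 (proj1 (LfP b' bl'))).
  by apply/(proj1 (proj1 (LfP b' bl'))); rewrite e.
- move=> r a rK; split=> [al|n].
    have [b [bl ab]] := lt_sup al.
    have h := raw_row (hr b bl) a rK; have [b' [bl' e]] := ev (rc r, [:: a]).
    rewrite e; have : Ys b' (rc r, [:: a]) <> mk0.
      by rewrite -e; apply: (up b) => //; rewrite (proj1 h).
    by move=> h'; have [k k'] := raw_row (hr b' bl') a rK; apply: k; apply: k'.
  have [b [bl e]] := nz _ n; apply: olt_le_trans (le_sup us bl).
  by apply: (proj2 (raw_row (hr b bl) a rK)); rewrite e.
- move=> t a tK; split=> [al|n|].
  + have [b [bl ab]] := lt_sup al; have [k1 k2 k3] := raw_tab (hr b bl) a tK.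
    have [b' [bl' e]] := ev (tc t, [:: a]); have [k1' k2' k3'] := raw_tab (hr b' bl') a tK.
    rewrite e; apply: k1'; apply: k2'; rewrite -e; apply: (up b) => //.
    by case: (k1 ab) => ->.
  + have [b [bl e]] := nz _ n; apply: olt_le_trans (le_sup us bl).
    by have [_ k _] := raw_tab (hr b bl) a tK; apply: k; rewrite e.
  + split=> [e|[b [bl tb]]].
      have [b [bl e']] := ev (tc t, [:: a]); exists b; split=> //.
      by have [_ _ k] := raw_tab (hr b bl) a tK; apply/k; rewrite -e'.
    have [_ _ k] := raw_tab (hr b bl) a tK; move/k: tb => tb.
    have [b' [bl' e]] := ev (tc t, [:: a]); have [k1 k2 _] := raw_tab (hr b' bl') a tK.
    have := hle b bl (tc t, [:: a]); rewrite tb e.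
    by case: (k1 _) => [|->|->] //; apply: k2; rewrite -e; apply: (up b) => //; rewrite tb.
- by move=> c s Bc n; have [b [bl e]] := nz _ n; apply: (raw_blank (hr b bl) Bc); rewrite e.
Qed.

End Raw.

(** * Register commands and reasoning about the memory *)

Definition rd r := at_comp r.*2 readbit.
Definition fl r := at_comp r.*2 flipbit.
Definition gtb t := at_comp t.*2.+1 readtab.
Definition stb t := at_comp t.*2.+1 settab.
Definition both r s := Bind (rd r) (Ret 0) (rd s) (Ret 0).

(** [zero] flips the true bits one after the other, [inc] flips the first false bit. In the two
    comparisons the sweep stops at the minimum of both values, where the bits tell which register
    attains it. *)
Definition zero B KK r := sweep B KK.*2 (rd r) (fl r) (Ret 0).
Definition inc B KK r := sweep B KK.*2 (rd r) (Ret 0) (fl r).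
Definition get B KK t r := sweep B KK.*2 (rd r) (Ret 0) (gtb t).
Definition set B KK t r := sweep B KK.*2 (rd r) (Ret 0) (stb t).
Definition eqr B KK r s := sweep B KK.*2 (both r s) (Ret 0)
  (Bind (rd r) (Bind (rd s) (Ret 1) (Ret 0) (Ret 0)) (Ret 0) (Ret 0)).
Definition ler B KK r s := sweep B KK.*2 (both r s) (Ret 0) (Bind (rd r) (Ret 1) (Ret 0) (Ret 0)).

Record mem (U : zfc_universe) := Mem {
  regs : nat -> ON U;
  tabs : nat -> ON U -> Prop;
  trees : nat -> seq (ON U) -> mark
}.

(* Access rights: a register of level 0 is constant, of level 1 only
   incremented, of level 2 arbitrary; [etr] allows changes of the trees. *)
Record eff := Eff { acc : nat -> nat; etr : bool }.
Definition sub_eff e e' := (forall r, acc e r <= acc e' r) /\ (etr e -> etr e').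

Section Mem.
Variables (U : zfc_universe) (M : machine) (X0 : tape U) (B KK : nat).
Local Notation ON := (ON U).
Local Notation cell := (cell U).
Local Notation tape := (tape U).
Local Notation mem := (mem U).
Local Notation exec := (@exec U M X0).
Local Notation reach := (@reach U M X0).
Local Notation K := (KK.*2).
Local Notation rc := (rc B).
Local Notation tc := (tc B).
Local Notation raw := (@raw U B KK).
Local Notation same := (@same U B).
Local Notation origin := (origin U).
Implicit Types (a b u : ON) (X Y : tape) (lb : cell) (rb tb : nat -> ON -> Prop) (tr : nat -> seq ON -> mark)
  (m : mem) (e : eff) (D : Prop).

Lemma cleB a c : B <= c -> cle (B, [:: a]) (c, [:: a]).
Proof. by move=> h; rewrite -(subnKC h); apply: cle_add. Qed.

Lemma exec_rd u rb tb tr Y r a (Q : nat -> cell -> tape -> Prop) D : raw u rb tb tr Y -> r < KK ->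
  Q (b2 (rb r a)) (B, [:: a]) Y -> exec rk (B, [:: a]) (rd r) (B, [:: a]) Y Q D.
Proof.
move=> hr rK q; have [L [hL _]] := raw_hist hr a rK.
apply: (exec_at (X' := Y) (v := b2 (rb r a))) => //.
- by rewrite /b2; case: lem.
apply: (exec_readbit hL); first by apply: cleB; rewrite /rc; lia.
split=> //; apply: b2_iff; exact: (raw_bit hr a rK).
Qed.

Lemma exec_fl u rb tb tr Y r a (Q : nat -> cell -> tape -> Prop) D : raw u rb tb tr Y -> r < KK -> olt a u ->
  (forall Y', raw u (fun r' a' => (r' = r /\ a' = a /\ ~ rb r a) \/ (~ (r' = r /\ a' = a) /\ rb r' a')) tb tr Y' ->
     (forall r' a', ~ (r' = r /\ a' = a) -> same Y Y' r' a') -> grow B Y Y' r a ->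
     (forall d, Y d <> mk0 -> Y' d = Y d) -> Q 0 (B, [:: a]) Y') ->
  exec rk (B, [:: a]) (fl r) (B, [:: a]) Y Q D.
Proof.
move=> hr rK au q; have [L [hL _]] := raw_hist hr a rK.
have [h1 h2 h3] := raw_flip hr rK au hL.
apply: (exec_at (X' := upd Y (rc r, [:: a; L]) (if lem (bit Y (rc r) a) then mk1 else mk2)) (v := 0)) => //.
- apply: (exec_flipbit hL) => [|k ->]; first by apply: cleB; rewrite /rc; lia.
  by split.
- apply: q => // d nd; rewrite upd_neq // => ed; apply: nd; rewrite ed.
  exact: hist_blank hL _.
Qed.

Lemma exec_gtb u rb tb tr Y t a (Q : nat -> cell -> tape -> Prop) D : raw u rb tb tr Y -> t < KK ->
  Q (b2 (tb t a)) (B, [:: a]) Y -> exec rk (B, [:: a]) (gtb t) (B, [:: a]) Y Q D.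
Proof.
move=> hr tK q; have [_ _ h] := raw_tab hr a tK.
apply: (exec_at (X' := Y) (v := b2 (tb t a))) => //.
- by rewrite /b2; case: lem.
apply: (exec_act (k := Y (tc t, [:: a])) (mv := mvS) (v := if Y (tc t, [:: a]) is mk2 then 1 else 0) (h' := (tc t, [:: a]))) => //.
- exact: moves_s.
- by apply: cleB; rewrite /tc; lia.
rewrite upd_id; split=> //; case: (classic (tb t a)) => hb.
  by rewrite b2T // (proj2 h hb).
by rewrite b2F //; case E : (Y _) => //; case: hb; apply/h.
Qed.

Lemma exec_stb u rb tb tr Y t a (Q : nat -> cell -> tape -> Prop) D : raw u rb tb tr Y -> t < KK -> olt a u ->
  (forall Y', raw u rb (fun t' a' => tb t' a' \/ (t' = t /\ a' = a)) tr Y' ->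
     (forall r b, same Y Y' r b) -> Q 0 (B, [:: a]) Y') ->
  exec rk (B, [:: a]) (stb t) (B, [:: a]) Y Q D.
Proof.
move=> hr tK au q; have [h1 h2] := raw_set hr tK au.
apply: (exec_at (X' := upd Y (tc t, [:: a]) mk2) (v := 0)) => //; last exact: q.
apply: (exec_act (k := mk2) (mv := mvS) (v := 0) (h' := (tc t, [:: a]))) => //.
- exact: moves_s.
- by have [h _ _] := raw_tab hr a tK; case: (h au) => ->.
- by apply: cleB; rewrite /tc; lia.
Qed.

Lemma limtape_const l (Ys : ON -> tape) Yl : olimit l -> limtape l Ys Yl -> forall d k,
  (exists b, olt b l /\ forall b', ole b b' -> olt b' l -> Ys b' d = k) -> Yl d = k.
Proof.
move=> ll hY d k [b [bl hb]]; have [g [gl hg]] := hY d.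
case: (ole_olt b g) => h; first by rewrite -(hg g) // hb.
by rewrite -(hg b) ?hb //; left.
Qed.

Lemma limtape_same l (Ys : ON -> tape) Yl b X r a : olimit l -> limtape l Ys Yl -> olt b l ->
  (forall b', ole b b' -> olt b' l -> same X (Ys b') r a) -> same X Yl r a.
Proof.
move=> ll hY bl h t; symmetry; apply: (limtape_const ll hY); exists b; split=> // b' bb' b'l.
by rewrite -h.
Qed.

Lemma exec_sweep cond act fin (J : ON -> tape -> Prop) (Jf : tape -> Prop) de X
    (Q : nat -> cell -> tape -> Prop) D v :
  J (ozero U) X -> v < 3 ->
  (forall b Y, olt b de -> J b Y -> exec rk (B, [:: b]) (sweep_row K cond act fin) (B, [:: b]) Y
     (fun w h' Y' => [/\ w = 0, h' = (B, [:: osucc b]) & J (osucc b) Y']) D) ->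
  (forall Y, J de Y -> exec rk (B, [:: de]) (sweep_row K cond act fin) (B, [:: de]) Y
     (fun w h' Y' => [/\ w = v.+1, h' = (B, [:: de]) & Jf Y']) D) ->
  (forall l Ys Yl, ole l de -> olimit l -> (forall b, olt b l -> J b (Ys b)) ->
     (forall b b', olt b b' -> olt b' l -> tle rk (Ys b) (Ys b')) -> limtape l Ys Yl ->
     (forall b, olt b l -> tle rk (Ys b) Yl) -> J l Yl) ->
  (forall Y, tle rk X Y -> Jf Y -> Q v origin Y) ->
  exec rk origin (sweep B K cond act fin) origin X Q D.
Proof.
move=> j0 v3 hrow hend hlim q.
apply: (exec_jmpS (c := 0) (s := [::])) => //; rewrite add0n.
apply: (exec_seq_mv (h' := (B, [:: ozero U]))) => //; first exact: (moves_z [:: onat U B]).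
apply: (exec_bind (Q1 := fun w h' Y => [/\ w = v, h' = (B, [:: de]) & Jf Y])).
  apply: exec_loop.
  have R : reach false rk origin (sweep_row K cond act fin) (B, [:: ozero U]) X
    (fun h' X' => h' = (B, [:: de]) /\ exists g : unit, J de X' /\ True) D.
    apply: (@reach_tf _ _ _ unit rk origin _ (fun b => (B, [:: b])) (fun b _ Y => J b Y) (fun _ _ _ _ => True) de tt X D) => //.
    - exact: rk_ok.
    - by move=> b b' bb' _; apply: (cle_rcons B [::]).
    - by move=> l d _ ll h; apply: (@cle_lub _ B [::]).
    - move=> b _ Y bde jb.
      apply: (@reach_weak _ _ _ true _ _ (B, [:: b]) _ _ _ _ (fun h' X' => h' = (B, [:: osucc b]) /\ J (osucc b) X') _ D D) => //.
        apply: reach_iter; first exact: cle_refl.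
        by apply: (exec_weak (hrow b Y bde jb))  => // w h' Y' _ [].
      by move=> h' Y' _ [-> ?]; split=> //; exists tt.
    - move=> l gs Ys Yl lde ll hJ hp hY hle; exists tt; split=> //.
      by apply: (hlim l Ys Yl) => // b b' bb' b'l; case: (hp b b' bb' b'l).
  apply: (reach_weak R) => //.
  move=> h' Y _ [-> [_ [jd _]]]; split=> //.
  apply: (exec_weak (hend Y jd)) => // w h'' Y' _ [-> -> ?]; by split.
move=> w h1 Y tXY [-> -> jf]; have qY := q Y tXY jf.
have fin' w' : w' = v -> exec rk origin (seqc (mv1 mvU) (seqc (jmp mvJMinus B) (Ret w'))) (B, [:: de]) Y Q D.
  move=> ->; apply: (exec_seq_mv (h' := (B, [::]))) => //; first exact: (moves_u [:: onat U B]).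
  by rewrite -[B]add0n; apply: exec_jmpM => //; apply: exec_ret.
by case: v v3 qY fin' {hend q} => [|[|[|v]]] // _ _ h; apply: h.
Qed.

Lemma exec_row_cont cond act fin u rb tb tr Y a (Q : nat -> cell -> tape -> Prop) D :
  raw u rb tb tr Y -> ole a u ->
  (forall u' Y', raw u' rb tb tr Y' -> olt a u' -> (forall r b, same Y Y' r b) ->
     exec rk (B, [:: a]) cond (B, [:: a]) Y' (fun w h Z => [/\ w = 1, h = (B, [:: a]) & Z = Y']) D) ->
  (forall u' Y', raw u' rb tb tr Y' -> olt a u' -> (forall r b, same Y Y' r b) ->
     exec rk (B, [:: a]) act (B, [:: a]) Y' (fun w h Z => h = (B, [:: a]) /\ Q 0 (B, [:: osucc a]) Z) D) ->
  exec rk (B, [:: a]) (sweep_row K cond act fin) (B, [:: a]) Y Q D.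
Proof.
move=> hr au hc ha; have lbr := cle_refl (B, [:: a]).
have [u' [hr' au' _ sm]] := raw_touch hr au.
have sm' r b : same Y (touched Y B K a) r b by move=> t; rewrite sm.
apply: (exec_seq (Q1 := fun w h Z => h = (B, [:: a]) /\ Z = touched Y B K a)); first by apply: exec_touch.
move=> _ _ _ _ [-> ->]; apply: exec_bind (hc u' _ hr' au' sm') _ => w h1 Z _ [-> -> ->] /=.
apply: exec_seq (ha u' _ hr' au' sm') _ => w' h2 Z' _ [-> q].
by apply: exec_mv1 q => //; exact: (moves_plus [:: onat U B] a).
Qed.

Lemma exec_row_stop cond act fin u rb tb tr Y a v (Q : nat -> cell -> tape -> Prop) D :
  raw u rb tb tr Y -> ole a u -> v < 3 ->
  (forall u' Y', raw u' rb tb tr Y' -> olt a u' -> (forall r b, same Y Y' r b) ->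
     exec rk (B, [:: a]) cond (B, [:: a]) Y' (fun w h Z => [/\ w = 0, h = (B, [:: a]) & Z = Y']) D) ->
  (forall u' Y', raw u' rb tb tr Y' -> olt a u' -> (forall r b, same Y Y' r b) ->
     exec rk (B, [:: a]) fin (B, [:: a]) Y' (fun w h Z => w = v /\ Q v.+1 h Z) D) ->
  exec rk (B, [:: a]) (sweep_row K cond act fin) (B, [:: a]) Y Q D.
Proof.
move=> hr au v3 hc ha; have lbr := cle_refl (B, [:: a]).
have [u' [hr' au' _ sm]] := raw_touch hr au.
have sm' r b : same Y (touched Y B K a) r b by move=> t; rewrite sm.
apply: (exec_seq (Q1 := fun w h Z => h = (B, [:: a]) /\ Z = touched Y B K a)); first by apply: exec_touch.
move=> _ _ _ _ [-> ->]; apply: exec_bind (hc u' _ hr' au' sm') _ => w h1 Z _ [-> -> ->] /=.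
apply: exec_bind (ha u' _ hr' au' sm') _ => w' h2 Z' _ [-> q].
by case: v v3 q {ha} => [|[|[|v]]] // _ q; apply: exec_ret.
Qed.

Definition hext X Y := forall r a t, r < KK -> X (rc r, [:: a; t]) <> mk0 -> Y (rc r, [:: a; t]) = X (rc r, [:: a; t]).

Lemma sweep_pure cond fin X u rb tb tr v de (Jf : tape -> Prop) (Q : nat -> cell -> tape -> Prop) D :
  raw u rb tb tr X -> v < 3 ->
  (forall b u' Y, ole b de -> raw u' rb tb tr Y -> olt b u' ->
     exec rk (B, [:: b]) cond (B, [:: b]) Y (fun w h Z => [/\ w = b2 (olt b de), h = (B, [:: b]) & Z = Y]) D) ->
  (forall u' Y, raw u' rb tb tr Y -> olt de u' -> (forall r b, r < KK -> same X Y r b) ->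
     exec rk (B, [:: de]) fin (B, [:: de]) Y (fun w h Z => [/\ w = v, h = (B, [:: de]) & Jf Z]) D) ->
  (forall Y, tle rk X Y -> Jf Y -> Q v origin Y) ->
  exec rk origin (sweep B K cond (Ret 0) fin) origin X Q D.
Proof.
move=> hr v3 hc hf q.
pose J b Y := exists u', [/\ raw u' rb tb tr Y, ole b u' & forall r a, r < KK -> same X Y r a].
apply: (@exec_sweep _ _ _ J Jf de X Q D v) => //.
- by exists u; split.
- move=> b Y bde [u' [hr' bu' sm]]; apply: (@exec_row_cont _ _ _ u' rb tb tr) => //.
    move=> u2 Y2 hr2 bu2 _; apply: (exec_weak (hc b u2 Y2 _ hr2 bu2)) => //.
    + by left.
    by move=> w h Z _ [-> -> ->]; rewrite b2T.
  move=> u2 Y2 hr2 bu2 sm2; apply: exec_ret; split=> //; split=> //; exists u2; split=> //.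
    exact/oleS.
  by move=> r a rK; apply: same_trans (sm r a rK) (sm2 r a).
- move=> Y [u' [hr' bu' sm]]; apply: (@exec_row_stop _ _ _ u' rb tb tr _ _ v) => //.
    move=> u2 Y2 hr2 bu2 _; apply: (exec_weak (hc de u2 Y2 _ hr2 bu2)) => //.
    by move=> w h Z _ [-> -> ->]; rewrite b2F //; apply: olt_irr.
  move=> u2 Y2 hr2 bu2 sm2.
  have sm3 r a : r < KK -> same X Y2 r a by move=> rK; apply: same_trans (sm r a rK) (sm2 r a).
  apply: (exec_weak (hf u2 Y2 hr2 bu2 sm3)) => //.
  by move=> w h Z _ [-> -> jz]; split.
- move=> l Ys Yl lde ll hJ hp hY hle.
  pose us b := epsilon (inhabits (ozero U)) (fun u' => [/\ raw u' rb tb tr (Ys b), ole b u' & forall r a, r < KK -> same X (Ys b) r a]).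
  have usP b : olt b l -> [/\ raw (us b) rb tb tr (Ys b), ole b (us b) & forall r a, r < KK -> same X (Ys b) r a].
    by move=> bl; apply: (epsilon_spec (inhabits (ozero U)) (fun u' => [/\ raw u' rb tb tr (Ys b), ole b u' & forall r a, r < KK -> same X (Ys b) r a])); apply: hJ.
  have sm r a : r < KK -> same X Yl r a.
    move=> rK; apply: (limtape_same ll hY (proj1 ll)) => b' _ /usP[_ _]; exact.
  exists (sup l us); split=> //.
    apply: (raw_eqv (raw_limit (us := us) (rbs := fun _ => rb) (tbs := fun _ => tb) (trs := fun _ => tr) ll _ hY hle)).
    + by move=> b /usP[].
    + by move=> r a rK; rewrite -(same_bit (sm r a rK)); apply: (raw_bit hr).
    + by move=> t a tK; split=> [[b [_]]|h] //; exists (ozero U); split=> //; case: ll.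
    + move=> c s cB; apply: (limtape_const ll hY); exists (ozero U); split; first by case: ll.
      by move=> b' _ /usP[h _ _]; apply: (raw_trees h).
  suff h : ole (sup l id) (sup l us) by rewrite (sup_id ll) in h.
  apply: sup_le => b bl; apply: ole_trans (le_sup us bl).
  by case: (usP b bl).
Qed.

Definition Rep m X := exists u, raw u (fun r a => olt a (regs m r)) (tabs m) (trees m) X.

(* How the tape records changes of the registers: clobbering a register
   rewrites an end segment of the rows below its value. *)
Definition hrel e m X Y := [/\ forall r a, r < KK -> acc e r < 2 -> olt a (regs m r) -> same X Y r a,
  forall r a a', r < KK -> olt a a' -> olt a' (regs m r) -> same X Y r a' -> same X Y r a & hext X Y].

(* Tables 0 and 2 are frozen on the rows listed in table 1. *)
Definition kext m m' := forall a b, tabs m 1 a ->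
  (tabs m' 0 (pr a b) <-> tabs m 0 (pr a b)) /\ (tabs m' 2 (pr a b) <-> tabs m 2 (pr a b)).

Definition mstep e m m' := [/\ forall r, acc e r = 0 -> regs m' r = regs m r,
  forall r, acc e r < 2 -> ole (regs m r) (regs m' r),
  forall t a, tabs m t a -> tabs m' t a,
  etr e = false -> trees m' = trees m & kext m m'].

Lemma mstep_refl e m : mstep e m m. Proof. by split=> // *. Qed.

Lemma mstep_trans e m1 m2 m3 : mstep e m1 m2 -> mstep e m2 m3 -> mstep e m1 m3.
Proof.
move=> [h1 h2 h3 h4 h5] [k1 k2 k3 k4 k5]; split.
- by move=> r hr; rewrite k1 // h1.
- by move=> r hr; apply: ole_trans (h2 r hr) (k2 r hr).
- by move=> t a /h3/k3.
- by move=> ht; rewrite k4 // h4.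
- move=> a b ha; have [p1 p2] := h5 a b ha; have [q1 q2] := k5 a b (h3 _ _ ha).
  by rewrite q1 q2.
Qed.

Lemma mstep_sub e e' m m' : sub_eff e e' -> mstep e m m' -> mstep e' m m'.
Proof.
move=> [s1 s2] [h1 h2 h3 h4 h5]; split=> //.
- by move=> r hr; apply: h1; have := s1 r; lia.
- by move=> r hr; apply: h2; have := s1 r; lia.
- by move=> ht; apply: h4; case: (etr e) s2 => // /(_ isT); rewrite ht.
Qed.

Lemma hrel_refl e m X : hrel e m X X. Proof. by split. Qed.

Lemma hrel_sub e e' m X Y : sub_eff e e' -> hrel e m X Y -> hrel e' m X Y.
Proof.
by move=> [s1 _] [h1 h2 h3]; split=> // r a rK hr; apply: h1 => //; have := s1 r; lia.
Qed.

Lemma hrel_trans e m X m' Y Z : Rep m X -> Rep m' Y -> tle rk X Y -> tle rk Y Z -> mstep e m m' ->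
  hrel e m X Y -> hrel e m' Y Z -> hrel e m X Z.
Proof.
move=> [u hX] [u' hY] xy yz [s1 s2 _ _ _] [h1 h2 h3] [k1 k2 k3]; split.
- move=> r a rK hr ha; apply: same_trans (h1 r a rK hr ha) (k1 r a rK hr _).
  by apply: olt_le_trans ha (s2 r hr).
(* Ranks only grow, so a row that is the same on [X] and [Z] is the same on [Y] in between. *)
- move=> r a a' rK aa' ha' sm; have sm1 := same_mid xy yz sm.
  have sm2 : same Y Z r a' by move=> t; rewrite -sm sm1.
  apply: same_trans (h2 r a a' rK aa' ha' sm1) (k2 r a a' rK aa' _ sm2).
  by apply/(raw_bit hY a' rK)/(same_bit sm1)/(raw_bit hX a' rK).
- by move=> r a t rK n; rewrite k3 ?h3.
Qed.

(** Commands on the memory start and end at the origin. As this is the least cell, a loop over such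
    commands finds the head there again at limit stages. *)
Definition wp e c (Q : nat -> mem -> Prop) D m := forall X, Rep m X ->
  exec rk origin c origin X (fun v h Y => h = origin /\ exists m',
    [/\ Rep m' Y, hrel e m X Y, mstep e m m' & Q v m']) D.

Definition mreach st e c m (P : mem -> Prop) D := forall X, Rep m X ->
  reach st rk origin c origin X (fun h Y => h = origin /\ exists m',
    [/\ Rep m' Y, hrel e m X Y, mstep e m m' & P m']) D.

Lemma wp_ret e v (Q : nat -> mem -> Prop) D m : Q v m -> wp e (Ret v) Q D m.
Proof.
move=> q X hX; apply: exec_ret; split=> //; by exists m.
Qed.

Lemma wp_weak e e' c (Q Q' : nat -> mem -> Prop) D D' m : wp e c Q D m -> sub_eff e e' -> (D -> D') ->
  (forall v m', mstep e m m' -> Q v m' -> Q' v m') -> wp e' c Q' D' m.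
Proof.
move=> h s hD hQ X hX; apply: (exec_weak (h X hX)) => //.
move=> v h' Y _ [-> [m' [r1 r2 r3 q]]]; split=> //; exists m'; split=> //.
- exact: hrel_sub r2.
- exact: mstep_sub r3.
- exact: hQ.
Qed.

Lemma wp_bind e c c0 c1 c2 (Q1 Q : nat -> mem -> Prop) D m : wp e c Q1 D m ->
  (forall v m', mstep e m m' -> Q1 v m' -> wp e (pick c0 c1 c2 v) Q D m') -> wp e (Bind c c0 c1 c2) Q D m.
Proof.
move=> h hg X hX; apply: exec_bind (h X hX) _ => v h1 Y xy [-> [m' [r1 r2 r3 q]]].
apply: (exec_weak (hg v m' r3 q Y r1)) => //.
move=> w h' Z yz [-> [m2 [s1 s2 s3 q2]]]; split=> //; exists m2; split=> //.
- exact: hrel_trans r2 s2.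
- exact: mstep_trans r3 s3.
Qed.

Lemma wp_seq e c d (Q1 Q : nat -> mem -> Prop) D m : wp e c Q1 D m ->
  (forall v m', mstep e m m' -> Q1 v m' -> wp e d Q D m') -> wp e (seqc c d) Q D m.
Proof.
move=> h hd; apply: wp_bind h _ => v m' s q; have := hd v m' s q.
by case: v {q} => [|[|v]].
Qed.

Lemma mreach_refl e c m (P : mem -> Prop) D : P m -> mreach false e c m P D.
Proof.
move=> q X hX; apply: reach_refl; split=> //; by exists m.
Qed.

Lemma mreach_weak (st st' : bool) e e' c (P P' : mem -> Prop) D D' m : mreach st e c m P D -> sub_eff e e' ->
  (D -> D') -> (st' -> st) -> (forall m', mstep e m m' -> P m' -> P' m') -> mreach st' e' c m P' D'.
Proof.
move=> h s hD hst hQ X hX; apply: (reach_weak (h X hX)) => //.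
move=> h' Y _ [-> [m' [r1 r2 r3 q]]]; split=> //; exists m'; split=> //.
- exact: hrel_sub r2.
- exact: mstep_sub r3.
- exact: hQ.
Qed.

Lemma mreach_trans st e c m (P' P : mem -> Prop) D : mreach st e c m P' D ->
  (forall m', mstep e m m' -> P' m' -> mreach false e c m' P D) -> mreach st e c m P D.
Proof.
move=> h hg X hX; apply: (reach_trans (h X hX)) => h1 Y xy [-> [m' [r1 r2 r3 q]]].
apply: (reach_weak (hg m' r3 q Y r1)) => //.
move=> h' Z yz [-> [m2 [s1 s2 s3 q2]]]; split=> //; exists m2; split=> //.
- exact: hrel_trans r2 s2.
- exact: mstep_trans r3 s3.
Qed.

Lemma mreach_iter e c m (P : mem -> Prop) D : wp e c (fun v m' => v = 0 /\ P m') D m -> mreach true e c m P D.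
Proof.
move=> h X hX; apply: reach_iter; first exact: cle_refl.
apply: (exec_weak (h X hX)) => //.
by move=> v h' Y _ [-> [m' [r1 r2 r3 [-> q]]]]; split=> //; split=> //; exists m'; split.
Qed.

Lemma wp_loop e c (Q : nat -> mem -> Prop) D m :
  mreach false e c m (fun m' => wp e c (fun v m'' => 0 < v /\ Q v.-1 m'') D m') D ->
  wp e (Loop c) Q D m.
Proof.
move=> h X hX; apply: exec_loop; apply: (reach_weak (h X hX)) => //.
move=> h' Y xy [-> [m' [r1 r2 r3 q]]]; split; first exact: cle_refl.
apply: (exec_weak (q Y r1)) => //.
move=> v h'' Z yz [-> [m2 [s1 s2 s3 [v0 q2]]]]; split=> //; split=> //; exists m2; split=> //.
- exact: hrel_trans r2 s2.
- exact: mstep_trans r3 s3.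
Qed.

Definition limmem e l (ms : ON -> mem) ml := [/\
  forall r, acc e r < 2 -> is_lub (fun x => exists b, olt b l /\ x = regs (ms b) r) (regs ml r),
  forall t a, tabs ml t a <-> exists b, olt b l /\ tabs (ms b) t a,
  forall c s, c < B -> exists b, olt b l /\ forall b', ole b b' -> olt b' l -> trees (ms b') c s = trees ml c s &
  forall b, olt b l -> mstep e (ms b) ml].

Lemma segment_ex (P : ON -> Prop) u : (forall a b, olt a b -> P b -> P a) -> (forall a, P a -> olt a u) ->
  exists x, forall a, P a <-> olt a x.
Proof.
move=> dn bd; have [|x [nx hx]] := @least U (fun a => ~ P a) u; first by move=> /bd/olt_irr.
exists x => a; split=> [pa|ax]; last by apply: NNPP; apply: hx.
by apply: NNPP => /oltNge[xa|e]; apply: nx; [apply: dn xa pa|rewrite e].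
Qed.

(** The issue is that every register has a value at all, that is, that its true bits on the limit
    tape form an initial segment. The row of a true bit is unchanged from some stage on; by the
    second clause of [hrel] so are all lower rows, whose bits were true at that stage. *)
Lemma limit_mem e l (ms : ON -> mem) Xs Xl : olimit l ->
  (forall b, olt b l -> Rep (ms b) (Xs b)) ->
  (forall b b', olt b b' -> olt b' l -> [/\ tle rk (Xs b) (Xs b'), hrel e (ms b) (Xs b) (Xs b') & mstep e (ms b) (ms b')]) ->
  limtape l Xs Xl -> (forall b, olt b l -> tle rk (Xs b) Xl) ->
  exists ml, [/\ Rep ml Xl, limmem e l ms ml & forall b, olt b l -> hrel e (ms b) (Xs b) Xl].
Proof.
move=> ll hR hp hX hle.
have hp' b b' : ole b b' -> olt b' l -> [/\ tle rk (Xs b) (Xs b'), hrel e (ms b) (Xs b) (Xs b') & mstep e (ms b) (ms b')].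
  case=> [bb'|->] b'l; first exact: hp.
  by split; [exact: tle_refl|exact: hrel_refl|exact: mstep_refl].
pose us b := epsilon (inhabits (ozero U)) (fun u => raw u (fun r a => olt a (regs (ms b) r)) (tabs (ms b)) (trees (ms b)) (Xs b)).
have usP b : olt b l -> raw (us b) (fun r a => olt a (regs (ms b) r)) (tabs (ms b)) (trees (ms b)) (Xs b).
  by move=> bl; apply: (epsilon_spec (inhabits (ozero U)) (fun u => raw u _ _ _ _)); apply: hR.
have hraw := raw_limit ll usP hX hle.
have hrl b : olt b l -> hrel e (ms b) (Xs b) Xl.
  move=> bl; split.
  - move=> r a rK ar ha; apply: (limtape_same ll hX bl) => b' bb' b'l.
    by case: (hp' b b' bb' b'l) => _ [h _ _] _; apply: h.
  - move=> r a a' rK aa' ha' sm; apply: (limtape_same ll hX bl) => b' bb' b'l.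
    case: (hp' b b' bb' b'l) => t1 [_ h _] _; apply: (h r a a') => //.
    exact: same_mid t1 (hle b' b'l) sm.
  - move=> r a t rK n; apply: (limtape_const ll hX); exists b; split=> // b' bb' b'l.
    by case: (hp' b b' bb' b'l) => _ [_ _ h] _; apply: h.
have keep b r a : olt b l -> r < KK -> same (Xs b) Xl r a -> bit Xl (rc r) a <-> olt a (regs (ms b) r).
  by move=> bl rK sm; rewrite -(same_bit sm); apply: (raw_bit (usP b bl)).
(* A true bit is a mark at some position [t] followed by a blank. Once this mark is present the
   history has length [osucc t] for good. *)
have ev r a : bit Xl (rc r) a -> r < KK -> exists b, olt b l /\ forall b', ole b b' -> olt b' l ->
    same (Xs b) (Xs b') r a /\ olt a (regs (ms b) r).
  move=> [t [t2 ts]] rK; have [b [bl hb]] := hX (rc r, [:: a; t]); exists b; split=> // b' bb' b'l.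
  have bs c : olt c l -> Xs c (rc r, [:: a; osucc t]) = mk0.
    by move=> cl; have := hle c cl (rc r, [:: a; osucc t]); rewrite ts; case: (Xs c _).
  have [L [hL _]] := raw_hist (usP b bl) a rK.
  have eL : L = osucc t.
    apply: ole_anti; last by apply/oleS/(proj1 hL); rewrite hb // t2.
    by apply/oltNge => /(proj1 hL); rewrite bs.
  have [L' [hL' _]] := raw_hist (usP b' b'l) a rK.
  split; last first.
    by apply/(raw_bit (usP b bl) a rK); exists t; rewrite hb // bs.
  move=> t'; case: (classic (olt t' L)) => h.
    by case: (hp' b b' bb' b'l) => _ [_ _ ->] //; apply/(proj1 hL).
  have -> : Xs b (rc r, [:: a; t']) = mk0 by apply: (hist_blank hL); apply/oltNge.
  symmetry; apply: (hist_blank hL'); apply: (@ole_trans _ _ L); last exact/oltNge.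
  by rewrite eL; apply/oltNge => /(proj1 hL'); rewrite bs.
have seg r : r < KK -> exists x, forall a, bit Xl (rc r) a <-> olt a x.
  move=> rK; apply: (@segment_ex _ (sup l us)).
    move=> a a' aa' ha'; have [b [bl hb]] := ev r a' ha' rK.
    have sm : same (Xs b) Xl r a.
      apply: (limtape_same ll hX bl) => b' bb' b'l; have [sm ab] := hb b' bb' b'l.
      by case: (hp' b b' bb' b'l) => _ [_ h _] _; apply: (h r a a').
    apply/(keep b r a bl rK sm); apply: olt_trans aa' _.
    by case: (hb b (ole_refl b) bl).
  move=> a [t [t2 _]]; have [L [hL hu]] := raw_hist hraw a rK.
  by apply: (hu t); apply/(proj1 hL); rewrite t2.
(* Registers of level below 2 take the supremum of their earlier values. For the others the value is
   read off the limit tape. *)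
pose rl r := if acc e r < 2 then sup l (fun b => regs (ms b) r) else
  epsilon (inhabits (ozero U)) (fun x => r < KK -> forall a, bit Xl (rc r) a <-> olt a x).
pose ml := Mem rl (fun t a => exists b, olt b l /\ tabs (ms b) t a)
  (if etr e then (fun c s => if c < B then Xl (c, s) else mk0) else trees (ms (ozero U))).
have l0 := proj1 ll.
have rlP r a : r < KK -> bit Xl (rc r) a <-> olt a (rl r).
  move=> rK; rewrite /rl; case: ifP => ar; last first.
    apply: (epsilon_spec (inhabits (ozero U)) (fun x => r < KK -> forall a, bit Xl (rc r) a <-> olt a x)) => //.
    by have [x hx] := seg r rK; exists x.
  split=> [ha|/lt_sup[b [bl ab]]].
    have [b [bl hb]] := ev r a ha rK; have [_ ab] := hb b (ole_refl b) bl.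
    exact: olt_le_trans ab (le_sup (fun b => regs (ms b) r) bl).
  by apply/(keep b r a bl rK) => //; case: (hrl b bl) => h _ _; apply: h.
have trP c s : c < B -> Xl (c, s) = trees ml c s.
  move=> cB; rewrite /ml /=; case E : (etr e); first by rewrite cB.
  apply: (limtape_const ll hX); exists (ozero U); split=> // b' _ b'l.
  rewrite (raw_trees (usP b' b'l)) //; case: (hp' _ _ (ole0 b') b'l) => _ _ [_ _ _ h _].
  by rewrite h.
exists ml; split=> //.
  exists (sup l us); apply: (raw_eqv hraw) => //.
split=> //=.
- by move=> r ar; rewrite /rl ar; apply: supP.
- move=> c s cB; have [b [bl hb]] := hX (c, s); exists b; split=> // b' bb' b'l.
  have := trP c s cB; rewrite /ml /= => <-.
  by rewrite -(hb b' bb' b'l) (raw_trees (usP b' b'l)).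
- move=> b bl; split=> /=.
  + move=> r ar; rewrite /rl ar /=; apply: ole_anti; last exact: (le_sup (fun b => regs (ms b) r)).
    apply: sup_le => b' b'l; case: (ole_olt b b') => h.
      by case: (hp' b b' h b'l) => _ _ [k _ _ _ _]; rewrite k.
    by case: (hp b' b h bl) => _ _ [_ k _ _ _]; apply: k; rewrite ar.
  + by move=> r ar; rewrite /rl ar; apply: (le_sup (fun b => regs (ms b) r)).
  + by move=> t a ha; exists b.
  + move=> ht; rewrite ht; by case: (hp' _ _ (ole0 b) bl) => _ _ [_ _ _ h _]; rewrite h.
  + have mono t a b1 b2 : ole b1 b2 -> olt b2 l -> tabs (ms b1) t a -> tabs (ms b2) t a.
      by move=> h1 h2; case: (hp' b1 b2 h1 h2) => _ _ [_ _ h _ _]; apply: h.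
    move=> a c ha; split; (split=> [[b' [b'l h]]|h]; last by exists b);
    (case: (ole_olt b b') => bb'; last by apply: (mono _ _ b') => //; left);
    by case: (hp' b b' bb' b'l) => _ _ [_ _ _ _ /(_ a c ha)[k1 k2]]; apply/k1 || apply/k2.
Qed.

Lemma mreach_tf e c (I : ON -> mem -> Prop) de m D :
  I (ozero U) m ->
  (forall b m', olt b de -> mstep e m m' -> I b m' -> mreach false e c m' (I (osucc b)) D) ->
  (forall l ms ml, ole l de -> olimit l -> (forall b, olt b l -> I b (ms b)) ->
     (forall b b', olt b b' -> olt b' l -> mstep e (ms b) (ms b')) ->
     (forall b, olt b l -> mstep e m (ms b)) -> limmem e l ms ml -> I l ml) ->
  mreach false e c m (I de) D.
Proof.
move=> i0 istep ilim X hX.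
pose E m1 X1 m2 X2 := Rep m1 X1 -> [/\ Rep m2 X2, tle rk X1 X2, hrel e m1 X1 X2 & mstep e m1 m2].
apply: (@reach_weak _ _ _ false false _ _ _ _ _ _ (fun h Y => h = origin /\ exists m', (Rep m' Y /\ mstep e m m' /\ I de m') /\ E m X m' Y) _ D D) => //.
- apply: (@reach_tf _ _ _ mem rk origin c (fun _ => origin) (fun b m' Y => Rep m' Y /\ mstep e m m' /\ I b m') E de m X D).
  + exact: rk_ok.
  + by move=> m1 X1 h; split=> //.
  + move=> m1 X1 m2 X2 m3 X3 h1 h2 r1; have [r2 t2 k2 s2] := h1 r1; have [r3 t3 k3 s3] := h2 r2.
    by split=> //; [exact: tle_trans t2 t3|exact: hrel_trans k2 k3|exact: mstep_trans s2 s3].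
  + exact: cle_refl.
  + by move=> *; apply: cle_refl.
  + by move=> l d _ [l0 _] h; apply: h l0.
  + by split=> //; split=> //; apply: mstep_refl.
  + move=> b m1 X1 bde [r1 [s1 i1]]; apply: (reach_weak (istep b m1 bde s1 i1 X1 r1)) => //.
    move=> h' Y t1 [-> [m2 [r2 k2 s2 i2]]]; split=> //; exists m2; split; last by split.
    by split=> //; split=> //; apply: mstep_trans s1 s2.
  + move=> l gs Xs Xl lde ll hI hp hX' hle.
    have hp' b b' : olt b b' -> olt b' l -> [/\ tle rk (Xs b) (Xs b'), hrel e (gs b) (Xs b) (Xs b') & mstep e (gs b) (gs b')].
      move=> bb' b'l; have [_ h] := hp b b' bb' b'l.
      by case: (h (proj1 (hI b (olt_trans bb' b'l)))).
    have [|ml [r1 lm h1]] := limit_mem ll _ hp' hX' hle; first by move=> b /hI[].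
    exists ml; split; last by move=> b bl _; split; [|exact: hle|exact: h1|case: lm => _ _ _; apply].
    split=> //; split.
      case: lm => _ _ _ h; apply: mstep_trans (h _ (proj1 ll)); by case: (hI _ (proj1 ll)) => _ [].
    apply: (ilim l gs ml) => //.
    * by move=> b /hI[_ []].
    * by move=> b b' bb' b'l; case: (hp' b b' bb' b'l).
    * by move=> b /hI[_ []].
- move=> h' Y t1 [-> [m' [[r1 [s1 i1]] /(_ hX)[_ _ k1 _]]]]; split=> //; by exists m'.
Qed.

Lemma wp_never e c (I : ON -> mem -> Prop) m (Q : nat -> mem -> Prop) D :
  D -> I (ozero U) m ->
  (forall b m', mstep e m m' -> I b m' -> mreach true e c m' (I (osucc b)) D) ->
  (forall l ms ml, olimit l -> (forall b, olt b l -> I b (ms b)) ->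
     (forall b b', olt b b' -> olt b' l -> mstep e (ms b) (ms b')) ->
     (forall b, olt b l -> mstep e m (ms b)) -> limmem e l ms ml -> I l ml) ->
  wp e (Loop c) Q D m.
Proof.
move=> hD i0 istep ilim X hX.
pose E m1 X1 m2 X2 := Rep m1 X1 -> [/\ Rep m2 X2, tle rk X1 X2, hrel e m1 X1 X2 & mstep e m1 m2].
apply: (@reach_never _ _ _ mem rk origin c origin (fun b m' Y => Rep m' Y /\ mstep e m m' /\ I b m') E m X D).
+ exact: rk_ok.
+ exact: hD.
+ move=> m1 X1 m2 X2 m3 X3 h1 h2 r1; have [r2 t2 k2 s2] := h1 r1; have [r3 t3 k3 s3] := h2 r2.
  by split=> //; [exact: tle_trans t2 t3|exact: hrel_trans k2 k3|exact: mstep_trans s2 s3].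
+ exact: cle_refl.
+ by split=> //; split=> //; apply: mstep_refl.
+ move=> b m1 X1 [r1 [s1 i1]]; apply: (reach_weak (istep b m1 s1 i1 X1 r1)) => //.
  move=> h' Y t1 [-> [m2 [r2 k2 s2 i2]]]; split=> //; exists m2; split; last by split.
  by split=> //; split=> //; apply: mstep_trans s1 s2.
+ move=> l gs Xs Xl ll hI hp hX' hle.
  have hp' b b' : olt b b' -> olt b' l -> [/\ tle rk (Xs b) (Xs b'), hrel e (gs b) (Xs b) (Xs b') & mstep e (gs b) (gs b')].
    move=> bb' b'l; have [_ h] := hp b b' bb' b'l.
    by case: (h (proj1 (hI b (olt_trans bb' b'l)))).
  have [|ml [r1 lm h1]] := limit_mem ll _ hp' hX' hle; first by move=> b /hI[].
  exists ml; split; last by move=> b bl _; split; [|exact: hle|exact: h1|case: lm => _ _ _; apply].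
  split=> //; split.
    case: lm => _ _ _ h; apply: mstep_trans (h _ (proj1 ll)); by case: (hI _ (proj1 ll)) => _ [].
  apply: (ilim l gs ml) => //.
  * by move=> b /hI[_ []].
  * by move=> b b' bb' b'l; case: (hp' b b' bb' b'l).
  * by move=> b /hI[_ []].
Qed.

End Mem.

Arguments exec_rd {U M X0 B KK u rb tb tr Y r a Q D}.
Arguments exec_fl {U M X0 B KK u rb tb tr Y r a Q D}.
Arguments exec_gtb {U M X0 B KK u rb tb tr Y t a Q D}.
Arguments exec_stb {U M X0 B KK u rb tb tr Y t a Q D}.
Arguments wp_ret {U M X0 B KK e v Q D m}.
Arguments wp_weak {U M X0 B KK e e' c Q Q' D D' m}.
Arguments wp_bind {U M X0 B KK e c c0 c1 c2 Q1 Q D m}.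
Arguments wp_seq {U M X0 B KK e c d Q1 Q D m}.
Arguments mreach_refl {U M X0 B KK e c m P D}.
Arguments mreach_weak {U M X0 B KK st st' e e' c P P' D D' m}.
Arguments mreach_trans {U M X0 B KK st e c m P' P D}.
Arguments mreach_iter {U M X0 B KK e c m P D}.
Arguments wp_loop {U M X0 B KK e c Q D m}.

(** * Counting loops, searches and pairing commands *)

Definition setr U (m : mem U) r x := Mem (fun r' => if r' == r then x else regs m r') (tabs m) (trees m).
Definition settb U (m : mem U) t a := Mem (regs m) (fun t' a' => tabs m t' a' \/ (t' = t /\ a' = a)) (trees m).

(** The bound [b] stays fixed and the counter [j] ends equal to it. The search [find_] has outcome 1
    with [d] at the first success, and otherwise outcome 0 with [d] equal to the bound. *)
Definition for_ B KK j b body := seqc (zero B KK j)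
  (Loop (Bind (eqr B KK j b) (seqc body (seqc (inc B KK j) (Ret 0))) (Ret 1) (Ret 1))).
Definition find_ B KK d b test := seqc (zero B KK d)
  (Loop (Bind (eqr B KK d b) (Bind test (seqc (inc B KK d) (Ret 0)) (Ret 2) (Ret 2)) (Ret 1) (Ret 1))).
Definition copy B KK d s := for_ B KK d s (Ret 0).

Definition inc2 B KK p := seqc (inc B KK p) (inc B KK p).
(** Nested counting loops following the recursions of [rs] and [ad]; the result is accumulated in
    register 1, with counters 2 and 3. *)
Definition trp B KK a b := seqc (zero B KK 1) (seqc
  (for_ B KK 2 b (seqc (for_ B KK 3 2 (inc2 B KK 1)) (inc2 B KK 1)))
  (for_ B KK 3 a (inc2 B KK 1))).
Definition pairp B KK a b := Bind (ler B KK a b) (seqc (trp B KK b a) (inc B KK 1)) (trp B KK a b) (Ret 0).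
Definition get2 B KK t a b := seqc (pairp B KK a b) (get B KK t 1).
Definition set2 B KK t a b := seqc (pairp B KK a b) (set B KK t 1).

(* Registers below [L] and in [ds] may be clobbered; register 0 may be incremented if [c]. *)
Definition effl (L : nat) (ds : seq nat) (c t : bool) :=
  Eff (fun r => if r == 0 then (c : nat) else if (r < L) || (r \in ds) then 2 else 0) t.

Lemma sub_effl L ds (c t : bool) L' ds' (c' t' : bool) : L <= L' -> all (fun d => (d < L') || (d \in ds')) ds ->
  (c -> c') -> (t -> t') -> sub_eff (effl L ds c t) (effl L' ds' c' t').
Proof.
move=> hL /allP hd hc ht; split=> // r /=; case: eqP => _; first by case: c hc => // ->.
case: ifP => // /orP[h|/hd h]; first by case: ifP => //; rewrite (leq_trans h hL).
by rewrite h.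
Qed.

#[global] Hint Extern 0 (sub_eff _ _) => solve [by apply: sub_effl | by apply: sub_effl => //=; lia] : core.

Lemma sub_eff_refl e : sub_eff e e. Proof. by split. Qed.

Section Ops.
Variables (U : zfc_universe) (M : machine) (X0 : tape U) (B KK : nat).
Local Notation ON := (ON U).
Local Notation cell := (cell U).
Local Notation tape := (tape U).
Local Notation mem := (mem U).
Local Notation exec := (@exec U M X0).
Local Notation K := (KK.*2).
Local Notation rc := (rc B).
Local Notation raw := (@raw U B KK).
Local Notation same := (@same U B).
Local Notation Rep := (@Rep U B KK).
Local Notation wp := (@wp U M X0 B KK).
Local Notation limmem := (@limmem U B).
Local Notation zero := (zero B KK).
Local Notation inc := (inc B KK).
Local Notation get := (get B KK).
Local Notation set := (set B KK).
Local Notation eqr := (eqr B KK).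
Local Notation ler := (ler B KK).
Local Notation for_ := (for_ B KK).
Local Notation find_ := (find_ B KK).
Local Notation copy := (copy B KK).
Implicit Types (a b u : ON) (m : mem).

Lemma bit_limit l (Ys : ON -> tape) Yl c a : olimit l -> limtape l Ys Yl -> (forall b, olt b l -> tle rk (Ys b) Yl) ->
  bit Yl c a -> exists b, olt b l /\ forall b', ole b b' -> olt b' l -> bit (Ys b') c a.
Proof.
move=> ll hY hle [t [t2 ts]]; have [b [bl hb]] := hY (c, [:: a; t]); exists b; split=> // b' bb' b'l.
exists t; rewrite hb //; split=> //.
by have := hle b' b'l (c, [:: a; osucc t]); rewrite ts; case: (Ys b' _).
Qed.

Lemma hext_same X Y : (forall r a, r < KK -> same X Y r a) -> hext B KK X Y.
Proof. by move=> h r a t rK _; rewrite -h. Qed.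

(** Every row below the old value receives a new mark, so all of them change and the end segment
    condition of [hrel] holds. For this reason the invariant [J] records [grow]. *)
Lemma wp_zero e r Q D m : r < KK -> 1 < acc e r -> Q 0 (setr m r (ozero U)) -> wp e (zero r) Q D m.
Proof.
move=> rK er q X [u hX].
pose rbb b r' a := olt a (regs m r') /\ ~ (r' = r /\ olt a b).
pose J b Y := exists u', [/\ raw u' (rbb b) (tabs m) (trees m) Y, ole b u',
  forall r' a, r' < KK -> ~ (r' = r /\ olt a b) -> same X Y r' a,
  forall a, olt a b -> grow B X Y r a & hext B KK X Y].
apply: (@exec_sweep _ M X0 B KK (rd r) (fl r) (Ret 0) J (J (regs m r)) (regs m r) X _ D 0) => //.
- exists u; split=> //; last by move=> a /olt0.
  by apply: (raw_eqv hX) => // r' a _; rewrite /rbb; split=> [|[]] //; split=> // -[_ /olt0].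
- move=> b Y bde [u' [hY bu sm nsm hx]].
  apply: (@exec_row_cont _ M X0 B KK _ _ _ u' (rbb b) (tabs m) (trees m)) => //.
    move=> u2 Y2 h2 bu2 _; apply: (exec_rd h2 rK); split=> //; apply: b2T; split=> // -[_]; exact: olt_irr.
  move=> u2 Y2 h2 bu2 sm2; apply: (exec_fl h2 rK bu2) => Y3 h3 sm3 nsm3 hx3.
  split=> //; split=> //; exists u2; split.
  + apply: (raw_eqv h3) => // r' a rK'; rewrite /rbb oltS /ole.
    have hb : olt b (regs m r) /\ ~ (r = r /\ olt b b) by split=> // -[_]; exact: olt_irr.
    by case: hb; tauto.
  + exact/oleS.
  + move=> r' a rK' n; apply: same_trans (sm r' a rK' _) _.
      by move=> [? ?]; apply: n; split=> //; apply/oltS; left.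
    apply: same_trans (sm2 r' a) (sm3 r' a _) => -[? ?]; apply: n; split=> //.
    by apply/oltS; right.
  + move=> a /oltS[ab|->].
      have [t [t0 tn]] := nsm a ab; exists t; split=> //.
      by rewrite hx3 -(sm2 r a t).
    have [t [t0 tn]] := nsm3; exists t; split=> //.
    rewrite (sm r b rK) ?(sm2 r b t) //.
    by move=> [_]; exact: olt_irr.
  + move=> r' a t rK' n; rewrite -(hx r' a t rK' n) (sm2 r' a t); apply: hx3.
    by rewrite -(sm2 r' a t) (hx r' a t rK' n).
- move=> Y [u' [hY bu sm nsm hx]].
  apply: (@exec_row_stop _ M X0 B KK _ _ _ u' (rbb (regs m r)) (tabs m) (trees m) _ _ 0) => //.
    move=> u2 Y2 h2 bu2 _; apply: (exec_rd h2 rK); split=> //; apply: b2F => -[h _]; exact: olt_irr h.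
  move=> u2 Y2 h2 bu2 sm2; apply: exec_ret; split=> //; split=> //; exists u2; split=> //.
  + by left.
  + by move=> r' a rK' n; apply: same_trans (sm r' a rK' n) (sm2 r' a).
  + by move=> a ab; have [t [t0 tn]] := nsm a ab; exists t; rewrite -(sm2 r a t).
  + by move=> r' a t rK' n; rewrite -(sm2 r' a t) hx.
- move=> l Ys Yl lde ll hJ hp hY hle.
  pose us b := epsilon (inhabits (ozero U)) (fun u' => [/\ raw u' (rbb b) (tabs m) (trees m) (Ys b), ole b u',
    forall r' a, r' < KK -> ~ (r' = r /\ olt a b) -> same X (Ys b) r' a,
    forall a, olt a b -> grow B X (Ys b) r a & hext B KK X (Ys b)]).
  have usP b : olt b l -> [/\ raw (us b) (rbb b) (tabs m) (trees m) (Ys b), ole b (us b),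
    forall r' a, r' < KK -> ~ (r' = r /\ olt a b) -> same X (Ys b) r' a,
    forall a, olt a b -> grow B X (Ys b) r a & hext B KK X (Ys b)].
    by move=> bl; apply: (epsilon_spec (inhabits (ozero U)) (fun u' => [/\ raw u' _ _ _ (Ys b), ole b u', _, _ & _])); apply: hJ.
  have sm r' a : r' < KK -> ~ (r' = r /\ olt a l) -> same X Yl r' a.
    move=> rK' n; apply: (limtape_same ll hY (proj1 ll)) => b' _ b'l.
    case: (usP b' b'l) => _ _ h _ _; apply: h => // -[? ?]; apply: n; split=> //; exact: olt_trans b'l.
  exists (sup l us); split=> //.
  + apply: (raw_eqv (raw_limit (us := us) (rbs := rbb) (tbs := fun _ => tabs m) (trs := fun _ => trees m) ll _ hY hle)).
    * by move=> b /usP[].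
    * move=> r' a rK'; case: (classic (r' = r /\ olt a l)) => [[-> al]|n].
        split=> [/(bit_limit ll hY hle)[b [bl hb]]|[_ []]] //.
        have [b' [bb' [b'l ab']]] : exists b', ole b b' /\ olt b' l /\ olt a b'.
          have sl := proj2 ll _ al; case: (ole_olt b (osucc a)) => h; first by exists (osucc a).
          by exists b; split=> //; split=> //; apply: olt_trans (olt_succ a) h.
        have hh := hb b' bb' b'l; case: (usP b' b'l) => hr _ _ _ _.
        by move/(raw_bit hr a rK): hh => -[_ []].
      by rewrite -(same_bit (sm r' a rK' n)) (raw_bit hX a rK') /rbb; tauto.
    * by move=> t a tK; split=> [[b [_]]|h] //; exists (ozero U); split=> //; case: ll.
    * move=> c s cB; apply: (limtape_const ll hY); exists (ozero U); split; first by case: ll.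
      by move=> b' _ /usP[h _ _ _ _]; apply: (raw_trees h).
  + suff h : ole (sup l id) (sup l us) by rewrite (sup_id ll) in h.
    apply: sup_le => b bl; apply: ole_trans (le_sup us bl); by case: (usP b bl).
  + move=> a al; have sl := proj2 ll _ al; case: (usP _ sl) => _ _ _ /(_ a (olt_succ a))[t [t0 tn]] _.
    exists t; split=> // tl; have := hle _ sl (rc r, [:: a; t]); rewrite tl.
    by case: (Ys _ _) tn.
  + move=> r' a t rK' n; apply: (limtape_const ll hY); exists (ozero U); split; first by case: ll.
    by move=> b' _ /usP[_ _ _ _ h]; apply: h.
- move=> Y tXY [u' [hY _ sm nsm hx]]; split=> //; exists (setr m r (ozero U)); split=> //.
  + exists u'; apply: (raw_eqv hY) => // r' a _; rewrite /rbb /=; case: eqP => [->|n]; last by tauto.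
    by split=> [[h []]|/olt0].
  + split=> //.
    * move=> r' a rK' h _; apply: sm => // -[e1 _]; move: h; rewrite e1; lia.
    * move=> r' a a' rK' aa' ha' s; case: (classic (r' = r)) => [e1|n]; last by apply: sm => // -[].
      by subst r'; have [t [t0 tn]] := nsm a' ha'; case: tn; rewrite -s.
  + split=> //= r'; case: eqP => [->|] // h; first by rewrite h in er.
    by move: h; lia.
Qed.

(** Only the row at the value itself changes, none below it: this is why incrementing is allowed at
    level 1. *)
Lemma wp_inc e r Q D m : r < KK -> 0 < acc e r -> Q 0 (setr m r (osucc (regs m r))) -> wp e (inc r) Q D m.
Proof.
move=> rK er q X [u hX].
apply: (@sweep_pure _ M X0 B KK (rd r) (fl r) X u (fun r a => olt a (regs m r)) (tabs m) (trees m) 0 (regs m r)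
  (fun Z => exists m', [/\ Rep m' Z, hrel B KK e m X Z, mstep e m m' & Q 0 m'])) => //.
  by move=> b u' Y _ hY bu; apply: (exec_rd hY rK).
move=> u' Y hY bu sm; apply: (exec_fl hY rK bu) => Z hZ sm2 _ hx; split=> //.
exists (setr m r (osucc (regs m r))); split=> //.
- exists u'; apply: (raw_eqv hZ) => //= r' a rK'; case: eqP => [->|n]; last by tauto.
  rewrite oltS; split=> [[[_ [-> _]]|[_ h]]|[h|->]]; [by right|by left| |].
    by right; split=> // -[_ e1]; move: h; rewrite e1; exact: olt_irr.
  by left; split=> //; split=> //; exact: olt_irr.
- split.
  + move=> r' a rK' _ ha; apply: same_trans (sm r' a rK') (sm2 r' a _) => -[e1 e2].
    by move: ha; rewrite e1 e2; exact: olt_irr.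
  + move=> r' a a' rK' aa' ha' _; apply: same_trans (sm r' a rK') (sm2 r' a _) => -[e1 e2].
    by subst; exact: olt_asym aa' ha'.
  + by move=> r' a t rK' n; rewrite (sm r' a rK' t); apply: hx; rewrite -(sm r' a rK' t).
- split=> //= r'; case: eqP => [->|] // h; by [rewrite h in er|left].
Qed.

Lemma hrel_same e m X Z : (forall r a, r < KK -> same X Z r a) -> hrel B KK e m X Z.
Proof. by move=> sm; split=> *; [exact: sm|exact: sm|apply: hext_same]. Qed.

Lemma wp_get e t r Q D m : r < KK -> t < KK -> Q (b2 (tabs m t (regs m r))) m -> wp e (get t r) Q D m.
Proof.
move=> rK tK q X [u hX].
apply: (@sweep_pure _ M X0 B KK (rd r) (gtb t) X u (fun r a => olt a (regs m r)) (tabs m) (trees m) (b2 (tabs m t (regs m r))) (regs m r)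
  (fun Z => exists m', [/\ Rep m' Z, hrel B KK e m X Z, mstep e m m' & Q (b2 (tabs m t (regs m r))) m'])) => //.
- by rewrite /b2; case: lem.
- by move=> b u' Y _ hY bu; apply: (exec_rd hY rK).
move=> u' Y hY bu sm; apply: (exec_gtb hY tK); split=> //.
exists m; split=> //; [by exists u'|exact: hrel_same].
Qed.

Lemma wp_set e t r Q D m : r < KK -> t < KK -> kext m (settb m t (regs m r)) ->
  Q 0 (settb m t (regs m r)) -> wp e (set t r) Q D m.
Proof.
move=> rK tK hk q X [u hX].
apply: (@sweep_pure _ M X0 B KK (rd r) (stb t) X u (fun r a => olt a (regs m r)) (tabs m) (trees m) 0 (regs m r)
  (fun Z => exists m', [/\ Rep m' Z, hrel B KK e m X Z, mstep e m m' & Q 0 m'])) => //.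
- by move=> b u' Y _ hY bu; apply: (exec_rd hY rK).
move=> u' Y hY bu sm; apply: (exec_stb hY tK bu) => Z hZ sm2; split=> //.
exists (settb m t (regs m r)); split=> //; first by exists u'.
  by apply: hrel_same => r' a rK'; apply: same_trans (sm r' a rK') (sm2 r' a).
by split=> //= *; left.
Qed.

Lemma exec_both u Y r s b rb tb tr (Q : nat -> cell -> tape -> Prop) D : r < KK -> s < KK -> raw u rb tb tr Y ->
  Q (b2 (rb r b /\ rb s b)) (B, [:: b]) Y -> exec rk (B, [:: b]) (both r s) (B, [:: b]) Y Q D.
Proof.
move=> rK sK hY q.
apply: (exec_bind (Q1 := fun w h Z => [/\ w = b2 (rb r b), h = (B, [:: b]) & Z = Y])); first exact: (exec_rd hY rK).
move=> w h Z _ [-> -> ->]; case: (classic (rb r b)) => h1.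
  rewrite b2T //=; apply: (exec_rd hY sK).
  by have -> : b2 (rb s b) = b2 (rb r b /\ rb s b) by apply: b2_iff; tauto.
by rewrite b2F //=; apply: exec_ret; rewrite b2F // in q; tauto.
Qed.

Arguments exec_both {u Y r s b rb tb tr Q D}.

Lemma omin_ex a b : exists d, [/\ ole d a, ole d b, d = a \/ d = b & forall c, (olt c a /\ olt c b) <-> olt c d].
Proof.
case: (ole_olt a b) => h.
  exists a; split=> //; first by left.
  by move=> c; split=> [[]|ca] //; split=> //; apply: olt_le_trans h.
exists b; split=> //; [by left|by right|].
by move=> c; split=> [[]|cb] //; split=> //; apply: olt_trans h.
Qed.

Lemma wp_cmp e r s fin v Q D m : r < KK -> s < KK -> v < 3 ->
  (forall b u Y, olt b u -> raw u (fun r a => olt a (regs m r)) (tabs m) (trees m) Y ->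
     ole b (regs m r) -> ole b (regs m s) -> b = regs m r \/ b = regs m s ->
     exec rk (B, [:: b]) fin (B, [:: b]) Y (fun w h Z => [/\ w = v, h = (B, [:: b]) & Z = Y]) D) ->
  Q v m -> wp e (sweep B K (both r s) (Ret 0) fin) Q D m.
Proof.
move=> rK sK v3 hf q X [u hX]; have [d [d1 d2 d3 dE]] := omin_ex (regs m r) (regs m s).
apply: (@sweep_pure _ M X0 B KK _ fin X u (fun r a => olt a (regs m r)) (tabs m) (trees m) v d
  (fun Z => exists m', [/\ Rep m' Z, hrel B KK e m X Z, mstep e m m' & Q v m'])) => //.
- move=> b u' Y _ hY bu; apply: (exec_both rK sK hY); split=> //.
  by apply: b2_iff; apply: dE.
move=> u' Y hY bu sm; apply: (exec_weak (hf d u' Y bu hY d1 d2 d3)) => //.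
move=> w h Z _ [-> -> ->]; split=> //.
exists m; split=> //; [by exists u'|exact: hrel_same].
Qed.

Arguments wp_cmp {e r s fin v Q D m}.

Lemma wp_ler e r s Q D m : r < KK -> s < KK -> Q (b2 (ole (regs m r) (regs m s))) m -> wp e (ler r s) Q D m.
Proof.
move=> rK sK q; apply: (wp_cmp (v := b2 (ole (regs m r) (regs m s)))) => //.
  by rewrite /b2; case: lem.
move=> b u Y bu hY b1 b2' b3.
apply: (exec_bind (Q1 := fun w h Z => [/\ w = b2 (olt b (regs m r)), h = (B, [:: b]) & Z = Y])); first exact: (exec_rd hY rK).
move=> w h Z _ [-> -> ->]; case: (classic (olt b (regs m r))) => h1.
  rewrite b2T //=; apply: exec_ret; split=> //; rewrite b2F // => h2.
  case: b3 => e1; first by rewrite e1 in h1; case: (olt_irr h1).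
  by rewrite -e1 in h2; case: (olt_irr (olt_le_trans h1 h2)).
rewrite b2F //=; apply: exec_ret; split=> //; rewrite b2T //.
by case: b1 => // <-.
Qed.

Lemma wp_eqr e r s Q D m : r < KK -> s < KK -> Q (b2 (regs m r = regs m s)) m -> wp e (eqr r s) Q D m.
Proof.
move=> rK sK q; apply: (wp_cmp (v := b2 (regs m r = regs m s))) => //.
  by rewrite /b2; case: lem.
move=> b u Y bu hY b1 b2' b3.
apply: (exec_bind (Q1 := fun w h Z => [/\ w = b2 (olt b (regs m r)), h = (B, [:: b]) & Z = Y])); first exact: (exec_rd hY rK).
move=> w h Z _ [-> -> ->]; case: (classic (olt b (regs m r))) => h1.
  rewrite b2T //=; apply: exec_ret; split=> //; rewrite b2F // => h2.
  rewrite -h2 in b3; case: b3 => e1; rewrite e1 in h1; exact: olt_irr h1.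
have e1 : b = regs m r by case: b1.
rewrite b2F //=.
apply: (exec_bind (Q1 := fun w h Z => [/\ w = b2 (olt b (regs m s)), h = (B, [:: b]) & Z = Y])); first exact: (exec_rd hY sK).
move=> w' h' Z' _ [-> -> ->]; case: (classic (olt b (regs m s))) => h2.
  by rewrite b2T //=; apply: exec_ret; split=> //; rewrite b2F // -e1; exact: olt_neq.
have e2 : b = regs m s by case: b2'.
by rewrite b2F //=; apply: exec_ret; split=> //; rewrite b2T // -e1.
Qed.

Lemma mem_eq m m' : (forall r, regs m r = regs m' r) -> tabs m = tabs m' -> trees m = trees m' -> m = m'.
Proof.
by case: m m' => [r t s] [r' t' s'] /= /funext -> -> ->.
Qed.

(** The counter of a loop is reset before the loop and only incremented inside it. At level 1 its
    value at limit stages is a supremum, hence the stage itself. *)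
Definition bump e j := Eff (fun r => if r == j then 1 else acc e r) (etr e).

Lemma sub_bump e e' j : sub_eff e e' -> 0 < acc e' j -> sub_eff (bump e j) e'.
Proof. by move=> [h1 h2] h; split=> //= r; case: eqP => [->|]. Qed.

Lemma sub_bump0 e j : acc e j = 0 -> sub_eff e (bump e j).
Proof. by move=> h; split=> //= r; case: eqP => [->|]; rewrite ?h. Qed.

Lemma wp_for e e0 j (b : nat) body (I : ON -> mem -> Prop) Q D m : j < KK -> b < KK -> j <> b ->
  1 < acc e j -> acc e0 j = 0 -> acc e0 b = 0 -> sub_eff e0 e ->
  I (ozero U) (setr m j (ozero U)) ->
  (forall i m', olt i (regs m b) -> regs m' j = i -> regs m' b = regs m b -> mstep (bump e0 j) (setr m j (ozero U)) m' -> I i m' ->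
     wp e0 body (fun _ m2 => I (osucc i) (setr m2 j (osucc i))) D m') ->
  (forall l ms ml, ole l (regs m b) -> olimit l -> (forall i, olt i l -> I i (ms i) /\ regs (ms i) j = i) ->
     (forall i i', olt i i' -> olt i' l -> mstep (bump e0 j) (ms i) (ms i')) ->
     (forall i, olt i l -> mstep (bump e0 j) (setr m j (ozero U)) (ms i)) ->
     limmem (bump e0 j) l ms ml -> regs ml j = l -> I l ml) ->
  (forall m', mstep (bump e0 j) (setr m j (ozero U)) m' -> regs m' j = regs m b -> I (regs m b) m' -> Q 0 m') ->
  wp e (for_ j b body) Q D m.
Proof.
move=> jK bK jb ej e0j e0b se i0 hbody hlim hq.
have se1 : sub_eff (bump e0 j) e by apply: sub_bump se _; lia.
apply: (wp_seq (Q1 := fun _ m' => m' = setr m j (ozero U))); first exact: wp_zero.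
move=> _ _ _ ->; set m0 := setr m j (ozero U).
have m0b : regs m0 b = regs m b by rewrite /m0 /=; case: eqP => // e1; case: jb.
apply: wp_loop.
apply: (mreach_weak (st := false) (e := bump e0 j) (P := fun m' => [/\ regs m' j = regs m b, mstep (bump e0 j) m0 m' & I (regs m b) m']) (D := D)) => //.
  apply: (@mreach_weak U M X0 B KK false false (bump e0 j) (bump e0 j) _ (fun m' => regs m' j = regs m b /\ I (regs m b) m') _ D D); [|exact: sub_eff_refl|by []|by []|by move=> m' h []].
  apply: (@mreach_tf U M X0 B KK (bump e0 j) _ (fun i m' => regs m' j = i /\ I i m') (regs m b) m0 D).
  - by rewrite /m0 /= eqxx.
  - move=> i m' ib s1 [ej' ii].
    have eb : regs m' b = regs m b.
      by rewrite -m0b; case: s1 => h _ _ _ _; apply: h => /=; case: eqP => // e1; case: jb.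
    apply: (@mreach_weak U M X0 B KK true false (bump e0 j) (bump e0 j) _ (fun m2 => regs m2 j = osucc i /\ I (osucc i) m2) _ D D); [|exact: sub_eff_refl|by []|by []|by []].
    apply: mreach_iter.
    apply: (wp_bind (Q1 := fun v m2 => v = 0 /\ m2 = m')).
      by apply: wp_eqr => //; rewrite ej' eb b2F //; apply: olt_neq.
    move=> v m2 _ [-> ->] /=.
    apply: (wp_seq (Q1 := fun _ m3 => regs m3 j = i /\ I (osucc i) (setr m3 j (osucc i)))).
      apply: (wp_weak (hbody i m' ib ej' eb s1 ii)) => //; first exact: sub_bump0.
      by move=> _ m3 [h _ _ _ _] ?; split=> //; rewrite h.
    move=> _ m3 _ [ej3 i3]; apply: (wp_seq (Q1 := fun _ m4 => m4 = setr m3 j (osucc i))).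
      by apply: wp_inc => //=; rewrite ?eqxx // ej3.
    move=> _ m4 _ ->; apply: wp_ret; split=> //=; by rewrite eqxx.
  - move=> l ms ml lde ll hI hp h0 lm.
    have ejl : regs ml j = l.
      case: (lm) => h _ _ _; have {}h := h j _; rewrite -(sup_id ll).
      apply: (lub_uniq (P := fun x => exists b, olt b l /\ x = regs (ms b) j)); first by apply: h => /=; rewrite eqxx.
      have [s1 s2] := supP l (@id ON); split=> [x [c [cl ->]]|t ht].
        by case: (hI c cl) => -> _; apply: (le_sup id).
      by apply: s2 => x [c [cl ->]]; apply: ht; exists c; split=> //; case: (hI c cl).
    split=> //; apply: (hlim l ms ml) => // i il; by case: (hI i il).
move=> m' s' [ej' s1 ii].
have eb : regs m' b = regs m b.
  by rewrite -m0b; case: s1 => h _ _ _ _; apply: h => /=; case: eqP => // e1; case: jb.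
apply: (wp_bind (Q1 := fun v m2 => v = 1 /\ m2 = m')).
  by apply: wp_eqr => //; rewrite ej' eb b2T.
move=> v m2 _ [-> ->] /=; apply: wp_ret; split=> //=; exact: hq.
Qed.

(** The counter of an empty loop ends at the bound. *)
Lemma wp_copy e d s Q D m : d < KK -> s < KK -> d <> s -> 1 < acc e d -> Q 0 (setr m d (regs m s)) -> wp e (copy d s) Q D m.
Proof.
move=> dK sK ds ed q.
pose e0 := Eff (fun _ => 0) false.
apply: (@wp_for e e0 d s (Ret 0) (fun i m' => m' = setr m d i)) => //.
- move=> i m' _ _ _ _ ->; apply: wp_ret; apply: mem_eq => //= r; by case: eqP.
- move=> l ms ml _ ll hI hp h0 lm ejl.
  have [l1 l2 _ h1] := lm; have [k1 _ _ k4 _] := h0 _ (proj1 ll).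
  have [s1 s2 s3 s4 _] := h1 _ (proj1 ll).
  apply: mem_eq => /=.
  + move=> r; case: eqP => [->|n] //; rewrite s1 /=; last by case: eqP.
    by case: (hI _ (proj1 ll)) => -> _ /=; case: eqP.
  + apply: funext => t; apply: funext => a.
    apply: propext; rewrite l2; split=> [[b [bl]]|h].
      by case: (hI b bl) => ->.
    by exists (ozero U); split; [case: ll|case: (hI _ (proj1 ll)) => ->].
  + rewrite s4 //; by case: (hI _ (proj1 ll)) => ->.
- by move=> m' _ _ ->.
Qed.

Definition eqtt m m' := tabs m' = tabs m /\ trees m' = trees m.

Lemma limmem_eqtt e l (ms : ON -> mem) ml m : etr e = false -> olimit l -> limmem e l ms ml ->
  (forall i, olt i l -> eqtt m (ms i)) -> eqtt m ml.
Proof.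
move=> et ll [_ h2 _ h4] hm; have [e1 e2] := hm _ (proj1 ll); split; last first.
  by have [_ _ _ h _] := h4 _ (proj1 ll); rewrite h.
apply: funext => t; apply: funext => a.
apply: propext; rewrite h2; split=> [[b [bl]]|h].
  by case: (hm b bl) => ->.
by exists (ozero U); split; [case: ll|rewrite e1].
Qed.

Lemma wp_find e e0 d (b : nat) test (P : ON -> Prop) Q D m : d < KK -> b < KK -> d <> b ->
  1 < acc e d -> acc e0 d = 0 -> acc e0 b = 0 -> sub_eff e0 e -> etr e0 = false ->
  (forall i m', olt i (regs m b) -> regs m' d = i -> mstep (bump e0 d) (setr m d (ozero U)) m' -> eqtt m m' ->
     wp e0 test (fun v m2 => v = b2 (P i) /\ eqtt m m2) D m') ->
  (forall m' i, mstep (bump e0 d) (setr m d (ozero U)) m' -> eqtt m m' -> regs m' d = i -> olt i (regs m b) -> P i ->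
     (forall i', olt i' i -> ~ P i') -> Q 1 m') ->
  (forall m', mstep (bump e0 d) (setr m d (ozero U)) m' -> eqtt m m' -> regs m' d = regs m b ->
     (forall i', olt i' (regs m b) -> ~ P i') -> Q 0 m') ->
  wp e (find_ d b test) Q D m.
Proof.
move=> dK bK db ed e0d e0b se et ht hq1 hq0.
have se1 : sub_eff (bump e0 d) e by apply: sub_bump se _; lia.
apply: (wp_seq (Q1 := fun _ m' => m' = setr m d (ozero U))); first exact: wp_zero.
move=> _ _ _ ->; set m0 := setr m d (ozero U).
have m0b : regs m0 b = regs m b by rewrite /m0 /=; case: eqP => // e1; case: db.
(* [i] is the first success, or the bound if there is none: the place where the search will stop. *)
have [i [ib hi himin]] : exists i, [/\ ole i (regs m b), (olt i (regs m b) -> P i) & forall i', olt i' i -> ~ P i'].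
  case: (classic (exists i, olt i (regs m b) /\ P i)) => [[i0 [i0b pi0]]|n].
    have [i [[ib pi] hm]] := @least U (fun i => olt i (regs m b) /\ P i) i0 (conj i0b pi0).
    exists i; split=> //; first by left.
    by move=> i' ii' pi'; apply: (hm i' ii'); split=> //; apply: olt_trans ii' ib.
  exists (regs m b); split=> //; first by move/olt_irr.
  by move=> i' ii' pi'; apply: n; exists i'.
apply: wp_loop.
apply: (mreach_weak (st := false) (e := bump e0 d) (P := fun m' => [/\ regs m' d = i, mstep (bump e0 d) m0 m' & eqtt m m']) (D := D)) => //.
  apply: (@mreach_weak U M X0 B KK false false (bump e0 d) (bump e0 d) _ (fun m' => regs m' d = i /\ eqtt m m') _ D D); [|exact: sub_eff_refl|by []|by []|by move=> m' h []].
  apply: (@mreach_tf U M X0 B KK (bump e0 d) _ (fun i m' => regs m' d = i /\ eqtt m m') i m0 D).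
  - by rewrite /m0 /= eqxx.
  - move=> i' m' ii' s1 [ej' ii].
    have eb : regs m' b = regs m b.
      by rewrite -m0b; case: s1 => h _ _ _ _; apply: h => /=; case: eqP => // e1; case: db.
    apply: (@mreach_weak U M X0 B KK true false (bump e0 d) (bump e0 d) _ (fun m2 => regs m2 d = osucc i' /\ eqtt m m2) _ D D); [|exact: sub_eff_refl|by []|by []|by []].
    have i'b : olt i' (regs m b) by apply: olt_le_trans ii' ib.
    apply: mreach_iter.
    apply: (wp_bind (Q1 := fun v m2 => v = 0 /\ m2 = m')).
      by apply: wp_eqr => //; rewrite ej' eb b2F //; apply: olt_neq.
    move=> v m2 _ [-> ->] /=.
    apply: (wp_bind (Q1 := fun v m3 => [/\ v = 0, regs m3 d = i' & eqtt m m3])).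
      apply: (wp_weak (ht i' m' i'b ej' s1 ii)) => //; first exact: sub_bump0.
      by move=> w m3 [h _ _ _ _] [-> ?]; split=> //; [rewrite b2F //; apply: himin|rewrite h].
    move=> w m3 _ [-> ej3 i3]; apply: (wp_seq (Q1 := fun _ m4 => m4 = setr m3 d (osucc i'))).
      by apply: wp_inc => //=; rewrite ?eqxx // ej3.
    move=> _ m4 _ ->; apply: wp_ret; split=> //=; by rewrite eqxx.
  - move=> l ms ml lde ll hI hp h0 lm.
    split; last by apply: (limmem_eqtt _ ll lm) => // i' /hI[].
    case: (lm) => h _ _ _; have {}h := h d _; rewrite -(sup_id ll).
    apply: (lub_uniq (P := fun x => exists b, olt b l /\ x = regs (ms b) d)); first by apply: h => /=; rewrite eqxx.
    have [s1 s2] := supP l (@id ON); split=> [x [c [cl ->]]|t ht'].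
      by case: (hI c cl) => -> _; apply: (le_sup id).
    by apply: s2 => x [c [cl ->]]; apply: ht'; exists c; split=> //; case: (hI c cl).
move=> m' s' [ej' s1 ii].
have eb : regs m' b = regs m b.
  by rewrite -m0b; case: s1 => h _ _ _ _; apply: h => /=; case: eqP => // e1; case: db.
case: ib => [ib|e1].
  apply: (wp_bind (Q1 := fun v m2 => v = 0 /\ m2 = m')).
    by apply: wp_eqr => //; rewrite ej' eb b2F //; apply: olt_neq.
  move=> v m2 _ [-> ->] /=.
  apply: (wp_bind (Q1 := fun v m3 => [/\ v = 1, regs m3 d = i, eqtt m m3 & mstep (bump e0 d) m0 m3])).
    apply: (wp_weak (ht i m' ib ej' s1 ii)) => //.
    move=> w m3 s3 [-> ?]; split=> //; first by rewrite b2T //; apply: hi.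
      by case: s3 => h _ _ _ _; rewrite h.
    by apply: mstep_trans s1 _; apply: mstep_sub s3; apply: sub_bump0.
  move=> w m3 _ [-> h1 h2 h3] /=; apply: wp_ret; split=> //=; apply: (hq1 m3 i) => //; exact: hi.
apply: (wp_bind (Q1 := fun v m2 => v = 1 /\ m2 = m')).
  by apply: wp_eqr => //; rewrite ej' eb b2T.
move=> v m2 _ [-> ->] /=; apply: wp_ret; split=> //=; apply: hq0 => //; by rewrite -e1.
Qed.

End Ops.

Arguments wp_zero {U M X0 B KK e r Q D m}.
Arguments wp_inc {U M X0 B KK e r Q D m}.
Arguments wp_get {U M X0 B KK e t r Q D m}.
Arguments wp_set {U M X0 B KK e t r Q D m}.
Arguments wp_eqr {U M X0 B KK e r s Q D m}.
Arguments wp_ler {U M X0 B KK e r s Q D m}.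
Arguments wp_copy {U M X0 B KK e d s Q D m}.
Arguments wp_for {U M X0 B KK e} e0 {j b body} I {Q D m}.
Arguments wp_find {U M X0 B KK e} e0 {d b test} P {Q D m}.

(** * The heap: sets as canonical rows *)

(* Table 0: elements of rows; 1: canonical rows; 2: transitive closures of
   canonical rows; 3: values in recursions; 4, 5: opened and closed tree nodes;
   6: emitted elements.  Register 0 is the next free row. *)
Definition diff_row B KK d t := find_ B KK 4 0
  (Bind (get2 B KK 0 d 4) (get2 B KK 0 t 4) (Bind (get2 B KK 0 t 4) (Ret 1) (Ret 0) (Ret 0)) (Ret 0)).
(** Row [d] receives the elements of [t] and, in table 2, itself together with the closures of its
    elements. It is declared canonical only afterwards, because [kext] freezes tables 0 and 2 on
    canonical rows. *)
Definition alloc B KK t d := seqc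
  (for_ B KK 5 0 (Bind (get2 B KK 0 t 5) (Ret 0)
     (seqc (set2 B KK 0 d 5) (for_ B KK 6 0 (Bind (get2 B KK 2 5 6) (Ret 0) (set2 B KK 2 d 6) (Ret 0)))) (Ret 0)))
  (seqc (set2 B KK 2 d d) (seqc (set B KK 1 d) (inc B KK 0))).
(** A failed search leaves [d] equal to register 0, which is the first free row: exactly where
    [alloc] puts the copy. *)
Definition find_alloc B KK t d := Bind
  (find_ B KK d 0 (Bind (get B KK 1 d) (Ret 0) (Bind (diff_row B KK d t) (Ret 1) (Ret 0) (Ret 0)) (Ret 0)))
  (alloc B KK t d) (Ret 0) (Ret 0).
Definition new_row B KK t := seqc (copy B KK t 0) (inc B KK 0).

Section Pair.
Variables (U : zfc_universe) (M : machine) (X0 : tape U) (B KK : nat).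
Local Notation ON := (ON U).
Local Notation mem := (mem U).
Local Notation wp := (@wp U M X0 B KK).
Implicit Types (m : mem).

Definition lv L := effl L [::] false false.

Lemma eqtt_trans m1 m2 m3 : eqtt m1 m2 -> eqtt m2 m3 -> eqtt m1 m3.
Proof. by move=> [e1 e2] [e3 e4]; split; rewrite ?e3 ?e4. Qed.

Lemma limmem_sup e l (ms : ON -> mem) ml r f : acc e r < 2 -> limmem B e l ms ml ->
  (forall i, olt i l -> regs (ms i) r = f i) -> regs ml r = sup l f.
Proof.
move=> er [h _ _ _] hf; apply: sup_lub; have [h1 h2] := h r er; split=> [x [c [cl ->]]|t ht].
  by rewrite -(hf c cl); apply: h1; exists c.
by apply: h2 => x [c [cl ->]]; rewrite hf //; apply: ht; exists c.
Qed.

Lemma wp_inc2 e r Q D m : r < KK -> 0 < acc e r -> Q 0 (setr m r (osucc (osucc (regs m r)))) -> wp e (inc2 B KK r) Q D m.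
Proof.
move=> rK er q; apply: (wp_seq (Q1 := fun _ m' => m' = setr m r (osucc (regs m r)))); first exact: wp_inc.
move=> _ _ _ ->; apply: wp_inc => //=; rewrite eqxx.
by have -> // : setr (setr m r (osucc (regs m r))) r (osucc (osucc (regs m r))) = setr m r (osucc (osucc (regs m r)));
  apply: mem_eq => //= s; case: eqP.
Qed.

Lemma wp_addloop e (s : nat) x D m : 3 < KK -> s < KK -> s <> 3 -> s <> 1 -> 1 < acc e 3 -> 0 < acc e 1 ->
  regs m 1 = x -> wp e (for_ B KK 3 s (inc2 B KK 1)) (fun _ m' => regs m' 1 = ad x (regs m s) /\ eqtt m m') D m.
Proof.
move=> K3 sK s3 s1 e3 e1 mx.
apply: (wp_for (Eff (fun r => if r == 1 then 1 else 0) false) (fun i m' => regs m' 1 = ad x i /\ eqtt m m')) => //.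
- by move: K3; lia.
- by rewrite /=; move/eqP/negbTE: s1 => ->.
- by split=> //= r; case: eqP => [->|].
- by rewrite /= mx ad0.
- move=> i m' _ _ _ _ [h1 h2]; apply: wp_inc2 => //=; first by move: K3; lia.
  by rewrite h1 adS.
- move=> l ms ml _ ll hI _ _ lm _; split; last by apply: (limmem_eqtt _ ll lm) => // i /hI[[]].
  rewrite (limmem_sup (f := ad x) _ lm) //; first by rewrite /ad (titerL _ _ ll).
  by move=> i /hI[[]].
Qed.

Lemma wp_trp (a b : nat) D m : 3 < KK -> a < KK -> b < KK -> (a == 0) || (3 < a) -> (b == 0) || (3 < b) ->
  wp (lv 4) (trp B KK a b) (fun _ m' => regs m' 1 = tr (regs m a) (regs m b) /\ eqtt m m') D m.
Proof.
move=> K3 aK bK ha hb.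
apply: (wp_seq (Q1 := fun _ m' => m' = setr m 1 (ozero U))); first by apply: wp_zero => //=; lia.
move=> _ _ _ ->; set m0 := setr _ _ _.
apply: (wp_seq (Q1 := fun _ m' => regs m' 1 = rs (regs m b) /\ eqtt m m')).
  have eb : regs m0 b = regs m b by rewrite /m0 /=; case: (b) hb => [|[|r]].
  rewrite -eb; apply: (wp_for (Eff (fun r => if r == 1 then 1 else if r == 3 then 2 else 0) false)
    (fun i m' => regs m' 1 = rs i /\ eqtt m m')) => //=; try lia.
  - by case: (b) hb => [|[|[|[|r]]]].
  - by split=> //= r; case: eqP => [->|] //; case: eqP => [->|].
  - by rewrite /rs titer0.
  - move=> i m' _ e2 _ _ [h1 h2].
    apply: (wp_seq (Q1 := fun _ m2 => regs m2 1 = ad (rs i) i /\ eqtt m m2)).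
      apply: (wp_weak (@wp_addloop (Eff (fun r => if r == 1 then 1 else if r == 3 then 2 else 0) false) 2 (rs i) D m' K3 _ _ _ _ _ h1)) => //=; try lia.
      by move=> _ m2 _ [k1 k2]; rewrite k1 e2; split=> //; apply: eqtt_trans k2.
    move=> _ m2 _ [k1 k2]; apply: wp_inc2 => //=; first by lia.
    by rewrite k1 /rs titerS.
  - move=> l ms ml _ ll hI _ _ lm _; split; last by apply: (limmem_eqtt _ ll lm) => // i /hI[[]].
    rewrite (limmem_sup (f := @rs U) _ lm) //; first by rewrite /rs (titerL _ _ ll).
    by move=> i /hI[[]].
move=> _ m1 s1 [h1 h2].
have ea : regs m1 a = regs m a.
  case: s1 => h _ _ _ _; rewrite h; last by case: (a) ha => [|[|[|[|r]]]].
  by rewrite /m0 /=; case: (a) ha => [|[|r]].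
apply: (wp_weak (@wp_addloop (lv 4) a (rs (regs m b)) D m1 K3 _ _ _ _ _ h1)) => //=; try lia.
- by move=> _ m2 _ [k1 k2]; rewrite k1 ea; split=> //; apply: eqtt_trans k2.
Qed.

Lemma wp_pairp (a b : nat) D m : 3 < KK -> a < KK -> b < KK -> (a == 0) || (3 < a) -> (b == 0) || (3 < b) ->
  wp (lv 4) (pairp B KK a b) (fun _ m' => regs m' 1 = pr (regs m a) (regs m b) /\ eqtt m m') D m.
Proof.
move=> K3 aK bK ha hb.
apply: (wp_bind (Q1 := fun v m' => v = b2 (ole (regs m a) (regs m b)) /\ m' = m)); first by apply: wp_ler.
move=> _ _ _ [-> ->]; case: (classic (ole (regs m a) (regs m b))) => h.
  by rewrite b2T //=; rewrite pr_le //; apply: wp_trp.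
rewrite b2F //=; have h' : olt (regs m b) (regs m a) by case: (ole_olt (regs m a) (regs m b)).
rewrite pr_gt //; apply: wp_seq; first exact: (@wp_trp b a D m K3 bK aK hb ha).
move=> _ m1 _ [e1 e2]; apply: wp_inc => //=; first by lia.
by rewrite e1.
Qed.

Lemma wp_get2 t (a b : nat) D m : 3 < KK -> t < KK -> a < KK -> b < KK -> (a == 0) || (3 < a) -> (b == 0) || (3 < b) ->
  wp (lv 4) (get2 B KK t a b) (fun v m' => v = b2 (tabs m t (pr (regs m a) (regs m b))) /\ eqtt m m') D m.
Proof.
move=> K3 tK aK bK ha hb; apply: wp_seq; first exact: (@wp_pairp a b D m K3 aK bK ha hb).
move=> _ m1 _ [e1 [e2 e3]]; apply: wp_get => //; first by lia.
by rewrite e1 e2.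
Qed.

Lemma wp_set2 t (a b : nat) D m : 3 < KK -> t < KK -> a < KK -> b < KK -> (a == 0) || (3 < a) -> (b == 0) || (3 < b) ->
  kext m (settb m t (pr (regs m a) (regs m b))) ->
  wp (lv 4) (set2 B KK t a b) (fun v m' => tabs m' = tabs (settb m t (pr (regs m a) (regs m b))) /\ trees m' = trees m) D m.
Proof.
move=> K3 tK aK bK ha hb hk; apply: wp_seq; first exact: (@wp_pairp a b D m K3 aK bK ha hb).
move=> _ m1 _ [e1 [e2 e3]]; apply: wp_set => //; first by lia.
  by move=> x y hx; rewrite /= e1 e2; apply: hk; rewrite -e2.
by rewrite /= e1 e2.
Qed.

End Pair.

Arguments wp_get2 {U M X0 B KK t a b D m}.
Arguments wp_set2 {U M X0 B KK t a b D m}.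

Ltac wp_get D K3 := apply: (wp_weak (wp_get2 (D := D) K3 _ _ _ _ _)) => //; try lia.
Ltac wp_put D K3 := apply: (wp_weak (wp_set2 (D := D) K3 _ _ _ _ _ _)) => //; try lia.

Section Heap.
Variable U : zfc_universe.
Local Notation ON := (ON U).
Local Notation mem := (mem U).
Implicit Types (a b c u : ON) (m : mem).

Definition cnt m := regs m 0.
Definition C m a b := tabs m 0 (pr a b).
Definition Kn m a := tabs m 1 a.
Definition Dn m a b := tabs m 2 (pr a b).

Definition own a t p := [\/ t \in [:: 0; 2; 6] /\ exists b, p = pr a b,
  t \in [:: 1; 4; 5] /\ p = a | t = 3 /\ exists b c, p = pr (pr a b) c].

(** Rows not listed in table 1 are under construction or scratch and are only bounded. Elements of
    canonical rows are canonical with smaller numbers, so that membership between rows is well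
    founded; [h_inj] is the uniqueness provided by hash-consing. *)
Record heap m : Prop := Heap {
  h_own : forall a t p, own a t p -> tabs m t p -> olt a (cnt m);
  h_row : forall a b, C m a b -> olt b (cnt m);
  h_can : forall a b, Kn m a -> C m a b -> Kn m b /\ olt b a;
  h_inj : forall a b, Kn m a -> Kn m b -> (forall c, C m a c <-> C m b c) -> a = b;
  h_trc : forall a b, Kn m a -> Dn m a b <-> b = a \/ exists c, C m a c /\ Dn m c b;
  h_trc_lt : forall a b, Dn m a b -> olt b (cnt m) }.

Lemma ownC a b : own a 0 (pr a b). Proof. by constructor 1; split=> //; exists b. Qed.
Lemma ownK a : own a 1 a. Proof. by constructor 2. Qed.
Lemma ownD a b : own a 2 (pr a b). Proof. by constructor 1; split=> //; exists b. Qed.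

Lemma own_inj a a' t p : own a t p -> own a' t p -> a = a'.
Proof.
case=> [[ht [b ->]]|[ht ->]|[-> [b [c ->]]]]; case=> [[ht' [b' e]]|[ht' e]|[et [b' [c' e]]]] //.
- by case/pr_inj: e.
- by exfalso; move: ht ht'; rewrite !inE; lia.
- by exfalso; move: ht; rewrite et.
- by exfalso; move: ht ht'; rewrite !inE; lia.
- by exfalso; move: ht; rewrite et.
- by case/pr_inj: e => /pr_inj[].
Qed.

(** Restricting to elements below [a] makes the recursion well founded on arbitrary rows. On
    canonical rows [h_can] makes the restriction void. *)
Lemma hv_ex m : exists h : ON -> U, forall a z, z ∈ h a <-> exists b, [/\ olt b a, C m a b & z = h b].
Proof.
have [|h hh] := @wf_rec U U empty (fun a f s => forall z, z ∈ s <-> exists b, [/\ olt b a, C m a b & z = f b]).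
  move=> a f g s e hs z; rewrite hs; split=> -[b [ba cb ->]]; exists b; split=> //; by rewrite e.
exists h => a; apply: hh.
have [|s hs] := @replacement U (sval a) (fun (u z : U) => exists b, [/\ sval b = u, C m a b & z = h b]).
  by move=> v z z' _ [b [e1 _ ->]] [b' [e2 _ ->]]; congr h; apply: on_eq; rewrite e1 e2.
exists s => z; rewrite hs; split=> [[v [va [b [e1 cb ->]]]]|[b [ba cb ->]]].
  by exists b; split=> //; rewrite /olt e1.
by exists (sval b); split=> //; exists b.
Qed.

Definition hv m : ON -> U := proj1_sig (cid _ (hv_ex m)).

Lemma hvP m a z : z ∈ hv m a <-> exists b, [/\ olt b a, C m a b & z = hv m b].
Proof. exact: (proj2_sig (cid _ (hv_ex m))). Qed.

Lemma in_hv m a z : heap m -> Kn m a -> z ∈ hv m a <-> exists b, C m a b /\ z = hv m b.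
Proof.
move=> hm ka; rewrite hvP; split=> [[b [_ cb e]]|[b [cb e]]]; exists b => //.
by split=> //; case: (h_can hm ka cb).
Qed.

(** By induction, rows with the same value have elements with the same values, hence the same
    elements, and [h_inj] applies. *)
Lemma hv_inj m a b : heap m -> Kn m a -> Kn m b -> hv m a = hv m b -> a = b.
Proof.
move=> hm; elim/olt_ind: a b => a ih b ka kb e; apply: (h_inj hm ka kb) => c.
split=> hc.
  have [kc lc] := h_can hm ka hc.
  have : hv m c ∈ hv m b by rewrite -e; apply/in_hv => //; exists c.
  by case/(in_hv _ hm kb) => c' [hc' e']; rewrite (ih c lc c') //; case: (h_can hm kb hc').
have [kc lc] := h_can hm kb hc.
have : hv m c ∈ hv m a by rewrite e; apply/in_hv => //; exists c.
case/(in_hv _ hm ka) => c' [hc' e'].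
by have [kc' lc'] := h_can hm ka hc'; rewrite -(ih c' lc' c kc' kc (esym e')).
Qed.

Lemma hv_kext m m' a : heap m -> kext m m' -> Kn m a -> hv m' a = hv m a.
Proof.
move=> hm hk; elim/olt_ind: a => a ih ka; apply: extensionality => z; rewrite !hvP.
split=> -[b [ba cb ->]]; exists b; split=> //.
- by apply/(proj1 (hk a b ka)).
- by apply: ih => //; apply: (proj1 (h_can hm ka _)); apply/(proj1 (hk a b ka)).
- by apply/(proj1 (hk a b ka)).
- by rewrite ih //; case: (h_can hm ka cb).
Qed.

(** New entries belong to rows created later. Unlike [kext] this also protects rows that are not
    canonical, such as those being filled by an enclosing computation. *)
Definition ext m m' := ole (cnt m) (cnt m') /\
  forall a t p, own a t p -> olt a (cnt m) -> (tabs m' t p <-> tabs m t p).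

(** The stronger form is for the tree traversals, which must know that the stack in tables 4 and 5
    has not moved. *)
Definition exta m m' := ext m m' /\ forall t p, 2 < t -> (tabs m' t p <-> tabs m t p).

Lemma ext_refl m : ext m m. Proof. by []. Qed.
Lemma ext_trans m1 m2 m3 : ext m1 m2 -> ext m2 m3 -> ext m1 m3.
Proof.
move=> [c1 h1] [c2 h2]; split; first exact: ole_trans c1 c2.
by move=> a t p o la; rewrite (h2 a t p o) ?(h1 a t p o) //; apply: olt_le_trans la c1.
Qed.

Lemma ext_kext m m' : heap m -> ext m m' -> kext m m'.
Proof.
move=> hm [_ h] a b ka; have la := h_own hm (ownK a) ka.
by split; apply: (h a) => //; [apply: ownC|apply: ownD].
Qed.

Definition pt m a x := Kn m a /\ hv m a = x.

Lemma pt_ext m m' a x : heap m -> ext m m' -> pt m a x -> pt m' a x.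
Proof.
move=> hm he [ka e]; split; last by rewrite (hv_kext hm (ext_kext hm he)).
by apply/(proj2 he a 1 a (ownK a)) => //; exact: (h_own hm (ownK a) ka).
Qed.

Lemma pt_inj m a b x : heap m -> pt m a x -> pt m b x -> a = b.
Proof. by move=> hm [ka ea] [kb eb]; apply: (hv_inj hm) => //; rewrite ea eb. Qed.

Lemma pt_in m a b x y : heap m -> pt m a x -> pt m b y -> y ∈ x <-> C m a b.
Proof.
move=> hm [ka <-] [kb <-]; rewrite in_hv //; split=> [[c [cc e]]|h]; last by exists b.
by rewrite (hv_inj hm kb _ e) //; case: (h_can hm ka cc).
Qed.

(** A canonical row at the limit is canonical at some earlier stage, and from then on [kext] keeps
    its elements and its closure fixed. So each clause can be checked at a single stage. *)
Lemma heap_lim B e l (ms : ON -> mem) ml : acc e 0 < 2 -> olimit l -> limmem B e l ms ml ->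
  (forall i i', olt i i' -> olt i' l -> mstep e (ms i) (ms i')) ->
  (forall i, olt i l -> heap (ms i)) -> heap ml.
Proof.
move=> e0 ll [l1 l2 _ l4] hp hm.
have c_le i : olt i l -> ole (cnt (ms i)) (cnt ml).
  by move=> il; case: (l4 i il) => _ h _ _ _; apply: h.
have kx i : olt i l -> kext (ms i) ml by move=> il; case: (l4 i il).
have rowE i a c : olt i l -> Kn (ms i) a -> (C ml a c <-> C (ms i) a c) /\ (Dn ml a c <-> Dn (ms i) a c).
  by move=> il ka; apply: (kx i il).
have kE a : Kn ml a -> exists i, olt i l /\ Kn (ms i) a by move/l2.
have kup i i' a : ole i i' -> olt i' l -> Kn (ms i) a -> Kn (ms i') a.
  by case=> [ii'|->] // i'l; case: (hp i i' ii' i'l) => _ _ h _ _; apply: h.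
split.
- by move=> a t p o /l2[i [il h]]; apply: olt_le_trans (c_le i il); apply: (h_own (hm i il) o).
- by move=> a b /l2[i [il h]]; apply: olt_le_trans (c_le i il); apply: (h_row (hm i il) h).
- move=> a b /kE[i [il ka]] /(proj1 (rowE i a b il ka)) cb.
  by have [kb lb] := h_can (hm i il) ka cb; split=> //; apply/l2; exists i.
- move=> a b /kE[i [il ka]] /kE[i' [i'l kb]] hc.
  have [k [kl ka' kb']] : exists k, [/\ olt k l, Kn (ms k) a & Kn (ms k) b].
    case: (ole_olt i i') => h; [exists i'|exists i]; split=> //; first exact: kup h i'l ka.
    by apply: kup kb => //; left.
  apply: (h_inj (hm k kl)) => // c.
  by rewrite -(proj1 (rowE k a c kl ka')) -(proj1 (rowE k b c kl kb')).
- move=> a b /kE[i [il ka]]; rewrite (proj2 (rowE i a b il ka)) (h_trc (hm i il) _ ka).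
  split=> -[->|[c [cc dc]]]; try (by left); right; exists c.
    split; first by apply/(proj1 (rowE i a c il ka)).
    by apply/(proj2 (rowE i c b il _)) => //; case: (h_can (hm i il) ka cc).
  have cc' : C (ms i) a c by apply/(proj1 (rowE i a c il ka)).
  split=> //; apply/(proj2 (rowE i c b il _)) => //; by case: (h_can (hm i il) ka cc').
- by move=> a b /l2[i [il h]]; apply: olt_le_trans (c_le i il); apply: (h_trc_lt (hm i il) h).
Qed.

Lemma ext_lim B e l (ms : ON -> mem) ml m : acc e 0 < 2 -> olimit l -> limmem B e l ms ml ->
  (forall i, olt i l -> ext m (ms i)) -> ext m ml.
Proof.
move=> e0 ll [l1 l2 _ l4] hx; split.
  apply: ole_trans (proj1 (hx _ (proj1 ll))) _.
  by case: (l4 _ (proj1 ll)) => _ h _ _ _; apply: h.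
move=> a t p o la; rewrite l2; split=> [[i [il h]]|h]; first by apply/(proj2 (hx i il) a t p o la).
by exists (ozero U); split; [case: ll|apply/(proj2 (hx _ (proj1 ll)) a t p o la)].
Qed.

Lemma heap_eqtt m m' : heap m -> eqtt m m' -> ole (cnt m) (cnt m') -> heap m'.
Proof.
move=> hm [e _] hc; case: hm => h1 h2 h3 h4 h5 h6; rewrite /C /Kn /Dn -e in h1 h2 h3 h4 h5 h6.
split=> // [a t p o h|a b h|a b h]; apply: olt_le_trans hc; [exact: h1 o h|exact: h2 h|exact: h6 h].
Qed.

Lemma ext_eqtt m m' : eqtt m m' -> ole (cnt m) (cnt m') -> ext m m'.
Proof. by move=> [e _] hc; split=> // a t p _ _; rewrite e. Qed.

Lemma hv_tabs m m' : tabs m = tabs m' -> hv m = hv m'.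
Proof.
move=> e; apply: funext; apply: olt_ind => a ih; apply: extensionality => z.
by rewrite !hvP /C e; split=> -[b [ba cb ->]]; exists b; split=> //; rewrite ih.
Qed.

Lemma kext_set m t a p : own a t p -> ~ Kn m a -> kext m (settb m t p).
Proof.
move=> o na c b kc; split; (split=> [[//|[e1 e2]]|]; last by left);
case: na; suff -> : a = c by []; apply: (own_inj o); rewrite -e1 -e2; [exact: ownC|exact: ownD].
Qed.

End Heap.

Section NewRow.
Variable U : zfc_universe.
Local Notation ON := (ON U).
Local Notation mem := (mem U).
Implicit Types (m : mem).

(* Adding the row [cnt m] as a canonical copy of row [s]. *)
Lemma heap_new m s mf : heap m -> olt s (cnt m) -> (forall c, C m s c -> Kn m c) ->
  (forall i, Kn m i -> ~ (forall c, C m i c <-> C m s c)) ->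
  cnt mf = osucc (cnt m) ->
  (forall t p, tabs mf t p <-> [\/ tabs m t p, t = 0 /\ exists c, C m s c /\ p = pr (cnt m) c,
     t = 2 /\ exists c b, [/\ C m s c, Dn m c b & p = pr (cnt m) b] |
     t = 2 /\ p = pr (cnt m) (cnt m) \/ t = 1 /\ p = cnt m]) ->
  [/\ heap mf, ext m mf, Kn mf (cnt m) & forall z, z ∈ hv mf (cnt m) <-> exists c, C m s c /\ z = hv m c].
Proof.
set n := cnt m => hm sn hcan hnew ec ht.
have CE a b : C mf a b <-> C m a b \/ (a = n /\ C m s b).
  rewrite /C ht; split=> [[h|[_ [c [hc /pr_inj[-> ->]]]]|[] //|[[]|[]] //]|[h|[-> h]]].
  - by left.
  - by right.
  - by constructor 1.
  - by constructor 2; split=> //; exists b.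
have KE a : Kn mf a <-> Kn m a \/ a = n.
  rewrite /Kn ht; split=> [[h|[] //|[] //|[[] //|[_ ->]]]|[h|->]]; first by left.
  - by right.
  - by constructor 1.
  - by constructor 4; right.
have DE a b : Dn mf a b <-> Dn m a b \/ (a = n /\ (b = n \/ exists c, C m s c /\ Dn m c b)).
  rewrite /Dn ht; split=> [[h|[] //|[_ [c [b' [h1 h2 /pr_inj[-> ->]]]]]|[[_ /pr_inj[-> ->]]|[] //]]|].
  - by left.
  - by right; split=> //; right; exists c.
  - by right; split=> //; left.
  - case=> [h|[-> [->|[c [h1 h2]]]]]; [by constructor 1|by constructor 4; left|].
    by constructor 3; split=> //; exists c, b.
have nK : ~ Kn m n by move=> /(h_own hm (ownK n))/olt_irr.
have nC b : ~ C m n b by move=> /(h_own hm (ownC n b))/olt_irr.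
have nD b : ~ Dn m n b by move=> /(h_own hm (ownD n b))/olt_irr.
have ex : ext m mf.
  split; first by rewrite ec; left.
  move=> a t p o an; rewrite ht; split=> [[//|[e [c [_ e']]]|[e [c [b [_ _ e']]]]|[[e e']|[e e']]]|h].
  - by subst; case: (@olt_irr _ n); rewrite {1}(own_inj (ownC n c) o).
  - by subst; case: (@olt_irr _ n); rewrite {1}(own_inj (ownD n b) o).
  - by subst; case: (@olt_irr _ n); rewrite {1}(own_inj (ownD n n) o).
  - by subst; case: (@olt_irr _ n); rewrite {1}(own_inj (ownK n) o).
  - by constructor 1.
have kn : Kn mf n by apply/KE; right.
have hf : heap mf.
  split.
  - move=> a t p o; rewrite ht ec oltS => -[h|[e [c [_ e']]]|[e [c [b [_ _ e']]]]|[[e e']|[e e']]].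
    + by left; apply: (h_own hm o h).
    + by right; subst; apply: (own_inj o (ownC n c)).
    + by right; subst; apply: (own_inj o (ownD n b)).
    + by right; subst; apply: (own_inj o (ownD n n)).
    + by right; subst; apply: (own_inj o (ownK n)).
  - by move=> a b /CE[h|[_ h]]; rewrite ec oltS; left; apply: (h_row hm h).
  - move=> a b /KE[ka|->] /CE[cb|[e cb]].
    + by have [kb lb] := h_can hm ka cb; split=> //; apply/KE; left.
    + by subst a.
    + by case: (nC b).
    + by split; [apply/KE; left; apply: hcan|apply: (h_row hm cb)].
  - move=> a b /KE[ka|->] /KE[kb|->] h //.
    + apply: (h_inj hm ka kb) => c; have := h c; rewrite !CE => h'.
      split=> hc.
        by case: (proj1 h' (or_introl hc)) => // -[e _]; subst b.
      by case: (proj2 h' (or_introl hc)) => // -[e _]; subst a.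
    + case: (hnew a ka) => c; have := h c; rewrite !CE => h'; split=> hc.
        by case: (proj1 h' (or_introl hc)) => [/nC|[]].
      by case: (proj2 h' (or_intror (conj erefl hc))) => // -[e _]; subst a.
    + case: (hnew b kb) => c; have := h c; rewrite !CE => h'; split=> hc.
        by case: (proj2 h' (or_introl hc)) => [/nC|[]].
      by case: (proj1 h' (or_intror (conj erefl hc))) => // -[e _]; subst b.
  - move=> a b /KE[ka|->]; rewrite DE.
      have an : a <> n by move=> e; subst a.
      rewrite (h_trc hm b ka); split=> [[[->|[c [cc dc]]]|[]//]|[->|[c [/CE[cc|[]//] /DE[dc|[e _]]]]]].
      + by left.
      + by right; exists c; split; [apply/CE; left|apply/DE; left].
      + by left; left.
      + by left; right; exists c.
      + by have [kc _] := h_can hm ka cc; subst c.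
    split=> [[/nD //|[_ [->|[c [cc dc]]]]]|[->|[c [/CE[/nC //|[_ cc]] /DE[dc|[e _]]]]]].
    + by left.
    + by right; exists c; split; [apply/CE; right|apply/DE; left].
    + by right; split=> //; left.
    + by right; split=> //; right; exists c.
    + by have := hcan c cc; rewrite e => /nK.
  - move=> a b /DE[h|[_ [->|[c [_ h]]]]]; rewrite ec oltS; [left|by right|left]; exact: (h_trc_lt hm h).
split=> // z; rewrite in_hv //; split=> -[c [h ->]].
  case/CE: h => [/nC //|[_ h]]; exists c; split=> //.
  by rewrite (hv_kext hm (ext_kext hm ex)) //; apply: hcan.
exists c; split; first by apply/CE; right.
by rewrite (hv_kext hm (ext_kext hm ex)) //; apply: hcan.
Qed.

End NewRow.

Section Alloc.
Variables (U : zfc_universe) (M : machine) (X0 : tape U) (B KK : nat).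
Local Notation ON := (ON U).
Local Notation mem := (mem U).
Local Notation wp := (@wp U M X0 B KK).
Hypothesis hKK : 32 < KK.
Implicit Types (m : mem).

Lemma bumpC e0 j x m m' r : mstep (bump e0 j) (setr m j x) m' -> r <> j -> acc e0 r = 0 -> regs m' r = regs m r.
Proof. by case=> h _ _ _ _ /eqP/negbTE rj er; rewrite h /= rj. Qed.

Lemma mstepC e m m' r : mstep e m m' -> acc e r = 0 -> regs m' r = regs m r.
Proof. by case=> h _ _ _ _; apply: h. Qed.

Lemma lv_hi L r : L <= r -> acc (lv L) r = 0.
Proof. by move=> h; rewrite /= ltnNge h /=; case: eqP. Qed.

Lemma wp_new_row e t Q D m : t < KK -> t <> 0 -> 1 < acc e t -> 0 < acc e 0 ->
  Q 0 (setr (setr m t (cnt m)) 0 (osucc (cnt m))) -> wp e (new_row B KK t) Q D m.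
Proof.
move=> tK t0 et e0 q; apply: (wp_seq (Q1 := fun _ m' => m' = setr m t (cnt m))).
  by apply: wp_copy => //; lia.
move=> _ _ _ ->; apply: wp_inc => //; first by lia.
by rewrite /=; case: eqP => // e1; case: t0.
Qed.

Lemma wp_diff_row (d t : nat) D m : 4 < d < KK -> 4 < t < KK ->
  wp (lv 5) (diff_row B KK d t) (fun v m' => v = b2 (exists c, olt c (cnt m) /\ ~ (C m (regs m d) c <-> C m (regs m t) c)) /\ eqtt m m') D m.
Proof.
move=> /andP[d4 dK] /andP[t4 tK]; have K3 : 3 < KK by lia.
have hc x r m' : mstep (bump (lv 4) 4) (setr m 4 x) m' -> 4 < r -> regs m' r = regs m r.
  by move=> s r4; apply: (bumpC s); [lia|apply: lv_hi; lia].
apply: (wp_find (lv 4) (fun i => ~ (C m (regs m d) i <-> C m (regs m t) i))) => //; try lia.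
- move=> i m' _ e4 s et.
  apply: (wp_bind (Q1 := fun v m2 => v = b2 (C m (regs m d) i) /\ eqtt m m2)).
    wp_get D K3.
    move=> v m2 _ [-> e2]; rewrite e4 (hc _ _ _ s d4) (proj1 et); split=> //.
    exact: eqtt_trans et e2.
  have G m2 : mstep (lv 4) m' m2 -> eqtt m m2 -> wp (lv 4) (get2 B KK 0 t 4)
      (fun v m3 => v = b2 (C m (regs m t) i) /\ eqtt m m3) D m2.
    move=> s2 et2; wp_get D K3.
    move=> v m3 _ [-> e3]; split; last exact: eqtt_trans et2 e3.
    have r4 : regs m2 4 = i by rewrite (mstepC s2).
    have rt : regs m2 t = regs m t by rewrite (mstepC s2) ?(hc _ _ _ s t4) //; apply: lv_hi; lia.
    by rewrite r4 rt (proj1 et2).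
  move=> v m2 s2 [-> et2]; case: (classic (C m (regs m d) i)) => h1.
    rewrite b2T //=; apply: wp_bind; first exact: (G m2).
    move=> w m3 _ [-> et3]; case: (classic (C m (regs m t) i)) => h2.
      by rewrite b2T //=; apply: wp_ret; split=> //; rewrite b2F //; tauto.
    by rewrite b2F //=; apply: wp_ret; split=> //; rewrite b2T //; tauto.
  rewrite b2F //=; apply: (wp_weak (G m2 s2 et2)) => //.
  by move=> w m3 _ [-> e3]; split=> //; apply: b2_iff; tauto.
- by move=> m' i _ et _ il pi _; split=> //; rewrite b2T //; exists i.
- by move=> m' _ et _ h; split=> //; rewrite b2F // => -[c [lc hc']]; apply: (h c lc).
Qed.

Lemma wp_alloc (t d : nat) D m : 6 < t < KK -> 6 < d < KK -> t <> d -> heap m -> olt (regs m t) (cnt m) ->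
  (forall c, C m (regs m t) c -> Kn m c) -> (forall i, Kn m i -> ~ (forall c, C m i c <-> C m (regs m t) c)) ->
  regs m d = cnt m ->
  wp (effl 7 [:: d] true false) (alloc B KK t d)
    (fun _ m' => [/\ heap m', exta m m', Kn m' (regs m' d) &
       forall z, z ∈ hv m' (regs m' d) <-> exists c, C m (regs m t) c /\ z = hv m c]) D m.
Proof.
move=> /andP[t6 tK] /andP[d6 dK] td hm; set s := regs m t; set n := cnt m => sn hcan hnew dn.
have K3 : 3 < KK by lia.
have nK : ~ Kn m n by move=> /(h_own hm (ownK n))/olt_irr.
have nn a : olt a n -> a <> n by exact: olt_neq.
(* [T1 i] are the entries added for the elements below [i]; [T2 i k] adds element [i] itself and the
   members of its closure below [k]. *)
pose T1 i t p := (t = 0 /\ exists c, [/\ olt c i, C m s c & p = pr n c]) \/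
  (t = 2 /\ exists c b, [/\ olt c i, C m s c, Dn m c b & p = pr n b]).
pose I i m' := forall t p, tabs m' t p <-> tabs m t p \/ T1 i t p.
pose T2 i k t p := T1 i t p \/ (t = 0 /\ p = pr n i) \/ (t = 2 /\ exists b, [/\ olt b k, Dn m i b & p = pr n b]).
pose J i k m' := forall t p, tabs m' t p <-> tabs m t p \/ T2 i k t p.
pose e1 := effl 5 [:: 6] false false.
have e1c r : 6 < r -> acc e1 r = 0.
  by case: r => [|[|[|[|[|[|[|r]]]]]]].
apply: (wp_seq (Q1 := fun _ m' => [/\ I n m', regs m' d = n, regs m' 0 = n & regs m' t = s])).
  have bc m' r : mstep (bump e1 5) (setr m 5 (ozero U)) m' -> 6 < r \/ r = 0 -> regs m' r = regs m r.
    move=> st hr; apply: (bumpC st); first by lia.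
    by case: hr => [/e1c|->].
  apply: (wp_for e1 I) => //; try lia.
  - move=> t' p; split=> [|[//|[[_ [c [/olt0]]]|[_ [c [b [/olt0]]]]]]] //; by left.
  - move=> i m' il e5 e0 st hi; rewrite /= -/n in il.
    have mt : regs m' t = s by apply: (bc m') => //; left.
    have md : regs m' d = n by rewrite -dn; apply: (bc m') => //; left.
    have m0 : regs m' 0 = n by apply: (bc m') => //; right.
    have nKm m2 k : J i k m2 -> ~ Kn m2 n.
      by move=> hj /hj[//|[[[]|[]]|[[]|[]]]].
    have nKm' : ~ Kn m' n by move=> /hi[//|[[]|[]]].
    apply: (wp_bind (Q1 := fun v m2 => v = b2 (C m s i) /\ eqtt m' m2)).
      wp_get D K3.
      move=> v m2 _ [-> e2]; split=> //; apply: b2_iff.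
      rewrite mt e5 hi; split=> [[//|[[_ [c [_ _ /pr_inj[e3 _]]]]|[]]]|] //; last by left.
      by rewrite e3 in sn; case: (olt_irr sn).
    move=> v m2 s2 [-> [et1 et2]]; case: (classic (C m s i)) => hci; last first.
      rewrite b2F //=; apply: wp_ret => t' p /=; rewrite et1 hi; split=> -[h|[[e [c [h1 h2 h3]]]|[e [c [b [h1 h2 h3 h4]]]]]];
        try (by left); right.
      + by left; split=> //; exists c; split=> //; apply/oltS; left.
      + by right; split=> //; exists c, b; split=> //; apply/oltS; left.
      + case/oltS: h1 => [h1|h1]; last by subst c.
        by left; split=> //; exists c.
      + case/oltS: h1 => [h1|h1]; last by subst c.
        by right; split=> //; exists c, b.
    rewrite b2T //=.
    have c2 r : 6 < r \/ r = 0 \/ r = 5 -> regs m2 r = regs m' r.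
      move=> hr; apply: (mstepC s2).
      by case: hr => [/e1c|[->|->]].
    apply: (wp_seq (Q1 := fun _ m3 => J i (ozero U) m3)).
      wp_put D K3.
      - rewrite c2 ?md; last by left.
        by apply: (kext_set (ownC n _)); rewrite /Kn et1.
      - move=> _ m3 _ [et3 _] t' p; rewrite et3 /= et1 hi c2 ?md ?c2 ?e5; try tauto.
        rewrite /T2; split=> [[[h|h]|[-> ->]]|[h|[h|[[-> ->]|[_ [b [/olt0]]]]]]] //; tauto.
    move=> _ m3 s3 j0.
    have c3 r : 6 < r \/ r = 0 \/ r = 5 -> regs m3 r = regs m' r.
      move=> hr; rewrite -(c2 r hr); apply: (mstepC s3).
      by case: hr => [/e1c|[->|->]].
    apply: (wp_for (lv 4) (J i)) => //; try lia.
    + move=> k m4 kl e6 _ s4 jk.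
      have c4 r : 6 < r \/ r = 0 \/ r = 5 -> regs m4 r = regs m' r.
        move=> hr; rewrite -(c3 r hr); apply: (bumpC s4); first by lia.
        by case: hr => [h|[->|->]] //; apply: lv_hi; lia.
      apply: (wp_bind (Q1 := fun v m5 => v = b2 (Dn m i k) /\ eqtt m4 m5)).
        wp_get D K3.
        move=> w m5 _ [-> e7]; split=> //; apply: b2_iff.
        rewrite c4 ?e5; last by tauto.
        rewrite e6 jk /T2 /T1; split=> [[//|[[[]|[_ [c [b [_ _ _ /pr_inj[e8 _]]]]]]|[[]|[_ [b [_ _ /pr_inj[e8 _]]]]]]]|] //.
        * by case: (nn i il e8).
        * by case: (nn i il e8).
        * by left.
      move=> w m5 s5 [-> [et3 et4]]; case: (classic (Dn m i k)) => hd; last first.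
        rewrite b2F //=; apply: wp_ret => t' p /=; rewrite et3 jk /T2.
        split=> -[h|[h|[h|[e8 [b [h1 h2 h3]]]]]]; try tauto; right; right; right; split=> //; exists b; split=> //.
          by apply/oltS; left.
        by case/oltS: h1 => // e9; subst b.
      rewrite b2T //=; wp_put D K3.
      - rewrite (mstepC s5) ?c4 ?md; try tauto; last by apply: lv_hi; lia.
        by apply: (kext_set (ownD n _)); rewrite /Kn et3; apply: nKm jk.
      - move=> _ m6 _ [et5 _] t' p /=; rewrite et5 /= et3 jk.
        rewrite (mstepC s5) ?c4 ?md; try tauto; last by apply: lv_hi; lia.
        rewrite (mstepC s5) ?e6 //.
        rewrite /T2; split=> [[[h|[h|[h|[e8 [b [h1 h2 h3]]]]]]|[-> ->]]|[h|[h|[h|[e8 [b [h1 h2 h3]]]]]]]; try tauto.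
        + by right; right; right; split=> //; exists b; split=> //; apply/oltS; left.
        + by right; right; right; split=> //; exists k; split=> //; apply/oltS; right.
        + case/oltS: h1 => [h1|e9]; last by right; rewrite h3 e9.
          by left; right; right; right; split=> //; exists b.
    + move=> l ms ml lde ll hI _ _ [_ lm _ _] _ t' p; rewrite lm.
      split=> [[b [bl]]|].
        case: (hI b bl) => hj _ /hj[h|[h|[h|[e8 [b' [h1 h2 h3]]]]]]; rewrite /T2; try tauto.
        by right; right; right; split=> //; exists b'; split=> //; apply: olt_trans h1 bl.
      have [hz _] := hI _ (proj1 ll).
      move=> h; have [hh|hh] : (tabs m t' p \/ T1 i t' p \/ t' = 0 /\ p = pr n i) \/ (t' = 2 /\ exists b, [/\ olt b l, Dn m i b & p = pr n b]).
        by rewrite /T2 in h; tauto.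
        by exists (ozero U); split; [case: ll|apply/hz; rewrite /T2; tauto].
      case: hh => e8 [b [h1 h2 h3]]; have sb := proj2 ll _ h1; exists (osucc b); split=> //.
      by apply/(proj1 (hI _ sb)); right; right; right; split=> //; exists b.
    + move=> m4 _ e6 jn t' p /=; rewrite jn /T2 c3 ?m0; last by tauto.
      rewrite /T1; split=> [[h|[[[e8 [c [h1 h2 h3]]]|[e8 [c [b [h1 h2 h3 h4]]]]]|[[-> ->]|[-> [b [h1 h2 h3]]]]]]|[h|[[e8 [c [h1 h2 h3]]]|[e8 [c [b [h1 h2 h3 h4]]]]]]];
        try (by left); right.
      - by left; split=> //; exists c; split=> //; apply/oltS; left.
      - by right; split=> //; exists c, b; split=> //; apply/oltS; left.
      - by left; split=> //; exists i; split=> //; apply/oltS; right.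
      - by right; split=> //; exists i, b; split=> //; apply/oltS; right.
      - case/oltS: h1 => [h1|e9]; first by left; left; split=> //; exists c.
        by right; left; subst.
      - case/oltS: h1 => [h1|e9]; first by left; right; split=> //; exists c, b.
        subst c; right; right; split=> //; exists b; split=> //; exact: (h_trc_lt hm h3).
  - move=> l ms ml lde ll hI _ _ [_ lm _ _] _ t' p; rewrite lm; split=> [[b [bl]]|].
      case: (hI b bl) => hj _ /hj[h|[[e8 [c [h1 h2 h3]]]|[e8 [c [b' [h1 h2 h3 h4]]]]]]; try (by left); right.
        by left; split=> //; exists c; split=> //; apply: olt_trans h1 bl.
      by right; split=> //; exists c, b'; split=> //; apply: olt_trans h1 bl.
    case=> [h|[[e8 [c [h1 h2 h3]]]|[e8 [c [b' [h1 h2 h3 h4]]]]]].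
    + by exists (ozero U); split; [case: ll|apply/(proj1 (hI _ (proj1 ll))); left].
    + have sb := proj2 ll _ h1; exists (osucc c); split=> //; apply/(proj1 (hI _ sb)); right; left.
      by split=> //; exists c.
    + have sb := proj2 ll _ h1; exists (osucc c); split=> //; apply/(proj1 (hI _ sb)); right; right.
      by split=> //; exists c, b'.
  - move=> m' st _ hi; split=> //; [rewrite -dn| |]; apply: (bc m') => //; tauto.
move=> _ m1 s1 [hi md m0 mt].
apply: (wp_seq (Q1 := fun _ m2 => [/\ tabs m2 = tabs (settb m1 2 (pr n n)), regs m2 d = n & regs m2 0 = n])).
  wp_put D K3.
  - by rewrite md; apply: (kext_set (ownD n _)) => /hi[|[[]|[]]].
  - move=> _ m2 s2 [-> _]; rewrite md; split=> //; rewrite (mstepC s2) //; apply: lv_hi; lia.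
move=> _ m2 s2 [et md2 m02].
apply: (wp_seq (Q1 := fun _ m3 => m3 = settb m2 1 n)).
  apply: wp_set => //; try lia; last by rewrite md2.
  rewrite md2; apply: (kext_set (ownK n)); rewrite /Kn et /= => -[/hi[|[[]|[]]]|[]] //.
move=> _ _ _ ->; apply: wp_inc => //; first by lia.
have [||h1 h2 h3 h4] := @heap_new _ m s (setr (settb m2 1 n) 0 (osucc (regs (settb m2 1 n) 0))) hm sn hcan hnew.
- by rewrite /cnt /= m02.
- move=> t' p /=; rewrite et /= hi /T1.
  split=> [[[[h|[[e8 [c [_ h2 h3]]]|[e8 [c [b [_ h2 h3 h4]]]]]]|h]|h]|].
  + by constructor 1.
  + by constructor 2; split=> //; exists c.
  + by constructor 3; split=> //; exists c, b.
  + by constructor 4; left.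
  + by constructor 4; right.
  case=> [h|[e8 [c [h2 h3]]]|[e8 [c [b [h2 h3 h4]]]]|[h|h]]; try tauto.
  + left; left; right; left; split=> //; exists c; split=> //; exact: (h_row hm h2).
  + left; left; right; right; split=> //; exists c, b; split=> //; exact: (h_row hm h2).
have rd : regs (setr (settb m2 1 n) 0 (osucc (regs (settb m2 1 n) 0))) d = n.
  by rewrite /= md2; case: eqP => // e8; move: d6; rewrite e8.
split; rewrite ?rd //; split=> // t' p t2 /=; rewrite et /= hi /T1.
split=> [[[[h|[[e8 _]|[e8 _]]]|[e8 _]]|[e8 _]]|h] //; try (by exfalso; lia).
by left; left; left.
Qed.

(* Hash-consing: the canonical row with the elements of row [t]. *)
Lemma wp_find_alloc (t d : nat) D m : 6 < t < KK -> 6 < d < KK -> t <> d -> heap m -> olt (regs m t) (cnt m) ->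
  (forall c, C m (regs m t) c -> Kn m c) ->
  wp (effl 7 [:: d] true false) (find_alloc B KK t d)
    (fun _ m' => [/\ heap m', exta m m', Kn m' (regs m' d) &
       forall z, z ∈ hv m' (regs m' d) <-> exists c, C m (regs m t) c /\ z = hv m c]) D m.
Proof.
move=> ht hd td hm sn hcan; have [t6 tK] := andP ht; have [d6 dK] := andP hd.
pose P i := Kn m i /\ ~ (exists c, olt c (cnt m) /\ ~ (C m i c <-> C m (regs m t) c)).
have PE i : P i <-> Kn m i /\ forall c, C m i c <-> C m (regs m t) c.
  split=> -[ki h]; split=> //.
    move=> c; case: (classic (olt c (cnt m))) => lc; first by apply: NNPP => n; apply: h; exists c.
    by split=> hc; case: lc; apply: (h_row hm hc).
  by case=> c [_ n]; apply: n.
have bc m' r : mstep (bump (lv 5) d) (setr m d (ozero U)) m' -> r <> d -> 4 < r \/ r = 0 -> regs m' r = regs m r.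
  move=> st rd hr; apply: (bumpC st) => //.
  by case: hr => [h|->] //; apply: lv_hi.
have dE : acc (effl 7 [:: d] true false) d = 2.
  by rewrite /= inE eqxx orbT; case: eqP => // e; move: d6; rewrite e.
apply: (wp_bind (Q1 := fun v m' => mstep (bump (lv 5) d) (setr m d (ozero U)) m' /\ eqtt m m' /\
   ((v = 1 /\ P (regs m' d)) \/ (v = 0 /\ regs m' d = cnt m /\ forall i, ~ P i)))).
  apply: (wp_find (lv 5) P) => //; try lia.
  - by apply: lv_hi; lia.
  - move=> i m' il ed st et.
    apply: (wp_bind (Q1 := fun v m2 => v = b2 (Kn m i) /\ m2 = m')).
      by apply: wp_get => //; try lia; rewrite ed (proj1 et).
    move=> _ _ _ [-> ->]; case: (classic (Kn m i)) => hk; last first.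
      by rewrite b2F //=; apply: wp_ret; rewrite b2F // => -[].
    rewrite b2T //=; apply: wp_bind; first by apply: (@wp_diff_row d t D m'); lia.
    move=> v m2 s2 [-> et2]; have ec : cnt m' = cnt m by apply: (bc m') => //; [lia|right].
    rewrite ed (bc m' t) //; try lia; rewrite ec /C (proj1 et) -/(C m i).
    have et3 := eqtt_trans et et2.
    case: (classic (exists c, olt c (cnt m) /\ ~ (tabs m 0 (pr i c) <-> tabs m 0 (pr (regs m t) c)))) => hx.
      by rewrite b2T //=; apply: wp_ret; split=> //; rewrite b2F // => -[].
    by rewrite b2F //=; apply: wp_ret; split=> //; rewrite b2T.
  - by move=> m' i st et ed _ pi _; split=> //; split=> //; left; rewrite ed.
  - move=> m' st et ed h; split=> //; split=> //; right; split=> //; split=> // i pi.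
    by apply: (h i _ pi); apply: (h_own hm (ownK i)); case: pi.
move=> v m1 s1 [st [et h]].
have ec : cnt m1 = cnt m by apply: (bc m1) => //; [lia|right].
have tt : regs m1 t = regs m t by apply: (bc m1) => //; lia.
have CE a b : C m1 a b = C m a b by rewrite /C (proj1 et).
have KE a : Kn m1 a = Kn m a by rewrite /Kn (proj1 et).
have hm1 : heap m1 by apply: heap_eqtt et _ => //; rewrite ec.
have ex1 : ext m m1 by apply: ext_eqtt et _; rewrite ec.
have xa1 : exta m m1 by split=> // t' p _; rewrite (proj1 et).
case: h => [[-> /PE[kd hd']]|[-> [ed np]]] /=.
  apply: wp_ret; split=> //; first by rewrite KE.
  move=> z; rewrite in_hv ?KE //; split=> -[c [hc ->]]; exists c; split.
  + by apply/hd'; rewrite -CE.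
  + by rewrite (hv_tabs (proj1 et)).
  + by rewrite CE; apply/hd'.
  + by rewrite (hv_tabs (proj1 et)).
apply: (wp_weak (@wp_alloc t d D m1 ht hd td hm1 _ _ _ _)) => //.
- by rewrite tt ec.
- by move=> c; rewrite tt CE KE; apply: hcan.
- move=> i; rewrite KE => ki hi; apply: (np i); apply/PE; split=> // c.
  by have := hi c; rewrite tt !CE.
- by rewrite ed ec.
- move=> _ m2 _ [h1 h2 h3 h4]; split=> //.
    by case: h2 => h2 h5; split; [exact: ext_trans ex1 h2|move=> t' p t2; rewrite h5 // (proj1 et)].
  move=> z; rewrite h4 tt (hv_tabs (proj1 et)); split=> -[c [hc ->]]; exists c; split=> //.
    by rewrite -CE.
  by rewrite CE.
Qed.

End Alloc.
#[global] Hint Extern 0 (acc (lv _) _ = 0) => by apply: lv_hi; lia : core.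

Definition copyrow B KK t a j := for_ B KK j 0 (Bind (get2 B KK 0 a j) (Ret 0) (set2 B KK 0 t j) (Ret 0)).

(** Access rights of a compiled program: the working registers 1 to 6 of the heap commands, the
    destination [d], and all registers from [base] on. Register 0 may only grow. *)
Definition effp (d base : nat) := Eff (fun r => if r == 0 then 1 else if [|| r < 7, r == d | base <= r] then 2 else 0) false.

Lemma sub_effp_l L ds c d base : L <= 7 -> 7 <= base -> all (fun r => (r == d) || (base <= r)) ds -> sub_eff (effl L ds c false) (effp d base).
Proof.
move=> hL hb /allP hd; split=> // r /=; case: eqP => // _; first by case: c.
case: ifP => // /orP[h|/hd h]; first by rewrite (leq_trans h hL).
by rewrite h orbT.
Qed.

Lemma sub_effp d' b' d b : (d' == d) || (b <= d') -> b <= b' -> sub_eff (effp d' b') (effp d b).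
Proof.
move=> h1 h2; split=> // r /=; case: eqP => // _; case: ifP => // h; case: ifP => //.
move=> h3; move: h h1 h2 h3; lia.
Qed.

#[global] Hint Extern 0 (sub_eff _ (effp _ _)) => solve [by apply: sub_effp_l => //=; lia | by apply: sub_effp; lia] : core.

Lemma effpC d b r : 7 <= r < b -> r <> d -> acc (effp d b) r = 0.
Proof. by move=> h1 h2 /=; case: eqP => [|_]; [lia|]; case: ifP => //; lia. Qed.

Lemma effp_dst d b : 0 < d -> acc (effp d b) d = 2.
Proof. by move=> h /=; rewrite eqxx orbT; case: eqP => //; lia. Qed.

Lemma effp_scr d b r : 0 < r -> b <= r -> acc (effp d b) r = 2.
Proof. by move=> h h2 /=; rewrite h2 !orbT; case: eqP => //; lia. Qed.

#[global] Hint Extern 0 (acc (effp _ _) _ = _) => solve [by rewrite effp_scr //; lia | by rewrite effpC //; lia] : core.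
#[global] Hint Extern 0 (is_true (_ < acc (effp _ _) _)) => by rewrite effp_scr //; lia : core.

Section Pend.
Variable U : zfc_universe.
Local Notation ON := (ON U).
Local Notation mem := (mem U).
Implicit Types (m : mem).

Lemma pt_step e m m' a x : heap m -> mstep e m m' -> pt m a x -> pt m' a x.
Proof.
move=> hm [_ _ h _ hk] [ka <-]; split; first exact: h.
exact: hv_kext.
Qed.

Lemma cnt_step e m m' : acc e 0 < 2 -> mstep e m m' -> ole (cnt m) (cnt m').
Proof. by move=> e0 [_ h _ _ _]; apply: h. Qed.

Definition vals m (a : seq nat) (xs : seq U) := size a = size xs /\
  forall i, i < size a -> pt m (regs m (nth 0 a i)) (nth empty xs i).

Lemma vals_nil m : vals m [::] [::]. Proof. by []. Qed.

Lemma vals_cons m r (a : seq nat) x xs : pt m (regs m r) x -> vals m a xs -> vals m (r :: a) (x :: xs).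
Proof. by move=> h [sz h']; split=> [|[|i] ia] //=; [rewrite sz|apply: h']. Qed.

Lemma vals_cat m (a a' : seq nat) xs xs' : vals m a xs -> vals m a' xs' -> vals m (a ++ a') (xs ++ xs').
Proof.
move=> [sz h] [sz' h']; split=> [|i]; rewrite ?size_cat ?sz ?sz' // => ia; rewrite !nth_cat sz.
by case: ltnP => hi; [apply: h; rewrite sz|apply: h'; rewrite sz'; lia].
Qed.

Lemma vals_split m (a : seq nat) xs xs' : vals m a (xs ++ xs') -> vals m (take (size xs) a) xs /\ vals m (drop (size xs) a) xs'.
Proof.
move=> [sz h]; rewrite size_cat in sz; have st : size (take (size xs) a) = size xs by rewrite size_takel // sz; lia.
split; split=> //.
- move=> i; rewrite st => hi; have := h i; rewrite nth_cat hi nth_take //; apply; lia.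
- by rewrite size_drop sz; lia.
- move=> i; rewrite size_drop sz => hi; have := h (size xs + i); rewrite nth_cat nth_drop.
  have -> : (size xs + i < size xs) = false by lia.
  by rewrite addKn; apply; lia.
Qed.

(* Row [n], created after [m0], is being filled and contains exactly [S]. *)
Definition pend m0 m n S := [/\ heap m, ext m0 m, ole (cnt m0) n /\ olt n (cnt m), ~ Kn m n & forall c, C m n c <-> S c].

Lemma pend_eqv m0 m n S T : pend m0 m n S -> (forall c, S c <-> T c) -> pend m0 m n T.
Proof. by move=> [h1 h2 h3 h4 h5] e; split=> // c; rewrite h5. Qed.

Lemma pend_new m m' : heap m -> tabs m' = tabs m -> cnt m' = osucc (cnt m) -> pend m m' (cnt m) (fun _ => False).
Proof.
move=> hm et ec; have le : ole (cnt m) (cnt m') by rewrite ec; left.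
split.
- split; rewrite /C /Kn /Dn et.
  + by move=> a t p o h; apply: olt_le_trans le; apply: (h_own hm o).
  + by move=> a b h; apply: olt_le_trans le; apply: (h_row hm h).
  + exact: h_can hm.
  + exact: h_inj hm.
  + exact: h_trc hm.
  + by move=> a b h; apply: olt_le_trans le; apply: (h_trc_lt hm h).
- by split=> // a t p _ _; rewrite et.
- by split=> //; rewrite ec.
- by rewrite /Kn et => /(h_own hm (ownK _))/olt_irr.
- by move=> c; rewrite /C et; split=> // /(h_own hm (ownC _ _))/olt_irr.
Qed.

Lemma pend_fill m0 m m' n S T : pend m0 m n S ->
  (forall t p, tabs m' t p <-> tabs m t p \/ (t = 0 /\ exists c, T c /\ p = pr n c)) ->
  (forall c, T c -> olt c (cnt m)) -> cnt m' = cnt m -> pend m0 m' n (fun c => S c \/ T c).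
Proof.
move=> [hm he [n1 n2] nk hS] ht hT ec.
have CE a b : C m' a b <-> C m a b \/ (a = n /\ T b).
  rewrite /C ht; split=> [[h|[_ [c [hc /pr_inj[-> ->]]]]]|[h|[-> h]]]; [by left|by right|by left|].
  by right; split=> //; exists b.
have KE a : Kn m' a <-> Kn m a by rewrite /Kn ht; split=> [[|[]]|] //; left.
have DE a b : Dn m' a b <-> Dn m a b by rewrite /Dn ht; split=> [[|[]]|] //; left.
have CK a b : Kn m a -> C m' a b <-> C m a b.
  by move=> ka; rewrite CE; split=> [[|[e _]]|] //; [subst a|left].
split=> //.
- split; rewrite ?ec.
  + move=> a t p o; rewrite ht => -[h|[e [c [_ e']]]]; first exact: (h_own hm o h).
    by subst; rewrite (own_inj o (ownC n c)).
  + by move=> a b /CE[/(h_row hm)|[_ /hT]].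
  + by move=> a b /KE ka /(CK a b ka) h; rewrite KE; apply: (h_can hm ka h).
  + by move=> a b /KE ka /KE kb h; apply: (h_inj hm ka kb) => c; rewrite -CK // -CK.
  + move=> a b /KE ka; rewrite DE (h_trc hm b ka).
    split=> -[->|[c [cc dc]]]; try (by left); right; exists c; split; rewrite ?DE ?CK //.
      by rewrite -CK.
    by rewrite -DE.
  + by move=> a b /DE; apply: (h_trc_lt hm).
- split; first by rewrite ec; case: he.
  move=> a t p o la; rewrite ht -(proj2 he a t p o la); split=> [[//|[e [c [_ e']]]]|]; last by left.
  by subst; rewrite (own_inj o (ownC n c)) in la; case: (olt_irr (ole_lt_trans n1 la)).
- by rewrite ec.
- by rewrite KE.
- by move=> c; rewrite CE hS; split=> [[|[_]]|[]] //; [left|right|left|right].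
Qed.

Lemma pend_set m0 m m' n S a : pend m0 m n S -> tabs m' = tabs (settb m 0 (pr n a)) -> olt a (cnt m) ->
  cnt m' = cnt m -> pend m0 m' n (fun c => S c \/ c = a).
Proof.
move=> hp et la ec; apply: (pend_fill (T := fun c => c = a) hp) => // [t p|c ->] //.
rewrite et /=; split=> -[h|]; try (by left).
  by case=> -> ->; right; split=> //; exists a.
by case=> -> [c [-> ->]]; right.
Qed.

Lemma pend_ext m0 m m' n S : pend m0 m n S -> heap m' -> ext m m' -> pend m0 m' n S.
Proof.
move=> [hm he [n1 n2] nk hS] hm' [c1 h]; split=> //.
- exact: ext_trans he (conj c1 h).
- by split=> //; apply: olt_le_trans n2 c1.
- by rewrite /Kn (h n 1 n (ownK n) n2).
- by move=> c; rewrite /C (h n 0 _ (ownC n c) n2); apply: hS.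
Qed.

Lemma pend_ext0 m1 m0 m n S : pend m1 m n S -> ext m0 m1 -> pend m0 m n S.
Proof.
move=> [hm he [n1 n2] nk hS] hx; split=> //; first exact: ext_trans hx he.
by split=> //; case: hx => h _; apply: ole_trans h n1.
Qed.

Lemma pend_other m0 m m' n n' S a : pend m0 m n S -> heap m' -> n' <> n -> ole (cnt m0) n' -> ole (cnt m) (cnt m') ->
  tabs m' = tabs (settb m 0 (pr n' a)) -> pend m0 m' n S.
Proof.
move=> [hm he [n1 n2] nk hS] hm' nn n1' hc et; split=> //.
- split; first by case: he => h _; apply: ole_trans h hc.
  move=> b t p o la; rewrite et /= (proj2 he b t p o la); split=> [[|[e e']]|] //; last by left.
  by subst; rewrite (own_inj o (ownC n' a)) in la; case: (olt_irr (ole_lt_trans n1' la)).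
- by split=> //; apply: olt_le_trans n2 hc.
- by rewrite /Kn et /= => -[|[]].
- move=> c; rewrite /C et /= -hS; split=> [[|[_ /pr_inj[e _]]]|] //; last by left.
  by case: nn.
Qed.

Lemma pend_lim B e l (ms : ON -> mem) ml m0 n (S : ON -> ON -> Prop) : acc e 0 < 2 -> olimit l -> limmem B e l ms ml ->
  (forall i i', olt i i' -> olt i' l -> mstep e (ms i) (ms i')) ->
  (forall i, olt i l -> pend m0 (ms i) n (S i)) -> pend m0 ml n (fun c => exists i, olt i l /\ S i c).
Proof.
move=> e0 ll lm hp hI; have l0 := proj1 ll; split.
- by apply: heap_lim e0 ll lm hp _ => i /hI[].
- by apply: ext_lim e0 ll lm _ => i /hI[].
- case: (hI _ l0) => _ _ [n1 n2] _ _; split=> //; apply: olt_le_trans n2 _.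
  by case: lm => _ _ _ /(_ _ l0)[_ h _ _ _]; apply: h.
- by case: lm => _ h _ _ /h[i [il k]]; case: (hI i il).
- move=> c; case: lm => _ h _ _; rewrite /C h; split=> -[i [il k]]; exists i; split=> //; by case: (hI i il) => _ _ _ _ hS; apply/hS.
Qed.

(** The invariant constrains the tables from 3 on by ownership only. *)
Lemma heap_aux m t a p : heap m -> 2 < t -> own a t p -> olt a (cnt m) -> heap (settb m t p).
Proof.
move=> hm t2 o la; case: (hm) => h1 h2 h3 h4 h5 h6.
have E t' p' : t' < 3 -> tabs (settb m t p) t' p' <-> tabs m t' p'.
  by move=> t3 /=; split=> [[|[e _]]|] //; [lia|left].
have CE a' b' : C (settb m t p) a' b' <-> C m a' b' by apply: E.
have KE a' : Kn (settb m t p) a' <-> Kn m a' by apply: E.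
have DE a' b' : Dn (settb m t p) a' b' <-> Dn m a' b' by apply: E.
split.
- move=> a' t' p' o' /= [h|[e e']]; first exact: h1 o' h.
  by subst; rewrite (own_inj o' o).
- by move=> a' b' /CE/h2.
- by move=> a' b' /KE ka /CE h; rewrite KE; apply: h3 h.
- by move=> a' b' /KE ka /KE kb h; apply: h4 => // c; rewrite -CE -(CE b').
- move=> a' b' /KE ka; rewrite DE h5 //; split=> -[->|[c [cc dc]]]; try (by left); right; exists c; split.
  + exact/CE.
  + exact/DE.
  + exact/CE.
  + exact/DE.
- by move=> a' b' /DE/h6.
Qed.

Lemma ext_aux m0 m t a p : ext m0 m -> own a t p -> ole (cnt m0) a -> ext m0 (settb m t p).
Proof.
move=> [c1 h] o la; split=> // a' t' p' o' la' /=; rewrite (h a' t' p' o' la').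
split=> [[|[e e']]|] //; last by left.
by subst; rewrite (own_inj o' o) in la'; case: (olt_irr (ole_lt_trans la la')).
Qed.

Lemma trc_can m a b : heap m -> Kn m a -> Dn m a b -> Kn m b /\ ole b a.
Proof.
move=> hm; elim/olt_ind: a => a ih ka /(h_trc hm b ka)[->//|[c [cc dc]]].
have [kc lc] := h_can hm ka cc; have [kb lb] := ih c lc kc dc; split=> //.
by left; apply: ole_lt_trans lb lc.
Qed.

Lemma trc_down m a b c : heap m -> Kn m a -> Dn m a b -> C m b c -> Dn m a c.
Proof.
move=> hm; elim/olt_ind: a => a ih ka /(h_trc hm b ka)[->|[d [cd db]]] bc; apply/(h_trc hm c ka); right.
  have [kc _] := h_can hm ka bc; exists c; split=> //; apply/(h_trc hm c kc); by left.
have [kd ld] := h_can hm ka cd; exists d; split=> //; exact: ih.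
Qed.

End Pend.

Section Macros.
Variables (U : zfc_universe) (M : machine) (X0 : tape U) (B KK : nat).
Local Notation ON := (ON U).
Local Notation mem := (mem U).
Local Notation wp := (@wp U M X0 B KK).
Hypothesis hKK : 32 < KK.

Lemma wp_copyrowt (t r j : nat) m0 m n S D : 6 < t < KK -> 6 < r < KK -> 6 < j < KK -> j <> t -> j <> r ->
  pend m0 m n S -> regs m t = n -> regs m r <> n ->
  wp (effl 4 [:: j] false false) (copyrow B KK t r j) (fun _ m' => pend m0 m' n (fun c => S c \/ C m (regs m r) c) /\ forall t' p, 0 < t' -> (tabs m' t' p <-> tabs m t' p)) D m.
Proof.
move=> /andP[t6 tK] /andP[r6 rK] /andP[j6 jK] jt jr hp tn rn; have K3 : 3 < KK by lia.
have [hm he [n1 n2] nk hS] := hp; set s := regs m r.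
pose T i c := olt c i /\ C m s c.
pose I i m' := forall t p, tabs m' t p <-> tabs m t p \/ (t = 0 /\ exists c, T i c /\ p = pr n c).
have bc m' q : mstep (bump (lv 4) j) (setr m j (ozero U)) m' -> 6 < q \/ q = 0 -> q <> j -> regs m' q = regs m q.
  move=> st hq qj; apply: (bumpC st) => //.
  by case: hq => [h|->] //; apply: lv_hi; lia.
apply: (wp_for (lv 4) I) => //; try lia.
- by rewrite /= inE eqxx orbT; case: eqP => // e; move: j6; rewrite e.
- by move=> t' p; split=> [|[|[_ [c [[/olt0]]]]]] //; left.
- move=> i m' il ej _ st hi.
  have rt : regs m' t = n by rewrite (bc m') //; [left|lia].
  have rr : regs m' r = s by rewrite (bc m') //; [left|lia].
  apply: (wp_bind (Q1 := fun v m2 => v = b2 (C m s i) /\ eqtt m' m2)).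
    wp_get D K3.
    move=> v m2 _ [-> e2]; split=> //; apply: b2_iff.
    rewrite rr ej hi; split=> [[//|[_ [c [_ /pr_inj[e3 _]]]]]|]; last by left.
    by case: rn.
  move=> v m2 s2 [-> [et1 et2]]; case: (classic (C m s i)) => hci; last first.
    rewrite b2F //=; apply: wp_ret => t' p /=; rewrite et1 hi; split=> -[h|[e1 [c [[h1 h2] h3]]]]; try (by left); right; split=> //; exists c; split=> //; split=> //.
      by apply/oltS; left.
    by case/oltS: h1 => // e2; subst c.
  rewrite b2T //=; wp_put D K3.
    rewrite (mstepC s2) ?rt; last by apply: lv_hi; lia.
    by apply: (kext_set (ownC n _)); rewrite /Kn et1 => /hi[|[]].
  move=> _ m3 _ [et3 _] t' p /=; rewrite et3 /= et1 hi.
  rewrite (mstepC s2) ?rt; last by apply: lv_hi; lia.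
  rewrite (mstepC s2) ?ej; last by apply: lv_hi; lia.
  split=> [[[h|[e1 [c [[h1 h2] h3]]]]|[-> ->]]|[h|[e1 [c [[h1 h2] h3]]]]]; try tauto.
  + by right; split=> //; exists c; split=> //; split=> //; apply/oltS; left.
  + by right; split=> //; exists i; split=> //; split=> //; apply/oltS; right.
  + case/oltS: h1 => [h1|e2]; last by right; rewrite h3 e2.
    by left; right; split=> //; exists c.
- move=> l ms ml lde ll hI _ _ [_ lm _ _] _ t' p; rewrite lm; split=> [[b [bl]]|].
    case: (hI b bl) => hj _ /hj[h|[e1 [c [[h1 h2] h3]]]]; [by left|right; split=> //; exists c; split=> //; split=> //].
    exact: olt_trans h1 bl.
  case=> [h|[e1 [c [[h1 h2] h3]]]].
    by exists (ozero U); split; [case: ll|apply/(proj1 (hI _ (proj1 ll))); left].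
  have sb := proj2 ll _ h1; exists (osucc c); split=> //; apply/(proj1 (hI _ sb)); right; split=> //.
  by exists c.
- move=> m' st _ hi; split; last by move=> t' p t0; rewrite hi; split=> [[//|[e _]]|]; [lia|left].
  apply: (pend_eqv (S := fun c => S c \/ T (cnt m) c)).
    apply: (pend_fill hp) => //; first by move=> c [].
    by apply: (bc m') => //; [right|lia].
  move=> c; rewrite /T; split=> -[h|h]; try (by left); right; first by case: h.
  by split=> //; apply: (h_row hm h).
Qed.

Lemma wp_copyrow (t r j : nat) m0 m n S D : 6 < t < KK -> 6 < r < KK -> 6 < j < KK -> j <> t -> j <> r ->
  pend m0 m n S -> regs m t = n -> regs m r <> n ->
  wp (effl 4 [:: j] false false) (copyrow B KK t r j) (fun _ m' => pend m0 m' n (fun c => S c \/ C m (regs m r) c)) D m.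
Proof.
move=> ht hr hj jt jr hp tn rn; apply: (wp_weak (wp_copyrowt D ht hr hj jt jr hp tn rn)) => //.
by move=> _ m' _ [].
Qed.

Lemma wp_setC (t r : nat) m0 m n S D : 6 < t < KK -> (r == 0) || (6 < r) -> r < KK -> pend m0 m n S -> regs m t = n -> olt (regs m r) (cnt m) ->
  wp (lv 4) (set2 B KK 0 t r) (fun _ m' => pend m0 m' n (fun c => S c \/ c = regs m r) /\ tabs m' = tabs (settb m 0 (pr n (regs m r)))) D m.
Proof.
move=> /andP[t6 tK] r6 rK hp tn lr; have K3 : 3 < KK by lia.
wp_put D K3.
  by rewrite tn; apply: (kext_set (ownC n _)); case: hp.
move=> _ m' s1 [et _]; rewrite tn in et; split=> //; apply: (pend_set hp) => //.
exact: (mstepC s1).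
Qed.

Lemma wp_mkt (t d : nat) m0 m n S y D : 6 < t < KK -> 6 < d < KK -> t <> d -> pend m0 m n S -> regs m t = n ->
  (forall c, S c -> Kn m c) -> (forall z, z ∈ y <-> exists c, S c /\ z = hv m c) ->
  wp (effl 7 [:: d] true false) (find_alloc B KK t d)
    (fun _ m' => [/\ heap m', exta m m' & pt m' (regs m' d) y]) D m.
Proof.
move=> ht hd td [hm he [n1 n2] nk hS] tn sk hy.
apply: (wp_weak (@wp_find_alloc _ _ _ _ _ hKK t d D m ht hd td hm _ _)) => //.
- by rewrite tn.
- by move=> c; rewrite tn hS; apply: sk.
move=> _ m' _ [h1 h2 h3 h4]; split=> //; split=> //; apply: extensionality => z.
by rewrite h4 hy tn; split=> -[c [hc ->]]; exists c; split=> //; apply/hS.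
Qed.

Lemma wp_mk (t d : nat) m0 m n S y D : 6 < t < KK -> 6 < d < KK -> t <> d -> pend m0 m n S -> regs m t = n ->
  (forall c, S c -> Kn m c) -> (forall z, z ∈ y <-> exists c, S c /\ z = hv m c) ->
  wp (effl 7 [:: d] true false) (find_alloc B KK t d)
    (fun _ m' => [/\ heap m', ext m m' & pt m' (regs m' d) y]) D m.
Proof.
move=> ht hd td hp tn sk hy; apply: (wp_weak (wp_mkt D ht hd td hp tn sk hy)) => //.
by move=> _ m' _ [h1 [h2 _] h3].
Qed.

Lemma wp_newp (t : nat) e D m : 6 < t < KK -> 1 < acc e t -> 0 < acc e 0 -> heap m ->
  wp e (new_row B KK t) (fun _ m' => [/\ pend m m' (cnt m) (fun _ => False), regs m' t = cnt m, tabs m' = tabs m &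
     forall r, r <> 0 -> r <> t -> regs m' r = regs m r]) D m.
Proof.
move=> /andP[t6 tK] et e0 hm; apply: wp_new_row => //; first by lia.
split=> //=.
- by apply: pend_new.
- by rewrite eqxx; case: eqP => // e1; move: t6; rewrite e1.
- by move=> r /eqP/negbTE -> /eqP/negbTE ->.
Qed.

End Macros.

Lemma cat_tupleE (T : Type) m n (x : (m + n).-tuple T) : exists (y : m.-tuple T) (z : n.-tuple T), x = [tuple of y ++ z].
Proof.
have h1 : size (take m x) == m by rewrite size_takel // size_tuple leq_addr.
have h2 : size (drop m x) == n by rewrite size_drop size_tuple addKn.
by exists (Tuple h1), (Tuple h2); apply: val_inj; rewrite /= cat_take_drop.
Qed.

Lemma rcons_tupleE (T : Type) n (x : n.+1.-tuple T) : exists (y : n.-tuple T) (z : T), x = [tuple of rcons y z].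
Proof.
case: x => s; case/lastP: s => [//|s z] hs; have h : size s == n by move: hs; rewrite size_rcons.
by exists (Tuple h), z; apply: val_inj.
Qed.

(** * Programs for the initial functions and for composition *)

Section Programs.
Variable U : zfc_universe.
Local Notation ON := (ON U).
Local Notation mem := (mem U).
Local Notation classfun := (classfun U).
Implicit Types (m : mem).

Definition argsok (a : seq nat) d base := [/\ all (fun r => 6 < r < base) a, d \notin a & 6 < d < base].

(** Definedness of [F x] is part of the postcondition. Together with the condition [F x = None]
    attached to divergence in [computes], it makes termination equivalent to definedness. *)
Definition value n (F : classfun n) x m d := fun (_ : nat) m' => [/\ heap m', ext m m' & exists2 y, F x = Some y & pt m' (regs m' d) y].

(* [prog] stores [F x] in register [d] when the registers [a] hold [x], with the
   registers from [base] to [base + sz] as scratch space. *)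
Definition computes n (F : classfun n) sz (prog : nat -> nat -> seq nat -> nat -> nat -> cmd) :=
  forall M X0 B KK a d base m (x : n.-tuple U), 32 < KK -> base + sz <= KK -> argsok a d base -> heap m -> vals m a x ->
  @wp U M X0 B KK (effp d base) (prog B KK a d base) (value F x m d) (F x = None) m.

Lemma wp_sub M X0 B KK e e' (c : cmd) Q D (D' : Prop) m : @wp U M X0 B KK e c Q D m -> sub_eff e e' -> (D -> D') -> @wp U M X0 B KK e' c Q D' m.
Proof. by move=> h s hD; apply: (wp_weak h). Qed.

Lemma heap_setr m r x : heap m -> r <> 0 -> heap (setr m r x).
Proof. by move=> hm r0; apply: (heap_eqtt hm) => //; rewrite /cnt /=; case: eqP => [e|_]; [case: r0|]. Qed.

Lemma ext_setr m m' r x : ext m m' -> r <> 0 -> ext m (setr m' r x).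
Proof.
move=> hx r0; apply: ext_trans hx _; apply: ext_eqtt => //; rewrite /cnt /=; case: eqP => [e|_] //; by case: r0.
Qed.

Lemma pend_setr m0 m n S r x : pend m0 m n S -> r <> 0 -> pend m0 (setr m r x) n S.
Proof.
move=> hp r0; apply: (pend_ext hp); first by apply: heap_setr => //; case: hp.
exact: ext_setr.
Qed.

Lemma pt_setr m r (x : ON) a y : pt (setr m r x) a y <-> pt m a y.
Proof. by rewrite /pt (@hv_tabs _ (setr m r x) m). Qed.

Lemma pt_lt m a y : heap m -> pt m a y -> olt a (cnt m).
Proof. by move=> hm [ka _]; apply: (h_own hm (ownK a)). Qed.

Lemma C_ext m m' a b : ext m m' -> olt a (cnt m) -> C m' a b <-> C m a b.
Proof. by move=> [_ h] la; apply: (h a 0 _ (ownC a b)). Qed.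

Lemma D_ext m m' a b : ext m m' -> olt a (cnt m) -> Dn m' a b <-> Dn m a b.
Proof. by move=> [_ h] la; apply: (h a 2 _ (ownD a b)). Qed.

Lemma vals_ext m m' a xs : heap m -> ext m m' -> (forall r, r \in a -> regs m' r = regs m r) -> vals m a xs -> vals m' a xs.
Proof.
move=> hm he hr [sz h]; split=> // i ia; rewrite hr ?mem_nth //; exact: pt_ext (h i ia).
Qed.

Lemma vals_tnth m (a : seq nat) n (x : n.-tuple U) (i : 'I_n) : vals m a x -> pt m (regs m (nth 0 a i)) (tnth x i).
Proof. by move=> [sz h]; rewrite (tnth_nth empty); apply: h; rewrite sz size_tuple. Qed.

Lemma arg_bound (a : seq nat) d base r : argsok a d base -> r \in a -> 6 < r < base /\ r <> d.
Proof. by move=> [/allP h1 h2 _] ra; split; [apply: h1|move=> e; rewrite -e ra in h2]. Qed.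

Lemma arg_nth (a : seq nat) d base i : argsok a d base -> i < size a -> 6 < nth 0 a i < base /\ nth 0 a i <> d.
Proof. by move=> h ia; apply: (arg_bound h); rewrite mem_nth. Qed.

Lemma effp_arg (a : seq nat) d base d' b' r : argsok a d base -> base <= d' -> d' < b' -> r \in a -> acc (effp d' b') r = 0.
Proof. by move=> h h1 h2 /(arg_bound h)[h3 h4]; apply: effpC; lia. Qed.

Lemma computes_zero (F : classfun 1) : (forall x, F x = Some empty) ->
  computes F 1 (fun B KK a d base => seqc (new_row B KK base) (find_alloc B KK base d)).
Proof.
move=> hF M X0 B KK a d base m x hK hb [_ _ hd] hm hv.
have hbK : 6 < base < KK by lia.
apply: wp_seq.
  apply: (wp_newp hK (t := base)) => //.
move=> _ m1 _ [hp tn _ _].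
apply: (wp_weak (wp_mk hK (t := base) (d := d) (y := empty) (F x = None) hbK _ _ hp tn _ _)) => //; try lia.
- by move=> z; split=> [/emptyP|[c []]].
move=> v m2 _ [h1 h2 h3]; split=> //; last by exists empty.
by apply: ext_trans h2; case: hp.
Qed.

Lemma computes_proj n (i : 'I_n) (F : classfun n) : (forall x, F x = Some (tnth x i)) ->
  computes F 0 (fun B KK a d base => copy B KK d (nth 0 a i)).
Proof.
move=> hF M X0 B KK a d base m x hK hb ha hm hv.
have hh := arg_nth (i := i) ha; have [h1 h2] : 6 < nth 0 a i < base /\ nth 0 a i <> d by apply: hh; case: hv => ->; rewrite size_tuple.
case: (ha) => _ _ hd.
apply: wp_copy; rewrite ?effp_dst //; try lia.
have d0 : d <> 0 by lia.
split; [exact: heap_setr|exact: ext_setr|exists (tnth x i) => //].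
by apply/pt_setr; rewrite /= eqxx; apply: vals_tnth.
Qed.

Lemma computes_adjoin (F : classfun 2) : (forall x y, F [tuple x; y] = Some (adjoin x y)) ->
  computes F 2 (fun B KK a d base => seqc (new_row B KK base) (seqc (copyrow B KK base (nth 0 a 0) base.+1)
     (seqc (set2 B KK 0 base (nth 0 a 1)) (find_alloc B KK base d)))).
Proof.
move=> hF M X0 B KK a d base m x hK hb ha hm hv.
have sa : size a = 2 by case: hv => ->; rewrite size_tuple.
have [b1 n1] := arg_nth (i := 0) ha ltac:(by rewrite sa); have [b2 n2] := arg_nth (i := 1) ha ltac:(by rewrite sa).
case: (ha) => _ _ hd; have hbK : 6 < base < KK by lia.
set r1 := nth 0 a 0 in b1 n1 *; set r2 := nth 0 a 1 in b2 n2 *.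
have {}hF : F x = Some (adjoin (nth empty x 0) (nth empty x 1)).
  by case: x hv => -[|x [|y [|]]] //= hx hv; rewrite -(hF x y); congr F; apply: val_inj.
have p1 : pt m (regs m r1) (nth empty x 0) by apply: (proj2 hv); rewrite sa.
have p2 : pt m (regs m r2) (nth empty x 1) by apply: (proj2 hv); rewrite sa.
apply: wp_seq.
  apply: (wp_newp hK (t := base)) => //.
move=> _ m1 _ [hp tn _ er]; have r11 : regs m1 r1 = regs m r1 by apply: er; lia.
have r12 : regs m1 r2 = regs m r2 by apply: er; lia.
have l1 := pt_lt hm p1; have l2 := pt_lt hm p2.
apply: (wp_seq (Q1 := fun _ m2 => [/\ pend m m2 (cnt m) (fun c => C m (regs m r1) c), regs m2 base = cnt m, regs m2 r2 = regs m r2 & True])).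
  apply: (wp_weak (wp_copyrow hK (t := base) (r := r1) (j := base.+1) (F x = None) _ _ _ _ _ hp tn _)) => //; try lia.
  - by rewrite r11; apply: olt_neq.
  move=> _ m2 s2 hp2; split=> //.
  - apply: (pend_eqv hp2) => c; rewrite r11 (C_ext c _ l1); last by case: hp.
    by split=> [[]|]; [| |right].
  - by rewrite (mstepC s2) //= inE; do 2 (case: eqP; first by lia); case: ifP => //; lia.
  - by rewrite (mstepC s2) // /= inE; do 1 (case: eqP; first by lia); case: ifP => //; lia.
move=> _ m2 _ [hp2 tn2 r22 _].
apply: (wp_seq (Q1 := fun _ m3 => pend m m3 (cnt m) (fun c => C m (regs m r1) c \/ c = regs m r2) /\ regs m3 base = cnt m)).
  apply: (wp_weak (wp_setC hK (t := base) (r := r2) (F x = None) _ _ _ hp2 tn2 _)) => //; try lia.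
  - by rewrite r22; apply: olt_le_trans l2 _; case: hp2 => _ [].
  move=> _ m3 s3 [hp3 _]; rewrite r22 in hp3; split=> //.
  by rewrite (mstepC s3) //; lia.
move=> _ m3 _ [hp3 tn3]; have [hm3 he3 _ _ _] := hp3.
have k1 : Kn m3 (regs m r1) by case: (pt_ext hm he3 p1).
have [k2 v2] := pt_ext hm he3 p2.
apply: (wp_weak (wp_mk hK (t := base) (d := d) (y := adjoin (nth empty x 0) (nth empty x 1)) (F x = None) hbK _ _ hp3 tn3 _ _)) => //; try lia.
- move=> c [h|-> //]; rewrite -(C_ext c he3 l1) in h; by case: (h_can hm3 k1 h).
- move=> z; have [_ v1] := pt_ext hm he3 p1; rewrite adjoinP -v1 in_hv // -v2.
  split=> [[[c [h ->]]|->]|[c [[h|->] ->]]]; [exists c|exists (regs m r2)|left; exists c|right] => //.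
  + by split=> //; left; rewrite -(C_ext c he3 l1).
  + by split=> //; right.
  + by rewrite (C_ext c he3 l1).
move=> v m4 _ [h1 h2 h3]; split=> //; first exact: ext_trans he3 h2.
by exists (adjoin (nth empty x 0) (nth empty x 1)).
Qed.

(** Arguments are canonical rows, so membership is a single lookup in table 0, by [pt_in]. *)
Lemma computes_cond (F : classfun 4) : (forall x y u v, x ∈ y -> F [tuple x; y; u; v] = Some u) ->
  (forall x y u v, ~ x ∈ y -> F [tuple x; y; u; v] = Some v) ->
  computes F 0 (fun B KK a d base => Bind (get2 B KK 0 (nth 0 a 1) (nth 0 a 0)) (copy B KK d (nth 0 a 3)) (copy B KK d (nth 0 a 2)) (Ret 0)).
Proof.
move=> hF1 hF2 M X0 B KK a d base m x hK hb ha hm hv; have K3 : 3 < KK by lia.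
have sa : size a = 4 by case: hv => ->; rewrite size_tuple.
have hr i : i < 4 -> [/\ 6 < nth 0 a i < base, nth 0 a i <> d & pt m (regs m (nth 0 a i)) (nth empty x i)].
  by move=> i4; rewrite -sa in i4; have [h1 h2] := arg_nth ha i4; split=> //; apply: (proj2 hv).
case: (ha) => _ _ hd; have d0 : d <> 0 by lia.
have [b0 n0 p0] := hr 0 isT; have [b1 n1 p1] := hr 1 isT; have [b2' n2 p2] := hr 2 isT; have [b3 n3 p3] := hr 3 isT.
apply: (wp_bind (Q1 := fun v m' => [/\ v = b2 (nth empty x 0 ∈ nth empty x 1), eqtt m m', cnt m' = cnt m & forall r, 6 < r -> regs m' r = regs m r])).
  apply: (wp_weak (wp_get2 (D := F x = None) K3 _ _ _ _ _)); try lia.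
  - by apply: sub_effp_l => //; lia.
  - by [].
  move=> v m1 s1 [-> e1]; split=> //.
  + apply: b2_iff; symmetry; exact: (pt_in hm p1 p0).
  + by apply: (mstepC s1).
  + by move=> r r6; rewrite (mstepC s1) //; lia.
have he m1 : eqtt m m1 -> cnt m1 = cnt m -> heap m1 /\ ext m m1.
  by move=> e1 c1; split; [apply: heap_eqtt hm e1 _; rewrite c1|apply: ext_eqtt e1 _; rewrite c1].
have main i m1 y : 1 < i < 4 -> eqtt m m1 -> cnt m1 = cnt m -> (forall r, 6 < r -> regs m1 r = regs m r) -> F x = Some (nth empty x i) -> y = F x ->
   @wp U M X0 B KK (effp d base) (copy B KK d (nth 0 a i)) (value F x m d) (F x = None) m1.
  move=> i4 e1 c1 rr hF _; have [|bi ni pi] := hr i; first by lia.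
  have [h1 h2] := he m1 e1 c1; apply: wp_copy; rewrite ?effp_dst //; try lia.
  - split; [exact: heap_setr|exact: ext_setr|exists (nth empty x i) => //].
    by apply/pt_setr; rewrite /= eqxx rr; [apply: pt_ext pi|lia].
move=> v m1 _ [-> e1 c1 rr]; case: (classic (nth empty x 0 ∈ nth empty x 1)) => hin.
  rewrite b2T //=; apply: (main 2 _ (F x)) => //.
  case: x hin {hv hr p0 p1 p2 p3 main} => -[|x [|y [|u [|w [|]]]]] //= hx hin.
  by rewrite -(hF1 x y u w) //; congr F; apply: val_inj.
rewrite b2F //=; apply: (main 3 _ (F x)) => //.
case: x hin {hv hr p0 p1 p2 p3 main} => -[|x [|y [|u [|w [|]]]]] //= hx hin.
by rewrite -(hF2 x y u w) //; congr F; apply: val_inj.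
Qed.

Lemma argsok_take (a : seq nat) d base k : argsok a d base -> argsok (take k a) base base.+1.
Proof.
move=> [/allP h1 h2 h3]; split; [|apply/negP => /mem_take/h1; lia|lia].
by apply/allP => r /mem_take/h1; lia.
Qed.

Lemma argsok_sub (a a' : seq nat) d base b' : argsok a d base -> base <= b' -> (forall r, r \in a' -> r \in a \/ base <= r < b') -> argsok a' d b'.
Proof.
move=> [/allP h1 h2 h3] hb h; split; [|apply/negP => /h[|]; [exact/negP|lia]|lia].
by apply/allP => r /h[/h1|]; lia.
Qed.

(** Both composition rules at once: [keep] tells whether the arguments of [H] are passed on to [G].
    The intermediate value is held in register [base], above which both programs have their scratch
    space. *)
Lemma computes_comp (m n k : nat) (G : classfun k) (H : classfun m) (F : classfun (m + n)) sg g sh h (keep : bool) :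
  computes G sg g -> computes H sh h ->
  (forall (x : m.-tuple U) (y : n.-tuple U) w, exists2 t : k.-tuple U, tval t = (if keep then tval x else [::]) ++ w :: y &
     (H x = Some w -> F [tuple of x ++ y] = G t)) ->
  (forall (x : m.-tuple U) (y : n.-tuple U), H x = None -> F [tuple of x ++ y] = None) ->
  computes F (maxn sh sg).+1 (fun B KK a d base => seqc (h B KK (take m a) base base.+1)
     (g B KK ((if keep then take m a else [::]) ++ base :: drop m a) d base.+1)).
Proof.
move=> hG hH hF hF0 M X0 B KK a d base mm xy hK hb ha hm hv.
have [x [y exy]] := cat_tupleE xy; subst xy.
have [v1 v2] := vals_split hv; rewrite size_tuple in v1 v2.
apply: (wp_seq (Q1 := fun _ m' => [/\ heap m', ext mm m', forall r, r \in a -> regs m' r = regs mm r & exists2 w, H x = Some w & pt m' (regs m' base) w])).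
  apply: (wp_weak (hH M X0 B KK (take m a) base base.+1 mm x hK _ _ hm v1)).
  - by lia.
  - exact: argsok_take ha.
  - by apply: sub_effp; lia.
  - by move/hF0; apply.
  move=> _ m' s1 [h1 h2 h3]; split=> // r ra; apply: (mstepC s1).
  by apply: (effp_arg ha).
move=> _ m1 _ [h1 h2 hr [w hw pw]]; have [t et hFt] := hF x y w.
apply: (wp_weak (hG M X0 B KK ((if keep then take m a else [::]) ++ base :: drop m a) d base.+1 m1 t hK _ _ h1 _)).
- by lia.
- apply: (argsok_sub ha) => // r; rewrite mem_cat inE => /or3P[|/eqP ->|/mem_drop ra]; [|right; lia|by left].
  by case: (keep) => // /mem_take ra; left.
- rewrite et; apply: vals_cat; first case: (keep); [|exact: vals_nil|].
    by apply: (vals_ext hm h2 _ v1) => r /mem_take; apply: hr.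
  apply: vals_cons => //; by apply: (vals_ext hm h2 _ v2) => r /mem_drop; apply: hr.
- by apply: sub_effp; rewrite ?eqxx.
- by rewrite hFt.
move=> v m2 _ [k1 k2 [z hz pz]]; split=> //; first exact: ext_trans h2 k2.
by exists z => //; rewrite hFt.
Qed.

End Programs.

(** * Recursion on membership *)

(** The inner pair is computed in register 1, which the next pairing overwrites; hence the copy in
    [s]. *)
Definition find_val B KK i j s k := seqc (pairp B KK i j) (seqc (copy B KK s 1) (find_ B KK k 0 (get2 B KK 3 s k))).
Definition set_val B KK i j s v := seqc (pairp B KK i j) (seqc (copy B KK s 1) (set2 B KK 3 s v)).

(** Registers: [b] the tag of the call, [b + 1] the row at which the function is evaluated, [b + 2]
    the row collecting the union, [b + 3] its loop index, [b + 4] the value at a member, [b + 5] and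
    [b + 6] scratch, [b + 7] the canonical union, [b + 8] the new value. The program [g] works from
    [b + 9] on. *)
Definition rec_step B KK a b (g : nat -> nat -> seq nat -> nat -> nat -> cmd) :=
  seqc (new_row B KK (b + 2)) (seqc
   (for_ B KK (b + 3) (b + 1) (Bind (get2 B KK 0 (b + 1) (b + 3)) (Ret 0)
      (seqc (find_val B KK b (b + 3) (b + 5) (b + 4)) (copyrow B KK (b + 2) (b + 4) (b + 6))) (Ret 0))) (seqc
   (find_alloc B KK (b + 2) (b + 7)) (seqc
   (g B KK (b + 7 :: rcons a (b + 1)) (b + 8) (b + 9))
   (set_val B KK b (b + 1) (b + 5) (b + 8))))).

(** Members have smaller row numbers, so an increasing loop over row numbers evaluates members
    before sets. Only rows in the closure of [z] are evaluated, because the function may be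
    undefined elsewhere and its evaluation would not return. Table bits are never cleared, so the
    values of a call are tagged by the number of a fresh row. The loop stops short of [z], leaving
    its counter at [z] for the last [rec_step]. *)
Definition rec_prog g B KK aa (d b : nat) :=
  let a := take (size aa).-1 aa in let z := last 0 aa in
  seqc (new_row B KK b) (seqc
   (for_ B KK (b + 1) z (Bind (get2 B KK 2 z (b + 1)) (Ret 0) (rec_step B KK a b g) (Ret 0))) (seqc
   (rec_step B KK a b g) (copy B KK d (b + 8)))).

Section Rec.
Variables (U : zfc_universe) (M : machine) (X0 : tape U) (B KK : nat).
Local Notation ON := (ON U).
Local Notation mem := (mem U).
Local Notation wp := (@wp U M X0 B KK).
Hypothesis hKK : 32 < KK.
Implicit Types (m : mem).

Definition Rv m i j c := tabs m 3 (pr (pr i j) c).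

Lemma ownR i j c : @own U i 3 (pr (pr i j) c). Proof. by constructor 3; split=> //; exists j, c. Qed.

Lemma R_ext m m' (i j c : ON) : ext m m' -> olt i (cnt m) -> Rv m' i j c <-> Rv m i j c.
Proof. by move=> [_ h] la; apply: (h i 3 _ (ownR i j c)). Qed.

Lemma wp_find_val (i j s k : nat) m D : 6 < i < KK -> 6 < j < KK -> 6 < s < KK -> 6 < k < KK -> k <> s ->
  (exists c, olt c (cnt m) /\ Rv m (regs m i) (regs m j) c) ->
  wp (effl 4 [:: s; k] false false) (find_val B KK i j s k)
    (fun _ m' => Rv m (regs m i) (regs m j) (regs m' k) /\ eqtt m m') D m.
Proof.
move=> hi hj hs hk ks [c [lc hc]]; have K3 : 3 < KK by lia.
apply: (wp_seq (Q1 := fun _ m' => regs m' 1 = pr (regs m i) (regs m j) /\ eqtt m m')).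
  by apply: (wp_sub (@wp_pairp U M X0 B KK i j D m K3 _ _ _ _)) => //; try lia; apply: sub_effl.
move=> _ m1 s1 [e1 et]; apply: (wp_seq (Q1 := fun _ m' => [/\ regs m' s = pr (regs m i) (regs m j), cnt m' = cnt m & eqtt m m'])).
  apply: wp_copy; try lia.
    by rewrite /= inE eqxx orbT; case: eqP => //; lia.
  split; rewrite ?/cnt /= ?eqxx //; case: eqP => [e|_]; [by lia|exact: (mstepC s1)].
move=> _ m2 _ [es ec et2].
apply: (wp_find (lv 4) (fun x => Rv m (regs m i) (regs m j) x)) => //; try lia.
- by rewrite /= !inE eqxx !orbT; case: eqP => //; lia.
- move=> x m3 lx ex s3 et3; wp_get D K3.
  move=> v m4 _ [-> et4]; split; last exact: eqtt_trans et3 et4.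
  have -> : tabs m3 = tabs m by case: et3 => -> _; case: et2.
  congr b2; rewrite ex; congr (tabs m 3 (pr _ _)).
  by rewrite (bumpC s3) // ?es //; lia.
- by move=> m3 x _ et3 ex _ hx _; split; [rewrite ex|apply: eqtt_trans et2 et3].
- by move=> m3 _ _ _ /(_ c); rewrite -/(cnt m2) ec => /(_ lc); case.
Qed.

Lemma wp_set_val (i j s v : nat) m0 m D : 6 < i < KK -> 6 < j < KK -> 6 < s < KK -> 6 < v < KK -> v <> s ->
  heap m -> ext m0 m -> ole (cnt m0) (regs m i) -> olt (regs m i) (cnt m) -> ~ Kn m (regs m i) ->
  wp (effl 4 [:: s] false false) (set_val B KK i j s v)
    (fun _ m' => [/\ heap m', ext m0 m' & tabs m' = tabs (settb m 3 (pr (pr (regs m i) (regs m j)) (regs m v)))]) D m.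
Proof.
move=> hi hj hs hv vs hm he i1 i2 nk; have K3 : 3 < KK by lia.
apply: (wp_seq (Q1 := fun _ m' => regs m' 1 = pr (regs m i) (regs m j) /\ eqtt m m')).
  by apply: (wp_sub (@wp_pairp U M X0 B KK i j D m K3 _ _ _ _)) => //; try lia; apply: sub_effl.
move=> _ m1 s1 [e1 et]; apply: (wp_seq (Q1 := fun _ m' => [/\ regs m' s = pr (regs m i) (regs m j), cnt m' = cnt m, regs m' v = regs m v & eqtt m m'])).
  apply: wp_copy; try lia.
    by rewrite /= inE eqxx orbT; case: eqP => //; lia.
  split; rewrite ?/cnt /= ?eqxx //; first by case: eqP => [e|_]; [by lia|exact: (mstepC s1)].
  case: eqP => [e|_]; [by lia|]; apply: (mstepC s1) => /=.
  by case: eqP => [|_]; [lia|]; rewrite inE; case: eqP => //; case: ifP => //; lia.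
move=> _ m2 _ [es ec ev et2].
have o := ownR (regs m i) (regs m j) (regs m v).
wp_put D K3.
- by rewrite es ev; apply: (kext_set o); rewrite /Kn; case: et2 => ->.
move=> _ m3 s3 [e3 _]; rewrite es ev in e3; case: et2 => e2 _.
have {}e3 : tabs m3 = tabs (settb m 3 (pr (pr (regs m i) (regs m j)) (regs m v))) by rewrite e3 /= e2.
have c3 : cnt m3 = cnt m by rewrite -ec; apply: (mstepC s3).
have h3 : heap (settb m 3 (pr (pr (regs m i) (regs m j)) (regs m v))) by apply: (heap_aux hm _ o).
have x3 := ext_aux he o i1.
split=> //.
- case: h3; rewrite /C /Kn /Dn /cnt -e3 /= -!/(cnt _) -c3; by split.
- by case: x3; rewrite /cnt -e3 /= -!/(cnt _) -c3.
Qed.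

Variables (n : nat) (G : classfun U n.+2) (F : classfun U n.+1) (sg : nat) (g : nat -> nat -> seq nat -> nat -> nat -> cmd).
Hypothesis hG : computes G sg g.
Hypothesis hF : forall (x : n.-tuple U) z y,
         F [tuple of rcons x z] = Some y <->
         exists w,
           [/\ forall u, u ∈ z -> exists v, F [tuple of rcons x u] = Some v,
               forall p, p ∈ w <-> exists u v,
                 [/\ u ∈ z, F [tuple of rcons x u] = Some v & p ∈ v] &
               G [tuple of w :: rcons x z] = Some y].
Variables (x : n.-tuple U) (a : seq nat) (b : nat).
Hypothesis hb : b + 9 + sg <= KK.
Hypothesis b6 : 6 < b.
Hypothesis sa : size a = n.
Hypothesis ha : forall r, r \in a -> 6 < r < b.

(** A defined value forces values on the whole transitive closure. Read backwards: divergence at any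
    row of the closure implies that the function is undefined at the argument. *)
Lemma rec_down m (i j : ON) y : heap m -> Kn m i -> F [tuple of rcons x (hv m i)] = Some y -> Dn m i j ->
  exists y', F [tuple of rcons x (hv m j)] = Some y'.
Proof.
move=> hm; elim/olt_ind: i y => i ih y ki fy /(h_trc hm j ki)[->|[c [cc dc]]]; first by exists y.
have [kc lc] := h_can hm ki cc; have [w [h _ _]] := proj1 (hF x (hv m i) y) fy.
have [|y' fy'] := h (hv m c); first by apply/in_hv => //; exists c.
exact: ih lc y' kc fy' dc.
Qed.

(* At row [i], with the values at its elements recorded in table 3 under [id]. *)
Lemma wp_rec_step m0 m (i : ON) D : heap m -> ext m0 m -> heap m0 -> vals m0 a x -> (forall r, r \in a -> regs m r = regs m0 r) ->
  ole (cnt m0) (regs m b) -> olt (regs m b) (cnt m) -> ~ Kn m (regs m b) ->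
  regs m (b + 1) = i -> Kn m0 i ->
  (forall j, C m0 i j -> exists c, Rv m (regs m b) j c) ->
  (forall j c, C m0 i j -> Rv m (regs m b) j c -> exists y, F [tuple of rcons x (hv m0 j)] = Some y /\ pt m c y) ->
  (F [tuple of rcons x (hv m0 i)] = None -> D) ->
  wp (effp (b + 2) (b + 2)) (rec_step B KK a b g) (fun _ m' => [/\ heap m', ext m0 m',
     exists y, F [tuple of rcons x (hv m0 i)] = Some y /\ pt m' (regs m' (b + 8)) y, ~ Kn m' (regs m b) &
     forall j c, Rv m' (regs m b) j c <-> Rv m (regs m b) j c \/ (j = i /\ c = regs m' (b + 8))]) D m.
Proof.
move=> hm he hm0 hv0 hr id1 id2 nk al ki hR1 hR2 hD; set id := regs m b; have K3 : 3 < KK by lia.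
have li : olt i (cnt m) by apply: olt_le_trans (proj1 he); apply: (h_own hm0 (ownK i)).
apply: (wp_seq (Q1 := fun _ m1 => [/\ pend m m1 (cnt m) (fun _ => False), regs m1 (b + 2) = cnt m & forall r, r <> 0 -> r <> b + 2 -> regs m1 r = regs m r])).
  apply: (wp_weak (wp_newp hKK (t := b + 2) (e := effp (b + 2) (b + 2)) D _ _ _ hm)) => //; try lia.
  by move=> v m1 _ [].
move=> _ m1 _ [hp1 tn1 r1].
(* The rows contained in the values at the members of [i] below [k]; at the end they make up the
   union in the recursion. *)
pose S k c := exists j e, [/\ olt j k, C m0 i j, Rv m id j e & C m e c].
pose e0 := effl 4 [:: b + 4; b + 5; b + 6] false false.
have e0hi r : 6 < r -> r <> b + 4 -> r <> b + 5 -> r <> b + 6 -> acc e0 r = 0.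
  by move=> h h1 h2 h3; rewrite /= !inE; case: eqP => //; case: ifP => //; lia.
have eb r k m' : mstep (bump e0 (b + 3)) (setr m1 (b + 3) k) m' -> 6 < r -> r <> b + 3 -> r <> b + 4 -> r <> b + 5 -> r <> b + 6 -> r <> b + 2 -> regs m' r = regs m r.
  by move=> s h h1 h2 h3 h4 h5; rewrite (bumpC s) ?r1 ?e0hi //; lia.
apply: (wp_seq (Q1 := fun _ m2 => [/\ pend m m2 (cnt m) (S i), regs m2 (b + 2) = cnt m & forall r, r \in a \/ r = b \/ r = b + 1 -> regs m2 r = regs m r])).
  apply: (wp_for e0 (fun k m' => pend m m' (cnt m) (S k))) => //; try lia.
  - by apply: e0hi; lia.
  - by apply: e0hi; lia.
  - apply: pend_setr; last by lia.
    by apply: (pend_eqv hp1) => c; split=> // -[j [e [/olt0]]].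
  - move=> k m2 lk ek _ s2 hp2; have [hm2 he2 [n1 n2] nk2 hS2] := hp2.
    have rid : regs m2 b = id by rewrite (eb _ _ _ s2) //; lia.
    have ral : regs m2 (b + 1) = i by rewrite (eb _ _ _ s2) //; lia.
    have rt : regs m2 (b + 2) = cnt m by rewrite (bumpC s2) ?tn1 ?e0hi //; lia.
    have CE j : C m2 i j <-> C m0 i j.
      rewrite (C_ext j he2 li) (C_ext j he) //; exact: (h_own hm0 (ownK i)).
    apply: (wp_bind (Q1 := fun v m3 => [/\ v = b2 (C m0 i k), eqtt m2 m3, cnt m3 = cnt m2 & forall r, 6 < r -> regs m3 r = regs m2 r])).
      wp_get D K3.
      move=> v m3 s3 [-> et3]; split=> //.
      + by apply: b2_iff; rewrite ral ek; apply: CE.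
      + by apply: (mstepC s3).
      + by move=> r r6; rewrite (mstepC s3) //; lia.
    move=> v m3 _ [-> et3 c3 r3]; have c3' : ole (cnt m2) (cnt m3) by rewrite c3.
    have hp3 : pend m m3 (cnt m) (S k) by apply: (pend_ext hp2); [apply: heap_eqtt et3 c3'|apply: ext_eqtt].
    case: (classic (C m0 i k)) => hc; last first.
      rewrite b2F //=; apply: wp_ret; apply: pend_setr; last by lia.
      apply: (pend_eqv hp3) => c; split=> -[j [e [h1 h2 h3 h4]]]; exists j, e; split=> //; first by apply/oltS; left.
      by case/oltS: h1 => // e1; subst j.
    rewrite b2T //=; have [q hq] := hR1 k hc; have [y [fy py]] := hR2 k q hc hq.
    have [hm3 he3 [_ n3] _ _] := hp3.
    have rkk : regs m3 (b + 3) = k by rewrite r3 //; lia.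
    have rid3 : regs m3 b = id by rewrite r3.
    apply: (wp_seq (Q1 := fun _ m4 => [/\ Rv m id k (regs m4 (b + 4)), pend m m4 (cnt m) (S k) & regs m4 (b + 2) = cnt m])).
      apply: (wp_weak (@wp_find_val b (b + 3) (b + 5) (b + 4) m3 D _ _ _ _ _ _)) => //; try lia.
      + exists q; rewrite rid3 rkk; split; last by apply/(R_ext k q he3 id2).
        by apply: pt_lt hm3 (pt_ext hm he3 py).
      + apply: sub_effl => //=; rewrite !inE !eqxx !orbT; lia.
      move=> _ m4 s4 [h4 et4]; rewrite rid3 rkk in h4.
      have c4 : ole (cnt m3) (cnt m4) by right; symmetry; apply: (mstepC s4).
      split.
      + by apply/(R_ext k _ he3 id2).
      + by apply: (pend_ext hp3); [apply: heap_eqtt et4 c4|apply: ext_eqtt].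
      + rewrite (mstepC s4) ?r3 ?rt //; first by lia.
        by rewrite /= !inE; case: eqP => //; case: ifP => //; lia.
    move=> _ m4 _ [h4 hp4 rt4]; set w := regs m4 (b + 4) in h4.
    have [y' [fy' [kw _]]] := hR2 k w hc h4.
    have lw : olt w (cnt m) by apply: (h_own hm (ownK w)).
    apply: (wp_weak (wp_copyrow hKK (t := b + 2) (r := b + 4) (j := b + 6) D _ _ _ _ _ hp4 rt4 _)) => //; try lia.
    + by apply: olt_neq.
    + by apply: sub_effl => //=; rewrite !inE !eqxx !orbT; lia.
    move=> _ m5 _ hp5; apply: pend_setr; last by lia.
    apply: (pend_eqv hp5) => c; rewrite -/w (C_ext c _ lw); last by case: hp4.
    split=> [[[j [e [h1 h2 h3 h5]]]|hcw]|[j [e [/oltS h1 h2 h3 h5]]]].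
    + by exists j, e; split=> //; apply/oltS; left.
    + by exists k, w; split=> //; apply/oltS; right.
    + case: h1 => [h1|e1]; first by left; exists j, e.
      subst j; right; have [y1 [fy1 py1]] := hR2 k e hc h3; rewrite fy' in fy1; case: fy1 => e1; subst y1.
      have [y2 [fy2 py2]] := hR2 k w hc h4; rewrite fy' in fy2; case: fy2 => e2; subst y2.
      by rewrite (pt_inj hm py2 py1).
  - move=> l ms ml lde ll hI hp h0 lm _.
    have e0' : acc (bump e0 (b + 3)) 0 < 2 by rewrite /=; case: ifP.
    apply: (pend_eqv (pend_lim (S := S) e0' ll lm hp _)) => [k|c]; first by move=> /hI[].
    split=> [[k [kl [j [e [h1 h2 h3 h4]]]]]|[j [e [h1 h2 h3 h4]]]].
      by exists j, e; split=> //; apply: olt_trans h1 kl.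
    exists (osucc j); split; first exact: (proj2 ll).
    by exists j, e.
  - move=> m2 s2 _; rewrite r1 ?al; [move=> hp2|lia|lia]; split=> //.
    + by rewrite (bumpC s2) ?tn1 ?e0hi //; lia.
    + move=> r hrr; have hrr' : 6 < r <= b + 1 by case: hrr => [/ha|]; lia.
      by rewrite (eb _ _ _ s2) //; lia.
move=> _ m2 _ [hp2 tn2 r2]; have [hm2 he2 [n1 n2] nk2 hS2] := hp2.
have KE e y : pt m e y -> forall c, C m2 e c <-> C m e c.
  by move=> py c; apply: (C_ext c he2); apply: pt_lt py.
have SK c : S i c -> Kn m2 c.
  move=> [j [e [_ h2 h3 h4]]]; have [y [_ py]] := hR2 j e h2 h3.
  have [ke _] := pt_ext hm he2 py.
  by apply: (proj1 (h_can hm2 ke _)); apply/(KE e y py).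
apply: (wp_seq (Q1 := fun _ m3 => [/\ heap m3, ext m2 m3, Kn m3 (regs m3 (b + 7)),
   forall z, z ∈ hv m3 (regs m3 (b + 7)) <-> exists c, S i c /\ z = hv m2 c & forall r, r \in a \/ r = b \/ r = b + 1 -> regs m3 r = regs m r])).
  apply: (wp_weak (@wp_find_alloc U M X0 B KK hKK (b + 2) (b + 7) D m2 _ _ _ hm2 _ _)) => //; try lia.
  - by rewrite tn2.
  - by move=> c; rewrite tn2 hS2; apply: SK.
  move=> v m3 s3 [h1 [h2 _] h3 h4]; split=> //.
    by move=> z; rewrite h4 tn2; split=> -[c [hc ->]]; exists c; split=> //; apply/hS2.
  move=> r hrr; have hrr' : 6 < r <= b + 1 by case: hrr => [/ha|]; lia.
  rewrite (mstepC s3) ?r2 //= inE; case: eqP; first by lia.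
  by case: ifP => //; lia.
move=> _ m3 _ [hm3 he3 k3 w3 r3]; set T := hv m3 (regs m3 (b + 7)) in w3.
have TE p : p ∈ T <-> exists u v, [/\ u ∈ hv m0 i, F [tuple of rcons x u] = Some v & p ∈ v].
  rewrite w3; split=> [[c [[j [e [ji h2 h3 h4]]] ->]]|[u [v [/(in_hv _ hm0 ki)[j [cj ->]] fu pv]]]].
    have [y [fy py]] := hR2 j e h2 h3; exists (hv m0 j), y; split=> //; first by apply/in_hv => //; exists j.
    have [ke <-] := pt_ext hm he2 py; apply/in_hv => //; exists c; split=> //; by apply/(KE e y py).
  have [e he'] := hR1 j cj; have [y [fy py]] := hR2 j e cj he'; rewrite fu in fy; case: fy => e1; subst y.
  have [ke ev] := pt_ext hm he2 py; rewrite -ev in pv; case/(in_hv _ hm2 ke): pv => c [cc ->].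
  exists c; split=> //; exists j, e; split=> //; first by case: (h_can hm0 ki cj).
  by apply/(KE e v py).
(* The set just built is the only candidate for the union [w], and the values at all members exist,
   so the recursion equation reduces to [G]. *)
have FG y : F [tuple of rcons x (hv m0 i)] = Some y <-> G [tuple of T :: rcons x (hv m0 i)] = Some y.
  rewrite hF; split=> [[w [h1 h2 h3]]|h]; first by have -> : T = w by apply: extensionality => p; rewrite TE h2.
  exists T; split=> // u /(in_hv _ hm0 ki)[j [cj ->]]; have [c hc] := hR1 j cj.
  by have [y' [fy' _]] := hR2 j c cj hc; exists y'.
have he03 : ext m0 m3 by apply: ext_trans he (ext_trans he2 he3).
have r30 : forall r, r \in a -> regs m3 r = regs m0 r by move=> r ra; rewrite r3; [apply: hr|left].
have id3 : regs m3 b = id by rewrite r3 //; right; left.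
have al3 : regs m3 (b + 1) = i by rewrite r3 //; right; right.
apply: (wp_seq (Q1 := fun _ m4 => [/\ heap m4, ext m3 m4, exists2 y, F [tuple of rcons x (hv m0 i)] = Some y & pt m4 (regs m4 (b + 8)) y, regs m4 b = id & regs m4 (b + 1) = i])).
  apply: (wp_weak (hG (a := b + 7 :: rcons a (b + 1)) (d := b + 8) (base := b + 9) (x := [tuple of T :: rcons x (hv m0 i)]) hKK _ _ hm3 _)) => //.
  - split; last by lia.
      apply/allP => r; rewrite inE mem_rcons inE => /or3P[/eqP ->|/eqP ->|/ha]; lia.
    by rewrite inE mem_rcons inE; apply/negP => /or3P[/eqP|/eqP|/ha]; lia.
  - apply: vals_cons => //; rewrite -[rcons a _]cats1 /= -[rcons x _]cats1; apply: vals_cat.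
      by apply: (vals_ext hm0 he03).
    apply: vals_cons; last exact: vals_nil.
    by rewrite al3; apply: (pt_ext hm0 he03).
  - move=> gn; apply: hD; case E : (F _) => [y|] //; by move/FG: E; rewrite gn.
  move=> v m4 s4 [h1 h2 [y gy py]]; split=> //; first by exists y => //; apply/FG.
    by rewrite (mstepC s4) ?id3 //; lia.
  by rewrite (mstepC s4) ?al3 //; lia.
move=> _ m4 _ [hm4 he4 [y fy py] id4 al4].
have hem4 : ext m m4 by apply: ext_trans he2 (ext_trans he3 he4).
have lid4 : olt id (cnt m4) by apply: olt_le_trans (proj1 hem4).
apply: (wp_weak (@wp_set_val b (b + 1) (b + 5) (b + 8) m0 m4 D _ _ _ _ _ hm4 _ _ _ _)) => //; try lia.
- exact: ext_trans he hem4.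
- by rewrite id4.
- by rewrite id4.
- by rewrite id4 /Kn (proj2 hem4 id 1 id (ownK id) id2).
move=> v m5 s5 [h1 h2 h3].
have v5 : regs m5 (b + 8) = regs m4 (b + 8).
  by rewrite (mstepC s5) //= inE; case: eqP; [lia|case: ifP => //; lia].
split=> //.
- by exists y; split=> //; rewrite v5; apply: pt_step s5 py.
- by rewrite /Kn h3 /= (proj2 hem4 id 1 id (ownK id) id2) => -[|[]].
move=> j c; rewrite /Rv h3 /= id4 al4 v5 -/(Rv m4 id j c) (R_ext j c hem4 id2).
by split=> -[h|h]; try (by left); right; [case: h => _ /pr_inj[/pr_inj[]]|case: h => -> ->].
Qed.

Lemma wp_rec_prog (z d : nat) m zs : heap m -> 6 < z < b -> d <> z -> 6 < d < b -> d \notin a -> vals m a x -> pt m (regs m z) zs ->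
  wp (effp d b) (rec_prog g B KK (rcons a z) d b) (value F [tuple of rcons x zs] m d) (F [tuple of rcons x zs] = None) m.
Proof.
move=> hm hz dz hd da hv0 pz; have K3 : 3 < KK by lia.
rewrite /rec_prog size_rcons last_rcons -cats1 take_size_cat //=.
have [kz vz] := pz; set zr := regs m z in pz kz vz.
have lz : olt zr (cnt m) := pt_lt hm pz.
apply: (wp_seq (Q1 := fun _ m1 => [/\ pend m m1 (cnt m) (fun _ => False), regs m1 b = cnt m, tabs m1 = tabs m & forall r, r <> 0 -> r <> b -> regs m1 r = regs m r])).
  by apply: (wp_newp hKK (t := b) _ _ _ _ hm) => //; lia.
move=> _ m1 _ [hp1 id1 et1 r1]; have [hm1 he1 [_ n1] nk1 _] := hp1; set id := cnt m in id1 n1 nk1.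
(* Entries of table 3 under the tag [id] are correct, concern rows below [i], and are complete for
   the rows of the closure below [i]. *)
pose I i m' := [/\ heap m', ext m m', ~ Kn m' id,
  forall j c, Rv m' id j c -> [/\ olt j i, Dn m zr j & exists y, F [tuple of rcons x (hv m j)] = Some y /\ pt m' c y] &
  forall j, olt j i -> Dn m zr j -> exists c, Rv m' id j c].
have step i m' D : I i m' -> (forall r, r \in a -> regs m' r = regs m r) -> regs m' b = id -> olt id (cnt m') -> regs m' (b + 1) = i ->
    Dn m zr i -> (F [tuple of rcons x zs] = None -> D) ->
    wp (effp (b + 2) (b + 2)) (rec_step B KK a b g) (fun _ m2 => [/\ I (osucc i) m2 & exists y, F [tuple of rcons x (hv m i)] = Some y /\ pt m2 (regs m2 (b + 8)) y]) D m'.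
  move=> [h1 h2 h3 h4 h5] hr idm lid al dz' hD; have [ki _] := trc_can hm kz dz'.
  apply: (wp_weak (@wp_rec_step m m' i D h1 h2 hm hv0 hr _ _ _ al ki _ _ _)) => //.
  - by rewrite idm; right.
  - by rewrite idm.
  - by rewrite idm.
  - move=> j cj; have [_ lj] := h_can hm ki cj; rewrite idm; apply: h5 => //; exact: trc_down cj.
  - by move=> j c _; rewrite idm => /h4[].
  - move=> fn; apply: hD; case E: (F _) => [y|] //.
    by rewrite -vz in E; have [y' fy'] := rec_down hm kz E dz'; rewrite fn in fy'.
  move=> v m2 s2 [k1 k2 k3 k4 k5]; rewrite idm in k4 k5; split=> //; split=> //.
  - move=> j c /k5[/h4[l1 l2 [y [l3 l4]]]|[-> ->]].
      split=> //; first by apply/oltS; left.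
      by exists y; split=> //; apply: pt_step s2 l4.
    by split=> //; apply: olt_succ.
  - move=> j /oltS[lj|->] dj; last by exists (regs m2 (b + 8)); apply/k5; right.
    by have [c hc] := h5 j lj dj; exists c; apply/k5; left.
have eb k r m' : mstep (bump (effp (b + 2) (b + 2)) (b + 1)) (setr m1 (b + 1) k) m' -> 6 < r <= b -> regs m' r = regs m1 r.
  by move=> s hr; rewrite (bumpC s) //; lia.
apply: (wp_seq (Q1 := fun _ m2 => [/\ I zr m2, regs m2 (b + 1) = zr, olt id (cnt m2) & forall r, 6 < r <= b -> regs m2 r = regs m1 r])).
  have rz1 : regs m1 z = zr by apply: r1; lia.
  apply: (wp_for (effp (b + 2) (b + 2)) I) => //; try lia.
  - have b0 : b + 1 <> 0 by lia.
    split; [exact: heap_setr|exact: ext_setr|by []| |by move=> j /olt0].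
    by move=> j c; rewrite /Rv /= et1 => /(h_own hm (ownR _ _ _))/olt_irr.
  - move=> i m2 li ei _ s2 hI; have [h1 h2 h3 h4 h5] := hI.
    have id2 : regs m2 b = id by rewrite (eb _ _ _ s2) //; lia.
    have lid2 : olt id (cnt m2).
      have -> : id = regs m1 b by []. 
      rewrite id1; apply: olt_le_trans n1 _; have := cnt_step _ s2; rewrite /cnt /=; case: eqP; first by lia.
      by move=> _; apply.
    apply: (wp_bind (Q1 := fun v m3 => [/\ v = b2 (Dn m zr i), eqtt m2 m3, cnt m3 = cnt m2 & forall r, 6 < r -> regs m3 r = regs m2 r])).
      apply: (wp_weak (wp_get2 (D := F [tuple of rcons x zs] = None) K3 _ _ _ _ _)) => //; try lia.
      move=> v m3 s3 [-> et3]; split=> //.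
      + apply: b2_iff.
        by rewrite ei (eb _ _ _ s2) ?rz1; [exact: (D_ext i h2 lz)|lia].
      + by apply: (mstepC s3).
      + by move=> r r6; rewrite (mstepC s3) //; lia.
    move=> v m3 _ [-> et3 c3 r3].
    have hI3 : I i m3.
      have c3' : ole (cnt m2) (cnt m3) by rewrite c3.
      case: (et3) => e3 _; split.
      + exact: heap_eqtt et3 c3'.
      + by apply: ext_trans h2 (ext_eqtt et3 c3').
      + by rewrite /Kn e3.
      + move=> j c; rewrite /Rv e3 => /h4[l1 l2 [y [l3 l4]]]; split=> //; exists y; split=> //.
        by apply: pt_ext (ext_eqtt et3 c3') l4.
      + by move=> j l1 l2; rewrite /Rv e3; apply: h5.
    have iset m4 k : I k m4 -> I k (setr m4 (b + 1) (osucc i)).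
      have b0 : b + 1 <> 0 by lia.
      move=> [k1 k2 k3 k4 k5]; split=> //; [exact: heap_setr|exact: ext_setr|].
      by move=> j c /k4[l1 l2 [y [l3 l4]]]; split=> //; exists y; split=> //; apply/pt_setr.
    case: (classic (Dn m zr i)) => di; last first.
      rewrite b2F //=; apply: wp_ret; apply: iset; have [k1 k2 k3 k4 k5] := hI3; split=> //.
        by move=> j c /k4[l1 l2 l3]; split=> //; apply/oltS; left.
      by move=> j /oltS[|->] //; apply: k5.
    rewrite b2T //=; apply: (wp_weak (step i m3 (F [tuple of rcons x zs] = None) hI3 _ _ _ _ di _)) => //.
    + move=> r ra; have := ha ra => hr'; rewrite r3 ?(eb _ _ _ s2) ?r1 //; lia.
    + by rewrite r3.
    + by rewrite c3.
    + by rewrite r3 //; lia.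
    by move=> v4 m4 _ [h _]; apply: iset.
  - move=> l ms ml lde ll hI hp h0 lm _.
    have e0' : acc (bump (effp (b + 2) (b + 2)) (b + 1)) 0 < 2 by rewrite /=; case: ifP.
    have [_ lt _ lst] := lm; split.
    + by apply: heap_lim e0' ll lm hp _ => i /hI[[]].
    + by apply: ext_lim e0' ll lm _ => i /hI[[]].
    + by move=> /lt[i [il h]]; case: (hI i il) => -[_ _ k _ _] _; apply: k.
    + move=> j c /lt[i [il h]]; case: (hI i il) => -[k1 _ _ k _] _; have [l1 l2 [y [l3 l4]]] := k j c h.
      split=> //; first exact: olt_trans l1 il.
      by exists y; split=> //; apply: pt_step (lst i il) l4.
    + move=> j jl dj; have sl := proj2 ll j jl; case: (hI _ sl) => -[_ _ _ _ k] _.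
      have [c hc] := k j (olt_succ j) dj; exists c; apply/lt; by exists (osucc j).
  - move=> m2 s2 e2; rewrite rz1 in e2 *; move=> hI; split=> //.
    + rewrite -/id; apply: olt_le_trans n1 _; have := cnt_step _ s2; rewrite /cnt /=; case: eqP; first by lia.
      by move=> _; apply.
    + by move=> r hr; apply: (eb _ _ _ s2).
move=> _ m2 _ [hI al lid r2].
have dzz : Dn m zr zr by apply/(h_trc hm zr kz); left.
apply: (wp_seq (Q1 := fun _ m3 => [/\ heap m3, ext m m3 & exists y, F [tuple of rcons x (hv m zr)] = Some y /\ pt m3 (regs m3 (b + 8)) y])).
  apply: (wp_weak (step zr m2 (F [tuple of rcons x zs] = None) hI _ _ _ al dzz _)) => //.
  - move=> r ra; have := ha ra => hr'; rewrite r2 ?r1 //; lia.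
  - by rewrite r2 //; lia.
  by move=> v m3 _ [[h1 h2 _ _ _] h6].
move=> _ m3 _ [hm3 he3 [y [fy py]]]; rewrite vz in fy.
apply: wp_copy; rewrite ?effp_dst //; try lia.
have d0 : d <> 0 by lia.
split; [exact: heap_setr|exact: ext_setr|exists y => //].
by apply/pt_setr; rewrite /= eqxx.
Qed.

End Rec.

Lemma computes_rec (U : zfc_universe) n (G : classfun U n.+2) (F : classfun U n.+1) sg g : computes G sg g ->
  (forall (x : n.-tuple U) z y,
         F [tuple of rcons x z] = Some y <->
         exists w,
           [/\ forall u, u ∈ z -> exists v, F [tuple of rcons x u] = Some v,
               forall p, p ∈ w <-> exists u v,
                 [/\ u ∈ z, F [tuple of rcons x u] = Some v & p ∈ v] &
               G [tuple of w :: rcons x z] = Some y]) ->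
  computes F (sg + 9) (rec_prog g).
Proof.
move=> hG hF M X0 B KK aa d b m xz hK hb ha hm hv.
have [x [zs exz]] := rcons_tupleE xz; subst xz.
have saa : size aa = n.+1 by rewrite (proj1 hv) /= size_rcons size_tuple.
case/lastP: aa saa ha hv => [//|a z]; rewrite size_rcons => -[sa] ha hv.
have [hz dz] := arg_bound (r := z) ha ltac:(by rewrite mem_rcons inE eqxx).
have hv' : vals m (rcons a z) (rcons x zs) := hv.
rewrite -[rcons x zs]cats1 -cats1 in hv'; case/vals_split: hv' => v1 v2.
have sx : size a = size x by rewrite size_tuple.
rewrite take_size_cat // in v1; rewrite drop_size_cat // in v2.
have hd : 6 < d < b by case: ha.
apply: (wp_rec_prog hK hG hF) => //; try lia.
- by move=> r ra; case: (arg_bound (r := r) ha) => //; rewrite mem_rcons inE ra orbT.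
- by case: ha => _ h _; move: h; rewrite mem_rcons inE negb_or => /andP[].
- exact: (proj2 v2 0 isT).
Qed.

(** * Rows described by the sets they list, and pairs of sets *)

Section Prow.
Variable U : zfc_universe.
Local Notation ON := (ON U).
Local Notation mem := (mem U).
Implicit Types (Z : U -> Prop).

(* Row [n], created after [m0], is being filled and lists codes of the members of [Z]. *)
Definition prow m0 m n Z := [/\ heap m, ext m0 m, ole (cnt m0) n /\ olt n (cnt m), ~ Kn m n &
  (forall c, C m n c <-> exists z, Z z /\ pt m c z) /\ (forall z, Z z -> exists c, pt m c z)].

Lemma prow_eqv m0 m n Z Z' : prow m0 m n Z -> (forall z, Z z <-> Z' z) -> prow m0 m n Z'.
Proof.
move=> [h1 h2 h3 h4 [h5 h6]] e; split=> //; split=> [c|z /e/h6 //].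
by rewrite h5; split=> -[z [/e hz p]]; exists z.
Qed.

Lemma prow_pend m0 m n S : pend m0 m n S -> (forall c, ~ S c) -> prow m0 m n (fun _ => False).
Proof.
move=> [h1 h2 h3 h4 h5] hS; split=> //; split=> // c.
by rewrite h5; split=> [/hS|[z []]].
Qed.

Lemma prow_ext m0 m m' n Z : prow m0 m n Z -> heap m' -> ext m m' -> prow m0 m' n Z.
Proof.
move=> [hm he [n1 n2] nk [h1 h2]] hm' hx; split=> //.
- exact: ext_trans he hx.
- by split=> //; case: hx => k _; apply: olt_le_trans n2 k.
- by rewrite /Kn (proj2 hx n 1 n (ownK n) n2).
- split=> [c|z /h2[c hc]]; last by exists c; apply: pt_ext hc.
  rewrite (C_ext c hx n2) h1; split=> -[z [hz pz]]; exists z; split=> //; first exact: pt_ext pz.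
  by have [c' pc] := h2 z hz; rewrite (pt_inj hm' pz (pt_ext hm hx pc)).
Qed.

Lemma prow_eqtt m0 m m' n Z : prow m0 m n Z -> eqtt m m' -> cnt m' = cnt m -> prow m0 m' n Z.
Proof.
move=> hp et ec; have hm : heap m by case: hp.
by apply: (prow_ext hp); [apply: (heap_eqtt hm et)|apply: ext_eqtt et _]; rewrite ec.
Qed.

Lemma prow_setr m0 m n Z r x : prow m0 m n Z -> r <> 0 -> prow m0 (setr m r x) n Z.
Proof. by move=> hp r0; apply: (prow_ext hp); [apply: heap_setr => //; case: hp|apply: ext_setr]. Qed.

Lemma prow_add e m0 m m' n Z a z : prow m0 m n Z -> pt m a z -> mstep e m m' ->
  tabs m' = tabs (settb m 0 (pr n a)) -> cnt m' = cnt m -> prow m0 m' n (fun z' => Z z' \/ z' = z).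
Proof.
move=> hp pz st et ec; have [hm he n1 nk [h1 h2]] := hp.
have [hm' he' n1' nk' h3] : pend m0 m' n (fun c => C m n c \/ c = a).
  by apply: (@pend_set _ m0 m m' n _ a) => //; exact: pt_lt pz.
have hpt c z' : pt m c z' -> pt m' c z' by apply: pt_step st.
split=> //; split=> [c|z' [/h2[c hc]|->]]; last 2 first.
- by exists c; apply: hpt.
- by exists a; apply: hpt.
rewrite h3 h1; split=> [[[z' [hz p]]|->]|[z' [[hz|->] p]]].
- by exists z'; split; [left|apply: hpt].
- by exists z; split; [right|apply: hpt].
- by left; exists z'; split=> //; have [c' pc] := h2 z' hz; rewrite (pt_inj hm' p (hpt _ _ pc)).
- by right; apply: (pt_inj hm' p (hpt _ _ pz)).
Qed.

Lemma prow_other e m0 m m' n n' Z a : prow m0 m n Z -> heap m' -> n' <> n -> ole (cnt m0) n' -> mstep e m m' ->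
  tabs m' = tabs (settb m 0 (pr n' a)) -> cnt m' = cnt m -> prow m0 m' n Z.
Proof.
move=> [hm he n1 nk [h1 h2]] hm' nn n1' st et ec.
have [_ he' n2 nk' h3] : pend m0 m' n (fun c => C m n c).
  by apply: (@pend_other _ m0 m m' n n' _ a) => //; rewrite ec.
have hpt c z' : pt m c z' -> pt m' c z' by apply: pt_step st.
split=> //; split=> [c|z' /h2[c hc]]; last by exists c; apply: hpt.
rewrite h3 h1; split=> -[z' [hz p]]; exists z'; split=> //; first exact: hpt.
by have [c' pc] := h2 z' hz; rewrite (pt_inj hm' p (hpt _ _ pc)).
Qed.

Lemma prow_lim B e l (ms : ON -> mem) ml m0 n (Z : ON -> U -> Prop) : acc e 0 < 2 -> olimit l -> limmem B e l ms ml ->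
  (forall i i', olt i i' -> olt i' l -> mstep e (ms i) (ms i')) ->
  (forall i, olt i l -> prow m0 (ms i) n (Z i)) -> prow m0 ml n (fun z => exists i, olt i l /\ Z i z).
Proof.
move=> e0 ll lm hp hI; have l0 := proj1 ll.
have hml : heap ml by apply: heap_lim e0 ll lm hp _ => i /hI[].
have hpt i c z : olt i l -> pt (ms i) c z -> pt ml c z.
  by move=> il; case: (hI i il) => hm _ _ _ _; case: lm => _ _ _ /(_ i il); apply: pt_step.
split=> //.
- by apply: ext_lim e0 ll lm _ => i /hI[].
- case: (hI _ l0) => _ _ [n1 n2] _ _; split=> //; apply: olt_le_trans n2 _.
  by case: lm => _ _ _ /(_ _ l0)[_ h _ _ _]; apply: h.
- by case: lm => _ h _ _ /h[i [il k]]; case: (hI i il).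
- split=> [c|z [i [il zz]]]; last first.
    by case: (hI i il) => _ _ _ _ [_ /(_ z zz)[c hc]]; exists c; apply: (hpt i).
  case: lm => _ h _ _; rewrite /C h; split=> [[i [il]]|[z [[i [il zz]] p]]].
    case: (hI i il) => _ _ _ _ [h1 h2] /h1[z [hz p]]; exists z; split; [by exists i|exact: hpt p].
  exists i; split=> //; case: (hI i il) => _ _ _ _ [h1 h2]; have [c' pc] := h2 z zz.
  by apply/h1; exists z; split=> //; rewrite (pt_inj hml p (hpt _ _ _ il pc)).
Qed.

End Prow.

Definition upairp B KK r x y q := seqc (new_row B KK r) (seqc (set2 B KK 0 r x) (seqc (set2 B KK 0 r y) (find_alloc B KK r q))).
Definition kpairp B KK r s x y q := seqc (upairp B KK r x x s) (seqc (upairp B KK r x y q) (upairp B KK r s q q)).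

Section Macros2.
Variables (U : zfc_universe) (M : machine) (X0 : tape U) (B KK : nat).
Local Notation mem := (mem U).
Local Notation wp := (@wp U M X0 B KK).
Hypothesis hKK : 32 < KK.

Lemma wp_mkrowt (t d : nat) m0 m n Z y D : 6 < t < KK -> 6 < d < KK -> t <> d -> prow m0 m n Z -> regs m t = n ->
  (forall z, z ∈ y <-> Z z) ->
  wp (effl 7 [:: d] true false) (find_alloc B KK t d) (fun _ m' => [/\ heap m', exta m m' & pt m' (regs m' d) y]) D m.
Proof.
move=> ht hd td [hm he n1 nk [h1 h2]] tn hy.
apply: (wp_mkt (m0 := m0) (n := n) (S := C m n) hKK) => // [c /h1[z [_ []]] //|z].
rewrite hy; split=> [hz|[c [/h1[z' [hz [_ e]]] ->]]]; last by rewrite e.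
have [c pc] := h2 z hz; exists c; split; last by case: pc.
by apply/h1; exists z.
Qed.

Lemma wp_mkrow (t d : nat) m0 m n Z y D : 6 < t < KK -> 6 < d < KK -> t <> d -> prow m0 m n Z -> regs m t = n ->
  (forall z, z ∈ y <-> Z z) ->
  wp (effl 7 [:: d] true false) (find_alloc B KK t d) (fun _ m' => [/\ heap m', ext m m' & pt m' (regs m' d) y]) D m.
Proof.
move=> ht hd td hp tn hy; apply: (wp_weak (wp_mkrowt D ht hd td hp tn hy)) => //.
by move=> _ m' _ [h1 [h2 _] h3].
Qed.

Lemma wp_addrow (t r : nat) m0 m n Z z D : 6 < t < KK -> 6 < r < KK -> prow m0 m n Z -> regs m t = n -> pt m (regs m r) z ->
  wp (lv 4) (set2 B KK 0 t r) (fun _ m' => prow m0 m' n (fun z' => Z z' \/ z' = z) /\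
     (forall n' Z', n' <> n -> prow m0 m n' Z' -> prow m0 m' n' Z')) D m.
Proof.
move=> ht hr hp tn pz; have [hm he [n1 n2] nk _] := hp.
have hpe : pend m0 m n (C m n) by split.
apply: (wp_weak (wp_setC hKK (t := t) (r := r) D ht _ _ hpe tn _)) => //; try lia.
  exact: pt_lt pz.
move=> _ m' st [hp' et]; have ec : cnt m' = cnt m by apply: (mstepC st).
split=> [|n' Z' nn hp2]; first exact: (prow_add hp pz st et ec).
by apply: (prow_other hp2 _ _ n1 st et ec); [case: hp'|move=> e; apply: nn].
Qed.

Lemma wp_upairp (r x y q : nat) m X Y D : 6 < r < KK -> 6 < x < KK -> 6 < y < KK -> 6 < q < KK -> r <> x -> r <> y -> r <> q ->
  heap m -> pt m (regs m x) X -> pt m (regs m y) Y ->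
  wp (effl 7 [:: r; q] true false) (upairp B KK r x y q)
    (fun _ m' => [/\ heap m', ext m m' & pt m' (regs m' q) (upair X Y)]) D m.
Proof.
move=> hr hx hy hq rx ry rq hm px py.
apply: (wp_seq (Q1 := fun _ m1 => [/\ prow m m1 (cnt m) (fun _ => False), regs m1 r = cnt m & forall s, 6 < s -> s <> r -> regs m1 s = regs m s])).
  apply: (wp_weak (wp_newp hKK (t := r) (e := effl 7 [:: r; q] true false) D _ _ _ hm)) => //; try lia.
  - by rewrite /= !inE eqxx !orbT; case: eqP => //; lia.
  move=> _ m1 _ [hp h1 _ h2]; split=> //; first by apply: (prow_pend hp) => c [].
  by move=> s s6 sr; apply: h2; lia.
move=> _ m1 _ [hp1 t1 r1].
have lv4 s : 6 < s -> acc (lv 4) s = 0 by move=> h; apply: lv_hi; lia.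
have he1 : ext m m1 by case: hp1.
apply: (wp_seq (Q1 := fun _ m2 => prow m m2 (cnt m) (fun z => z = X) /\ forall s, 6 < s -> regs m2 s = regs m1 s)).
  apply: (wp_weak (@wp_addrow r x m m1 _ _ X D hr hx hp1 t1 _)) => //.
  - by rewrite r1; [apply: pt_ext px|lia|move=> e; apply: rx].
  move=> _ m2 s2 [hp2 _]; split; last by move=> s s6; rewrite (mstepC s2) // lv4.
  by apply: (prow_eqv hp2) => z; split=> [[]|] //; right.
move=> _ m2 _ [hp2 r2]; have he2 : ext m m2 by case: hp2.
apply: (wp_seq (Q1 := fun _ m3 => prow m m3 (cnt m) (fun z => z = X \/ z = Y) /\ regs m3 r = cnt m)).
  apply: (wp_weak (@wp_addrow r y m m2 _ _ Y D hr hy hp2 _ _)) => //.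
  - by rewrite r2 ?t1 //; lia.
  - by rewrite r2 ?r1; [apply: pt_ext py|lia|move=> e; apply: ry|lia].
  by move=> _ m3 s3 [hp3 _]; split=> //; rewrite (mstepC s3) ?r2 ?t1 //; lia.
move=> _ m3 _ [hp3 t3].
apply: (wp_weak (@wp_mkrow r q m m3 _ _ (upair X Y) D hr hq rq hp3 t3 _)) => //.
- by move=> z; rewrite upairP.
- by apply: sub_effl => //=; rewrite !inE eqxx !orbT.
move=> _ m4 _ [h1 h2 h3]; split=> //; apply: ext_trans h2; by case: hp3.
Qed.

Lemma wp_kpairp (r s x y q : nat) m X Y D : 6 < r < KK -> 6 < s < KK -> 6 < x < KK -> 6 < y < KK -> 6 < q < KK ->
  r <> x -> r <> y -> r <> q -> r <> s -> s <> x -> s <> y -> s <> q ->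
  heap m -> pt m (regs m x) X -> pt m (regs m y) Y ->
  wp (effl 7 [:: r; s; q] true false) (kpairp B KK r s x y q)
    (fun _ m' => [/\ heap m', ext m m' & pt m' (regs m' q) (kpair X Y)]) D m.
Proof.
move=> hr hs hx hy hq rx ry rq rs sx sy sq hm px py.
have ac r' q' w : 6 < w -> w <> r' -> w <> q' -> acc (effl 7 [:: r'; q'] true false) w = 0.
  by move=> w6 h1 h2; rewrite /= !inE; case: eqP; [lia|case: ifP => //; lia].
have se r' q' : (q' == s) || (q' == q) -> r' = r -> sub_eff (effl 7 [:: r'; q'] true false) (effl 7 [:: r; s; q] true false).
  by move=> h ->; apply: sub_effl => //=; rewrite !inE eqxx !orbT /=; lia.
apply: (wp_seq (Q1 := fun _ m1 => [/\ heap m1, ext m m1, pt m1 (regs m1 s) (upair X X) & forall w, 6 < w -> w <> r -> w <> s -> regs m1 w = regs m w])).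
  apply: (wp_weak (@wp_upairp r x x s m X X D hr hx hx hs rx rx rs hm px px)) => //; first by apply: se; rewrite ?eqxx.
  by move=> _ m1 s1 [h1 h2 h3]; split=> // w *; apply: (mstepC s1); apply: ac.
move=> _ m1 _ [hm1 he1 ps r1].
have px1 : pt m1 (regs m1 x) X by rewrite r1 //; [apply: pt_ext px|lia|move=> e; apply: rx|move=> e; apply: sx].
have py1 : pt m1 (regs m1 y) Y by rewrite r1 //; [apply: pt_ext py|lia|move=> e; apply: ry|move=> e; apply: sy].
apply: (wp_seq (Q1 := fun _ m2 => [/\ heap m2, ext m m2, pt m2 (regs m2 q) (upair X Y) & pt m2 (regs m2 s) (upair X X)])).
  apply: (wp_weak (@wp_upairp r x y q m1 X Y D hr hx hy hq rx ry rq hm1 px1 py1)) => //; first by apply: se; rewrite ?eqxx ?orbT.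
  move=> _ m2 s2 [h1 h2 h3]; split=> //; first exact: ext_trans he1 h2.
  by rewrite (mstepC s2); [apply: pt_ext ps|apply: ac; lia].
move=> _ m2 _ [hm2 he2 pq ps2].
apply: (wp_weak (@wp_upairp r s q q m2 _ _ D hr hs hq hq rs rq rq hm2 ps2 pq)) => //; first by apply: se; rewrite ?eqxx ?orbT.
move=> _ m3 s3 [h1 h2 h3]; split=> //; exact: ext_trans he2 h2.
Qed.

End Macros2.

(** * The unbounded search for an ordinal *)

(** In round i row [b] lists the ordinals below i, so its canonical copy represents i as a set. The
    search for a member of the value in [b + 2] tests whether the value is empty. If not, i itself
    is added to row [b]. *)
Definition mu_body g B KK a b := seqc (find_alloc B KK b (b + 1)) (seqc (g B KK (rcons a (b + 1)) (b + 2) (b + 4))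
  (Bind (find_ B KK (b + 3) 0 (get2 B KK 0 (b + 2) (b + 3))) (Ret 1) (seqc (set2 B KK 0 b (b + 1)) (Ret 0)) (Ret 0))).
Definition mu_prog g B KK a (d b : nat) := seqc (new_row B KK b) (seqc (Loop (mu_body g B KK a b)) (copy B KK d (b + 1))).

Section Mu.
Variables (U : zfc_universe) (M : machine) (X0 : tape U) (B KK : nat).
Local Notation ON := (ON U).
Local Notation mem := (mem U).
Local Notation wp := (@wp U M X0 B KK).
Hypothesis hKK : 32 < KK.

Variables (n : nat) (G : classfun U n.+1) (sg : nat) (g : nat -> nat -> seq nat -> nat -> nat -> cmd).
Hypothesis hG : computes G sg g.
Variables (x : n.-tuple U) (a : seq nat) (b : nat).
Hypothesis hb : b + 4 + sg <= KK.
Hypothesis b6 : 6 < b.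
Hypothesis ha : forall r, r \in a -> 6 < r < b.

Lemma wp_mu_body m0 m nr (i : ON) D : heap m0 -> vals m0 a x -> (forall r, r \in a -> regs m r = regs m0 r) -> regs m b = nr ->
  prow m0 m nr (fun z => exists j, olt j i /\ z = sval j) ->
  (G [tuple of rcons x (sval i)] = None -> D) ->
  wp (effp (b + 1) (b + 1)) (mu_body g B KK a b) (fun v m' => exists2 y, G [tuple of rcons x (sval i)] = Some y &
     (v = 1 /\ [/\ y = empty, heap m', ext m0 m' & pt m' (regs m' (b + 1)) (sval i)]) \/
     [/\ v = 0, y <> empty & prow m0 m' nr (fun z => exists j, olt j (osucc i) /\ z = sval j)]) D m.
Proof.
move=> hm0 hv0 hr tn hp hD; have K3 : 3 < KK by lia.
apply: (wp_seq (Q1 := fun _ m1 => [/\ prow m0 m1 nr (fun z => exists j, olt j i /\ z = sval j),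
    pt m1 (regs m1 (b + 1)) (sval i) & forall r, 6 < r <= b -> regs m1 r = regs m r])).
  apply: (wp_weak (@wp_mkrow U M X0 B KK hKK b (b + 1) m0 m nr _ (sval i) D _ _ _ hp tn _)) => //; try lia.
  - move=> z; split=> [zi|[j [ji ->]] //].
    by exists (omk (ordinal_elem (svalP i) zi)); split=> //; apply/olt_mem.
  move=> _ m1 s1 [h1 h2 h3]; split=> //; first exact: prow_ext hp h1 h2.
  move=> r hr'; apply: (mstepC s1); rewrite /= inE; case: eqP; [lia|case: ifP => //; lia].
move=> _ m1 _ [hp1 pi r1].
have [hm1 he1 _ _ _] := hp1.
apply: (wp_seq (Q1 := fun _ m2 => [/\ prow m0 m2 nr (fun z => exists j, olt j i /\ z = sval j),
    pt m2 (regs m2 (b + 1)) (sval i), regs m2 b = nr & exists2 y, G [tuple of rcons x (sval i)] = Some y & pt m2 (regs m2 (b + 2)) y])).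
  apply: (wp_weak (hG (a := rcons a (b + 1)) (d := b + 2) (base := b + 4) (x := [tuple of rcons x (sval i)]) hKK _ _ hm1 _)) => //.
  - split; last by lia.
      apply/allP => r; rewrite mem_rcons inE => /orP[/eqP ->|/ha]; lia.
    by rewrite mem_rcons inE; apply/negP => /orP[/eqP|/ha]; lia.
  - rewrite -[rcons a _]cats1 /= -[rcons x _]cats1; apply: vals_cat.
      by apply: (vals_ext hm0 he1 _ hv0) => r ra; rewrite r1 ?hr //; have := ha ra; lia.
    by apply: vals_cons => //; apply: vals_nil.
  move=> v m2 s2 [h1 h2 h3].
  split=> //; first exact: prow_ext hp1 h1 h2.
    by rewrite (mstepC s2) ?effpC //; [apply: pt_ext pi|lia|lia].
  by rewrite (mstepC s2) ?effpC //; [rewrite r1 ?tn //; lia|lia|lia].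
move=> _ m2 _ [hp2 pi2 tn2 [y gy py]].
have [hm2 he2 _ _ _] := hp2; have [ky vy] := py; set yr := regs m2 (b + 2) in ky vy py.
have yE : y <> empty <-> exists c, olt c (cnt m2) /\ C m2 yr c.
  split=> [ne|[c [_ hc]] e].
    apply: NNPP => nc; apply: ne; apply: extensionality => z; split=> [|/emptyP //].
    by rewrite -vy => /(in_hv _ hm2 ky)[c [hc _]]; case: nc; exists c; split=> //; apply: (h_row hm2 hc).
  have : hv m2 c ∈ y by rewrite -vy; apply/in_hv => //; exists c.
  by rewrite e => /emptyP.
apply: (wp_bind (Q1 := fun v m3 => [/\ v = b2 (y <> empty), eqtt m2 m3, cnt m3 = cnt m2 & forall r, 6 < r < b + 3 -> regs m3 r = regs m2 r])).
  have bc m' q : mstep (bump (lv 4) (b + 3)) (setr m2 (b + 3) (ozero U)) m' -> q = 0 \/ 6 < q < b + 3 -> regs m' q = regs m2 q.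
    move=> st hq; apply: (bumpC st); first by lia.
    by case: hq => [->//|hq]; apply: lv_hi; lia.
  apply: (wp_find (lv 4) (fun c => C m2 yr c)) => //; try lia.
  - move=> c m3 lc ec s3 et3; wp_get D K3.
    move=> v m4 _ [-> et4]; split; last exact: eqtt_trans et3 et4.
    congr b2; rewrite /C /yr -(bc m3 (b + 2) s3) ?ec; last by lia.
    by case: et3 => ->.
  - move=> m3 c s3 et3 ec lc hc _; split=> //; first by rewrite b2T //; apply/yE; exists c.
      by apply: (bc m3 0 s3); left.
    by move=> r hrr; apply: (bc m3 r s3); right.
  - move=> m3 s3 et3 ec hc; split=> //; first by rewrite b2F // => /yE[c [lc]]; apply: hc.
      by apply: (bc m3 0 s3); left.
    by move=> r hrr; apply: (bc m3 r s3); right.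
move=> v m3 _ [-> et3 c3 r3]; have hp3 := prow_eqtt hp2 et3 c3.
have c3' : ole (cnt m2) (cnt m3) by rewrite c3.
have pi3 : pt m3 (regs m3 (b + 1)) (sval i) by rewrite r3 //; [apply: pt_ext (ext_eqtt et3 c3') pi2|lia].
case: (classic (y = empty)) => ye.
  rewrite b2F; last by [].
  apply: wp_ret; exists y => //; left; split=> //; split=> //; by case: hp3.
rewrite b2T //; apply: (wp_seq (Q1 := fun _ m4 => prow m0 m4 nr (fun z => exists j, olt j (osucc i) /\ z = sval j))).
  apply: (wp_weak (@wp_addrow U M X0 B KK hKK b (b + 1) m0 m3 nr _ (sval i) D _ _ hp3 _ pi3)) => //; try lia.
  - by rewrite r3 //; lia.
  move=> v2 m4 _ [hp4 _]; apply: (prow_eqv hp4) => z; split=> [[[j [ji ->]]|->]|[j [/oltS[ji|->] ->]]].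
  - by exists j; split=> //; apply/oltS; left.
  - by exists i; split=> //; apply: olt_succ.
  - by left; exists j.
  - by right.
move=> v2 m4 _ hp4; apply: wp_ret; exists y => //; right; by split.
Qed.

Lemma wp_mu_prog (F : classfun U n) m d : 
  (forall y, F x = Some y <-> exists i : ON, [/\ y = sval i, G [tuple of rcons x (sval i)] = Some empty &
               forall j : ON, olt j i -> exists v, G [tuple of rcons x (sval j)] = Some v /\ v <> empty]) ->
  heap m -> 6 < d < b -> vals m a x -> wp (effp d b) (mu_prog g B KK a d b) (value F x m d) (F x = None) m.
Proof.
move=> hF hm hd hv0; set D := F x = None.
apply: (wp_seq (Q1 := fun _ m1 => [/\ prow m m1 (cnt m) (fun z => exists j, olt j (ozero U) /\ z = sval j), regs m1 b = cnt m & forall r, r <> 0 -> r <> b -> regs m1 r = regs m r])).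
  apply: (wp_weak (wp_newp hKK (t := b) (e := effp d b) D _ _ _ hm)) => //; try lia.
  move=> _ m1 _ [h1 h2 _ h3]; split=> //; have h4 : prow m m1 (cnt m) (fun _ => False) by apply: (prow_pend h1) => c [].
  apply: (prow_eqv h4) => z.
  by split=> // -[j [/olt0]].
move=> _ m1 _ [hp1 t1 r1]; pose Z i := fun z => exists j : ON, olt j i /\ z = sval j.
pose e := effp (b + 1) (b + 1).
have ec m' : mstep e m1 m' -> regs m' b = cnt m /\ forall r, r \in a -> regs m' r = regs m r.
  move=> st; split=> [|r ra]; first by rewrite (mstepC st) ?effpC //; lia.
  have := ha ra => hr; rewrite (mstepC st) ?effpC ?r1 //; lia.
pose good (i : ON) := exists v, G [tuple of rcons x (sval i)] = Some v /\ v <> empty.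
have body i m' : mstep e m1 m' -> prow m m' (cnt m) (Z i) -> (G [tuple of rcons x (sval i)] = None -> D) ->
  wp e (mu_body g B KK a b) (fun v m' => exists2 y, G [tuple of rcons x (sval i)] = Some y &
     (v = 1 /\ [/\ y = empty, heap m', ext m m' & pt m' (regs m' (b + 1)) (sval i)]) \/
     [/\ v = 0, y <> empty & prow m m' (cnt m) (Z (osucc i))]) D m'.
  by move=> st hp hD; have [h1 h2] := ec m' st; apply: wp_mu_body.
have lim l ms ml : olimit l -> (forall i, olt i l -> prow m (ms i) (cnt m) (Z i)) ->
    (forall i i', olt i i' -> olt i' l -> mstep e (ms i) (ms i')) -> limmem B e l ms ml -> prow m ml (cnt m) (Z l).
  move=> ll hI hp lm; apply: (prow_eqv (@prow_lim _ B e l ms ml m (cnt m) Z _ ll lm hp hI)) => // z.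
  split=> [[i [il [j [ji ->]]]]|[j [jl ->]]]; first by exists j; split=> //; apply: olt_trans ji il.
  exists (osucc j); split; first exact: (proj2 ll).
  by exists j; split=> //; apply: olt_succ.
have se : sub_eff e (effp d b) by apply: sub_effp; lia.
have it i m' : good i -> mstep e m1 m' -> prow m m' (cnt m) (Z i) -> @mreach U M X0 B KK true e (mu_body g B KK a b) m' (fun m2 => prow m m2 (cnt m) (Z (osucc i))) D.
  move=> [v [gv nv]] st hp; apply: mreach_iter.
  apply: (wp_weak (body i m' st hp _)) => //; first by rewrite gv.
  move=> w m2 _ [y gy]; rewrite gv in gy; case: gy => <-; case=> [[_ [e1]]|[-> _ h]] //.
apply: (wp_seq (Q1 := fun _ m2 => [/\ heap m2, ext m m2 & exists2 y, F x = Some y & pt m2 (regs m2 (b + 1)) y])); last first.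
  move=> _ m2 _ [h1 h2 [y fy py]]; apply: wp_copy; rewrite ?effp_dst //; try lia.
  have d0 : d <> 0 by lia.
  split; [exact: heap_setr|exact: ext_setr|exists y => //].
  by apply/pt_setr; rewrite /= eqxx.
(* If all ordinals are good, the loop passes through [ON] and diverges. Otherwise it reaches the
   least ordinal that is not good. *)
case: (classic (forall i, good i)) => [hall|/neg_all[i0 hi0]]; last have [i [hi hlt]] := @least U (fun i => ~ good i) i0 hi0.
  apply: (wp_sub (e := e) (D := D)) => //.
  apply: (wp_never (I := fun i m2 => prow m m2 (cnt m) (Z i))) => //.
  - rewrite /D; case E: (F x) => [y|] //; move/hF: E => [i [_ gi _]]; have [v [gv]] := hall i.
    by rewrite gi in gv; case: gv => <-.
  - by move=> i m' st hp; apply: it.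
  - by move=> l ms ml ll hI hp h0; apply: lim.
apply: (wp_sub (e := e) (D := D)) => //.
apply: wp_loop.
have hj j : olt j i -> good j by move=> /hlt; apply: NNPP.
apply: (mreach_weak (st := false) (e := e) (P := fun m' => mstep e m1 m' /\ prow m m' (cnt m) (Z i)) (D := D)) => //.
  apply: (mreach_weak (st := false) (e := e) (P := fun m' => prow m m' (cnt m) (Z i)) (D := D)) => //.
    apply: (mreach_tf (I := fun i m2 => prow m m2 (cnt m) (Z i))) => //.
    - by move=> j m' ji st hp; apply: (mreach_weak (it j m' (hj j ji) st hp)).
    - by move=> l ms ml lde ll hI hp h0; apply: lim.
move=> m' _ [st hp]; apply: (wp_weak (body i m' st hp _)) => //.
(* If [G] is undefined at the least ordinal that is not good, no value can exist: it would lie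
   below, at or above that ordinal, and each case is excluded. *)
- move=> gn; rewrite /D; case E: (F x) => [y|] //; move/hF: E => [i' [_ gi' lt']].
  case: (olt_total i i') => [h|e1|h].
  + by have [v [gv _]] := lt' i h; rewrite gn in gv.
  + by subst i'; rewrite gn in gi'.
  + by have [v [gv]] := hj i' h; rewrite gi' in gv; case: gv => <-.
move=> v m2 _ [y gy]; case=> [[-> [ye h1 h2 h3]]|[_ ye]]; last by case: hi; exists y.
by split=> //; split=> //; exists (sval i) => //; apply/hF; exists i; split=> //; rewrite gy ye.
Qed.

End Mu.

Lemma computes_mu (U : zfc_universe) n (G : classfun U n.+1) (F : classfun U n) sg g : computes G sg g ->
  (forall (x : n.-tuple U) y, F x = Some y <-> exists i : ON U, [/\ y = sval i, G [tuple of rcons x (sval i)] = Some empty &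
               forall j : ON U, olt j i -> exists v, G [tuple of rcons x (sval j)] = Some v /\ v <> empty]) ->
  computes F (sg + 4) (mu_prog g).
Proof.
move=> hG hF M X0 B KK a d b m x hK hb ha hm hv; have hd : 6 < d < b by case: ha.
by apply: (wp_mu_prog hK hG) => //; try lia; move=> r /(arg_bound ha)[].
Qed.

(** * Well orderings of the arguments *)

(** Members of [x] are met in the order of their row numbers. Row [b] collects the pairs of the
    bijection, and row [b + 1] the ordinals already used, so that its canonical copy in [b + 3] is
    the next ordinal to assign. The row number in [b + 2] is at the same time the representation of
    the member. *)
Definition woo1 B KK x f b := seqc (new_row B KK b) (seqc (new_row B KK (b + 1)) (seqc
  (for_ B KK (b + 2) x (Bind (get2 B KK 0 x (b + 2)) (Ret 0)
    (seqc (find_alloc B KK (b + 1) (b + 3)) (seqc (kpairp B KK (b + 4) (b + 5) (b + 2) (b + 3) (b + 6)) (seqc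
      (set2 B KK 0 b (b + 6)) (set2 B KK 0 (b + 1) (b + 3))))) (Ret 0)))
  (find_alloc B KK b f))).

Fixpoint woos B KK a f b := if a is r :: a' then seqc (woo1 B KK r f b) (woos B KK a' f.+1 b) else Ret 0.

Definition woo_prog g B KK a (d b : nat) := seqc (woos B KK a b (b + size a)) (g B KK (a ++ iota b (size a)) d (b + size a)) : cmd.

Section Count.
Variable U : zfc_universe.
Local Notation ON := (ON U).
Variable S : ON -> Prop.

Lemma upair_inj (x y x' y' : U) : upair x y = upair x' y' -> (x = x' /\ y = y') \/ (x = y' /\ y = x').
Proof.
move=> e; have h z : z = x \/ z = y <-> z = x' \/ z = y' by rewrite -!upairP e.
have hx := proj1 (h x) (or_introl erefl); have hy := proj1 (h y) (or_intror erefl).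
have hx' := proj2 (h x') (or_introl erefl); have hy' := proj2 (h y') (or_intror erefl).
case: hx => e1; case: hy => e2; subst; try (by left); try (by right).
- by left; split=> //; case: hy'.
- by right; split=> //; case: hx'.
Qed.

Lemma kpair_inj (x y x' y' : U) : kpair x y = kpair x' y' -> x = x' /\ y = y'.
Proof.
case/upair_inj => -[/upair_inj h1 /upair_inj h2].
  have ex : x = x' by case: h1 => -[].
  by split=> //; case: h2 => -[e1 e2]; congruence.
have ex : x = x' by case: h1 => -[].
split=> //; case: h1 => -[e1 e2]; case: h2 => -[e3 e4]; congruence.
Qed.

(* The order type of the members of [S] below a given ordinal. *)
Definition ct : ON -> ON := titer (ozero U) (fun j c => if lem (S j) then osucc c else c).

Lemma ctS j : S j -> ct (osucc j) = osucc (ct j).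
Proof. by move=> h; rewrite /ct titerS; case: lem. Qed.
Lemma ctN j : ~ S j -> ct (osucc j) = ct j.
Proof. by move=> h; rewrite /ct titerS; case: lem. Qed.

Lemma ct_mono i j : ole i j -> ole (ct i) (ct j).
Proof. by apply: titer_mono => b c; case: (lem (S b)) => h; [left|right]. Qed.

Lemma ct_lt i j : S i -> olt i j -> olt (ct i) (ct j).
Proof. by move=> si /oleS/ct_mono h; apply: olt_le_trans h; rewrite ctS. Qed.

Lemma ct_inj i j : S i -> S j -> ct i = ct j -> i = j.
Proof.
move=> si sj e; case: (olt_total i j) => [/(ct_lt si)|//|/(ct_lt sj)]; rewrite e => /olt_irr //.
Qed.

Lemma ct_onto i c : olt c (ct i) -> exists j, [/\ olt j i, S j & ct j = c].
Proof.
elim/on_ind: i => [|i ih|l ll ih].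
- by rewrite /ct titer0 => /olt0.
- case: (classic (S i)) => si.
    rewrite ctS // => /oltS[/ih[j [ji sj e]]|->]; last by exists i.
    by exists j; split=> //; apply/oltS; left.
  by rewrite ctN // => /ih[j [ji sj e]]; exists j; split=> //; apply/oltS; left.
- rewrite /ct titerL // => /lt_sup[i [il]] /(ih i il)[j [ji sj e]]; exists j; split=> //; exact: olt_trans ji il.
Qed.

End Count.

Section Woo.
Variables (U : zfc_universe) (M : machine) (X0 : tape U) (B KK : nat).
Local Notation ON := (ON U).
Local Notation mem := (mem U).
Local Notation wp := (@wp U M X0 B KK).
Hypothesis hKK : 32 < KK.

(** Distinct members sit at distinct row numbers, and [ct] collapses the set of these numbers onto
    an ordinal. *)
Lemma woo_row m (a : ON) X phi : heap m -> pt m a X ->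
  (forall z, z ∈ phi <-> exists j, [/\ olt j a, C m a j & z = kpair (hv m j) (sval (ct (C m a) j))]) -> woo X phi.
Proof.
move=> hm [ka <-] hphi; exists (ct (C m a) a).
have inX j : C m a j -> hv m j ∈ hv m a by move=> cj; apply/in_hv => //; exists j.
have la j : C m a j -> olt j a by move=> cj; case: (h_can hm ka cj).
split.
- move=> p /hphi[j [ja cj ->]]; exists (hv m j), (sval (ct (C m a) j)); split=> //; first exact: inX.
  exact: ct_lt.
- move=> y /(in_hv _ hm ka)[j [cj ->]]; exists (sval (ct (C m a) j)); split.
    by split; [exact: ct_lt (la j cj)|apply/hphi; exists j; split=> //; apply: la].
  move=> z [_ /hphi[j' [_ cj' /kpair_inj[e ->]]]].
  by rewrite (hv_inj hm _ _ e) //; [case: (h_can hm ka cj)|case: (h_can hm ka cj')].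
- move=> z zc; pose c : ON := omk (ordinal_elem (svalP (ct (C m a) a)) zc).
  have [|j [ja cj e]] := @ct_onto _ (C m a) a c; first exact: zc.
  have ez : z = sval (ct (C m a) j) by rewrite e.
  exists (hv m j); split; first by split; [exact: inX|apply/hphi; exists j; split=> //; rewrite ez].
  move=> y [_ /hphi[j' [_ cj' /kpair_inj[-> e2]]]].
  by rewrite (ct_inj cj cj') //; apply: on_eq; rewrite -ez.
Qed.

Lemma wp_woo1 (x f b : nat) m X D : 6 < x < b -> 6 < f < b -> b + 7 <= KK -> heap m -> pt m (regs m x) X ->
  wp (effp f b) (woo1 B KK x f b) (fun _ m' => [/\ heap m', ext m m' & exists2 phi, woo X phi & pt m' (regs m' f) phi]) D m.
Proof.
move=> hx hf hb hm px; have K3 : 3 < KK by lia.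
set a := regs m x in px; pose S := C m a; have [ka _] := px; have la := pt_lt hm px.
apply: (wp_seq (Q1 := fun _ m1 => [/\ prow m m1 (cnt m) (fun _ => False), regs m1 b = cnt m & forall r, r <> 0 -> r <> b -> regs m1 r = regs m r])).
  apply: (wp_weak (wp_newp hKK (t := b) (e := effp f b) D _ _ _ hm)) => //; try lia.
  by move=> _ m1 _ [h1 h2 _ h3]; split=> //; apply: (prow_pend h1) => c [].
move=> _ m1 _ [hp1 t1 r1]; have [hm1 he1 [_ n1] _ _] := hp1; pose n2 := cnt m1.
have ne : n2 <> cnt m by move=> e; rewrite -/n2 e in n1; case: (olt_irr n1).
apply: (wp_seq (Q1 := fun _ m2 => [/\ prow m m2 (cnt m) (fun _ => False), prow m m2 n2 (fun _ => False), regs m2 b = cnt m, regs m2 (b + 1) = n2 &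
    regs m2 x = a])).
  apply: (wp_weak (wp_newp hKK (t := b + 1) (e := effp f b) D _ _ _ hm1)) => //; try lia.
  move=> _ m2 _ [h1 h2 _ h3]; have [hm2 he2 _ _ _] := h1; split=> //.
  - exact: prow_ext hp1 hm2 he2.
  - by apply: (prow_pend (pend_ext0 h1 he1)) => c [].
  - by rewrite h3 //; lia.
  - by rewrite h3 ?r1 //; lia.
move=> _ m2 _ [hp2 hq2 t2 u2 rx2].
pose Zp i z := exists j, [/\ olt j i, S j & z = kpair (hv m j) (sval (ct S j))].
pose Zt i z := exists c, olt c (ct S i) /\ z = sval c.
apply: (wp_seq (Q1 := fun _ m3 => prow m m3 (cnt m) (Zp a) /\ regs m3 b = cnt m)).
  pose e0 := effp (b + 3) (b + 3).
  have ec i m' r : mstep (bump e0 (b + 2)) (setr m2 (b + 2) i) m' -> 6 < r < b + 2 -> regs m' r = regs m2 r.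
    by move=> s hr; rewrite (bumpC s) //; [lia|rewrite effpC //; lia].
  apply: (wp_for e0 (fun i m' => prow m m' (cnt m) (Zp i) /\ prow m m' n2 (Zt i))) => //; try lia.
  - by rewrite effpC //; lia.
  - by rewrite effpC //; lia.
  - have b0 : b + 2 <> 0 by lia.
    split; apply: prow_setr => //.
      by apply: (prow_eqv hp2) => z; split=> // -[j [/olt0]].
    by apply: (prow_eqv hq2) => z; split=> // -[c []]; rewrite /ct titer0 => /olt0.
  - rewrite rx2 => i m3 li ei _ s3 [hp3 hq3]; have [hm3 he3 _ _ _] := hp3.
    have b0 : b + 2 <> 0 by lia.
    apply: (wp_bind (Q1 := fun v m4 => [/\ v = b2 (S i), prow m m4 (cnt m) (Zp i), prow m m4 n2 (Zt i) & forall r, 6 < r -> regs m4 r = regs m3 r])).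
      wp_get D K3.
        by apply: sub_effp_l => //; lia.
      move=> v m4 s4 [-> et4]; have c4 : cnt m4 = cnt m3 by apply: (mstepC s4).
      split.
      + by apply: b2_iff; rewrite ei (ec _ _ _ s3) ?rx2; [exact: C_ext|lia].
      + exact: prow_eqtt hp3 et4 c4.
      + exact: prow_eqtt hq3 et4 c4.
      + by move=> r r6; rewrite (mstepC s4) // lv_hi //; lia.
    move=> v m4 _ [-> hp4 hq4 r4]; have [hm4 he4 _ _ _] := hp4.
    case: (classic (S i)) => si; last first.
      rewrite b2F //=; apply: wp_ret; split; apply: prow_setr => //.
        apply: (prow_eqv hp4) => z; split=> -[j [h1 h2 h3]]; exists j; split=> //; first by apply/oltS; left.
        by case/oltS: h1 => // e; subst j.
      by apply: (prow_eqv hq4) => z; rewrite /Zt ctN.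
    rewrite b2T //=.
    have t4 : regs m4 b = cnt m by rewrite r4 ?(ec _ _ _ s3) //; lia.
    have u4 : regs m4 (b + 1) = n2 by rewrite r4 ?(ec _ _ _ s3) //; lia.
    have j4 : regs m4 (b + 2) = i by rewrite r4 //; lia.
    have pi : pt m i (hv m i) by split=> //; case: (h_can hm ka si).
    apply: (wp_seq (Q1 := fun _ m5 => [/\ prow m m5 (cnt m) (Zp i), prow m m5 n2 (Zt i), pt m5 (regs m5 (b + 3)) (sval (ct S i)) &
        forall r, 6 < r -> r <> b + 3 -> regs m5 r = regs m4 r])).
      apply: (wp_weak (@wp_mkrow U M X0 B KK hKK (b + 1) (b + 3) m m4 n2 _ (sval (ct S i)) D _ _ _ hq4 u4 _)) => //; try lia.
      - move=> z; split=> [zi|[c [ci ->]] //].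
        by exists (omk (ordinal_elem (svalP (ct S i)) zi)); split=> //; apply/olt_mem.
      - by apply: sub_effp_l => //=; lia.
      move=> _ m5 s5 [h1 h2 h3]; split=> //; [exact: prow_ext hp4 h1 h2|exact: prow_ext hq4 h1 h2|].
      move=> r r6 rn; apply: (mstepC s5); rewrite /= inE; case: eqP; [lia|case: ifP => //; lia].
    move=> _ m5 _ [hp5 hq5 po r5]; have [hm5 he5 _ _ _] := hp5.
    have j5 : regs m5 (b + 2) = i by rewrite r5 //; lia.
    apply: (wp_seq (Q1 := fun _ m6 => [/\ prow m m6 (cnt m) (Zp i), prow m m6 n2 (Zt i), pt m6 (regs m6 (b + 3)) (sval (ct S i)),
        pt m6 (regs m6 (b + 6)) (kpair (hv m i) (sval (ct S i))) & forall r, 6 < r < b + 4 -> regs m6 r = regs m5 r])).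
      apply: (wp_weak (@wp_kpairp U M X0 B KK hKK (b + 4) (b + 5) (b + 2) (b + 3) (b + 6) m5 (hv m i) (sval (ct S i)) D
         _ _ _ _ _ _ _ _ _ _ _ _ hm5 _ _)) => //; try lia.
      - by rewrite j5; apply: pt_ext pi.
      - by apply: sub_effp_l => //=; lia.
      move=> _ m6 s6 [h1 h2 h3].
      have r6 r : 6 < r < b + 4 -> regs m6 r = regs m5 r.
        by move=> hr; apply: (mstepC s6); rewrite /= !inE; case: eqP; [lia|case: ifP => //; lia].
      split=> //; [exact: prow_ext hp5 h1 h2|exact: prow_ext hq5 h1 h2|].
      by rewrite r6; [apply: pt_ext po|lia].
    move=> _ m6 _ [hp6 hq6 po6 pq6 r6].
    have t6 : regs m6 b = cnt m by rewrite r6 ?r5 //; lia.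
    have u6 : regs m6 (b + 1) = n2 by rewrite r6 ?r5 //; lia.
    apply: (wp_seq (Q1 := fun _ m7 => [/\ prow m m7 (cnt m) (Zp (osucc i)), prow m m7 n2 (Zt i), pt m7 (regs m7 (b + 3)) (sval (ct S i)) & regs m7 (b + 1) = n2])).
      apply: (wp_weak (@wp_addrow U M X0 B KK hKK b (b + 6) m m6 _ _ _ D _ _ hp6 t6 pq6)) => //; try lia.
        by apply: sub_effp_l => //; lia.
      move=> _ m7 s7 [hp7 ho]; split.
      + apply: (prow_eqv hp7) => z; split=> [[[j [h1 h2 h3]]|->]|[j [/oltS[h1|->] h2 h3]]].
        * by exists j; split=> //; apply/oltS; left.
        * by exists i; split=> //; apply: olt_succ.
        * by left; exists j.
        * by right.
      + exact: ho.
      + rewrite (mstepC s7); last by apply: lv_hi; lia.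
        by apply: pt_step s7 po6; case: hp6.
      + by rewrite (mstepC s7) // lv_hi //; lia.
    move=> _ m7 _ [hp7 hq7 po7 u7].
    apply: (wp_weak (@wp_addrow U M X0 B KK hKK (b + 1) (b + 3) m m7 _ _ _ D _ _ hq7 u7 po7)) => //; try lia.
      by apply: sub_effp_l => //; lia.
    move=> _ m8 _ [hq8 ho]; split; apply: prow_setr => //.
      by apply: ho hp7 => e; apply: ne.
    apply: (prow_eqv hq8) => z; rewrite /Zt ctS //; split=> [[[c [h1 h2]]|->]|[c [/oltS[h1|->] h2]]].
    + by exists c; split=> //; apply/oltS; left.
    + by exists (ct S i); split=> //; apply: olt_succ.
    + by left; exists c.
    + by right.
  - move=> l ms ml lde ll hI hp h0 lm _.
    have e0' : acc (bump e0 (b + 2)) 0 < 2 by rewrite /=; case: ifP.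
    split.
    + apply: (prow_eqv (prow_lim (Z := Zp) e0' ll lm hp _)) => [i /hI[[]] //|z].
      split=> [[i [il [j [ji sj ->]]]]|[j [jl sj ->]]]; first by exists j; split=> //; apply: olt_trans ji il.
      by exists (osucc j); split; [exact: (proj2 ll)|exists j; split=> //; apply: olt_succ].
    + apply: (prow_eqv (prow_lim (Z := Zt) e0' ll lm hp _)) => [i /hI[[]] //|z].
      split=> [[i [il [c [ci ->]]]]|[c []]].
        by exists c; split=> //; apply: olt_le_trans ci _; apply: ct_mono; left.
      by rewrite {1}/ct titerL // => /lt_sup[i [il ci]] ->; exists i; split=> //; exists c.
  - move=> m3 s3 _; rewrite rx2 => -[hp3 _]; split=> //.
    by rewrite (ec _ _ _ s3) //; lia.
move=> _ m3 _ [hp3 t3].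
have [phi hphi] : exists phi : U, forall z, z ∈ phi <-> Zp a z.
  have [|s hs] := @replacement U (sval a) (fun (u z : U) => exists j : ON, [/\ sval j = u, S j & z = kpair (hv m j) (sval (ct S j))]).
    by move=> w z z' _ [j [e1 _ ->]] [j' [e2 _ ->]]; have -> : j = j' by apply: on_eq; rewrite e1 e2.
  exists s => z; rewrite hs; split=> [[w [wa [j [e1 sj ->]]]]|[j [ja sj ->]]].
    by exists j; split=> //; rewrite /olt e1.
  by exists (sval j); split=> //; exists j.
apply: (wp_weak (@wp_mkrow U M X0 B KK hKK b f m m3 _ _ phi D _ _ _ hp3 t3 hphi)) => //; try lia.
move=> _ m4 _ [h1 h2 h3]; split=> //; first by apply: ext_trans h2; case: hp3.
by exists phi => //; apply: (woo_row hm px).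
Qed.

Lemma wp_woos (a : seq nat) f b m xs D : (forall r, r \in a -> 6 < r < f) -> 6 < f -> f + size a <= b -> b + 7 <= KK ->
  heap m -> vals m a xs ->
  wp (effp f f) (woos B KK a f b) (fun _ m' => [/\ heap m', ext m m' & exists fs, [/\ vals m' (iota f (size a)) fs,
      size fs = size xs & forall i, i < size xs -> woo (nth empty xs i) (nth empty fs i)]]) D m.
Proof.
elim: a f m xs => [|r a ih] f m xs ha f6 hfb hb hm hv /=.
  apply: wp_ret; split=> //; exists [::]; case: hv => /= sz _; split=> // i; by rewrite -sz.
case: xs hv => [[]|x xs hv] //; have [sz hv'] := hv.
have hr : 6 < r < f by apply: ha; rewrite mem_head.
have px : pt m (regs m r) x := hv' 0 isT.
have va : vals m a xs by split=> [|i ia]; [case: sz|exact: (hv' i.+1)].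
rewrite /= in hfb.
apply: (wp_seq (Q1 := fun _ m1 => [/\ heap m1, ext m m1, exists2 phi, woo x phi & pt m1 (regs m1 f) phi & forall r, r \in a -> regs m1 r = regs m r])).
  apply: (wp_weak (@wp_woo1 r f b m x D _ _ _ hm px)) => //; try lia.
  move=> _ m1 s1 [h1 h2 h3]; split=> // s sa; apply: (mstepC s1).
  have : 6 < s < f by apply: ha; rewrite inE sa orbT.
  by move=> hs; apply: effpC; lia.
move=> _ m1 _ [hm1 he1 [phi wphi pf] r1].
apply: (wp_weak (ih f.+1 m1 xs _ _ _ hb hm1 _)) => //; try lia.
- by move=> s sa; have : 6 < s < f by [apply: ha; rewrite inE sa orbT]; lia.
- exact: vals_ext va.
move=> _ m2 s2 [h1 h2 [fs [v1 v2 v3]]]; split=> //; first exact: ext_trans he1 h2.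
exists (phi :: fs); split=> /=; last 2 first.
- by rewrite v2.
- by case=> [|i] //= i1; apply: v3.
apply: vals_cons => //; rewrite (mstepC s2); first exact: pt_ext pf.
by apply: effpC; lia.
Qed.

End Woo.

(** The program evaluates [G] at one particular choice of well orderings. By [hw] a value at some
    choice is the value at every choice, so [F x] is defined exactly if [G] is defined at this
    one. *)
Lemma computes_woo (U : zfc_universe) n (G : classfun U (n + n)) (F : classfun U n) sg g : computes G sg g ->
  (forall (x : n.-tuple U) y,
         (forall f : n.-tuple U, all_woo x f -> G [tuple of x ++ f] = Some y)
         <->
         (exists f : n.-tuple U, all_woo x f /\ G [tuple of x ++ f] = Some y)) ->
  (forall (x : n.-tuple U) y,
         F x = Some y <->
         exists f : n.-tuple U, all_woo x f /\ G [tuple of x ++ f] = Some y) ->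
  computes F (n + 7 + sg) (woo_prog g).
Proof.
move=> hG hw hF M X0 B KK a d b m x hK hb ha hm hv.
have hd : 6 < d < b by case: ha.
have sa : size a = n by rewrite (proj1 hv) size_tuple.
have har r : r \in a -> 6 < r < b by case/(arg_bound ha).
apply: (wp_seq (Q1 := fun _ m1 => [/\ heap m1, ext m m1, (forall r, r \in a -> regs m1 r = regs m r) &
   exists f : n.-tuple U, all_woo x f /\ vals m1 (iota b n) f])).
  apply: (wp_weak (wp_woos hK (F x = None) har _ _ _ hm hv)) => //; try lia.
  move=> _ m1 s1 [h1 h2 [fs [v1 v2 v3]]]; split=> //.
    by move=> r ra; have := har r ra => hr; rewrite (mstepC s1) // effpC //; lia.
  have sf : size fs == n by rewrite v2 size_tuple.
  exists (Tuple sf); rewrite sa in v1; split=> // i.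
  by rewrite !(tnth_nth empty) /=; apply: v3; rewrite size_tuple.
move=> _ m1 _ [hm1 he1 r1 [f [wf vf]]].
apply: (wp_weak (hG M X0 B KK (a ++ iota b (size a)) d (b + size a) m1 [tuple of x ++ f] hK _ _ hm1 _)) => //.
- by lia.
- split; last by lia.
    by apply/allP => r; rewrite mem_cat mem_iota => /orP[/har|]; lia.
  by rewrite mem_cat mem_iota; case: ha => _ /negbTE -> _; rewrite /=; lia.
- by rewrite sa; apply: vals_cat => //; apply: (vals_ext hm he1).
- move=> gn; case E: (F x) => [y|] //; move/hF/hw: E => /(_ f wf); by rewrite gn.
move=> v m2 _ [h1 h2 [y gy py]]; split=> //; first exact: ext_trans he1 h2.
by exists y => //; apply/hF; exists f.
Qed.

Theorem REC_computes (U : zfc_universe) n (F : classfun U n) : REC F -> exists sz prog, computes F sz prog.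
Proof.
elim=> {n F} [F hF|n i F hF|F hF|F h1 h2|m n G H F _ [sg [g hg]] _ [sh [h hh]] hF|m n G H F _ [sg [g hg]] _ [sh [h hh]] hF
  |n G F _ [sg [g hg]] hF|n G F _ [sg [g hg]] hF|n G F _ [sg [g hg]] hw hF].
- by do 2 eexists; apply: computes_zero.
- by do 2 eexists; apply: (computes_proj hF).
- by do 2 eexists; apply: computes_adjoin.
- by do 2 eexists; apply: computes_cond.
- do 2 eexists; apply: (computes_comp (keep := false) hg hh) => [x y w|x y hx]; last first.
    by case E: (F _) => [z|] //; move/hF: E => [w [hw _]]; rewrite hx in hw.
  exists [tuple of w :: y] => // hx; case E: (G _) => [z|]; first by apply/hF; exists w.
  by case E': (F _) => [z|] //; move/hF: E' => [w' [hw]]; rewrite hx in hw; case: hw => <-; rewrite E.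
- do 2 eexists; apply: (computes_comp (keep := true) hg hh) => [x y w|x y hx]; last first.
    by case E: (F _) => [z|] //; move/hF: E => [w [hw _]]; rewrite hx in hw.
  exists [tuple of x ++ w :: y] => // hx; case E: (G _) => [z|]; first by apply/hF; exists w.
  by case E': (F _) => [z|] //; move/hF: E' => [w' [hw]]; rewrite hx in hw; case: hw => <-; rewrite E.
- by do 2 eexists; apply: (computes_rec hg hF).
- by do 2 eexists; apply: (computes_mu hg hF).
- by do 2 eexists; apply: (computes_woo hg hw hF).
Qed.

(** * Classes of sequences that are sets, and canonical codes *)

Lemma mkseqS (T : Type) (h : nat -> T) n : mkseq h n.+1 = h 0 :: mkseq (fun i => h i.+1) n.
Proof. by rewrite /mkseq /= (iotaDl 1 0) -map_comp. Qed.

Section Enum.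
Variable U : zfc_universe.
Local Notation ON := (ON U).

(** Zermelo's argument: new elements of [x] are chosen along the ordinals, and by [no_inj] this
    comes to an end. *)
Lemma enum_ex (x : U) : exists (f : ON -> U) (a : ON), [/\ forall b, olt b a -> f b ∈ x,
  forall y, y ∈ x -> exists b, olt b a /\ f b = y & forall b c, olt b a -> olt c a -> f b = f c -> b = c].
Proof.
have [f hf] := @wf_rec U U empty (fun a f y => y ∈ x /\ forall b, olt b a -> f b <> y) ltac:(by
  move=> a f g y eq [yx h]; split=> // b ba; rewrite -eq //; exact: h).
pose ok a := exists y, y ∈ x /\ forall b, olt b a -> f b <> y.
have [a0 ha0] : exists a, ~ ok a.
  apply: NNPP => na; have all a : ok a by apply: NNPP => k; apply: na; exists a.
  apply: (@no_inj U x f) => [a|a b eab]; first by case: (hf a (all a)).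
  case: (olt_total a b) => // hab; first by case: (hf b (all b)) => _ /(_ _ hab).
  by case: (hf a (all a)) => _ /(_ _ hab) [].
have [a [ha hl]] := least (P := fun a => ~ ok a) ha0.
have hok b : olt b a -> ok b by move=> /hl/NNPP.
exists f, a; split.
- by move=> b /hok/hf[].
- by move=> y yx; apply: NNPP => k; apply: ha; exists y; split=> // b ba fb; apply: k; exists b.
- move=> b c ba ca e; case: (olt_total b c) => // h; first by case: (hf c (hok c ca)) => _ /(_ _ h).
  by case: (hf b (hok b ba)) => _ /(_ _ h) [].
Qed.

End Enum.

Section Seqs.
Variable U : zfc_universe.
Local Notation ON := (ON U).
Implicit Types (s t : seq ON).

Lemma omega_ex : exists w : ON, forall b, olt b w <-> exists n, b = onat U n.
Proof.
have [x [x0 xS]] := infinity U.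
have xn n : sval (onat U n) ∈ x by elim: n => //= n; apply: xS.
have [w hw] := separation x (fun z => exists n, z = sval (onat U n)).
have inw n : sval (onat U n) ∈ w by apply/hw; split; [apply: xn|exists n].
have below n (b : ON) : olt b (onat U n) -> exists k, b = onat U k.
  elim: n => [|n ih] /=; first by move=> /olt0.
  by move=> /oltS[/ih|->] //; exists n.
have ow : ordinal w.
  split=> [y z zy /hw[_ [n e]]|y z /hw[_ [n ->]] /hw[_ [k ->]]].
    rewrite e in zy; have [b [<- hb]] := olt_mem zy; have [k ->] := below n b hb; exact: inw.
  by case: (olt_total (onat U n) (onat U k)) => h; [constructor 1|constructor 2; rewrite h|constructor 3].
exists (omk ow) => b; split=> [/hw[_ [n e]]|[n ->]]; last exact: inw.
by exists n; apply: on_eq.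
Qed.

Lemma nat_bound (f : nat -> ON) : exists b, forall n, olt (f n) b.
Proof.
have [w hw] := omega_ex.
have [|b hb] := @bounded_rel U w (fun x y => exists n, x = onat U n /\ y = f n).
  by move=> x y z _ [n [-> ->]] [k [/onat_inj <- ->]].
exists (osucc b) => n; apply/oltS; apply: (hb (onat U n)); last by exists n.
by apply/hw; exists n.
Qed.

(** Iterated pairing; the successor separates the empty sequence from the others. *)
Fixpoint sq s : ON := if s is a :: s' then osucc (pr a (sq s')) else ozero U.

Lemma sq_inj s t : sq s = sq t -> s = t.
Proof.
elim: s t => [|a s ih] [|b t] //=.
- by move=> e; have := olt_succ (pr b (sq t)); rewrite -e => /olt0.
- by move=> e; have := olt_succ (pr a (sq s)); rewrite e => /olt0.
- by move=> /osucc_inj/pr_inj[-> /ih ->].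
Qed.

Fixpoint below al s := if s is a :: s' then olt a al /\ below al s' else True.

(** For each length the codes are bounded by an iterated supremum, and the countably many bounds
    have a common one by [nat_bound]. *)
Lemma sq_bound al : exists b, forall s, below al s -> olt (sq s) b.
Proof.
have h n : exists b, forall s, size s = n -> below al s -> olt (sq s) b.
  elim: n => [|n [b hb]]; first by exists (osucc (ozero U)) => -[] //= _ _; apply: olt_succ.
  exists (osucc (sup al (fun a => sup b (fun c : ON => osucc (pr a c))))) => -[|a s] //= [sz] [la bs].
  apply/oltS; apply: ole_trans (le_sup (fun a => sup b (fun c : ON => osucc (pr a c))) la).
  by apply: (le_sup (fun c => osucc (pr a c))); apply: hb.
pose f n := proj1_sig (cid _ (h n)).
have fP n s : size s = n -> below al s -> olt (sq s) (f n) := proj2_sig (cid _ (h n)) s.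
have [b hb] := nat_bound f; exists b => s bs; apply: olt_trans (hb (size s)); exact: fP.
Qed.

Lemma is_set_below al (P : seq ON -> Prop) : (forall s, P s -> below al s) -> is_set U P.
Proof.
move=> h; have [b hb] := sq_bound al; exists (sval b), (fun s => sval (sq s)); split=> [s /h/hb //|s t _ _ e].
by apply: sq_inj; apply: on_eq.
Qed.

(** Each component injects into an ordinal by [enum_ex]. The number of the component and this
    ordinal are coded together as a sequence of length two. *)
Lemma is_set_cells (P : cell U -> Prop) n : (forall (c : nat) s, P (c, s) -> c < n) ->
  (forall c : nat, c < n -> is_set U (fun s => P (c, s))) -> is_set U P.
Proof.
move=> hn hP.
have hb (c : nat) : exists b : ON, exists e : seq ON -> ON, forall s, P (c, s) -> olt (e s) b /\ forall t, P (c, t) -> e s = e t -> s = t.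
  case: (ltnP c n) => [cn|nc]; last first.
    by exists (ozero U), (fun _ => ozero U) => s /hn; rewrite ltnNge nc.
  have [x [e [h1 h2]]] := hP c cn.
  have [f [a [f1 f2 f3]]] := enum_ex x.
  pose g y := epsilon (inhabits (ozero U)) (fun b => olt b a /\ f b = y).
  have gP y : y ∈ x -> olt (g y) a /\ f (g y) = y.
    by move=> yx; apply: (epsilon_spec (inhabits (ozero U)) (fun b => olt b a /\ f b = y)); apply: f2.
  have g1 y : y ∈ x -> olt (g y) a by case/gP.
  have g2 y z : y ∈ x -> z ∈ x -> g y = g z -> y = z by move=> /gP[_ {2}<-] /gP[_ {2}<-] ->.
  exists a, (fun s => g (e s)) => s ps; split; first by apply: g1; apply: h1.
  by move=> t pt eg; apply: h2 => //; apply: g2 => //; apply: h1.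
pose bf c := proj1_sig (cid _ (hb c)).
have hbf c := proj2_sig (cid _ (hb c)).
pose ef c := proj1_sig (cid _ (hbf c)).
have hef c s : P (c, s) -> olt (ef c s) (bf c) /\ forall t, P (c, t) -> ef c s = ef c t -> s = t :=
  proj2_sig (cid _ (hbf c)) s.
have [al hal] := nat_bound bf; have [w hw] := omega_ex.
pose mx := if lem (olt al w) then w else al.
have [m1 m2] : ole al mx /\ ole w mx.
  rewrite /mx; case: (classic (olt al w)) => h; rewrite ?(ifT _ _ h) ?(ifF _ _ h); split; try exact: ole_refl; first by left.
  by apply/oltNge.
have [b h] := sq_bound mx; exists (sval b), (fun c => sval (sq [:: onat U c.1; ef c.1 c.2])); split=> [[c s] ps|[c s] [c' s'] ps ps' e].
  apply: h => /=; split; [|split=> //].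
    by apply: olt_le_trans m2; apply/hw; exists c.
  by apply: olt_le_trans m1; apply: olt_trans (hal c); case: (hef c s ps).
have /sq_inj[/onat_inj ec es] := on_eq e.
by subst c'; case: (hef c s ps) => _ /(_ s' ps' es) ->.
Qed.

End Seqs.

Section Wellorder.
Variable U : zfc_universe.

Lemma trcl_ex (x : U) : exists t, is_trcl x t.
Proof.
have [w hw] := omega_ex U.
have [|s hs] := @replacement U (sval w) (fun y z => exists n, y = sval (onat U n) /\ z = iter n (@union U) x).
  by move=> y z z' _ [n [-> ->]] [k [e ->]]; have /onat_inj -> := on_eq e.
have uP z : z ∈ union s <-> exists n, z ∈ iter n (@union U) x.
  rewrite unionP; split=> [[v [zv /hs[_ [_ [n [_ e]]]]]]|[n zn]]; first by exists n; rewrite -e.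
  exists (iter n (@union U) x); split=> //; apply/hs; exists (sval (onat U n)); split; last by exists n.
  by apply/(hw (onat U n)); exists n.
exists (union s); split.
- move=> y z zy /uP[n yn]; apply/uP; exists n.+1 => /=; apply/unionP; by exists y.
- by move=> y yx; apply/uP; exists 0.
- move=> t ht hx y /uP[n]; elim: n y => [|n ih] y /=; first exact: hx.
  by move=> /unionP[z [yz /ih zt]]; apply: ht yz zt.
Qed.

End Wellorder.

(* The tree of a set [y] when the members of its transitive closure are listed,
   without repetition, by [g] on [dom]. *)
Section SetTree.
Variable U : zfc_universe.
Local Notation ON := (ON U).
Variables (g : ON -> U) (dom : ON -> Prop) (al : ON) (P : U -> Prop).
Hypothesis dom_lt : forall j, dom j -> olt j al.
Hypothesis P_dom : forall y z, P y -> z ∈ y -> exists j, dom j /\ g j = z.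
Hypothesis P_mem : forall y z, P y -> z ∈ y -> P z.

Definition kids y j := dom j /\ g j ∈ y.

(** Branch [a] at [y] leads to the member preceded by exactly [a] others in the order of indices,
    which [ct] counts. The construction serves twice: with an enumeration of the transitive closure
    for canonical codes, and with the canonical rows of the heap for the output. *)
Fixpoint stree y (s : seq ON) := if s is a :: s' then exists j, [/\ kids y j, ct (kids y) j = a & stree (g j) s'] else True.

Definition kid y a := epsilon (inhabits (ozero U)) (fun j => kids y j /\ ct (kids y) j = a).
Fixpoint label y (s : seq ON) := if s is a :: s' then label (g (kid y a)) s' else y.

Lemma kidE y j : kids y j -> kid y (ct (kids y) j) = j.
Proof.
move=> kj; have [k1 k2] := epsilon_spec (inhabits (ozero U)) (fun i => kids y i /\ ct (kids y) i = ct (kids y) j)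
  (ex_intro _ j (conj kj erefl)).
exact: (ct_inj k1 kj k2).
Qed.

Lemma stree_cat y s t : P y -> stree y (s ++ t) <-> stree y s /\ stree (label y s) t.
Proof.
elim: s y => [|a s ih] y py /=; first by tauto.
have pk j : kids y j -> P (g j) by case=> _; apply: P_mem.
split=> [[j [kj <- h]]|[[j [kj <- h]] h2]].
  rewrite kidE //; have [h1 h2] := proj1 (ih (g j) (pk j kj)) h; split=> //; by exists j.
by rewrite kidE // in h2; exists j; split=> //; apply/ih => //; apply: pk.
Qed.

Lemma label_rcons y s a : label y (rcons s a) = g (kid (label y s) a).
Proof. by elim: s y => [|b s ih] y //=. Qed.

Lemma label_P y s : P y -> stree y s -> P (label y s).
Proof.
elim: s y => [|a s ih] y py //= [j [kj <- h]]; rewrite kidE //; apply: ih => //; apply: P_mem py _; by case: kj.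
Qed.

Lemma stree_rcons y s a : P y -> stree y (rcons s a) <-> stree y s /\ exists j, kids (label y s) j /\ ct (kids (label y s)) j = a.
Proof.
move=> py; rewrite -cats1 stree_cat //=.
by split=> -[h1 [j h2]]; split=> //; exists j; [case: h2|case: h2].
Qed.

Lemma stree_below y s : P y -> stree y s -> below (osucc al) s.
Proof.
elim: s y => [|a s ih] y py //= [j [kj <- h]]; split; last by apply: (ih (g j)) => //; apply: P_mem py _; case: kj.
apply/oltS.
have hle : forall i, ole (ct (kids y) i) i.
  apply: on_ind => [|i hi|l ll hl]; first by rewrite /ct titer0; apply: ole_refl.
    case: (classic (kids y i)) => ki; first by rewrite ctS //; apply/oleS/oltS.
    by rewrite ctN //; apply: ole_trans hi _; left.
  rewrite /ct titerL //; apply: sup_le => i il; apply: ole_trans (hl i il) _; by left.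
apply: ole_trans (hle j) _; left; apply: dom_lt; by case: kj.
Qed.

(** Among the listed sets whose tree has an infinite branch, foundation yields a minimal one; the
    first node on its branch is a member with the same property. *)
Lemma stree_wf y : P y -> ~ exists h : nat -> ON, forall n, stree y (mkseq h n).
Proof.
have key j : dom j -> P (g j) -> ~ exists h : nat -> ON, forall n, stree (g j) (mkseq h n).
  move=> dj pj bad.
  have [|s hs] := @replacement U (sval al) (fun u z => exists i, [/\ sval i = u, dom i, z = g i, P z & exists h : nat -> ON, forall n, stree z (mkseq h n)]).
    by move=> u z z' _ [i [e1 _ -> _ _]] [i' [e2 _ -> _ _]]; have -> : i = i' by apply: on_eq; rewrite e1 e2.
  have [|z [/hs[u [_ [i [_ di ez pz [h hh]]]]] hmin]] := @foundation U s.
    by exists (g j); apply/hs; exists (sval j); split; [apply: dom_lt|exists j].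
  have /= [k [kk ek _]] := hh 1.
  apply: (hmin (g k)); first by case: kk.
  apply/hs; exists (sval k); split; first by apply: dom_lt; case: kk.
  exists k; split=> //; [by case: kk|by apply: P_mem pz _; case: kk|].
  exists (fun n => h n.+1) => n; have := hh n.+1; rewrite mkseqS /= => -[k' [kk' ek' hk]].
  by have -> : k = k' by apply: (ct_inj kk kk'); rewrite ek ek'.
move=> py [h hh]; have /= [j [kj ej _]] := hh 1.
apply: (key j); [by case: kj|by apply: P_mem py _; case: kj|].
exists (fun n => h n.+1) => n; have := hh n.+1; rewrite mkseqS /= => -[k' [kk' ek' hk]].
by have -> : j = k' by apply: (ct_inj kj kk'); rewrite ej ek'.
Qed.

Lemma stree_code y : P y -> basic_code (stree y).
Proof.
move=> py; split=> //.
- by apply: (is_set_below (al := osucc al)) => s; apply: stree_below.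
- by move=> s t /(stree_cat _ _ py)[].
- move=> s a b /(stree_rcons _ _ py)[h [j [kj ej]]] ba; apply/(stree_rcons _ _ py); split=> //.
  rewrite -ej in ba; have [i [_ ki ei]] := ct_onto ba; by exists i.
- exact: stree_wf.
Qed.

Lemma label_kids y s : P y -> stree y s -> forall z, z ∈ label y s <-> exists a, stree y (rcons s a) /\ z = label y (rcons s a).
Proof.
move=> py hs z; split=> [zl|[a [/(stree_rcons _ _ py)[_ [j [kj <-]]] ->]]]; last first.
  by rewrite label_rcons kidE //; case: kj.
have [j [dj ej]] := P_dom (label_P py hs) zl; have kj : kids (label y s) j by split=> //; rewrite ej.
exists (ct (kids (label y s)) j); split; last by rewrite label_rcons kidE.
by apply/(stree_rcons _ _ py); split=> //; exists j.
Qed.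

Lemma stree_Decode y : P y -> Decode (stree y) y.
Proof. by move=> py; exists (label y); split=> // s; apply: label_kids. Qed.

Lemma stree_induced x f : P x -> (forall j, dom j -> kpair (g j) (sval j) ∈ f) -> induced_code x f (stree x).
Proof.
move=> px hf; split; first exact: stree_code.
exists (label x); split=> // s hs; set y := label x s.
have ctl j : kids y j -> olt (ct (kids y) j) (ct (kids y) al) by move=> kj; apply: ct_lt => //; apply: dom_lt; case: kj.
have kP b : olt b (ct (kids y) al) -> kids y (kid y b) /\ ct (kids y) (kid y b) = b.
  by move=> /ct_onto[j [_ kj <-]]; rewrite kidE.
exists (ct (kids y) al), (fun b => g (kid y b)); split.
- split.
  + by move=> b /kP[[]].
  + move=> z zy; have [j [dj ej]] := P_dom (label_P px hs) zy; have kj : kids y j by split=> //; rewrite ej.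
    by exists (ct (kids y) j); rewrite kidE //; split=> //; apply: ctl.
  + move=> b c bc ca; have [k1 e1] := kP b (olt_trans bc ca); have [k2 e2] := kP c ca.
    exists (sval (kid y b)), (sval (kid y c)); split.
    * by apply: hf; case: k1.
    * by apply: hf; case: k2.
    * case: (olt_total (kid y b) (kid y c)) => // [e|h].
        by rewrite -e1 -e2 e in bc; case: (olt_irr bc).
      by have := ct_lt k2 h; rewrite e1 e2 => /(olt_trans bc)/olt_irr.
- move=> b; split; last by rewrite label_rcons.
  rewrite stree_rcons //; split=> [[_ [j [kj <-]]]|/kP[k e]]; first exact: ctl.
  by split=> //; exists (kid y b).
Qed.

End SetTree.

Lemma canonical_ex (U : zfc_universe) n (x : n.-tuple U) : 0 < n -> exists X, canonical_code x X.
Proof.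
move=> n0.
have h y : exists X : seq (ON U) -> Prop, basic_code X /\ exists t f, [/\ is_trcl y t, woo t f & induced_code y f X].
  have [t ht] := trcl_ex y; have [g [al [h1 h2 h3]]] := enum_ex t; have [ttr yt tmin] := ht.
  have [|f hf] := @replacement U (sval al) (fun u p => exists j, sval j = u /\ p = kpair (g j) (sval j)).
    by move=> u p q _ [j [e1 ->]] [j' [e2 ->]]; have -> : j = j' by apply: on_eq; rewrite e1 e2.
  have fP p : p ∈ f <-> exists j, olt j al /\ p = kpair (g j) (sval j).
    rewrite hf; split=> [[u [ua [j [e ->]]]]|[j [ja ->]]]; first by exists j; rewrite /olt e.
    by exists (sval j); split=> //; exists j.
  pose P z := forall w, w ∈ z -> w ∈ t.
  have hi : induced_code y f (stree g (fun j => olt j al) y).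
    apply: (@stree_induced U g _ al P) => //.
    + by move=> z w pz /pz/h2[j [ja e]]; exists j.
    + by move=> z w pz /pz wt v vw; apply: ttr vw wt.
    + by move=> j ja; apply/fP; exists j.
  exists (stree g (fun j => olt j al) y); split; first by case: hi.
  exists t, f; split=> //; exists al; split.
  - by move=> p /fP[j [ja ->]]; exists (g j), (sval j); split=> //; apply: h1.
  - move=> z zt; have [j [ja <-]] := h2 z zt; exists (sval j); split; first by split=> //; apply/fP; exists j.
    by move=> v [_ /fP[i [ia /kpair_inj[e ->]]]]; rewrite (h3 j i).
  - move=> z za; have [j [<- ja]] := olt_mem za; exists (g j); split.
      by split; [apply: h1|apply/fP; exists j].
    by move=> v [_ /fP[i [ia /kpair_inj[-> e]]]]; rewrite (on_eq e).
pose X0 y := proj1_sig (cid _ (h y)).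
have hX y : basic_code (X0 y) /\ exists t f, [/\ is_trcl y t, woo t f & induced_code y f (X0 y)] :=
  proj2_sig (cid _ (h y)).
pose X (c : cell U) := if lem (c.1 < n /\ X0 (nth empty x c.1) c.2) then mk1 else mk0.
have XE c s : X (c, s) <> mk0 <-> c < n /\ X0 (nth empty x c) s.
  rewrite /X /=; case: (classic (c < n /\ X0 (nth empty x c) s)) => hc; rewrite ?(ifT _ _ hc) ?(ifF _ _ hc) //.
have CE c : c < n -> component X c = X0 (nth empty x c).
  move=> cn; apply: predext => s.
  by rewrite /component XE; tauto.
exists X; split.
- split=> //.
  + apply: (@is_set_cells U _ n) => [c s /XE[] //|c cn].
    have [[hs _ _ _ _] _] := hX (nth empty x c); case: hs => s0 [e [e1 e2]]; exists s0, e.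
    by split=> [s /XE[_ /e1]|s t /XE[_ h1] /XE[_ h2]] //; apply: e2.
  + by move=> c cn; rewrite CE //; case: (hX (nth empty x c)).
  + by move=> c nc s /XE[]; rewrite ltnNge nc.
- move=> c; rewrite /X; case: (classic (c.1 < n /\ X0 (nth empty x c.1) c.2)) => hc; rewrite ?(ifT _ _ hc) ?(ifF _ _ hc); [by right|by left].
- move=> i; rewrite CE // (tnth_nth empty); by case: (hX (nth empty x i)).
Qed.

(** * Erasing trees *)

(* Erases the cells in lexicographic order up to the next star. *)
Definition erase_step := Act (fun k => match k with
  | mkstar => (mkstar, mvS, 1) | mk0 => (mk0, mvUPlus, 0) | _ => (mk0, mvZ, 0) end).
Definition erase := Loop erase_step.

Section Trees.
Variable U : zfc_universe.
Local Notation ON := (ON U).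

(** The properties of a tree on which erasing and traversal rely. They hold of basic codes and also
    of the components that store registers and tables. *)
Record shape N : Prop := Shape {
  sh_prefix : forall s t, N (s ++ t) -> N s;
  sh_left : forall s a b, N (rcons s a) -> olt b a -> N (rcons s b);
  sh_bound : forall s, exists a, ~ N (rcons s a);
  sh_wf : ~ exists h : nat -> ON, forall n, N (mkseq h n) }.

(** A node with children at all ordinals would inject [ON] into a set. *)
Lemma basic_shape N : basic_code N -> shape N.
Proof.
move=> [[x [e [e1 e2]]] n0 hp hl hw]; split=> // s; apply: NNPP => h.
have all a : N (rcons s a) by apply: NNPP => k; apply: h; exists a.
apply: (@no_inj U x (fun a => e (rcons s a))) => [a|a b eab]; first exact: e1.
by have /rcons_inj[] := e2 _ _ (all a) (all b) eab.
Qed.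

(* The order type of the children of a node. *)
Lemma shape_type N s : shape N -> exists l, forall a, N (rcons s a) <-> olt a l.
Proof.
move=> hN; have [a ha] := sh_bound hN s; have [l [hl hm]] := least (P := fun a => ~ N (rcons s a)) ha.
exists l => b; split=> [nb|/hm/NNPP //].
case: (ole_olt l b) => // -[lb|e]; last by rewrite e in hl.
by case: hl; apply: sh_left nb lb.
Qed.

(** Bar induction: a node violating [P] has a child violating it, and choosing such children yields
    an infinite branch. *)
Lemma shape_ind N (P : seq ON -> Prop) : shape N ->
  (forall s, N s -> (forall a, N (rcons s a) -> P (rcons s a)) -> P s) -> forall s, N s -> P s.
Proof.
move=> hN ih s0 ns0; apply: NNPP => np0.
have next s : {a | N s -> ~ P s -> N (rcons s a) /\ ~ P (rcons s a)}.
  apply: cid; case: (classic (N s /\ ~ P s)) => [[ns np]|h]; last first.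
    by exists (ozero U) => h1 h2; case: h.
  apply: NNPP => h; apply: np; apply: ih => // a na; apply: NNPP => npa; apply: h; by exists a.
pose F n := iter n (fun s => rcons s (proj1_sig (next s))) s0.
have FP n : N (F n) /\ ~ P (F n).
  elim: n => [|n [h1 h2]] //=; exact: (proj2_sig (next (F n)) h1 h2).
have Fsz n : size (F n) = size s0 + n by elim: n => [|n e] /=; rewrite ?addn0 // size_rcons e addnS.
have Fpre n k : take (size (F n)) (F (n + k)) = F n.
  elim: k => [|k e]; first by rewrite addn0 take_size.
  rewrite addnS /= -cats1 take_cat !Fsz; case: ltnP => h; first by rewrite -Fsz.
  have -> : k = 0 by lia.
  by rewrite addn0 subnn take0 cats0.
apply: (sh_wf hN); exists (fun n => nth (ozero U) (F n.+1) n) => n.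
have -> : mkseq (fun n => nth (ozero U) (F n.+1) n) n = take n (F n).
  apply: (@eq_from_nth _ (ozero U)); first by rewrite size_mkseq size_takel // Fsz leq_addl.
  move=> i; rewrite size_mkseq => hi; rewrite nth_mkseq // nth_take //.
  by rewrite -{1}(Fpre i.+1 (n - i.+1)) subnKC // nth_take // Fsz; lia.
by apply: (sh_prefix hN (t := drop n (F n))); rewrite cat_take_drop; case: (FP n).
Qed.

End Trees.

Section Erase.
Variables (U : zfc_universe) (M : machine) (X0 : tape U).
Local Notation ON := (ON U).
Local Notation cell := (cell U).
Local Notation tape := (tape U).
Local Notation reach := (@reach U M X0).
Implicit Types (X Y : tape).

Lemma reach_step o lb f h X k mv h' D : f (X h) = (k, mv, 0) -> moves mv (cell_seq h) (cell_seq h') -> o (X h) <= o k -> cle lb h ->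
  reach false o lb (Act f) h X (fun h1 X1 => h1 = h' /\ X1 = upd X h k) D.
Proof.
move=> ef mvs ok hlb.
apply: (@reach_weak _ _ _ true false o lb lb _ _ _ (fun h1 X1 => h1 = h' /\ X1 = upd X h k) _ D D) => //.
by apply: reach_iter => //; apply: (exec_act (k := k) (mv := mv) (v := 0) (h' := h')).
Qed.

Definition zap Y c s : tape := fun d => if lem (d.1 = c /\ exists u, d.2 = s ++ u) then mk0 else Y d.
Definition zaps Y c s l : tape := fun d =>
  if lem (d.1 = c /\ exists b u, olt b l /\ d.2 = rcons s b ++ u) then mk0 else Y d.

Lemma tape_ext Y Y' : (forall c s, Y (c, s) = Y' (c, s)) -> Y = Y'.
Proof. by move=> h; apply: funext => -[c s]. Qed.

Lemma zaps0 Y c s : zaps Y c s (ozero U) = Y.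
Proof. by apply: tape_ext => c' u; rewrite /zaps ifF // => -[_ [b [v [/olt0]]]]. Qed.

Lemma zaps_out Y c s l c' u : ~ (c' = c /\ exists b v, olt b l /\ u = rcons s b ++ v) -> zaps Y c s l (c', u) = Y (c', u).
Proof. by move=> h; rewrite /zaps ifF. Qed.

Lemma zapsS Y c s l : zap (zaps Y c s l) c (rcons s l) = zaps Y c s (osucc l).
Proof.
apply: tape_ext => c' u; rewrite /zap /zaps /=.
case: (classic (c' = c /\ exists v, u = rcons s l ++ v)) => [h|h].
  rewrite (ifT _ _ h) ifT //; case: h => -> [v ->]; split=> //; exists l, v; split=> //; exact: olt_succ.
rewrite (ifF _ _ h); case: (classic (c' = c /\ exists b v, olt b l /\ u = rcons s b ++ v)) => h2.
  rewrite (ifT _ _ h2) ifT //; case: h2 => -> [b [v [bl ->]]]; split=> //; exists b, v; split=> //; by apply/oltS; left.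
rewrite (ifF _ _ h2) ifF // => -[e [b [v [/oltS[bl|eb] eu]]]]; first by apply: h2; split=> //; exists b, v.
by apply: h; split=> //; exists v; rewrite -eb.
Qed.

Lemma rcons_cat_inj s a b (u v : seq ON) : rcons s a ++ u = rcons s b ++ v -> a = b /\ u = v.
Proof. by elim: s => [|x s ih] /= [] // => [-> ->|/ih]. Qed.

Variables (c : nat) (N : seq ON -> Prop).
Hypothesis hN : shape N.

(** The head enters a node, erases its subtree and leaves for the next sibling. It moves upwards in
    lexicographic order all the time, so at a limit it stands at the limit child; the marks only
    drop, hence [rkd]. *)
Definition erases_node s := forall p a Y, s = rcons p a -> (forall u, Y (c, s ++ u) <> mk0 <-> N (s ++ u)) ->
  (forall u, Y (c, s ++ u) <> mkstar) ->
  reach false rkd (c, s) erase_step (c, s) Y (fun h Y' => h = (c, rcons p (osucc a)) /\ Y' = zap Y c s) False.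

Lemma erase_children s Y l : (forall a, N (rcons s a) -> erases_node (rcons s a)) ->
  (forall a, N (rcons s a) <-> olt a l) ->
  (forall a u, Y (c, rcons s a ++ u) <> mk0 <-> N (rcons s a ++ u)) -> (forall a u, Y (c, rcons s a ++ u) <> mkstar) ->
  reach false rkd (c, rcons s (ozero U)) erase_step (c, rcons s (ozero U)) Y (fun h Y' => h = (c, rcons s l) /\ Y' = zaps Y c s l) False.
Proof.
move=> ih hl hY hS.
have R : reach false rkd (c, rcons s (ozero U)) erase_step (c, rcons s (ozero U)) Y
    (fun h' X' => h' = (c, rcons s l) /\ exists g : unit, X' = zaps Y c s l /\ True) False.
  apply: (@reach_tf _ _ _ unit rkd _ erase_step (fun b => (c, rcons s b)) (fun b _ X' => X' = zaps Y c s b) (fun _ _ _ _ => True) l tt Y False) => //.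
  - exact: rkd_ok.
  - by move=> b b' bb' _; apply: cle_rcons.
  - by move=> k e _ lk h; apply: cle_lub.
  - by rewrite zaps0.
  - move=> b _ Z bl ->.
    have out u : zaps Y c s b (c, rcons s b ++ u) = Y (c, rcons s b ++ u).
      by apply: zaps_out => -[_ [b' [v [lb e]]]]; have [e2 _] := rcons_cat_inj e; rewrite e2 in lb; case: (olt_irr lb).
    have nb : N (rcons s b) by apply/hl.
    apply: (reach_weak (@ih b nb s b (zaps Y c s b) erefl _ _)) => //.
    + by move=> u; rewrite out; apply: hY.
    + by move=> u; rewrite out; apply: hS.
    + by move=> h' X' _ [-> ->]; split=> //; exists tt; rewrite zapsS.
  - move=> k gs Xs Xl _ lk hI _ hX _; exists tt; split=> //.
    apply: tape_ext => c' u; have [g [gk hg]] := hX (c', u).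
    case: (classic (c' = c /\ exists b v, olt b k /\ u = rcons s b ++ v)) => h.
      have [b [v [bk eu]]] := proj2 h; have sb := proj2 lk b bk.
      have [m [mk1 mk2 mk3]] : exists m, [/\ olt m k, ole g m & olt b m].
        case: (ole_olt g (osucc b)) => hh; [exists (osucc b)|exists g]; split=> //; try exact: olt_succ.
        by apply: olt_trans (olt_succ b) hh.
      rewrite -(hg m mk2 mk1) (hI m mk1) /zaps !ifT //=; case: h => -> _; split=> //; by exists b, v.
    rewrite zaps_out // -(hg g (ole_refl g) gk) (hI g gk) zaps_out // => -[e [b [v [bg eu]]]].
    by apply: h; split=> //; exists b, v; split=> //; apply: olt_trans bg gk.
apply: (reach_weak R) => //.
by move=> h' X' _ [-> [_ [-> _]]].
Qed.

Lemma erase_enter s Y : Y (c, s) <> mk0 -> Y (c, s) <> mkstar ->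
  reach false rkd (c, s) erase_step (c, s) Y (fun h Y' => h = (c, rcons s (ozero U)) /\ Y' = upd Y (c, s) mk0) False.
Proof.
move=> h0 hs; apply: (reach_step (mv := mvZ)) => //.
- by case: (Y (c, s)) h0 hs.
- exact: (moves_z (cell_seq (c, s))).
- by case: (Y (c, s)).
Qed.

Lemma zap_enter s Y l : (forall b u, ~ olt b l -> Y (c, rcons s b ++ u) = mk0) -> zaps (upd Y (c, s) mk0) c s l = zap Y c s.
Proof.
move=> h; apply: tape_ext => c' u; rewrite /zap /zaps /=.
case: (classic (c' = c /\ exists v, u = s ++ v)) => [[-> [v ->]]|hn].
  rewrite [RHS]ifT; last by split=> //; exists v.
  case: v => [|b v].
    rewrite cats0 ifF ?upd_eq // => -[_ [b [v [_ e]]]].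
    by have := f_equal size e; rewrite size_cat size_rcons; lia.
  case: (classic (olt b l)) => bl; first by rewrite ifT //; split=> //; exists b, v; rewrite cat_rcons.
  rewrite ifF; first (rewrite upd_neq -?cat_rcons; [exact: h|move=> -[e]; have := f_equal size e; rewrite size_cat size_rcons; lia]).
  move=> [_ [b' [v' [bl' e]]]]; rewrite -cat_rcons in e; have [e2 _] := rcons_cat_inj e; by subst b'.
rewrite (ifF _ _ hn) ifF; last by move=> [e [b [v [_ e2]]]]; apply: hn; split=> //; exists (b :: v); rewrite e2 cat_rcons.
by rewrite upd_neq // => -[e1 e2]; apply: hn; split=> //; exists [::]; rewrite e2 cats0.
Qed.

Lemma sub_blank s l b u : (forall a, N (rcons s a) <-> olt a l) -> ~ olt b l -> ~ N (rcons s b ++ u).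
Proof. by move=> hl nb /(sh_prefix hN)/hl. Qed.

(** Once the children are gone the head is at the first missing child. This cell is blank, and
    [mvUPlus] leads from it to the next sibling of the node. *)
Lemma erase_node s : N s -> erases_node s.
Proof.
move: s; apply: (shape_ind hN) => s ns ih p a Y es hY hS.
have [l hl] := shape_type s hN.
have hY0 := hY [::]; have hS0 := hS [::]; rewrite cats0 in hY0 hS0.
have yb b u : ~ olt b l -> Y (c, rcons s b ++ u) = mk0.
  move=> nb; apply: NNPP; rewrite cat_rcons => /hY; rewrite -cat_rcons; exact: (sub_blank hl).
have out b u : upd Y (c, s) mk0 (c, rcons s b ++ u) = Y (c, rcons s b ++ u).
  by rewrite upd_neq // => -[e]; have := f_equal size e; rewrite size_cat size_rcons; lia.
apply: (reach_trans (erase_enter (s := s) _ _)) => //; first exact/hY0.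
move=> _ _ _ [-> ->].
have lbz : cle (c, s) (c, rcons s (ozero U)) by rewrite -cats1; apply: cle_cat.
have R := @erase_children s (upd Y (c, s) mk0) l ih hl.
apply: (reach_trans (P' := fun h Y' => h = (c, rcons s l) /\ Y' = zap Y c s)).
  apply: (reach_weak (R _ _)) => //.
  - by move=> b u; rewrite out cat_rcons; apply: hY.
  - by move=> b u; rewrite out cat_rcons; apply: hS.
  - by move=> h' X' _ [-> ->]; split=> //; apply: zap_enter.
move=> _ _ _ [-> ->].
have lbl : cle (c, s) (c, rcons s l) by rewrite -cats1; apply: cle_cat.
have zb : zap Y c s (c, rcons s l) = mk0 by rewrite /zap ifT //=; split=> //; exists [:: l]; rewrite cats1.
apply: (reach_weak (reach_step (k := mk0) (mv := mvUPlus) (h' := (c, rcons p (osucc a))) (lb := (c, s)) False _ _ _ _)) => //; rewrite ?zb //.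
- rewrite es /cell_seq /= -!rcons_cons; exact: (moves_uplus (onat U c :: p) a l).
- by move=> h' X' _ [-> ->]; split=> //; rewrite upd_idE.
Qed.

(** The root is already blank here. From the first missing child of the root [mvUPlus] increments
    the component number, so the pass goes on in the next component. *)
Lemma erase_below Y : (forall a u, Y (c, a :: u) <> mk0 <-> N (a :: u)) -> (forall a u, Y (c, a :: u) <> mkstar) -> Y (c, [::]) = mk0 ->
  reach false rkd (c, [:: ozero U]) erase_step (c, [:: ozero U]) Y (fun h Y' => h = (c.+1, [::]) /\ Y' = zap Y c [::]) False.
Proof.
move=> hY hS h0; have [l hl] := shape_type [::] hN.
have yb b u : ~ olt b l -> Y (c, rcons [::] b ++ u) = mk0.
  by move=> nb; apply: NNPP => /hY; exact: (sub_blank (s := [::]) hl).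
have zE : zaps Y c [::] l = zap Y c [::] by rewrite -(zap_enter yb) upd_idE.
apply: (reach_trans (P' := fun h Y' => h = (c, [:: l]) /\ Y' = zap Y c [::])).
  apply: (reach_weak (@erase_children [::] Y l _ hl _ _)) => //.
  - by move=> a na; apply: erase_node.
  - by move=> h' X' _ [-> ->]; split=> //; rewrite zE.
move=> _ _ _ [-> ->].
have lbl : cle (c, [:: ozero U]) (c, [:: l]) by apply: (cle_rcons c [::]); apply: ole0.
have zb : zap Y c [::] (c, [:: l]) = mk0 by rewrite /zap ifT //=; split=> //; exists [:: l].
apply: (reach_weak (reach_step (k := mk0) (mv := mvUPlus) (h' := (c.+1, [::])) (lb := (c, [:: ozero U])) False _ _ _ _)) => //; rewrite ?zb //.
- exact: (moves_uplus [::] (onat U c) l).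
- by move=> h' X' _ [-> ->]; split=> //; rewrite upd_idE.
Qed.

Lemma erase_comp Y : (forall u, Y (c, u) <> mk0 <-> N u) -> (forall u, Y (c, u) <> mkstar) -> N [::] ->
  reach false rkd (c, [::]) erase_step (c, [::]) Y (fun h Y' => h = (c.+1, [::]) /\ Y' = zap Y c [::]) False.
Proof.
move=> hY hS n0; apply: (reach_trans (erase_enter (s := [::]) _ _)) => //; first exact/hY.
move=> _ _ _ [-> ->].
have out u : u <> [::] -> upd Y (c, [::]) mk0 (c, u) = Y (c, u) by move=> nu; rewrite upd_neq // => -[].
apply: (reach_weak (@erase_below (upd Y (c, [::]) mk0) _ _ _)) => //.
- by move=> a u; rewrite out //; apply: hY.
- by move=> a u; rewrite out.
- by rewrite upd_eq.
- exact: cle_root.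
move=> h' X' _ [-> ->]; split=> //; apply: tape_ext => c' u; rewrite /zap.
case: (classic (c' = c /\ exists v, u = v)) => h; first by rewrite !ifT.
by rewrite !ifF // upd_neq // => -[e _]; apply: h; split=> //; exists u.
Qed.

End Erase.

Lemma erase_range (U : zfc_universe) (M : machine) (X0 : tape U) c k (Y : tape U) :
  (forall i, c <= i < c + k -> [/\ shape (fun u => Y (i, u) <> mk0), forall u, Y (i, u) <> mkstar & Y (i, [::]) <> mk0]) ->
  @reach U M X0 false rkd (c, [::]) erase_step (c, [::]) Y
     (fun h Y' => h = (c + k, [::]) /\ Y' = fun d => if c <= d.1 < c + k then mk0 else Y d) False.
Proof.
elim: k c Y => [|k ih] c Y hY.
  apply: reach_refl; rewrite addn0; split=> //; apply: funext => d.
  by case: ifP => //; lia.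
have [h1 h2 h3] := hY c ltac:(lia).
apply: (reach_trans (@erase_comp U M X0 c _ h1 Y _ _ _)) => //.
move=> _ _ _ [-> ->].
have zE d : zap Y c [::] d = if d.1 == c then mk0 else Y d.
  rewrite /zap; case: eqP => e; first by rewrite ifT //; split=> //; exists d.2.
  by rewrite ifF // => -[].
apply: (reach_weak (ih c.+1 (zap Y c [::]) _)) => //.
- move=> i hi; have -> : (fun u => zap Y c [::] (i, u) <> mk0) = (fun u => Y (i, u) <> mk0).
    by apply: funext => u; rewrite zE /=; case: eqP => //; lia.
  have [k1 k2 k3] := hY i ltac:(lia); split=> // [u|]; rewrite zE /=; case: eqP => //; lia.
- by apply/cleE; left.
- move=> h' X' _ [-> ->]; split; first by rewrite addSnnS.
  apply: funext => d; rewrite zE addSnnS.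
  by case: eqP => e; do ! case: ifP => //; lia.
Qed.

(** * Depth-first traversal by marks *)

(* One step of a depth-first traversal of the tree in component [c].  Nodes are
   marked 2 while open and 3 when closed; the root is marked 4, then 0*.  The
   head follows the open path to the first child that is neither open nor
   closed, which is opened if its mark satisfies [op]; otherwise the last open
   node is closed. *)
Definition descend_step (op : mark -> bool) := Act (fun k => match k with
  | mk3 => (mk3, mvPlus, 0) | mk2 => (mk2, mvZ, 0) | mk4 => (mk4, mvZ, 0)
  | k => if op k then (mk2, mvS, 1) else (k, mvU, 2) end).
Definition climb_step := Act (fun k => match k with mk4 | mk0star => (k, mvS, 1) | _ => (k, mvU, 0) end).
Definition finish c v := seqc (Loop climb_step) (seqc (jmp mvJMinus c) (Ret v)).
Definition tree_cmd op c := seqc (jmp mvJPlus c) (Bind (Loop (descend_step op)) (finish c 0)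
  (Bind (Act (fun k => if k is mk4 then (mk0star, mvS, 1) else (mk3, mvS, 0))) (finish c 1) (finish c 2) (Ret 0)) (Ret 0)).
Definition open_root c := seqc (jmp mvJPlus c) (seqc (Act (fun _ => (mk4, mvS, 0))) (seqc (jmp mvJMinus c) (Ret 0))).

Section TreeCmd.
Variables (U : zfc_universe) (M : machine) (X0 : tape U).
Local Notation ON := (ON U).
Local Notation cell := (cell U).
Local Notation tape := (tape U).
Local Notation exec := (@exec U M X0).
Local Notation reach := (@reach U M X0).
Local Notation origin := (origin U).
Implicit Types (op : mark -> bool).

(** Everything to the left of the open path is closed, including the children of [s] before [a]. The
    descent from the root is therefore forced and ends at [rcons s a]. *)
Record path_to (tr : seq ON -> mark) s a : Prop := PathTo {
  pt_root : tr [::] = mk4;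
  pt_open : forall p b q, s = p ++ b :: q -> tr (rcons p b) = mk2;
  pt_left : forall p b q b', rcons s a = p ++ b :: q -> olt b' b -> tr (rcons p b') = mk3 }.

Lemma reach_skip op c p a X D : (forall b, olt b a -> X (c, rcons p b) = mk3) ->
  reach false rk (c, rcons p (ozero U)) (descend_step op) (c, rcons p (ozero U)) X (fun h Y => h = (c, rcons p a) /\ Y = X) D.
Proof.
move=> hX.
have R : reach false rk (c, rcons p (ozero U)) (descend_step op) (c, rcons p (ozero U)) X
    (fun h' X' => h' = (c, rcons p a) /\ exists g : unit, X' = X /\ True) D.
  apply: (@reach_tf _ _ _ unit rk _ _ (fun b => (c, rcons p b)) (fun _ _ X' => X' = X) (fun _ _ _ _ => True) a tt X D) => //.
  - exact: rk_ok.
  - by move=> b b' bb' _; apply: cle_rcons.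
  - by move=> l e _ ll h; apply: cle_lub.
  - move=> b _ Y ba ->; have e := hX b ba.
    apply: (reach_weak (reach_step (k := mk3) (mv := mvPlus) (h' := (c, rcons p (osucc b))) (lb := (c, rcons p b)) D _ _ _ _)) => //; rewrite ?e //.
    + exact: (moves_plus (onat U c :: p) b).
    + by move=> h' X' _ [-> ->]; split=> //; exists tt; rewrite upd_idE.
  - move=> l gs Xs Xl _ ll hI _ hXl _; exists tt; split=> //.
    apply: funext => d; have [g [gl hg]] := hXl d.
    by rewrite -(hg g) // (hI g).
apply: (reach_weak R) => //.
by move=> h' X' _ [-> [_ [-> _]]].
Qed.

Lemma reach_descend op c s a X D : path_to (fun u => X (c, u)) s a ->
  reach false rk (c, [::]) (descend_step op) (c, [::]) X (fun h Y => h = (c, rcons s a) /\ Y = X) D.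
Proof.
move=> hp; suff H : forall q p, s = p ++ q -> reach false rk (c, p) (descend_step op) (c, p) X (fun h Y => h = (c, rcons s a) /\ Y = X) D.
  exact: (H s [::]).
elim=> [|b q ih] p es.
all: have mp : X (c, p) = mk2 \/ X (c, p) = mk4.
1,3: case/lastP: p es => [|p x] es; [right; exact: (pt_root hp)|left].
1: by apply: (pt_open hp (q := [::])); rewrite es cats0 cats1.
1: by apply: (pt_open hp (q := b :: q)); rewrite es cat_rcons.
all: have st P' : (reach false rk (c, p) (descend_step op) (c, rcons p (ozero U)) X P' D) -> reach false rk (c, p) (descend_step op) (c, p) X P' D.
1,3: move=> hr; apply: (reach_trans (P' := fun h Y => h = (c, rcons p (ozero U)) /\ Y = X)); last by move=> _ _ _ [-> ->].
1,2: apply: (reach_weak (reach_step (k := X (c, p)) (mv := mvZ) (h' := (c, rcons p (ozero U))) (lb := (c, p)) D _ _ _ _)) => //; try exact: cle_refl.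
1,4: by case: mp => ->.
1,3: exact: (moves_z (onat U c :: p)).
1,2: by move=> h' X' _ [-> ->]; rewrite upd_id.
all: apply: st.
all: have lb0 : cle (c, p) (c, rcons p (ozero U)) by rewrite -cats1; apply: cle_cat.
- rewrite cats0 in es; subst p; apply: (reach_weak (@reach_skip op c s a X D _)) => //.
  by move=> b ba; apply: (pt_left hp (q := [::]) (b := a)); rewrite ?cats1.
- apply: (reach_trans (P' := fun h Y => h = (c, rcons p b) /\ Y = X)).
    apply: (reach_weak (@reach_skip op c p b X D _)) => //.
    by move=> b' bb; apply: (pt_left hp (q := rcons q a) (b := b)) => //; rewrite es rcons_cat.
  move=> _ _ _ [-> ->]; apply: (reach_weak (ih (rcons p b) _)) => //; first by rewrite cat_rcons.
  by rewrite -cats1; apply: cle_cat.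
Qed.

Lemma reach_climb c s X D : (forall p b q, s = p ++ b :: q -> X (c, rcons p b) <> mk4 /\ X (c, rcons p b) <> mk0star) ->
  reach false rk (c, [::]) climb_step (c, s) X (fun h Y => h = (c, [::]) /\ Y = X) D.
Proof.
elim/last_ind: s => [|s a ih] hX; first exact: reach_refl.
have [h1 h2] := hX s a [::] (esym (cats1 s a)).
apply: (reach_trans (P' := fun h Y => h = (c, s) /\ Y = X)).
  apply: (reach_weak (reach_step (k := X (c, rcons s a)) (mv := mvU) (h' := (c, s)) (lb := (c, [::])) D _ _ _ _)) => //.
  - by case: (X (c, rcons s a)) h1 h2.
  - exact: (moves_u (onat U c :: s) a).
  - exact: cle_root.
  - by move=> h' X' _ [-> ->]; rewrite upd_id.
move=> _ _ _ [-> ->]; apply: ih => p b q e; apply: (hX p b (rcons q a)).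
by rewrite e rcons_cat.
Qed.

Lemma exec_finish c s v X (Q : nat -> cell -> tape -> Prop) D : (X (c, [::]) = mk4 \/ X (c, [::]) = mk0star) ->
  (forall p b q, s = p ++ b :: q -> X (c, rcons p b) <> mk4 /\ X (c, rcons p b) <> mk0star) ->
  Q v origin X -> exec rk origin (finish c v) (c, s) X Q D.
Proof.
move=> hr hX q; apply: (exec_seq (Q1 := fun _ h Y => h = (c, [::]) /\ Y = X)).
  apply: exec_loop; apply: (reach_weak (@reach_climb c s X D hX)) => //.
  move=> h' X' _ [-> ->]; split; first exact: cle_origin.
  apply: (exec_act (k := X (c, [::])) (mv := mvS) (v := 1) (h' := (c, [::]))) => //.
  - by case: hr => ->.
  - exact: moves_s.
  - by rewrite upd_id.
move=> _ _ _ _ [-> ->]; have -> : (c, [::]) = (0 + c, [::] : seq ON) by [].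
by apply: exec_jmpM; [exact: cle_origin|exact: exec_ret].
Qed.

(** The position of the traversal can be recovered from the marks alone, and each step walks down
    from the root and back to the origin. This makes a step an iteration that can be repeated
    through limits. Outcome 0 means that a node was opened, 1 that one was closed, 2 that the root
    was closed. *)
Lemma exec_tree op c s a X (Q : nat -> cell -> tape -> Prop) D : path_to (fun u => X (c, u)) s a ->
  X (c, rcons s a) = mk0 \/ X (c, rcons s a) = mk1 ->
  (op (X (c, rcons s a)) -> Q 0 origin (upd X (c, rcons s a) mk2)) ->
  (~~ op (X (c, rcons s a)) -> s <> [::] -> Q 1 origin (upd X (c, s) mk3)) ->
  (~~ op (X (c, rcons s a)) -> s = [::] -> Q 2 origin (upd X (c, s) mk0star)) ->
  exec rk origin (tree_cmd op c) origin X Q D.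
Proof.
move=> hp hk q0 q1 q2; have h0 := pt_root hp.
apply: exec_jmpS; first exact: cle_refl.
have nn (p : seq ON) b : rcons p b <> [::] by case: (p).
have path p b q : s = p ++ b :: q -> X (c, rcons p b) <> mk4 /\ X (c, rcons p b) <> mk0star.
  by move=> /(pt_open hp) ->.
have step w : descend_step op = Act w -> w (X (c, rcons s a)) = if op (X (c, rcons s a)) then (mk2, mvS, 1) else (X (c, rcons s a), mvU, 2).
  by case=> <-; case: hk => ->.
apply: (exec_bind (Q1 := fun v h Y => if op (X (c, rcons s a)) then [/\ v = 0, h = (c, rcons s a) & Y = upd X (c, rcons s a) mk2]
    else [/\ v = 1, h = (c, s) & Y = X])).
  rewrite add0n; apply: exec_loop; apply: (reach_weak (@reach_descend op c s a X D hp)) => //.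
  move=> h' X' _ [-> ->]; split; first exact: cle_origin.
  case: (boolP (op (X (c, rcons s a)))) => ho.
    apply: (exec_act (k := mk2) (mv := mvS) (v := 1) (h' := (c, rcons s a))) => //.
    - by rewrite (step _ erefl) ho.
    - exact: moves_s.
    - by case: hk => ->.
  apply: (exec_act (k := X (c, rcons s a)) (mv := mvU) (v := 2) (h' := (c, s))) => //.
  - by rewrite (step _ erefl) (negbTE ho).
  - exact: (moves_u (onat U c :: s) a).
  - by rewrite upd_id.
move=> v h1 X1 _; case: (boolP (op (X (c, rcons s a)))) => ho [-> -> ->] /=.
  apply: exec_finish; last exact: q0.
    by rewrite upd_neq; [left|move=> -[e]; apply: (nn s a); rewrite e].
  move=> p b q e; case: (classic (rcons p b = rcons s a)) => e2; first by rewrite e2 upd_eq.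
  rewrite upd_neq; last by move=> -[].
  case/lastP: q e => [|q x].
    by rewrite cats1 => e; case: e2.
  by rewrite -rcons_cons -rcons_cat => /rcons_inj[/path].
case: (classic (s = [::])) => es.
  subst s; apply: (exec_bind (Q1 := fun v h Y => [/\ v = 1, h = (c, [::]) & Y = upd X (c, [::]) mk0star])).
    apply: (exec_act (k := mk0star) (mv := mvS) (v := 1) (h' := (c, [::]))); rewrite ?h0 //.
    - exact: moves_s.
  move=> _ _ _ _ [-> -> ->] /=; apply: exec_finish; last exact: q2.
    by right; rewrite upd_eq.
  by move=> p b q e; have := f_equal size e; rewrite size_cat /=; lia.
have ms : X (c, s) = mk2.
  by case/lastP: s es {hp hk q0 q1 q2 path step ho} (pt_open hp) => // s' x _ /(_ s' x [::]); rewrite cats1; apply.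
apply: (exec_bind (Q1 := fun v h Y => [/\ v = 0, h = (c, s) & Y = upd X (c, s) mk3])).
  apply: (exec_act (k := mk3) (mv := mvS) (v := 0) (h' := (c, s))); rewrite ?ms //.
  - exact: moves_s.
move=> _ _ _ _ [-> -> ->] /=; apply: exec_finish; last exact: q1.
  by left; rewrite upd_neq // => -[e]; apply: es.
move=> p b q e; case: (classic (rcons p b = s)) => e2; first by rewrite e2 upd_eq.
by rewrite upd_neq; [apply: path e|move=> -[]].
Qed.

End TreeCmd.

Section TreeMem.
Variables (U : zfc_universe) (M : machine) (X0 : tape U) (B KK : nat).
Local Notation ON := (ON U).
Local Notation tape := (tape U).
Local Notation mem := (mem U).
Local Notation raw := (@raw U B KK).
Local Notation wp := (@wp U M X0 B KK).
Implicit Types (m : mem).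

Lemma raw_out u rb tb tr tr' X Y : raw u rb tb tr X -> (forall c s, B <= c -> Y (c, s) = X (c, s)) ->
  (forall c s, c < B -> Y (c, s) = tr' c s) -> raw u rb tb tr' Y.
Proof.
case=> h1 h2 h3 h4 h5 h6 h7 h8 h9 hY hT.
have rB r : B <= rc B r by rewrite /rc leq_addr.
have tB r : B <= tc B r by rewrite /tc leq_addr.
have sm r a : same B X Y r a by move=> t; rewrite hY.
constructor=> //.
- by rewrite hY.
- by move=> c hc; rewrite hY ?h3 //; lia.
- by rewrite hY // leq_addr.
- move=> r a rK; have [L [hL hu]] := h5 r a rK; exists L; split=> //.
  by split=> t; have := proj1 hL t; have := proj2 hL t; rewrite !hY.
- by move=> r a rK; rewrite -(same_bit (sm r a)) h6.
- by move=> r a rK; rewrite hY //; apply: h7.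
- by move=> t a tK; rewrite hY //; apply: h8.
- by move=> c s Bc; rewrite hY //; apply: h9.
Qed.

Definition sett m c (s : seq ON) k : mem := Mem (regs m) (tabs m)
  (fun c' s' => if lem ((c', s') = (c, s)) then k else trees m c' s').

Lemma sett_eq m c s k : trees (sett m c s k) c s = k.
Proof. by rewrite /= ifT. Qed.
Lemma sett_neq m c s k c' s' : (c', s') <> (c, s) -> trees (sett m c s k) c' s' = trees m c' s'.
Proof. by move=> h; rewrite /= ifF. Qed.

Lemma Rep_sett m c s k X : c < B -> Rep B KK m X -> Rep B KK (sett m c s k) (upd X (c, s) k).
Proof.
move=> cB [u hX]; exists u; apply: (raw_out hX) => [c' s' Bc|c' s' c'B].
  by rewrite upd_neq // => -[e]; lia.
by rewrite /= /upd -(raw_trees hX).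
Qed.

Lemma hrel_sett e m c s k X : c < B -> hrel B KK e m X (upd X (c, s) k).
Proof.
move=> cB; have h r t : upd X (c, s) k (rc B r, t) = X (rc B r, t) by rewrite upd_neq // => -[e1]; move: cB; rewrite /rc in e1; lia.
split=> [r a rK _ _ t|r a a2 rK _ _ _ t|r a t rK _]; by rewrite h.
Qed.

Lemma mstep_sett e m c s k : etr e -> mstep e m (sett m c s k).
Proof. by move=> h; split=> //; rewrite h. Qed.

Lemma wp_tree (op : mark -> bool) c s a e (Q : nat -> mem -> Prop) D m : c < B -> etr e -> path_to (trees m c) s a ->
  trees m c (rcons s a) = mk0 \/ trees m c (rcons s a) = mk1 ->
  (op (trees m c (rcons s a)) -> Q 0 (sett m c (rcons s a) mk2)) ->
  (~~ op (trees m c (rcons s a)) -> s <> [::] -> Q 1 (sett m c s mk3)) ->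
  (~~ op (trees m c (rcons s a)) -> s = [::] -> Q 2 (sett m c s mk0star)) ->
  wp e (tree_cmd op c) Q D m.
Proof.
move=> cB he hp hk q0 q1 q2 X hX; have [u hr] := hX.
have E t : X (c, t) = trees m c t by apply: (raw_trees hr).
have post v t k : Q v (sett m c t k) -> exists m', [/\ Rep B KK m' (upd X (c, t) k), hrel B KK e m X (upd X (c, t) k), mstep e m m' & Q v m'].
  by move=> q; exists (sett m c t k); split=> //; [exact: Rep_sett|exact: hrel_sett|exact: mstep_sett].
apply: (@exec_tree _ _ _ op c s a); rewrite ?E //.
- by case: hp => h1 h2 h3; split; [rewrite E|move=> p b q /h2; rewrite E|move=> p b q b' h /(h3 _ _ _ _ h); rewrite E].
- by move=> h; split=> //; apply: post; apply: q0.
- by move=> h h'; split=> //; apply: post; apply: q1.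
- by move=> h h'; split=> //; apply: post; apply: q2.
Qed.

Lemma wp_open_root c e (Q : nat -> mem -> Prop) D m : c < B -> etr e -> trees m c [::] = mk0 \/ trees m c [::] = mk1 ->
  Q 0 (sett m c [::] mk4) -> wp e (open_root c) Q D m.
Proof.
move=> cB he hk q X hX; have [u hr] := hX.
have E t : X (c, t) = trees m c t by apply: (raw_trees hr).
apply: exec_jmpS; first exact: cle_refl.
apply: (exec_seq (Q1 := fun _ h Y => h = (c, [::]) /\ Y = upd X (c, [::]) mk4)).
  apply: (exec_act (k := mk4) (mv := mvS) (v := 0) (h' := (c, [::]))) => //.
  - exact: moves_s.
  - by rewrite add0n E; case: hk => ->.
move=> _ _ _ _ [-> ->]; have {1}-> : (c, [::]) = (0 + c, [::] : seq ON) by [].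
apply: exec_jmpM; first exact: cle_origin.
apply: exec_ret; split=> //; exists (sett m c [::] mk4); split=> //.
- exact: Rep_sett.
- exact: hrel_sett.
- exact: mstep_sett.
Qed.

End TreeMem.

(** * Reading the input codes into the heap *)

(** A stack made of bits that are only ever set: table 4 records pushes, table 5 pops. Its top is
    searched for each time, since a register holding it would have an unknown value after a
    limit. *)
Definition opn B KK t := Bind (get B KK 4 t) (Ret 0) (Bind (get B KK 5 t) (Ret 1) (Ret 0) (Ret 0)) (Ret 0).

(* The open row with the largest number, which represents the last open node. *)
Definition top B KK t j := find_ B KK t 0 (Bind (opn B KK t) (Ret 0)
  (Bind (find_ B KK j 0 (Bind (ler B KK j t) (opn B KK j) (Ret 0) (Ret 0))) (Ret 1) (Ret 0) (Ret 0)) (Ret 0)).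

Definition is1 k := if k is mk1 then true else false.
Definition push B KK b := seqc (new_row B KK b) (set B KK 4 b).
Definition pop B KK b := seqc (top B KK b (b + 1)) (seqc (find_alloc B KK b (b + 2)) (set B KK 5 b)).
(** Opening a node pushes an empty row. Closing one turns its row into a canonical row in [b + 2],
    which is then listed in the row of the parent, the new top. Closing the root ends the loop and
    leaves the row of the whole set in [b + 2]. *)
Definition load_body B KK c b := Bind (tree_cmd is1 c) (seqc (push B KK b) (Ret 0))
  (seqc (pop B KK b) (seqc (top B KK b (b + 1)) (seqc (set2 B KK 0 b (b + 2)) (Ret 0))))
  (seqc (pop B KK b) (Ret 1)).
Definition load B KK c b := seqc (open_root c) (seqc (push B KK b) (Loop (load_body B KK c b))).

Definition efft b := Eff (fun r => if r == 0 then 1 else if (r < 7) || (b <= r) then 2 else 0) true.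

Lemma sub_efft L ds c t b : L <= 7 -> all (fun r => b <= r) ds -> sub_eff (effl L ds c t) (efft b).
Proof.
move=> hL /allP hd; split=> // r /=; case: eqP => // _; first by case: c.
case: ifP => // /orP[h|/hd ->]; [by rewrite (leq_trans h hL)|by rewrite orbT].
Qed.

#[global] Hint Extern 0 (sub_eff _ (efft _)) => by apply: sub_efft => //=; lia : core.

Section Stack.
Variable U : zfc_universe.
Local Notation ON := (ON U).
Local Notation mem := (mem U).
Implicit Types (m : mem).

Definition Open m j := tabs m 4 j /\ ~ tabs m 5 j.

Lemma own4 j : @own U j 4 j. Proof. by constructor 2. Qed.
Lemma own5 j : @own U j 5 j. Proof. by constructor 2. Qed.

Lemma Open_lt m j : heap m -> Open m j -> olt j (cnt m).
Proof. by move=> hm [h _]; apply: (h_own hm (own4 j) h). Qed.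

Lemma heap_tabs m m' : heap m -> tabs m' = tabs m -> ole (cnt m) (cnt m') -> heap m'.
Proof.
move=> hm e hc; case: hm => h1 h2 h3 h4 h5 h6; rewrite /C /Kn /Dn -e in h1 h2 h3 h4 h5 h6.
split=> // [a t p o h|a b h|a b h]; apply: olt_le_trans hc; [exact: h1 o h|exact: h2 h|exact: h6 h].
Qed.

Lemma ext_tabs m m' : tabs m' = tabs m -> ole (cnt m) (cnt m') -> ext m m'.
Proof. by move=> e hc; split=> // a t p _ _; rewrite e. Qed.

Lemma prow_tabs m0 m m' n Z : prow m0 m n Z -> tabs m' = tabs m -> ole (cnt m) (cnt m') -> prow m0 m' n Z.
Proof. by move=> hp e hc; apply: (prow_ext hp); [apply: heap_tabs e hc; case: hp|apply: ext_tabs]. Qed.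

Lemma pt_tabs m m' c z : tabs m' = tabs m -> pt m' c z <-> pt m c z.
Proof. by move=> e; rewrite /pt /Kn e (@hv_tabs _ m' m). Qed.

Lemma prow_aux m0 m n Z a t p : prow m0 m n Z -> 2 < t -> own a t p -> olt a (cnt m) -> ole (cnt m0) a -> prow m0 (settb m t p) n Z.
Proof.
move=> [hm he n1 nk [h1 h2]] t2 o la lb.
have E t' p' : t' < 3 -> tabs (settb m t p) t' p' <-> tabs m t' p'.
  by move=> t3 /=; split=> [[|[e _]]|] //; [lia|left].
have kx : kext m (settb m t p) by move=> x y _; split; apply: E.
have pE c z : pt m c z <-> pt (settb m t p) c z.
  split=> -[k e]; split; rewrite /Kn ?E // in k *; first by rewrite (hv_kext hm kx).
  by rewrite -(hv_kext hm kx).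
split.
- exact: (heap_aux hm t2 o la).
- exact: (ext_aux he o lb).
- by [].
- by rewrite /Kn E.
- split=> [c|z /h2[c hc]]; last by exists c; apply/pE.
  by rewrite /C E // -/(C m n c) h1; split=> -[z [hz /pE pz]]; exists z.
Qed.

End Stack.

Section Paths.
Variable U : zfc_universe.
Local Notation ON := (ON U).
Implicit Types (a b : ON).

Lemma path_sub s a p b q : rcons s a = p ++ b :: q -> (p = s /\ b = a /\ q = [::]) \/ exists q', q = rcons q' a /\ s = p ++ b :: q'.
Proof.
case/lastP: q => [|q x]; first by rewrite cats1 => /rcons_inj[-> ->]; left.
by rewrite -rcons_cons -rcons_cat => /rcons_inj[-> ->]; right; exists q.
Qed.

Lemma not_below s a v p b q : s = p ++ b :: q -> rcons p b <> rcons s a ++ v :> seq ON.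
Proof. by move=> -> e; have := f_equal size e; rewrite size_cat !size_rcons size_cat /=; lia. Qed.

Lemma path_kids tr tr' s a a' : path_to tr s a -> (forall u, ~ (exists b v, u = rcons s b ++ v) -> tr' u = tr u) ->
  (forall b, olt b a' -> tr' (rcons s b) = mk3) -> path_to tr' s a'.
Proof.
move=> [h1 h2 h3] ho hk; split.
- by rewrite ho // => -[b [v e]]; have := f_equal size e; rewrite size_cat size_rcons /=; lia.
- by move=> p b q e; rewrite ho ?(h2 p b q) // => -[b' [v]]; apply: not_below e.
- move=> p b q b' e bb; case: (path_sub e) => [[ep [eb _]]|[q' [_ es]]]; first by rewrite ep; apply: hk; rewrite -eb.
  rewrite ho; first by apply: (h3 p b (rcons q' a)) => //; rewrite es rcons_cat.
  by move=> [b'' [v e2]]; have := f_equal size e2; rewrite es size_cat !size_rcons size_cat /=; lia.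
Qed.

Lemma path_enter tr tr' s i : path_to tr s i -> tr' (rcons s i) = mk2 -> (forall u, u <> rcons s i -> tr' u = tr u) ->
  path_to tr' (rcons s i) (ozero U).
Proof.
move=> [h1 h2 h3] hi ho.
split.
- by rewrite ho //; case: (s).
- move=> p b q e; case: (path_sub e) => [[-> [-> _]] //|[q' [_ es]]].
  by rewrite ho ?(h2 p b q') // => e2; have := f_equal size e2; rewrite es !size_rcons size_cat /=; lia.
- move=> p b q b' e bb; case: (path_sub e) => [[_ [eb _]]|[q' [_ es]]]; first by rewrite eb in bb; case: (olt0 bb).
  rewrite ho; first exact: (h3 p b q').
  move=> e2; case: (path_sub es) => [[ep [eb _]]|[q2 [_ es2]]].
    by move: e2; rewrite ep => /rcons_inj[e3]; rewrite e3 eb in bb; case: (olt_irr bb).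
  by have := f_equal size e2; rewrite es2 !size_rcons size_cat /=; lia.
Qed.

End Paths.

Section StackOps.
Variables (U : zfc_universe) (M : machine) (X0 : tape U) (B KK : nat).
Local Notation ON := (ON U).
Local Notation mem := (mem U).
Local Notation wp := (@wp U M X0 B KK).
Hypothesis hKK : 32 < KK.

Lemma wp_opn e t m D : t < KK -> wp e (opn B KK t) (fun v m' => v = b2 (Open m (regs m t)) /\ m' = m) D m.
Proof.
move=> tK; apply: (wp_bind (Q1 := fun v m' => v = b2 (tabs m 4 (regs m t)) /\ m' = m)); first by apply: wp_get => //; lia.
move=> _ _ _ [-> ->]; case: (classic (tabs m 4 (regs m t))) => h4; last first.
  by rewrite (b2F h4) /=; apply: wp_ret; rewrite b2F // => -[].
rewrite (b2T h4) /=; apply: (wp_bind (Q1 := fun v m' => v = b2 (tabs m 5 (regs m t)) /\ m' = m)); first by apply: wp_get => //; lia.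
move=> _ _ _ [-> ->]; case: (classic (tabs m 5 (regs m t))) => h5.
  by rewrite (b2T h5) /=; apply: wp_ret; rewrite b2F // => -[].
by rewrite (b2F h5) /=; apply: wp_ret; rewrite b2T.
Qed.

Lemma wp_top (t j : nat) m n D : 6 < t < KK -> 6 < j < KK -> t <> j -> heap m -> Open m n -> (forall i, Open m i -> ole i n) ->
  wp (effl 0 [:: t; j] false false) (top B KK t j) (fun _ m' => [/\ regs m' t = n, cnt m' = cnt m & eqtt m m']) D m.
Proof.
move=> ht hj tj hm hn hmax; have ln := Open_lt hm hn.
have OE m' i : eqtt m m' -> Open m' i <-> Open m i by move=> [e _]; rewrite /Open e.
have cE m' e r q x : mstep (bump e r) (setr m q x) m' -> q <> 0 -> r <> 0 -> acc e 0 = 0 -> cnt m' = cnt m.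
  move=> [h _ _ _ _] q0 r0 e0; rewrite /cnt h /=; first by case: eqP => // e1; case: q0.
  by case: eqP => // e1; case: r0.
apply: (wp_find (effl 0 [:: j] false false) (fun i => Open m i /\ forall i', olt i' (cnt m) -> ~ (olt i i' /\ Open m i'))) => //; try lia.
- by rewrite /= !inE eqxx /=; case: eqP => //; lia.
- by rewrite /= inE; case: eqP => //; case: eqP => //; lia.
- by apply: sub_effl => //=; rewrite !inE eqxx !orbT.
- move=> i m1 li ei s1 et1.
  have c1 : cnt m1 = cnt m by apply: (cE _ _ _ _ _ s1) => //; lia.
  apply: (wp_bind (Q1 := fun v m' => v = b2 (Open m i) /\ m' = m1)).
    apply: (wp_weak (wp_opn (effl 0 [:: j] false false) (t := t) (m := m1) D _)); try lia; first exact: sub_eff_refl; first by [].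
    move=> v m2 _ [-> ->]; split=> //; apply: b2_iff; rewrite ei; exact: OE.
  move=> _ _ _ [-> ->]; case: (classic (Open m i)) => oi; last first.
    by rewrite b2F //=; apply: wp_ret; split=> //; rewrite b2F // => -[].
  rewrite b2T //=; apply: (wp_bind (Q1 := fun v m' => v = b2 (exists i', olt i' (cnt m) /\ (olt i i' /\ Open m i')) /\ eqtt m1 m')).
    apply: (wp_find (lv 0) (fun i' => olt i i' /\ Open m i')) => //; try lia.
    + by rewrite /= !inE eqxx /=; case: eqP => //; lia.
    + move=> i' m2 li' ei' s2 et2.
      have t2 : regs m2 t = i by rewrite (bumpC s2) ?ei //; apply: lv_hi; lia.
      apply: (wp_bind (Q1 := fun v m' => v = b2 (ole i' i) /\ m' = m2)).
        by apply: wp_ler; rewrite ?ei' ?t2 //; lia.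
      move=> _ _ _ [-> ->]; case: (classic (ole i' i)) => h.
        by rewrite b2T //=; apply: wp_ret; split=> //; rewrite b2F // => -[/(ole_lt_trans h)/olt_irr].
      rewrite b2F //=; apply: (wp_weak (wp_opn (lv 0) (t := j) (m := m2) D _)); try lia; first exact: sub_eff_refl; first by [].
      move=> v m3 _ [-> ->]; split=> //; apply: b2_iff; rewrite ei' OE; last exact: eqtt_trans et1 et2.
      split=> [o|[]] //; split=> //; by case: (ole_olt i' i).
    + by move=> m2 i' _ et2 ei' li' hi' _; split=> //; rewrite b2T //; exists i'; split=> //; rewrite -c1.
    + by move=> m2 _ et2 _ hno; split=> //; rewrite b2F // => -[i' [li' hi']]; apply: (hno i') => //; rewrite -/(cnt m1) c1.
  move=> _ m2 _ [-> et2]; have et02 := eqtt_trans et1 et2.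
  case: (classic (exists i', olt i' (cnt m) /\ (olt i i' /\ Open m i'))) => h.
    rewrite b2T //=; apply: wp_ret; split=> //; rewrite b2F // => -[_ hno].
    by case: h => i' [li' hi']; apply: (hno i').
  rewrite b2F //=; apply: wp_ret; split=> //; rewrite b2T //; split=> // i' li' hi'; apply: h; by exists i'.
- move=> m1 i s1 et1 ei li [oi hi] _; split=> //; last by apply: (cE _ _ _ _ _ s1) => //; lia.
  rewrite ei; apply: ole_anti; first exact: hmax.
  by apply/oltNge => lt; apply: (hi n).
- move=> m1 _ _ _ hno; case: (hno n ln); split=> // i' _ [lt /hmax le]; exact: (olt_irr (olt_le_trans lt le)).
Qed.

Lemma efft_hi b r : 6 < r < b -> acc (efft b) r = 0.
Proof. clear hKK; by move=> h /=; case: eqP; [lia|case: ifP => //; lia]. Qed.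

Lemma wp_pusht b m D : 6 < b < KK -> heap m ->
  wp (efft b) (push B KK b) (fun _ m' => [/\ prow m m' (cnt m) (fun _ => False), regs m' b = cnt m, trees m' = trees m /\ tabs m' = tabs (settb m 4 (cnt m)) &
    forall j, Open m' j <-> Open m j \/ j = cnt m]) D m.
Proof.
move=> hb hm; set n := cnt m.
have n5 : ~ tabs m 5 n by move=> /(h_own hm (own5 n))/olt_irr.
apply: (wp_seq (Q1 := fun _ m1 => [/\ prow m m1 n (fun _ => False), regs m1 b = n, tabs m1 = tabs m & trees m1 = trees m])).
  apply: (wp_weak (wp_newp hKK (t := b) (e := effl 4 [:: b] true false) D _ _ _ hm)) => //; try lia.
  - by rewrite /= inE eqxx orbT; case: eqP => //; lia.
  move=> _ m1 [_ _ _ s1 _] [h1 h2 h3 h4]; split=> //; first by apply: (prow_pend h1) => c [].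
  exact: s1.
move=> _ m1 _ [hp1 b1 t1 r1]; have [hm1 he1 [n1 n2] nk1 _] := hp1.
apply: wp_set; try lia.
  by rewrite b1; apply: (kext_set (own4 n)).
rewrite b1; split=> //; last 1 first.
- move=> j; rewrite /Open /= t1; split=> [[[h|[_ ->]] h5]|[[h h5]|->]]; [|by right| |].
  + by left; split=> // h'; apply: h5; left.
  + by split; [left|case=> [|[]]].
  + by split; [right|case=> [|[]]].
- by apply: (prow_aux hp1 _ (own4 n)).
- by rewrite /= t1.
Qed.

Lemma wp_push b m D : 6 < b < KK -> heap m ->
  wp (efft b) (push B KK b) (fun _ m' => [/\ prow m m' (cnt m) (fun _ => False), regs m' b = cnt m, trees m' = trees m &
    forall j, Open m' j <-> Open m j \/ j = cnt m]) D m.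
Proof.
by move=> hb hm; apply: (wp_weak (wp_pusht D hb hm)) => // _ m' _ [h1 h2 [h3 _] h4].
Qed.

(* The last open row [n] is closed and its canonical copy is left in [b + 2]. *)
Lemma wp_pop b m m0 n y D : 6 < b -> b + 2 < KK -> prow m0 m n (fun z => z ∈ y) -> Open m n -> (forall i, Open m i -> ole i n) ->
  wp (efft b) (pop B KK b) (fun _ m' => [/\ heap m', ext m0 m', pt m' (regs m' (b + 2)) y, trees m' = trees m &
    forall j, Open m' j <-> Open m j /\ j <> n]) D m.
Proof.
move=> b6 bK hp hn hmax; have hm : heap m by case: hp.
apply: (wp_seq (Q1 := fun _ m1 => [/\ regs m1 b = n, cnt m1 = cnt m & eqtt m m1])).
  apply: (wp_sub (@wp_top b (b + 1) m n D _ _ _ hm hn hmax)) => //; try lia.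
move=> _ m1 _ [b1 c1 [t1 r1]]; have c1' : ole (cnt m) (cnt m1) by rewrite c1.
have hp1 := prow_tabs hp t1 c1'.
apply: (wp_seq (Q1 := fun _ m2 => [/\ heap m2, ext m m2, pt m2 (regs m2 (b + 2)) y, regs m2 b = n /\ trees m2 = trees m & forall j, Open m2 j <-> Open m j])).
  apply: (wp_weak (@wp_mkrowt U M X0 B KK hKK b (b + 2) m0 m1 n _ y D _ _ _ hp1 b1 _)) => //; try lia.
  move=> _ m2 s2 [h1 [h2 h4] h3]; split=> //.
  - by apply: ext_trans (ext_tabs t1 c1') h2.
  - split; first by rewrite (mstepC s2) //= inE; case: eqP; [lia|case: eqP => //; case: ifP => //; lia].
    by case: s2 => _ _ _ -> // _; rewrite r1.
  - by move=> j; rewrite /Open !h4 // t1.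
move=> _ m2 _ [hm2 he2 p2 [b2' r2] OE]; have [_ he0 [n1 n2] _ _] := hp.
have l2 : olt n (cnt m2) by apply: olt_le_trans (proj1 he2).
have nk2 : ~ Kn m2 n by case: (prow_ext hp hm2 he2).
apply: wp_set; try lia.
  by rewrite b2'; apply: (kext_set (own5 n)).
rewrite b2'.
have hm3 : heap (settb m2 5 n) by apply: (heap_aux hm2 _ (own5 n)).
have kx : kext m2 (settb m2 5 n) by apply: (kext_set (own5 n)).
split=> //.
- apply: (ext_aux _ (own5 n)) => //; exact: ext_trans he0 he2.
- by case: p2 => k e; split; [left|rewrite (hv_kext hm2 kx)].
- move=> j; rewrite -OE /Open /=; split=> [[[h4|[//]] h5]|[[h4 h5] nj]].
    by split; [split=> // h; apply: h5; left|move=> e; apply: h5; right].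
  by split; [left|case=> [|[]]].
Qed.

End StackOps.

Section Load.
Variables (U : zfc_universe) (M : machine) (X0 : tape U) (B KK : nat).
Local Notation ON := (ON U).
Local Notation mem := (mem U).
Local Notation wp := (@wp U M X0 B KK).
Local Notation mreach := (@mreach U M X0 B KK).
Hypothesis hKK : 32 < KK.
Implicit Types (s u : seq ON).

Definition outside (c : nat) s m m' := forall (c' : nat) u, c' < B -> ~ (c' = c /\ exists a v, u = rcons s a ++ v) -> trees m' c' u = trees m c' u.

Lemma outside_trans c s m1 m2 m3 : outside c s m1 m2 -> outside c s m2 m3 -> outside c s m1 m3.
Proof. by move=> h1 h2 c' u c'B hn; rewrite h2 // h1. Qed.

Lemma outside_rcons c s i m m' : outside c (rcons s i) m m' -> outside c s m m'.
Proof.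
move=> h c' u c'B hn; apply: h => // -[e [a [v e2]]]; apply: hn; split=> //; exists i, (a :: v).
by rewrite e2 cat_rcons.
Qed.

Lemma outside_sett c s i k m m' : trees m' = trees m -> outside c s m (sett m' c (rcons s i) k).
Proof.
move=> e c' u c'B hn; rewrite sett_neq ?e // => -[e1 e2]; apply: hn; split=> //; exists i, [::]; by rewrite cats0.
Qed.

(** After loading the marks differ, but the same cells are nonblank and no new star has appeared, so
    the input trees can still be erased. *)
Definition tame m m' := forall (c : nat) u, c < B -> trees m' c u = trees m c u \/
  [/\ trees m c u <> mk0, trees m' c u <> mk0 & trees m' c u <> mkstar].

Lemma tame_refl m m' : trees m' = trees m -> tame m m'.
Proof. by move=> e c u cB; left; rewrite e. Qed.

Lemma tame_trans m1 m2 m3 : tame m1 m2 -> tame m2 m3 -> tame m1 m3.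
Proof.
move=> h1 h2 c u cB; case: (h1 c u cB) => [e1|[a1 a2 a3]]; case: (h2 c u cB) => [e2|[b1 b2 b3]].
- by left; rewrite e2.
- by right; rewrite -e1.
- by right; rewrite e2.
- by right.
Qed.

Lemma tame_sett m m' c u k : trees m' = trees (sett m c u k) -> trees m c u <> mk0 -> k <> mk0 -> k <> mkstar -> tame m m'.
Proof.
move=> e h h1 h2 c' u' cB; case: (classic ((c', u') = (c, u))) => [[-> ->]|hn].
  by right; rewrite e sett_eq.
by left; rewrite e sett_neq.
Qed.

Lemma not_kid s (b : ON) v : s <> rcons s b ++ v.
Proof. by move=> e; have := f_equal size e; rewrite size_cat size_rcons; clear; lia. Qed.

Lemma rcons_catE s i (a : ON) v u : rcons s i ++ u = rcons s a ++ v -> i = a.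
Proof. by case/(@rcons_cat_inj U). Qed.

Variables (c b : nat) (N : seq ON -> Prop) (dec : seq ON -> U).
Hypothesis cB : c < B.
Hypothesis b6 : 6 < b.
Hypothesis bK : b + 2 < KK.
Hypothesis hN : shape N.
Hypothesis hdec : forall s, N s -> forall z, z ∈ dec s <-> exists a, N (rcons s a) /\ z = dec (rcons s a).

Definition fresh (tr : seq ON -> mark) s := forall u, (N (s ++ u) -> tr (s ++ u) = mk1) /\ (~ N (s ++ u) -> tr (s ++ u) = mk0).

Lemma wp_opened m s i D : heap m -> path_to (trees m c) s i -> trees m c (rcons s i) = mk1 ->
  wp (efft b) (load_body B KK c b) (fun v m' => v = 0 /\ [/\ prow m m' (cnt m) (fun _ => False),
     trees m' = trees (sett m c (rcons s i) mk2) & forall j, Open m' j <-> Open m j \/ j = cnt m]) D m.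
Proof.
move=> hm hp hk; apply: (wp_bind (Q1 := fun v m' => v = 0 /\ m' = sett m c (rcons s i) mk2)).
  by apply: (wp_tree (s := s) (a := i)) => //; rewrite hk //; right.
move=> _ _ _ [-> ->] /=; set m1 := sett _ _ _ _.
have hm1 : heap m1 by apply: (heap_tabs hm) => //; apply: ole_refl.
apply: (wp_seq (Q1 := fun _ m' => [/\ prow m m' (cnt m) (fun _ => False), trees m' = trees m1 & forall j, Open m' j <-> Open m j \/ j = cnt m])).
  apply: (wp_weak (wp_push hKK D (b := b) _ hm1)) => //; try lia.
  move=> _ m2 _ [h1 h2 h3 h4]; split=> //.
by move=> _ m2 _ h; apply: wp_ret.
Qed.

Lemma wp_closed m m1 m0 n n' s i l Z D : n <> n' ->
  prow m1 m n' (fun z => z ∈ dec (rcons s i)) -> prow m0 m1 n Z -> Open m n' -> (forall j, Open m j -> ole j n') ->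
  Open m n -> (forall j, Open m j -> j <> n' -> ole j n) ->
  path_to (trees m c) (rcons s i) l -> trees m c (rcons (rcons s i) l) = mk0 ->
  wp (efft b) (load_body B KK c b) (fun v m' => v = 0 /\ [/\ prow m0 m' n (fun z => Z z \/ z = dec (rcons s i)),
     trees m' = trees (sett m c (rcons s i) mk3) & forall j, Open m' j <-> Open m j /\ j <> n']) D m.
Proof.
move=> nn hp hq on' hmax on hmax2 path hk.
have [hm1 he0 [n0 ln1] _ _] := hq.
apply: (wp_bind (Q1 := fun v m' => v = 1 /\ m' = sett m c (rcons s i) mk3)).
  apply: (wp_tree (s := rcons s i) (a := l)) => //; rewrite hk //; first by left.
  by move=> _ e; case: (s) e.
move=> _ _ _ [-> ->] /=; set m2 := sett _ _ _ _.
have hp2 : prow m1 m2 n' (fun z => z ∈ dec (rcons s i)) by apply: (prow_tabs hp) => //; apply: ole_refl.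
apply: (wp_seq (Q1 := fun _ m3 => [/\ prow m0 m3 n Z, pt m3 (regs m3 (b + 2)) (dec (rcons s i)), trees m3 = trees m2 &
    forall j, Open m3 j <-> Open m j /\ j <> n'])).
  apply: (wp_weak (@wp_pop U M X0 B KK hKK b m2 m1 n' (dec (rcons s i)) D b6 bK hp2 on' hmax)) => //.
  by move=> _ m3 _ [h1 h2 h3 h4 h5]; split=> //; apply: prow_ext hq h1 h2.
move=> _ m3 _ [hq3 p3 r3 o3]; have hm3 : heap m3 by case: hq3.
apply: (wp_seq (Q1 := fun _ m4 => [/\ prow m0 m4 n Z, pt m4 (regs m4 (b + 2)) (dec (rcons s i)), trees m4 = trees m2,
    regs m4 b = n & forall j, Open m4 j <-> Open m j /\ j <> n'])).
  apply: (wp_weak (@wp_top U M X0 B KK hKK b (b + 1) m3 n D _ _ _ hm3 _ _)) => //; try lia.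
  - by apply/o3; split.
  - by move=> j /o3[h1 h2]; apply: hmax2.
  move=> _ m4 s4 [h1 h2 [h3 h4]]; split=> //.
  - by apply: (prow_tabs hq3) => //; right.
  - apply/(pt_tabs _ _ h3); rewrite (mstepC s4) //= !inE; case: eqP; [lia|case: ifP => //; lia].
  - by rewrite h4.
  - by move=> j; rewrite -o3 /Open h3.
move=> _ m4 _ [hq4 p4 r4 b4 o4].
apply: (wp_seq (Q1 := fun _ m5 => [/\ prow m0 m5 n (fun z => Z z \/ z = dec (rcons s i)), trees m5 = trees m2 &
    forall j, Open m5 j <-> Open m j /\ j <> n'])).
  have K3 : 3 < KK by lia.
  have k4 : kext m4 (settb m4 0 (pr n (regs m4 (b + 2)))) by apply: (kext_set (ownC n _)); case: hq4.
  wp_put D K3; first by rewrite b4.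
  move=> _ m5 s5 [h1 h2]; rewrite b4 in h1; have c5 : cnt m5 = cnt m4 by apply: (mstepC s5).
  split.
  - exact: (prow_add hq4 p4 s5 h1 c5).
  - by rewrite h2.
  - move=> j; rewrite -o4 /Open h1 /=; split=> [[[h3|[//]] h4]|[h3 h4]].
      by split=> // h; apply: h4; left.
    by split; [left|case=> [|[]]].
by move=> _ m5 _ h; apply: wp_ret.
Qed.

(** Induction on the tree and, at each node, transfinitely over its children. A child takes one
    iteration that opens it, those for its subtree, and one that closes it; all are iterations of
    the same loop, composed by [mreach_trans]. *)
Lemma load_children s : N s -> forall m0 m n D, prow m0 m n (fun _ => False) -> Open m n -> (forall j, Open m j -> ole j n) ->
  path_to (trees m c) s (ozero U) -> (forall a, fresh (trees m c) (rcons s a)) ->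
  mreach false (efft b) (load_body B KK c b) m (fun m' => [/\ prow m0 m' n (fun z => z ∈ dec s),
    forall j, Open m' j <-> Open m j,
    exists l, path_to (trees m' c) s l /\ trees m' c (rcons s l) = mk0 &
    outside c s m m' /\ tame m m']) D.
Proof.
move: s; apply: (shape_ind hN) => s ns ih m0 m n D hp on hmax path hf.
have [l hl] := shape_type s hN.
pose I i m' := [/\ prow m0 m' n (fun z => exists j, olt j i /\ z = dec (rcons s j)), forall j, Open m' j <-> Open m j,
  forall a, olt a i -> trees m' c (rcons s a) = mk3,
  forall a, ~ olt a i -> forall u, trees m' c (rcons s a ++ u) = trees m c (rcons s a ++ u) & outside c s m m' /\ tame m m'].
have pathI i m' : I i m' -> path_to (trees m' c) s i.
  move=> [_ _ h3 _ [h5 _]]; apply: (path_kids path) => // u hu; apply: h5 => // -[_]; exact: hu.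
apply: (mreach_weak (st := false) (e := efft b) (P := I l) (D := D)) => //; first last.
- move=> m' _ hI; have [h1 h2 h3 h4 h5] := hI; split=> //.
  + apply: (prow_eqv h1) => z; rewrite hdec //; split=> -[a [ha ->]]; exists a; split=> //; by apply/hl.
  + exists l; split; first exact: pathI.
    have nl : ~ N (rcons s l) by move=> /hl/olt_irr.
    have := h4 l (@olt_irr U l) [::]; rewrite cats0 => ->.
    by have [_ h] := hf l [::]; rewrite cats0 in h; apply: h.
apply: (mreach_tf (I := I)).
- split=> //.
  + by apply: (prow_eqv hp) => z; split=> // -[j [/olt0]].
  + by move=> a /olt0.
  + by split=> //; apply: tame_refl.
- move=> i m' il _ hI; have [h1 h2 h3 h4 [h5 ht]] := hI; have hm' : heap m' by case: h1.
  have ni : N (rcons s i) by apply/hl.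
  have ci : trees m' c (rcons s i) = mk1.
    have := h4 i (@olt_irr U i) [::]; rewrite cats0 => ->.
    by have [h _] := hf i [::]; rewrite cats0 in h; apply: h.
  set n' := cnt m'.
  have ln : olt n n' by apply: (Open_lt hm'); apply/h2.
  apply: (mreach_trans (P' := fun m1 => [/\ prow m' m1 n' (fun _ => False), trees m1 = trees (sett m' c (rcons s i) mk2) &
     forall j, Open m1 j <-> Open m' j \/ j = n'])).
    apply: (@mreach_weak U M X0 B KK true false (efft b) (efft b) _ _ _ D D _ (mreach_iter (wp_opened D hm' (pathI i m' hI) ci))) => //.
  move=> m1 _ [hp1 r1 o1].
  have t1 u : u <> rcons s i -> trees m1 c u = trees m' c u by move=> hu; rewrite r1 sett_neq // => -[].
  have t1' : trees m1 c (rcons s i) = mk2 by rewrite r1 sett_eq.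
  have out1 : outside c s m m1 by apply: (outside_trans h5) => c' u c'B hu; rewrite r1; apply: (@outside_sett c s i mk2 m' m').
  apply: (mreach_trans (P' := fun m2 => [/\ prow m' m2 n' (fun z => z ∈ dec (rcons s i)), forall j, Open m2 j <-> Open m1 j,
     exists l', path_to (trees m2 c) (rcons s i) l' /\ trees m2 c (rcons (rcons s i) l') = mk0 & outside c (rcons s i) m1 m2 /\ tame m1 m2])).
    apply: (ih i ni) => //.
    + by apply/o1; right.
    + by move=> j /o1[/(Open_lt hm')|->]; [left|apply: ole_refl].
    + exact: (path_enter (pathI i m' hI)).
    + move=> a u; have hneq : rcons (rcons s i) a ++ u <> rcons s i.
        by move=> e; apply: (@not_kid (rcons s i) a u).
      rewrite t1 // cat_rcons (h4 i (@olt_irr U i)) -cat_rcons.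
      by have := hf i (a :: u); rewrite -!cat_rcons.
  move=> m2 _ [hp2 o2 [l' [path2 k2]] [out2 ht2]].
  apply: (@mreach_weak U M X0 B KK true false (efft b) (efft b) _ _ _ D D _
    (mreach_iter (@wp_closed m2 m' m0 n n' s i l' _ D _ hp2 h1 _ _ _ _ path2 k2))) => //.
  + by move=> e; rewrite e in ln; case: (olt_irr ln).
  + by apply/o2/o1; right.
  + by move=> j /o2/o1[/(Open_lt hm')|->]; [left|apply: ole_refl].
  + by apply/o2/o1; left; apply/h2.
  + by move=> j /o2/o1[/h2/hmax|].
  move=> m3 _ [hp3 r3 o3]; split.
  + apply: (prow_eqv hp3) => z; split=> [[[j [ji ->]]|->]|[j [/oltS[ji|->] ->]]].
    * by exists j; split=> //; apply/oltS; left.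
    * by exists i; split=> //; apply: olt_succ.
    * by left; exists j.
    * by right.
  + move=> j; rewrite o3 o2 o1 -h2; split=> [[[|->] h]|h] //; split; first by left.
    by move=> e; have := Open_lt hm' h; rewrite e => /olt_irr.
  + move=> a /oltS[ai|->]; last by rewrite r3 sett_eq.
    have ne : rcons s a <> rcons s i by move=> /rcons_inj[e]; rewrite e in ai; case: (olt_irr ai).
    rewrite r3 sett_neq; last by case.
    rewrite out2 ?t1 // ?h3 // => -[_ [a' [v e]]].
    by have := f_equal size e; rewrite size_cat !size_rcons; lia.
  + move=> a na u; have ne : a <> i by move=> e; apply: na; rewrite e; apply: olt_succ.
    have ne2 : rcons s a ++ u <> rcons s i by move=> e; apply: ne; apply: (@rcons_catE s a i [::] u); rewrite cats0.
    rewrite r3 sett_neq; last by case.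
    rewrite out2 ?t1 //; first by apply: h4 => h; apply: na; apply/oltS; left.
    by move=> [_ [a' [v e]]]; apply: ne; apply: (@rcons_catE s a i (a' :: v) u); rewrite e cat_rcons.
  + split.
      by move=> c' u c'B hu; rewrite r3 (@outside_sett c s i mk3 m2 m2) // (outside_rcons out2) //; exact: out1.
    apply: (tame_trans ht); apply: (tame_trans (m2 := m1)); first by apply: (tame_sett r1) => //; rewrite ci.
    apply: (tame_trans ht2); apply: (tame_sett r3) => //; rewrite out2 ?t1' // => -[_ [a' [v e]]].
    exact: (@not_kid (rcons s i) a' v e).
(* Between two children all inner nodes are closed again, so the same rows are open at every stage
   and hence at the limit. Each cell below [B] shows the mark it has at some stage. *)
- move=> k ms ml lk ll hI hpp hm lm.
  have e0 : acc (efft b) 0 < 2 by [].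
  have [_ lt lr lst] := lm; have z0 := proj1 ll.
  have tr u c' : c' < B -> exists i, [/\ olt i k, trees ml c' u = trees (ms i) c' u & forall i', ole i i' -> olt i' k -> trees (ms i') c' u = trees ml c' u].
    move=> c'B; have [i [ik h]] := lr c' u c'B; exists i; split=> //; by rewrite h //; apply: ole_refl.
  split.
  + apply: (prow_eqv (prow_lim (Z := fun i z => exists j, olt j i /\ z = dec (rcons s j)) e0 ll lm hpp _)) => [i /hI[] //|z].
    split=> [[i [ik [j [ji ->]]]]|[j [jk ->]]]; first by exists j; split=> //; apply: olt_trans ji ik.
    by exists (osucc j); split; [exact: (proj2 ll)|exists j; split=> //; apply: olt_succ].
  + move=> j; split=> [[/lt[i [ik h4]] h5]|[h4 h5]].
      case: (hI i ik) => _ o _ _ _; apply/o; split=> // h; apply: h5; apply/lt; by exists i.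
    split; first by apply/lt; exists (ozero U); split=> //; case: (hI _ z0) => _ o _ _ _; case: (proj2 (o j) (conj h4 h5)).
    by move=> /lt[i [ik h]]; case: (hI i ik) => _ o _ _ _; case: (proj2 (o j) (conj h4 h5)).
  + move=> a ak; have [i [ik _ hi]] := tr (rcons s a) c cB.
    have sa := proj2 ll a ak.
    case: (ole_olt i (osucc a)) => h.
      by rewrite -(hi _ h sa); case: (hI _ sa) => _ _ h3 _ _; apply: h3; apply: olt_succ.
    rewrite -(hi _ (ole_refl i) ik); case: (hI _ ik) => _ _ h3 _ _; apply: h3; exact: olt_trans (olt_succ a) h.
  + move=> a na u; have [i [ik -> _]] := tr (rcons s a ++ u) c cB; case: (hI _ ik) => _ _ _ h4 _; apply: h4 => h.
    by apply: na; apply: olt_trans h ik.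
  + split=> [c' u c'B hu|c' u c'B]; have [i [ik -> _]] := tr u c' c'B; case: (hI _ ik) => _ _ _ _ [h5 ht].
      exact: h5.
    exact: ht.
Qed.

Lemma wp_load m D : heap m -> (forall j, ~ Open m j) -> fresh (trees m c) [::] -> N [::] ->
  wp (efft b) (load B KK c b) (fun _ m' => [/\ heap m', ext m m', pt m' (regs m' (b + 2)) (dec [::]), forall j, ~ Open m' j &
    (forall (c' : nat) u, c' < B -> c' <> c -> trees m' c' u = trees m c' u) /\ tame m m']) D m.
Proof.
move=> hm no hf n0.
have [r0 _] := hf [::]; have {}r0 := r0 n0.
apply: (wp_seq (Q1 := fun _ m1 => m1 = sett m c [::] mk4)); first by apply: wp_open_root => //; right.
move=> _ _ _ ->; set m1 := sett _ _ _ _.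
have hm1 : heap m1 by apply: (heap_tabs hm) => //; apply: ole_refl.
apply: (wp_seq (Q1 := fun _ m2 => [/\ prow m m2 (cnt m) (fun _ => False), trees m2 = trees m1 & forall j, Open m2 j <-> j = cnt m])).
  apply: (wp_weak (wp_push hKK D (b := b) _ hm1)) => //; try lia.
  move=> _ m2 _ [h1 h2 h3 h4]; split=> // j; rewrite h4.
  by split=> [[/no|]|] //; right.
move=> _ m2 _ [hp2 r2 o2].
have t2 u : u <> [::] -> trees m2 c u = trees m c u by move=> hu; rewrite r2 sett_neq // => -[].
apply: (wp_loop (e := efft b)).
apply: (mreach_weak (@load_children [::] n0 m m2 (cnt m) D hp2 _ _ _ _)) => //.
- exact/o2.
- by move=> j /o2 ->; apply: ole_refl.
- split; first by rewrite r2 sett_eq.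
  + by move=> p x q e; have := f_equal size e; rewrite size_cat /=; lia.
  + move=> p x q x' e lx; case: (path_sub e) => [[_ [ex _]]|[q' [_ es]]]; first by rewrite ex in lx; case: (olt0 lx).
    by have := f_equal size es; rewrite size_cat /=; lia.
- by move=> a u; rewrite t2 //; apply: (hf (a :: u)).
move=> m3 _ [hp3 o3 [l [path3 k3]] [out3 ht3]]; have [hm3 _ _ _ _] := hp3.
apply: (wp_bind (Q1 := fun v m' => v = 2 /\ m' = sett m3 c [::] mk0star)).
  by apply: (wp_tree (s := [::]) (a := l)) => //; rewrite k3 //; left.
move=> _ _ _ [-> ->] /=; set m4 := sett _ _ _ _.
have hp4 : prow m m4 (cnt m) (fun z => z ∈ dec [::]) by apply: (prow_tabs hp3) => //; apply: ole_refl.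
apply: (wp_seq (Q1 := fun _ m5 => [/\ heap m5, ext m m5, pt m5 (regs m5 (b + 2)) (dec [::]), forall j, ~ Open m5 j & trees m5 = trees m4])).
  apply: (wp_weak (@wp_pop U M X0 B KK hKK b m4 m (cnt m) (dec [::]) D b6 bK hp4 _ _)) => //.
  - by apply/o3/o2.
  - by move=> j /o3/o2 ->; apply: ole_refl.
  by move=> _ m5 _ [h1 h2 h3 h4 h5]; split=> // j /h5[/o3/o2].
move=> _ m5 _ [h1 h2 h3 h4 h5]; apply: wp_ret; split=> //; split=> //; split=> [c' u c'B ne|].
  rewrite h5 sett_neq ?out3 //; [|by case|by case].
  by rewrite r2 sett_neq // => -[].
apply: (tame_trans (m2 := m2)); first by apply: (tame_sett r2) => //; rewrite r0.
apply: (tame_trans ht3); apply: (tame_sett h5) => //; by rewrite (pt_root path3).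
Qed.

End Load.

(** * Writing the value as a tree *)

Definition find_kid B KK b := find_ B KK (b + 2) 0 (Bind (get2 B KK 0 b (b + 2)) (Ret 0)
  (Bind (get2 B KK 6 b (b + 2)) (Ret 1) (Ret 0) (Ret 0)) (Ret 0)).
Definition enter B KK y b := seqc (push B KK (b + 4)) (copyrow B KK (b + 4) y (b + 3)).
(** Each node has a row of its own, a copy of the elements of its set, because the same set may
    occur at several nodes and table 6 records the emitted elements separately for each. If no
    element is left the node is closed; otherwise the next one is noted in table 6, a child is
    opened for it and its row is pushed. *)
Definition save_body B KK b := seqc (top B KK b (b + 1)) (Bind (find_kid B KK b)
  (seqc (set B KK 5 b) (Bind (tree_cmd (fun _ => false) 0) (Ret 0) (Ret 0) (Ret 1)))
  (seqc (set2 B KK 6 b (b + 2)) (seqc (tree_cmd (fun _ => true) 0) (seqc (enter B KK (b + 2) b) (Ret 0)))) (Ret 0)).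
Definition save B KK y b := seqc (open_root 0) (seqc (enter B KK y b) (Loop (save_body B KK b))).

Section Save.
Variables (U : zfc_universe) (M : machine) (X0 : tape U) (B KK : nat).
Local Notation ON := (ON U).
Local Notation mem := (mem U).
Local Notation wp := (@wp U M X0 B KK).
Local Notation mreach := (@mreach U M X0 B KK).
Hypothesis hKK : 32 < KK.
Implicit Types (n i j a k : ON).
Variable b : nat.
Hypothesis B0 : 0 < B.
Hypothesis b6 : 6 < b.
Hypothesis bK : b + 4 < KK.

Lemma own6 n j : own n 6 (pr n j). Proof. by constructor 1; split=> //; exists j. Qed.

Lemma pend_aux m0 m n S a t p : pend m0 m n S -> 2 < t -> own a t p -> olt a (cnt m) -> ole (cnt m0) a -> pend m0 (settb m t p) n S.
Proof.
move=> [hm he n1 nk h] t2 o la lb.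
have E t' p' : t' < 3 -> tabs (settb m t p) t' p' <-> tabs m t' p'.
  by move=> t3 /=; split=> [[|[e _]]|] //; [lia|left].
split.
- exact: (heap_aux hm t2 o la).
- exact: (ext_aux he o lb).
- by [].
- by rewrite /Kn E.
- by move=> c; rewrite /C E // -/(C m n c).
Qed.

Lemma pend_tabs m0 m m' n S : pend m0 m n S -> tabs m' = tabs m -> ole (cnt m) (cnt m') -> pend m0 m' n S.
Proof. by move=> hp e hc; apply: (pend_ext hp); [apply: heap_tabs e hc; case: hp|apply: ext_tabs]. Qed.

Lemma wp_enter (y : nat) m D : 6 < y < KK -> y <> b + 3 -> y <> b + 4 -> heap m -> olt (regs m y) (cnt m) ->
  wp (efft b) (enter B KK y b) (fun _ m' => [/\ pend m m' (cnt m) (C m (regs m y)), trees m' = trees m,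
    forall j, Open m' j <-> Open m j \/ j = cnt m & forall p, tabs m' 6 p <-> tabs m 6 p]) D m.
Proof.
move=> hy y3 y4 hm ly.
apply: (wp_seq (Q1 := fun _ m1 => [/\ pend m m1 (cnt m) (fun _ => False), regs m1 (b + 4) = cnt m, trees m1 = trees m,
    tabs m1 = tabs (settb m 4 (cnt m)) & regs m1 y = regs m y])).
  pose e := Eff (fun r => if r == 0 then 1 else if (r < 7) || (r == b + 4) then 2 else 0) true.
  apply: (wp_weak (e := e) (Q := fun _ m1 => [/\ pend m m1 (cnt m) (fun _ => False), regs m1 (b + 4) = cnt m, trees m1 = trees m &
    tabs m1 = tabs (settb m 4 (cnt m))]) (D := D)) => //.
  - apply: (wp_seq (Q1 := fun _ m1 => [/\ pend m m1 (cnt m) (fun _ => False), regs m1 (b + 4) = cnt m, tabs m1 = tabs m & trees m1 = trees m])).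
      apply: (wp_weak (wp_newp hKK (t := b + 4) (e := effl 4 [:: b + 4] true false) D _ _ _ hm)) => //; try lia.
      + by rewrite /= inE eqxx orbT; case: eqP => //; lia.
      + split=> // r /=; case: eqP => // _; rewrite inE; case: (r == b + 4); rewrite ?orbT // !orbF; case: ifP => // h; case: ifP => //; lia.
      by move=> _ m1 [_ _ _ s1 _] [h1 h2 h3 h4]; split=> //; apply: s1.
    move=> _ m1 _ [hp1 b1 t1 r1]; have [_ _ [n1 n2] nk1 _] := hp1.
    apply: wp_set; try lia; first by rewrite b1; apply: (kext_set (own4 _)).
    rewrite b1; split=> //; last by rewrite /= t1.
    exact: (pend_aux hp1 _ (own4 _)).
  - split=> // r /=; case: eqP => // _; case: ifP => // /orP[->|/eqP ->] //; by case: ifP => //; lia.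
  - move=> _ m1 s1 [h1 h2 h3 h4]; split=> //; apply: (mstepC s1) => /=.
    by case: eqP; [lia|case: ifP => //; lia].
move=> _ m1 _ [hp1 b1 r1 t1 y1]; have he1 : ext m m1 by case: hp1.
apply: (wp_weak (wp_copyrowt hKK (t := b + 4) (r := y) (j := b + 3) D _ _ _ _ _ hp1 b1 _)) => //; try lia.
- by rewrite y1; apply: olt_neq.
move=> _ m2 s2 [hp2 t2].
have n5 : ~ tabs m 5 (cnt m) by move=> /(h_own hm (own5 _))/olt_irr.
split.
- apply: (pend_eqv hp2) => c; rewrite y1 (C_ext c he1 ly).
  by split=> [[]|]; [| |right].
- by case: s2 => _ _ _ -> //; rewrite r1.
- move=> j; rewrite /Open !t2 // t1 /=; split=> [[[h|[_ ->]] h5]|[[h h5]|->]]; [|by right| |].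
  + by left; split=> // h'; apply: h5; left.
  + by split; [left|case=> [|[]]].
  + by split; [right|case=> [|[]]].
- by move=> p; rewrite t2 // t1 /=; split=> [[|[]]|] //; left.
Qed.

Lemma wp_find_kid m n D : heap m -> regs m b = n ->
  wp (efft b) (find_kid B KK b) (fun v m' => [/\ eqtt m m', cnt m' = cnt m, regs m' b = n &
     (v = 1 /\ [/\ C m n (regs m' (b + 2)), ~ tabs m 6 (pr n (regs m' (b + 2))) &
        forall j, olt j (regs m' (b + 2)) -> C m n j -> tabs m 6 (pr n j)]) \/
     (v = 0 /\ forall j, C m n j -> tabs m 6 (pr n j))]) D m.
Proof.
move=> hm bn; have K3 : 3 < KK by lia.
have bc m' x : mstep (bump (lv 4) (b + 2)) (setr m (b + 2) x) m' -> cnt m' = cnt m /\ regs m' b = n.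
  move=> st; split; first by apply: (bumpC st) => //; lia.
  by rewrite (bumpC st) //; lia.
have P1 j : C m n j -> ~ (C m n j /\ ~ tabs m 6 (pr n j)) -> tabs m 6 (pr n j).
  by move=> cj h; apply: NNPP => h6; apply: h.
apply: (wp_find (lv 4) (fun j => C m n j /\ ~ tabs m 6 (pr n j))) => //; try lia.
- by rewrite /=; case: eqP; [lia|case: ifP => //; lia].
- move=> j m1 lj ej s1 et1; have [c1 b1] := bc _ _ s1.
  apply: (wp_bind (Q1 := fun v m2 => [/\ v = b2 (C m n j), eqtt m m2, regs m2 b = n & regs m2 (b + 2) = j])).
    wp_get D K3.
    move=> v m2 s2 [-> et2]; split.
    + by congr b2; rewrite b1 ej /C (proj1 et1).
    + exact: eqtt_trans et1 et2.
    + by rewrite (mstepC s2) //; lia.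
    + by rewrite (mstepC s2) //; lia.
  move=> _ m2 _ [-> et2 n2 j2]; case: (classic (C m n j)) => hc; last first.
    by rewrite b2F //=; apply: wp_ret; split=> //; rewrite b2F // => -[].
  rewrite (b2T hc) /=; apply: (wp_bind (Q1 := fun v m3 => v = b2 (tabs m 6 (pr n j)) /\ eqtt m m3)).
    wp_get D K3.
    move=> v m3 s3 [-> et3]; split; last exact: eqtt_trans et2 et3.
    by congr b2; rewrite n2 j2 (proj1 et2).
  move=> _ m3 _ [-> et3]; case: (classic (tabs m 6 (pr n j))) => h6.
    by rewrite (b2T h6) /=; apply: wp_ret; split=> //; rewrite b2F // => -[].
  by rewrite (b2F h6) /=; apply: wp_ret; split=> //; rewrite b2T.
- move=> m1 j s1 et1 ej lj [hc h6] hmin; have [c1 b1] := bc _ _ s1; split=> //; left; split=> //.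
  by rewrite ej; split=> // i ij ci; apply: P1 => //; apply: hmin.
- move=> m1 s1 et1 ej hno; have [c1 b1] := bc _ _ s1; split=> //; right; split=> // j cj.
  by apply: P1 => //; apply: hno; apply: (h_row hm cj).
Qed.

Variable mm : mem.
Hypothesis hmm : heap mm.

(** The tree to be written, in terms of the rows of the memory [mm] before writing started; these
    rows stay fixed while it goes on. *)
Fixpoint otree k s := if s is a :: s' then exists j, [/\ C mm k j, ct (C mm k) j = a & otree j s'] else True.

Lemma wp_emit_open m m0 n k j s D : pend m0 m n (C mm k) -> ext mm m0 -> Kn mm j -> Open m n -> (forall i, Open m i -> ole i n) ->
  C mm k j -> (forall i, tabs m 6 (pr n i) <-> olt i j /\ C mm k i) ->
  path_to (trees m 0) s (ct (C mm k) j) -> trees m 0 (rcons s (ct (C mm k) j)) = mk0 ->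
  wp (efft b) (save_body B KK b) (fun v m' => v = 0 /\ [/\ pend (settb m 6 (pr n j)) m' (cnt m) (C mm j),
    trees m' = trees (sett m 0 (rcons s (ct (C mm k) j)) mk2), forall i, Open m' i <-> Open m i \/ i = cnt m &
    forall p, tabs m' 6 p <-> tabs m 6 p \/ p = pr n j]) D m.
Proof.
move=> hp hx kj on hmax cj h6 path hk; have K3 : 3 < KK by lia.
have [hm he [n0 ln] nk hC] := hp.
apply: (wp_seq (Q1 := fun _ m1 => [/\ regs m1 b = n, cnt m1 = cnt m & eqtt m m1])).
  apply: (wp_sub (@wp_top U M X0 B KK hKK b (b + 1) m n D _ _ _ hm on hmax)) => //; try lia.
move=> _ m1 _ [b1 c1 [t1 r1]]; have hm1 : heap m1 by apply: (heap_tabs hm t1); right.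
apply: (wp_bind (Q1 := fun v m2 => [/\ v = 1, regs m2 b = n, regs m2 (b + 2) = j, cnt m2 = cnt m & eqtt m m2])).
  apply: (wp_weak (@wp_find_kid m1 n D hm1 b1)) => //.
  move=> v m2 _ [[t2 r2] c2 b2' h].
  have et2 : eqtt m m2 by split; rewrite ?t2 ?r2.
  move: h; rewrite /C t1; set q := regs m2 _; case=> [[-> [h1 h2 h3]]|[_ h]]; last first.
    have /h6[] : tabs m 6 (pr n j) by apply: h; apply/hC.
    by move=> /olt_irr.
  split=> //; last by rewrite c2.
  move/hC: h1 => h1; case: (olt_total q j) => // [lt|lt]; first by case: h2; apply/h6.
  have /h6[] : tabs m 6 (pr n j) by apply: h3 => //; apply/hC.
  by move=> /olt_irr.
move=> _ m2 _ [-> b2' q2 c2 [t2 r2]] /=.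
set mj := settb m 6 (pr n j).
apply: (wp_seq (Q1 := fun _ m3 => [/\ tabs m3 = tabs mj, trees m3 = trees m, regs m3 (b + 2) = j & cnt m3 = cnt m])).
  wp_put D K3.
  - by rewrite b2' q2; apply: (kext_set (own6 n j)); rewrite /Kn t2.
  move=> _ m3 s3 [h1 h2]; split.
  - by rewrite h1 b2' q2 /mj /= t2.
  - by rewrite h2.
  - by rewrite (mstepC s3) //; lia.
  - by rewrite -c2; apply: (mstepC s3).
move=> _ m3 _ [t3 r3 q3 c3].
apply: (wp_seq (Q1 := fun v m4 => v = 0 /\ m4 = sett m3 0 (rcons s (ct (C mm k) j)) mk2)).
  by apply: (wp_tree (s := s) (a := ct (C mm k) j)) => //; rewrite ?r3 // hk; left.
move=> _ _ _ [_ ->]; set m4 := sett _ _ _ _.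
have hpj : pend m0 mj n (C mm k) by apply: (pend_aux hp _ (own6 n j)).
have [hmj _ _ _ _] := hpj.
have c4 : cnt m4 = cnt mj by rewrite /cnt /= -/(cnt m3) c3.
have hm4 : heap m4 by apply: (heap_tabs (m' := m4) hmj t3); right.
have xj : ext mm mj by apply: ext_trans hx _; case: hpj.
have lj : olt j (cnt mm) by apply: (h_own hmm (ownK j)).
have q4 : regs m4 (b + 2) = j by [].
apply: (wp_seq (Q1 := fun _ m5 => [/\ pend mj m5 (cnt m) (C mm j), trees m5 = trees m4, forall i, Open m5 i <-> Open m i \/ i = cnt m &
    forall p, tabs m5 6 p <-> tabs m 6 p \/ p = pr n j])).
  apply: (wp_weak (@wp_enter (b + 2) m4 D _ _ _ hm4 _)) => //; try lia.
  - by rewrite q4 c4; apply: olt_le_trans lj (proj1 xj).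
  move=> _ m5 _ [h1 h2 h3 h4]; rewrite q4 c4 in h1 h3; split=> //.
  - have h5 : pend m4 m5 (cnt m) (C mm j).
      by apply: (pend_eqv h1) => c; rewrite /C /m4 /= t3 -/(C mj j c) (C_ext c xj lj).
    by apply: (pend_ext0 h5); apply: (ext_tabs (m' := m4) t3); right.
  - by move=> i; rewrite h3 /Open /m4 /= t3 /mj /=; split=> -[h|h]; try (by right); left; case: h => h h';
      [split; [case: h => [//|[]//]|move=> h5; apply: h'; left]|split; [left|case=> [|[]]]].
  - move=> p; rewrite h4 /m4 /= t3 /mj /=; split=> -[h|h]; try (by left); right; [by case: h|by []].
move=> _ m5 _ [h1 h2 h3 h4]; apply: wp_ret; split=> //; split=> //.
by rewrite h2 /m4 /= r3.
Qed.

Lemma wp_emit_close m m1 n n' S s i l D : pend m1 m n' S -> Open m n' -> (forall j, Open m j -> ole j n') ->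
  (forall j, S j -> tabs m 6 (pr n' j)) -> path_to (trees m 0) (rcons s i) l -> trees m 0 (rcons (rcons s i) l) = mk0 -> olt n n' ->
  wp (efft b) (save_body B KK b) (fun v m' => v = 0 /\ [/\ heap m', ext m1 m', cnt m' = cnt m, trees m' = trees (sett m 0 (rcons s i) mk3) &
    (forall j, Open m' j <-> Open m j /\ j <> n') /\ forall p, tabs m' 6 p <-> tabs m 6 p]) D m.
Proof.
move=> hp on hmax h6 path hk nn.
have [hm he [n0 ln] nk hS] := hp.
apply: (wp_seq (Q1 := fun _ m2 => [/\ regs m2 b = n', cnt m2 = cnt m & eqtt m m2])).
  apply: (wp_sub (@wp_top U M X0 B KK hKK b (b + 1) m n' D _ _ _ hm on hmax)) => //; try lia.
move=> _ m2 _ [b2' c2 [t2 r2]]; have hm2 : heap m2 by apply: (heap_tabs hm t2); right.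
apply: (wp_bind (Q1 := fun v m3 => [/\ v = 0, regs m3 b = n', cnt m3 = cnt m & eqtt m m3])).
  apply: (wp_weak (@wp_find_kid m2 n' D hm2 b2')) => //.
  move=> v m3 _ [[t3 r3] c3 b3 h]; have et3 : eqtt m m3 by split; rewrite ?t3 ?r3.
  move: h; rewrite /C t2; case=> [[_ [h1 h2 _]]|[-> _]]; last by split=> //; rewrite c3.
  by case: h2; apply: h6; apply/hS.
move=> _ m3 _ [-> b3 c3 [t3 r3]] /=.
apply: (wp_seq (Q1 := fun _ m4 => m4 = settb m3 5 n')).
  apply: wp_set; try lia; last by rewrite b3.
  by rewrite b3; apply: (kext_set (own5 n')); rewrite /Kn t3.
move=> _ _ _ ->; apply: (wp_bind (Q1 := fun v m5 => v = 1 /\ m5 = sett (settb m3 5 n') 0 (rcons s i) mk3)).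
  apply: (wp_tree (s := rcons s i) (a := l)) => //=; rewrite ?r3 //; first by left.
  by move=> _ e; case: (s) e.
move=> _ _ _ [-> ->] /=; apply: wp_ret; split=> //.
have hp3 : pend m1 m3 n' S by apply: (pend_tabs hp) => //; right.
have [hm5 he5 _ _ _] : pend m1 (settb m3 5 n') n' S by apply: (pend_aux hp3 _ (own5 n')) => //; rewrite c3.
split=> //.
- by apply: (heap_tabs hm5) => //; apply: ole_refl.
- by rewrite /= r3.
- split=> [j|p] /=; rewrite /Open /= t3; last by split=> [[|[]]|] //; left.
  split=> [[[h4|[//]] h5]|[[h4 h5] nj]].
    by split; [split=> // h; apply: h5; left|move=> e; apply: h5; right].
  by split; [left|case=> [|[]]].
Qed.

(** Induction on the row [k], with an index running over the row numbers below [k]. A member takes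
    one iteration that opens its node, those for its subtree, and one that closes it. *)
Lemma save_children k : Kn mm k -> forall s m0 m n D, pend m0 m n (C mm k) -> ext mm m0 -> (forall p, ~ tabs m 6 (pr n p)) ->
  Open m n -> (forall j, Open m j -> ole j n) -> path_to (trees m 0) s (ozero U) ->
  (forall a u, trees m 0 (rcons s a ++ u) = mk0) ->
  mreach false (efft b) (save_body B KK b) m (fun m' => [/\ pend m0 m' n (C mm k),
    forall j, Open m' j <-> Open m j,
    (exists l, path_to (trees m' 0) s l /\ trees m' 0 (rcons s l) = mk0) /\ (forall j, C mm k j -> tabs m' 6 (pr n j)),
    forall a u, trees m' 0 (rcons s a ++ u) <> mk0 <-> otree k (a :: u) &
    outside B 0 s m m']) D.
Proof.
elim/olt_ind: k => k ih kk s m0 m n D hp hx h6 on hmax path hf.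
set pos := ct (C mm k).
pose I i m' := [/\ pend m0 m' n (C mm k), forall j, Open m' j <-> Open m j,
  forall j, tabs m' 6 (pr n j) <-> olt j i /\ C mm k j,
  (forall a, olt a (pos i) -> trees m' 0 (rcons s a) = mk3) /\ (forall a u, ~ olt a (pos i) -> trees m' 0 (rcons s a ++ u) = mk0) &
  (forall a u, olt a (pos i) -> trees m' 0 (rcons s a ++ u) <> mk0 <-> otree k (a :: u)) /\ outside B 0 s m m'].
have pathI i m' : I i m' -> path_to (trees m' 0) s (pos i).
  move=> [_ _ _ [h4 _] [_ h5]]; apply: (path_kids path) => // u hu; apply: h5 => // -[_]; exact: hu.
have ck j : C mm k j -> olt j k by move=> cj; case: (h_can hmm kk cj).
apply: (mreach_weak (st := false) (e := efft b) (P := I k) (D := D)) => //; first last.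
- move=> m' _ hI; have [h1 h2 h3 [h4 h5] [h7 h8]] := hI; split=> //.
  + split; last by move=> j cj; apply/h3; split=> //; apply: ck.
    exists (pos k); split; first exact: pathI.
    by have := h5 (pos k) [::] (@olt_irr U (pos k)); rewrite cats0.
  + move=> a u; case: (classic (olt a (pos k))) => ak; first exact: h7.
    rewrite h5 //; split=> // -[j [cj ej _]]; case: ak; rewrite -ej; exact: (ct_lt cj (ck j cj)).
apply: (mreach_tf (I := I)).
- have p0 : pos (ozero U) = ozero U by rewrite /pos /ct titer0.
  split=> //.
  + by move=> j; split=> [/h6|[/olt0]].
  + by rewrite p0; split=> // a /olt0.
  + by rewrite p0; split=> // a u /olt0.
- move=> j m' jk _ hI; have [h1 h2 h3 [h4 h5] [h7 h8]] := hI; have [hm' he' [n0 ln] nk _] := h1.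
  case: (classic (C mm k j)) => cj; last first.
    (* A row number that is not a member costs no iteration, and the position of the next child
       stays the same. *)
    apply: mreach_refl; have pE : pos (osucc j) = pos j by apply: ctN.
    split=> //; rewrite ?pE //.
    move=> i; rewrite h3; split=> -[ij ci]; split=> //; first by apply/oltS; left.
    by case/oltS: ij => // e; subst i.
  have [kj lj] := h_can hmm kk cj; set i := pos j; set n' := cnt m'; set mj := settb m' 6 (pr n j).
  have hk0 : trees m' 0 (rcons s i) = mk0 by have := h5 i [::] (@olt_irr U i); rewrite cats0.
  have on' : Open m' n by apply/h2.
  have hmax' x : Open m' x -> ole x n by move=> /h2/hmax.
  have hpj : pend m0 mj n (C mm k) by apply: (pend_aux h1 _ (own6 n j)).
  apply: (mreach_trans (P' := fun m1 => [/\ pend mj m1 n' (C mm j), trees m1 = trees (sett m' 0 (rcons s i) mk2),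
     forall x, Open m1 x <-> Open m' x \/ x = n' & forall p, tabs m1 6 p <-> tabs m' 6 p \/ p = pr n j])).
    apply: (@mreach_weak U M X0 B KK true false (efft b) (efft b) _ _ _ D D _
      (mreach_iter (@wp_emit_open m' m0 n k j s D h1 hx kj on' hmax' cj h3 (pathI j m' hI) hk0))) => //.
  move=> m1 _ [hp1 r1 o1 t6].
  have t1 u : u <> rcons s i -> trees m1 0 u = trees m' 0 u by move=> hu; rewrite r1 sett_neq // => -[].
  have out1 : outside B 0 s m m1 by apply: (outside_trans h8) => c' u c'B hu; rewrite r1; apply: (@outside_sett U B 0 s i mk2 m' m').
  have nn : olt n n' by [].
  have n6 p : ~ tabs m1 6 (pr n' p).
    move=> /t6[/(h_own hm' (own6 _ _))/olt_irr //|/pr_inj[e _]]; rewrite e in nn; exact: (olt_irr nn).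
  apply: (mreach_trans (P' := fun m2 => [/\ pend mj m2 n' (C mm j),
    forall x, Open m2 x <-> Open m1 x,
    (exists l, path_to (trees m2 0) (rcons s i) l /\ trees m2 0 (rcons (rcons s i) l) = mk0) /\ (forall x, C mm j x -> tabs m2 6 (pr n' x)),
    forall a u, trees m2 0 (rcons (rcons s i) a ++ u) <> mk0 <-> otree j (a :: u) &
    outside B 0 (rcons s i) m1 m2])).
    apply: (ih j lj kj) => //.
    + by apply: ext_trans hx _; case: hpj.
    + by apply/o1; right.
    + by move=> x /o1[/(Open_lt hm')|->]; [left|apply: ole_refl].
    + by apply: (path_enter (pathI j m' hI)) => //; rewrite r1 sett_eq.
    + move=> a u; have hneq : rcons (rcons s i) a ++ u <> rcons s i by move=> e; apply: (@not_kid U (rcons s i) a u).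
      by rewrite t1 // cat_rcons (h5 i _ (@olt_irr U i)).
  move=> m2 _ [hp2 o2 [[l [path2 k2]] d2] ot2 out2].
  apply: (@mreach_weak U M X0 B KK true false (efft b) (efft b) _ _ _ D D _
    (mreach_iter (@wp_emit_close m2 mj n n' (C mm j) s i l D hp2 _ _ d2 path2 k2 nn))) => //.
  + by apply/o2/o1; right.
  + by move=> x /o2/o1[/(Open_lt hm')|->]; [left|apply: ole_refl].
  move=> m3 _ [hm3 he3 c3 r3 [o3 t63]].
  have pE : pos (osucc j) = osucc i by apply: ctS.
  have ne a (u : seq ON) : a <> i -> rcons s a ++ u <> rcons s i.
    by move=> nai e; apply: nai; apply: (@rcons_catE U s a i [::] u); rewrite cats0.
  have far a u : a <> i -> trees m3 0 (rcons s a ++ u) = trees m' 0 (rcons s a ++ u).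
    move=> nai; rewrite r3 sett_neq; last by move=> -[]; apply: ne.
    rewrite out2 ?t1 //; first by apply: ne.
    by move=> [_ [a' [v e]]]; apply: nai; apply: (@rcons_catE U s a i (a' :: v) u); rewrite e cat_rcons.
  have ai_ne a : olt a i -> a <> i by move=> ai e; rewrite e in ai; case: (olt_irr ai).
  have hs3 : trees m3 0 (rcons s i) = mk3 by rewrite r3 sett_eq.
  split.
  + exact: (pend_ext hpj hm3 he3).
  + move=> x; rewrite o3 o2 o1 -h2; split=> [[[|->] h]|h] //; split; first by left.
    by move=> e; have := Open_lt hm' h; rewrite e => /olt_irr.
  + move=> x; rewrite t63.
    have -> : tabs m2 6 (pr n x) <-> tabs m1 6 (pr n x).
      have lnj : olt n (cnt mj) by [].
      case: hp2 => _ [_ e2] _ _ _; case: hp1 => _ [_ e1] _ _ _.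
      by rewrite (e2 n 6 _ (own6 n x) lnj) (e1 n 6 _ (own6 n x) lnj).
    rewrite t6 h3; split=> [[[xj cx]|/pr_inj[_ ->]]|[/oltS[xj|->] cx]].
    * by split=> //; apply/oltS; left.
    * by split=> //; apply: olt_succ.
    * by left.
    * by right.
  + rewrite pE; split=> [a /oltS[ai|->] //|a u na].
      by have := far a [::] (ai_ne a ai); rewrite cats0 => ->; apply: h4.
    rewrite far; first by apply: h5 => h; apply: na; apply/oltS; left.
    by move=> e; apply: na; rewrite e; apply: olt_succ.
  + rewrite pE; split; last first.
      by move=> c' u c'B hu; rewrite r3 (@outside_sett U B 0 s i mk3 m2 m2) // (outside_rcons out2) //; exact: out1.
    move=> a u /oltS[ai|->]; first by rewrite far; [apply: h7|apply: ai_ne].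
    have oE v : otree k (i :: v) <-> otree j v.
      by split=> /= [[x [cx ex ox]]|oj]; [have -> : j = x by apply: (ct_inj cj cx)|exists j].
    rewrite oE; case: u => [|a' u]; first by rewrite cats0 hs3.
    rewrite -cat_rcons r3 sett_neq; first exact: ot2.
    by move=> -[e]; apply: (@not_kid U (rcons s i) a' u).
- move=> w ms ml lk ll hI hpp hm lm.
  have e0 : acc (efft b) 0 < 2 by [].
  have [_ lt lr lst] := lm; have z0 := proj1 ll.
  have tr u c' : c' < B -> exists i, [/\ olt i w, trees ml c' u = trees (ms i) c' u & forall i', ole i i' -> olt i' w -> trees (ms i') c' u = trees ml c' u].
    by move=> c'B; have [i [ik h]] := lr c' u c'B; exists i; split=> //; rewrite h //; apply: ole_refl.
  have pL : pos w = sup w pos by rewrite /pos /ct titerL.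
  have posw a : olt a (pos w) -> exists i, olt i w /\ olt a (pos i) by rewrite pL => /lt_sup.
  have pmono i : olt i w -> ole (pos i) (pos w) by move=> iw; apply: ct_mono; left.
  have big a u : olt a (pos w) -> exists i, [/\ olt i w, olt a (pos i) & trees ml 0 (rcons s a ++ u) = trees (ms i) 0 (rcons s a ++ u)].
    move=> /posw[i [iw ai]]; have [i2 [i2w _ h]] := tr (rcons s a ++ u) 0 B0.
    case: (ole_olt i2 i) => hh; first by exists i; split=> //; rewrite h.
    exists i2; split=> //; first by apply: olt_le_trans ai (ct_mono _ _); left.
    by rewrite h //; apply: ole_refl.
  split.
  + apply: (pend_eqv (pend_lim (S := fun _ => C mm k) e0 ll lm hpp _)) => [i /hI[] //|x].
    by split=> [[i []]|cx] //; exists (ozero U).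
  + move=> x; split=> [[/lt[i [ik h4]] h5]|[h4 h5]].
      case: (hI i ik) => _ o _ _ _; apply/o; split=> // h; apply: h5; apply/lt; by exists i.
    split; first by apply/lt; exists (ozero U); split=> //; case: (hI _ z0) => _ o _ _ _; case: (proj2 (o x) (conj h4 h5)).
    by move=> /lt[i [ik h]]; case: (hI i ik) => _ o _ _ _; case: (proj2 (o x) (conj h4 h5)).
  + move=> x; split=> [/lt[i [iw h]]|[xw cx]].
      by case: (hI i iw) => _ _ h3 _ _; case/h3: h => xi cx; split=> //; apply: olt_trans xi iw.
    apply/lt; exists (osucc x); have sx := proj2 ll x xw; split=> //; case: (hI _ sx) => _ _ h3 _ _; apply/h3.
    by split=> //; apply: olt_succ.
  + split=> [a aw|a u na].
      have [i [iw ai e]] := big a [::] aw; rewrite cats0 in e; rewrite e.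
      by case: (hI i iw) => _ _ _ [h _] _; apply: h.
    have [i [iw -> _]] := tr (rcons s a ++ u) 0 B0; case: (hI i iw) => _ _ _ [_ h] _; apply: h => h.
    by apply: na; apply: olt_le_trans h (pmono i iw).
  + split=> [a u aw|c' u c'B hu].
      by have [i [iw ai ->]] := big a u aw; case: (hI i iw) => _ _ _ _ [h _]; apply: h.
    by have [i [iw -> _]] := tr u c' c'B; case: (hI i iw) => _ _ _ _ [_ h]; apply: h.
Qed.

End Save.

Section SaveTree.
Variables (U : zfc_universe) (M : machine) (X0 : tape U) (B KK : nat).
Local Notation ON := (ON U).
Local Notation mem := (mem U).
Local Notation wp := (@wp U M X0 B KK).
Hypothesis hKK : 32 < KK.
Implicit Types (k : ON).

Lemma wp_save (b y : nat) m D : 0 < B -> 6 < b -> b + 4 < KK -> 6 < y < b -> heap m -> Kn m (regs m y) ->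
  (forall u, trees m 0 u = mk0) ->
  wp (efft b) (save B KK y b) (fun _ m' => (forall u, trees m' 0 u <> mk0 <-> otree m (regs m y) u) /\
    forall (c' : nat) u, 0 < c' < B -> trees m' c' u = trees m c' u) D m.
Proof.
move=> B0 b6 bK hy hm ky hf; set k := regs m y.
apply: (wp_seq (Q1 := fun _ m1 => m1 = sett m 0 [::] mk4)); first by apply: wp_open_root => //; left.
move=> _ _ _ ->; set m1 := sett _ _ _ _.
have hm1 : heap m1 by apply: (heap_tabs hm) => //; apply: ole_refl.
apply: (wp_seq (Q1 := fun _ m2 => [/\ pend m m2 (cnt m) (C m k), trees m2 = trees m1, forall j, Open m2 j <-> Open m j \/ j = cnt m &
   forall p, tabs m2 6 p <-> tabs m 6 p])).
  apply: (wp_weak (@wp_enter U M X0 B KK hKK b B0 b6 bK y m1 D _ _ _ hm1 _)) => //; try lia.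
    exact: (h_own hm (ownK k) ky).
move=> _ m2 _ [hp2 r2 o2 t62]; set n := cnt m in hp2 o2.
have t2 u : u <> [::] -> trees m2 0 u = mk0 by move=> hu; rewrite r2 sett_neq ?hf // => -[].
have n6 p : ~ tabs m2 6 (pr n p) by move=> /t62/(h_own hm (own6 _ _))/olt_irr.
apply: (wp_loop (e := efft b)).
apply: (mreach_weak (@save_children U M X0 B KK hKK b B0 b6 bK m hm k ky [::] m m2 n D hp2 (ext_refl m) n6 _ _ _ _)) => //.
- by apply/o2; right.
- by move=> j /o2[/(Open_lt hm)|->]; [left|apply: ole_refl].
- split; first by rewrite r2 sett_eq.
  + by move=> p x q e; have := f_equal size e; rewrite size_cat /=; lia.
  + move=> p x q x' e lx; case: (path_sub e) => [[_ [ex _]]|[q' [_ es]]]; first by rewrite ex in lx; case: (olt0 lx).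
    by have := f_equal size es; rewrite size_cat /=; lia.
- by move=> a u; rewrite t2.
move=> m3 _ [hp3 o3 [[l [path3 k3]] d3] ot3 out3]; have [hm3 _ [_ ln3] nk3 hC3] := hp3.
have on3 : Open m3 n by apply/o3/o2; right.
have hmax3 j : Open m3 j -> ole j n by move=> /o3/o2[/(Open_lt hm)|->]; [left|apply: ole_refl].
apply: (wp_seq (Q1 := fun _ m4 => [/\ regs m4 b = n, cnt m4 = cnt m3 & eqtt m3 m4])).
  apply: (wp_sub (@wp_top U M X0 B KK hKK b (b + 1) m3 n D _ _ _ hm3 on3 hmax3)) => //; try lia.
move=> _ m4 _ [b4 c4 [t4 r4]]; have hm4 : heap m4 by apply: (heap_tabs hm3 t4); right.
apply: (wp_bind (Q1 := fun v m5 => [/\ v = 0, regs m5 b = n & eqtt m3 m5])).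
  apply: (wp_weak (@wp_find_kid U M X0 B KK hKK b B0 b6 bK m4 n D hm4 b4)) => //.
  move=> v m5 _ [[t5 r5] c5 b5 h]; have et5 : eqtt m3 m5 by split; rewrite ?t5 ?r5.
  move: h; rewrite /C t4; case=> [[_ [h1 h2 _]]|[-> _]] //.
  by case: h2; apply: d3; apply/hC3.
move=> _ m5 _ [-> b5 [t5 r5]] /=.
apply: (wp_seq (Q1 := fun _ m6 => m6 = settb m5 5 n)).
  apply: wp_set; try lia; last by rewrite b5.
  by rewrite b5; apply: (kext_set (own5 n)); rewrite /Kn t5.
move=> _ _ _ ->; apply: (wp_bind (Q1 := fun v m6 => v = 2 /\ m6 = sett (settb m5 5 n) 0 [::] mk0star)).
  by apply: (wp_tree (s := [::]) (a := l)) => //=; rewrite ?r5 //; left.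
move=> _ _ _ [-> ->] /=; apply: wp_ret; split=> //; split=> [u|c' u hc].
  case: u => [|a u]; first by rewrite sett_eq.
  by rewrite sett_neq //= r5; apply: (ot3 a u).
rewrite sett_neq; last by move=> [e]; lia.
rewrite /= r5 out3; [|by lia|by case; lia].
by rewrite r2 sett_neq // => -[e]; lia.
Qed.

(** The output tree is an instance of [stree], so that it is a code of the value follows from the
    general construction. *)
Lemma otree_stree m k : heap m -> Kn m k -> otree m k = stree (hv m) (Kn m) (hv m k).
Proof.
move=> hm kk; apply: predext => s.
have kE i : Kn m i -> kids (hv m) (Kn m) (hv m i) = C m i.
  move=> ki; apply: predext => j.
  split=> [[kj h]|cj]; first by apply/(pt_in hm (conj ki erefl) (conj kj erefl)).
  by split; [case: (h_can hm ki cj)|apply/in_hv => //; exists j].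
elim: s k kk => [|a s ih] k kk //=; rewrite kE //.
split=> -[j [cj ej h]]; exists j; have [kj _] := h_can hm kk cj; split=> //; by [apply/ih|apply/(ih j)].
Qed.

Lemma otree_code m k : heap m -> Kn m k -> basic_code (otree m k) /\ Decode (otree m k) (hv m k).
Proof.
move=> hm kk; rewrite otree_stree //.
have h1 j : Kn m j -> olt j (cnt m) by apply: (h_own hm (ownK j)).
have h y z : (exists i, Kn m i /\ hv m i = y) -> z ∈ y -> exists j, Kn m j /\ hv m j = z.
  by move=> [i [ki <-]] /(in_hv _ hm ki)[j [cj ->]]; exists j; split=> //; case: (h_can hm ki cj).
have py : exists i, Kn m i /\ hv m i = hv m k by exists k.
by split; [apply: (stree_code (hv m) h1 h py)|apply: (stree_Decode h h py)].
Qed.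

End SaveTree.

(** * The whole machine: setup, phases and correctness *)

Fixpoint roots k := if k is k'.+1 then seqc (Act (fun _ => (mk1, mvJPlus, 0))) (roots k') else Ret 0.
(** At a blank root the erasing step could not move, so the roots between the two sentinels are
    marked as well. *)
Definition setup B K := seqc (jmp mvJPlus B) (seqc (Act (fun _ => (mkstar, mvJPlus, 0))) (seqc (roots K.-1)
  (seqc (Act (fun _ => (mkstar, mvS, 0))) (seqc (jmp mvJMinus (B + K)) (Ret 0))))).
Definition erase_trees B := seqc erase (seqc (jmp mvJMinus B) (Ret 0)).
(** The star at the root of [B] would stop the pass at once. It is blanked separately, and the pass
    starts at the first row of that component. *)
Definition erase_regs B K := seqc (jmp mvJPlus B) (seqc (Act (fun _ => (mk0, mvZ, 0))) (seqc erase
  (seqc (Act (fun _ => (mk0, mvS, 0))) (seqc (jmp mvJMinus (B + K)) (Ret 0))))).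
Fixpoint loads B KK b k := if k is k'.+1 then seqc (loads B KK b k') (seqc (load B KK k' b) (copy B KK (7 + k') (b + 2))) else Ret 0.

Section Phases.
Variables (U : zfc_universe) (M : machine) (X0 : tape U) (B KK : nat).
Local Notation tape := (tape U).
Local Notation mem := (mem U).
Local Notation K := (KK.*2).
Local Notation wp := (@wp U M X0 B KK).
Local Notation exec := (@exec U M X0).
Local Notation origin := (origin U).
Local Notation o0 := (fun _ : mark => 0).
Hypothesis hKK : 32 < KK.
Implicit Types (X Y : tape).

(** Monotonicity of marks matters only for the limits inside a phase. Phases that use the opposite
    ranks [rk] and [rkd] are composed after weakening both to the constant rank. *)
Lemma exec_any o lb c h X Q D : exec o lb c h X Q D -> exec o0 lb c h X Q D.
Proof.
move=> he n ex em a ca; case: (he n ex em a ca) => [|[a' [v [h' [X' [h1 h2 [h3 h4] h5]]]]]]; first by left.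
right; exists a', v, h', X'; split=> //; split=> // g ag ga.
by have [d [k1 k2 k3 _ _]] := h4 g ag ga; exists d.
Qed.

Lemma wp_exec e c (Q : nat -> mem -> Prop) D m X : wp e c Q D m -> Rep B KK m X ->
  exec o0 origin c origin X (fun v h Y => h = origin /\ exists m', [/\ Rep B KK m' Y, mstep e m m' & Q v m']) D.
Proof.
move=> h hX; apply: exec_any; apply: (exec_weak (h X hX)) => //.
by move=> v h' Y _ [-> [m' [h1 _ h2 h3]]]; split=> //; exists m'.
Qed.

Definition rooted c k X : tape := fun d => if d.2 is [::] then if c <= d.1 < c + k then mk1 else X d else X d.

Lemma exec_roots c k X Q D : Q 0 (c + k, [::]) (rooted c k X) -> exec o0 origin (roots k) (c, [::]) X Q D.
Proof.
elim: k c X => [|k ih] c X q /=.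
  apply: exec_ret; move: q; rewrite addn0; have -> // : rooted c 0 X = X.
  apply: funext => -[c' [|a s]] //=; rewrite /rooted /= addn0.
  by case: ifP => //; lia.
apply: (exec_seq (Q1 := fun _ h Y => h = (c.+1, [::]) /\ Y = upd X (c, [::]) mk1)).
  apply: (exec_act (k := mk1) (mv := mvJPlus) (v := 0) (h' := (c.+1, [::]))) => //.
  - exact: (moves_jplus (onat U c) [::]).
move=> _ _ _ _ [-> ->]; apply: ih; rewrite addSnnS.
have <- // : rooted c k.+1 X = rooted c.+1 k (upd X (c, [::]) mk1).
apply: funext => -[c' [|a s]] //=; rewrite /rooted /=; last by rewrite upd_neq.
case: (c' =P c) => [->|ne]; first by rewrite upd_eq; do ! case: ifP => //; lia.
by rewrite upd_neq; [do ! case: ifP => //; lia|case].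
Qed.

Definition framed X : tape := fun d => if d.2 is [::] then
  if (d.1 == B) || (d.1 == B + K) then mkstar else if B < d.1 < B + K then mk1 else X d else X d.

Lemma exec_setup X Q D : Q 0 origin (framed X) -> exec o0 origin (setup B K) origin X Q D.
Proof.
move=> q; apply: exec_jmpS; first exact: cle_refl.
rewrite add0n; apply: (exec_seq (Q1 := fun _ h Y => h = (B.+1, [::]) /\ Y = upd X (B, [::]) mkstar)).
  apply: (exec_act (k := mkstar) (mv := mvJPlus) (v := 0) (h' := (B.+1, [::]))) => //.
  - exact: (moves_jplus (onat U B) [::]).
move=> _ _ _ _ [-> ->].
apply: (exec_seq (Q1 := fun _ h Y => h = (B + K, [::]) /\ Y = rooted B.+1 K.-1 (upd X (B, [::]) mkstar))).
  by apply: exec_roots; split=> //; congr pair; lia.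
move=> _ _ _ _ [-> ->].
apply: (exec_seq (Q1 := fun _ h Y => h = (B + K, [::]) /\ Y = framed X)).
  apply: (exec_act (k := mkstar) (mv := mvS) (v := 0) (h' := (B + K, [::]))) => //.
  - exact: moves_s.
  - split=> //; apply: funext => -[c s]; rewrite /framed /=.
    case: s => [|a s]; last by rewrite upd_neq // /rooted /= upd_neq.
    case: (c =P B + K) => [->|nK]; first by rewrite upd_eq orbT.
    rewrite upd_neq; last by case.
    rewrite /rooted /= orbF; case: (c =P B) => [->|nB].
      by rewrite upd_eq; case: ifP => //; lia.
    by rewrite upd_neq; [do ! case: ifP => //; lia|case].
move=> _ _ _ _ [-> ->]; apply: (@exec_jmpM U M X0 o0 origin (B + K) (Ret 0) 0 [::]) => //.
exact: exec_ret.
Qed.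

Definition mem0 X : mem := Mem (fun _ => ozero U) (fun _ _ => False) (fun c s => X (c, s)).

Lemma Rep_framed X : (forall c s, B <= c -> X (c, s) = mk0) -> Rep B KK (mem0 X) (framed X).
Proof.
move=> hX; exists (ozero U).
have fE c s : s <> [::] -> B <= c -> framed X (c, s) = mk0.
  by move=> hs Bc; rewrite /framed /=; case: s hs => [//|a s] _; apply: hX.
have rB r : B <= rc B r by rewrite /rc leq_addr.
have tB r : B <= tc B r by rewrite /tc leq_addr.
constructor.
- by move=> c s cB; rewrite /framed /=; case: s => // ; do ! (case: ifP; first lia).
- by rewrite /framed /= eqxx.
- by move=> c hc; rewrite /framed /=; case: ifP; [lia|rewrite hc].
- by rewrite /framed /= eqxx orbT.
- move=> r a rK; exists (ozero U); split; last by move=> t /olt0.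
  by split=> t; [rewrite fE //; split=> // /olt0|move=> /olt0].
- by move=> r a rK /=; split=> [[t [h _]]|/olt0 //]; rewrite fE in h.
- by move=> r a rK; split=> [/olt0 //|]; rewrite fE.
- move=> t a tK; rewrite fE //; split=> //.
  by move=> /olt0.
- move=> c s Bc; case: (classic (s = [::])) => [->|hs]; last by rewrite fE.
  move=> h; constructor 1; split=> //; rewrite leqNgt; apply/negP => lt; apply: h; rewrite /framed /=.
  by do ! (case: ifP; first lia); move=> _ _; apply: hX.
Qed.

Lemma exec_erase c k Y Q D : (forall i, c <= i < c + k -> [/\ shape (fun u => Y (i, u) <> mk0), forall u, Y (i, u) <> mkstar & Y (i, [::]) <> mk0]) ->
  Y (c + k, [::]) = mkstar -> Q 0 (c + k, [::]) (fun d => if c <= d.1 < c + k then mk0 else Y d) ->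
  exec rkd origin erase (c, [::]) Y Q D.
Proof.
move=> hY hS q; apply: exec_loop.
apply: (reach_weak (@erase_range U M X0 c k Y hY)) => //.
move=> h' X' _ [-> ->]; split; first exact: cle_origin.
set Z := (fun d => _) in q *.
have zS : Z (c + k, [::]) = mkstar by rewrite /Z /=; case: ifP => //; lia.
apply: (exec_act (k := mkstar) (mv := mvS) (v := 1) (h' := (c + k, [::]))); rewrite ?zS //.
- exact: moves_s.
- by split=> //; rewrite upd_idE.
Qed.

Lemma exec_erase_trees Y Q D : (forall i, i < B -> [/\ shape (fun u => Y (i, u) <> mk0), forall u, Y (i, u) <> mkstar & Y (i, [::]) <> mk0]) ->
  Y (B, [::]) = mkstar -> Q 0 origin (fun d => if d.1 < B then mk0 else Y d) -> exec o0 origin (erase_trees B) origin Y Q D.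
Proof.
move=> hY hS q; apply: (exec_seq (Q1 := fun _ h Z => h = (B, [::]) /\ Z = fun d => if d.1 < B then mk0 else Y d)).
  apply: (exec_any (o := rkd)); apply: (@exec_erase 0 B) => //.
move=> _ _ _ _ [-> ->]; apply: (@exec_jmpM U M X0 o0 origin B (Ret 0) 0 [::]) => //.
exact: exec_ret.
Qed.

(** Touched rows and histories are initial segments, so each of these components is a tree with
    sequences of length at most two. *)
Lemma raw_shape u rb tb tr Y c : raw B KK u rb tb tr Y -> B <= c < B + K -> shape (fun s => Y (c, s) <> mk0).
Proof.
move=> hr hc; have al a := raw_alive a hr hc.
have root : Y (c, [::]) <> mk0.
  by case: (c =P B) => [->|ne]; [rewrite (raw_base hr)|rewrite (raw_root hr) //; lia].
have forms s : Y (c, s) <> mk0 -> [\/ s = [::], exists a, s = [:: a] |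
    exists a t r, [/\ s = [:: a; t], r < KK & c = rc B r]].
  case/(raw_blank hr (c := c)) => [|[-> _]|[a [-> _]]|[a [t [r [-> h1 h2]]]]]; first by lia.
  - by constructor 1.
  - by constructor 2; exists a.
  - by constructor 3; exists a, t, r.
have hist2 a t : Y (c, [:: a; t]) <> mk0 -> olt a u /\ exists r L, [/\ c = rc B r, r < KK & hist Y c a L].
  move=> n; case: (forms _ n) => [//|[x []] //|[x [t' [r [[ex et] rK ec]]]]]; subst x t'.
  have [L [hL hu]] := raw_hist hr a rK; rewrite -ec in hL; split; last by exists r, L.
  by apply: (hu t); apply/(proj1 hL).
split.
- move=> [|a [|b [|e s]]] // t n.
  + case: t n => [|b t] // n; apply/al; have e : t = [::].
      by case: (forms _ n) => [|[x []]|[x [y [r [[_ _ ->]]]]]].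
    by rewrite e in n; case: (hist2 a b n).
  + have e : t = [::] by case: (forms _ n) => [|[x []]|[x [y [r [[_ _ ->]]]]]].
    by rewrite e in n.
  + by case: (forms _ n) => [|[x []]|[x [y [r []]]]].
- move=> s a b n ba; case: (forms _ n) => [e|[x e]|[x [t [r [e rK ec]]]]].
  + by case: s {n} e.
  + case: s n e => [|y [|z s]] //= n [ex]; subst; apply/al; apply: olt_trans ba _; exact/al.
  + case: s n e => [|y [|z [|w s]]] //= n [ex ey]; subst.
    have [_ [r' [L [_ _ hL]]]] := hist2 _ _ n; apply/(proj1 hL); apply: olt_trans ba _; exact/(proj1 hL).
- move=> s; case: s => [|x [|y s]] /=.
  + by exists u => /al/olt_irr.
  + case: (classic (exists t, Y (c, [:: x; t]) <> mk0)) => [[t /hist2[_ [r [L [_ _ hL]]]]]|n]; last by exists (ozero U) => h; apply: n; exists (ozero U).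
    by exists L => /(proj1 hL)/olt_irr.
  + by exists (ozero U) => /forms[|[a]|[a [t [r []]]]] //; case: s.
- by move=> [h hh]; case: (forms _ (hh 3)) => [|[a]|[a [t [r []]]]].
Qed.

Lemma raw_nostar u rb tb tr Y c s : raw B KK u rb tb tr Y -> B <= c < B + K -> (c, s) <> (B, [::]) -> Y (c, s) <> mkstar.
Proof.
move=> hr hc ne e.
have n0 : Y (c, s) <> mk0 by rewrite e.
case: (raw_blank hr (c := c) (s := s) _ n0) => [|[es _]|[a [es _]]|[a [t [r [es rK ec]]]]]; first by lia.
- subst s; have nB : c <> B by move=> eB; apply: ne; rewrite eB.
  by move: e; rewrite (raw_root hr) //; lia.
- subst s; case: (row_comp hc) => [[r rK ec]|[t tK ec]]; rewrite ec in e n0.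
    by case: (raw_row hr a rK) => h h'; rewrite (h (h' n0)) in e.
  by case: (raw_tab hr a tK) => h h' _; case: (h (h' n0)) => h2; rewrite h2 in e.
- subst; have [L [hL _]] := raw_hist hr a rK.
  have tL : olt t L by apply/(proj1 hL).
  by case: (proj2 hL t tL) => h; rewrite h in e.
Qed.

Lemma exec_erase_regs m Y Q D : Rep B KK m Y ->
  Q 0 origin (fun d => if d.1 < B then trees m d.1 d.2 else mk0) -> exec o0 origin (erase_regs B K) origin Y Q D.
Proof.
move=> [u hr] q; apply: exec_jmpS; first exact: cle_refl.
rewrite add0n; apply: (exec_seq (Q1 := fun _ h Z => h = (B, [:: ozero U]) /\ Z = upd Y (B, [::]) mk0)).
  apply: (exec_act (k := mk0) (mv := mvZ) (v := 0) (h' := (B, [:: ozero U]))) => //.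
  - exact: (moves_z (cell_seq (B, [::]))).
move=> _ _ _ _ [-> ->]; set Y1 := upd Y (B, [::]) mk0.
have BK : B <= B < B + K by lia.
pose Y2 : tape := fun d => if B <= d.1 < B + K then mk0 else Y d.
have Y1E d : d <> (B, [::]) -> Y1 d = Y d by move=> h; rewrite /Y1 upd_neq.
apply: (exec_seq (Q1 := fun _ h Z => h = (B + K, [::]) /\ Z = Y2)).
  apply: (exec_any (o := rkd)); apply: exec_loop.
  apply: (reach_weak (st := false) (lb := origin) (P := fun h Z => h = (B + K, [::]) /\ Z = Y2) (D := False)) => //; last 1 first.
  - move=> h' X' _ [-> ->]; split; first exact: cle_origin.
    have zS : Y2 (B + K, [::]) = mkstar by rewrite /Y2 /=; case: ifP; [lia|rewrite (raw_sent hr)].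
    apply: (exec_act (k := mkstar) (mv := mvS) (v := 1) (h' := (B + K, [::]))); rewrite ?zS //.
    + exact: moves_s.
    + by split=> //; split=> //; rewrite upd_idE.
  - apply: (reach_trans (P' := fun h Z => h = (B.+1, [::]) /\ Z = zap Y1 B [::])).
      apply: (reach_weak (@erase_below U M X0 B _ (raw_shape hr BK) Y1 _ _ _)) => //.
      + by move=> a s; rewrite Y1E.
      + by move=> a s; rewrite Y1E //; apply: (raw_nostar hr BK).
      + by rewrite /Y1 upd_eq.
    move=> _ _ _ [-> ->].
    have zE d : zap Y1 B [::] d = if d.1 == B then mk0 else Y d.
      rewrite /zap; case: eqP => e; first by rewrite ifT //; split=> //; exists d.2.
      rewrite ifF; last by case.
      by rewrite Y1E // => e2; apply: e; rewrite e2.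
    apply: (reach_weak (@erase_range U M X0 B.+1 K.-1 _ _)) => //; last 1 first.
    + move=> h' X' _ [-> ->]; split; first by congr pair; lia.
      apply: funext => d; rewrite /Y2 zE.
      by case: eqP => e; do ! case: ifP => //; lia.
    + move=> i hi; have hi' : B <= i < B + K by lia.
      have zi s : zap Y1 B [::] (i, s) = Y (i, s) by rewrite zE /=; case: eqP => //; lia.
      have -> : (fun s => zap Y1 B [::] (i, s) <> mk0) = (fun s => Y (i, s) <> mk0).
        by apply: funext => s; rewrite zi.
      split; first exact: raw_shape hr hi'.
        by move=> s; rewrite zi; apply: (raw_nostar hr hi') => -[e]; lia.
      by rewrite zi (raw_root hr) //; lia.
move=> _ _ _ _ [-> ->].
apply: (exec_seq (Q1 := fun _ h Z => h = (B + K, [::]) /\ Z = fun d => if d.1 < B then trees m d.1 d.2 else mk0)).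
  apply: (exec_act (k := mk0) (mv := mvS) (v := 0) (h' := (B + K, [::]))) => //.
  - exact: moves_s.
  - split=> //; apply: funext => -[c s] /=.
    case: (classic ((c, s) = (B + K, [::]))) => [[-> ->]|ne]; first by rewrite upd_eq; case: ifP => //; lia.
    rewrite upd_neq // /Y2 /=; case: (ltnP c B) => cB /=; first exact: (raw_trees hr).
    case: ifP => // hc; apply: NNPP => h.
    case: (raw_blank hr cB h) => [[es cK]|[a [es cK]]|[a [t [r [es rK ec]]]]].
    + by apply: ne; rewrite es; congr pair; lia.
    + by lia.
    + by rewrite /rc in ec; lia.
move=> _ _ _ _ [-> ->]; apply: (@exec_jmpM U M X0 o0 origin (B + K) (Ret 0) 0 [::]) => //.
exact: exec_ret.
Qed.

End Phases.

(** The labelling of an induced code satisfies the recursion of [Decode]; only the order of the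
    elements is forgotten. *)
Lemma induced_label (U : zfc_universe) (x f : U) X : induced_code x f X ->
  exists t : seq (ON U) -> U, t [::] = x /\ forall s, X s -> forall z, z ∈ t s <-> exists a, X (rcons s a) /\ z = t (rcons s a).
Proof.
move=> [_ [t [t0 ht]]]; exists t; split=> // s xs z; have [a [e [[h1 h2 _] h4]]] := ht s xs.
split=> [/h2[b [ba <-]]|[b [xb ->]]].
  by exists b; have [h5 h6] := h4 b; split; [apply/h5|rewrite h6].
by have [h5 h6] := h4 b; have ba := proj1 h5 xb; rewrite h6 //; apply: h1.
Qed.

Lemma Decode_uniq (U : zfc_universe) X (y y' : U) : basic_code X -> Decode X y -> Decode X y' -> y = y'.
Proof.
move=> hX [d [hd <-]] [d' [hd' <-]]; have hs := basic_shape hX; have [_ n0 _ _ _] := hX.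
move: [::] n0; apply: (shape_ind hs) => s ns ih; apply: extensionality => z.
by rewrite hd // hd' //; split=> -[a [na ->]]; exists a; rewrite ih.
Qed.

Section Machine.
Variables (U : zfc_universe) (n : nat) (F : classfun U n) (sz : nat) (prog : nat -> nat -> seq nat -> nat -> nat -> cmd).
Hypothesis n0 : 0 < n.
Hypothesis hF : computes F sz prog.
Local Notation mem := (mem U).

(** Registers 7 to 6 + n hold the arguments, 7 + n the value, and scratch space starts at 8 + n. The
    constant 41 is generous: it leaves room for loading and saving and ensures [32 < KK]. *)
Definition KK := 41 + n + sz.
Definition whole := seqc (setup n KK.*2) (seqc (loads n KK (8 + n) n) (seqc (erase_trees n)
  (seqc (prog n KK (iota 7 n) (7 + n) (8 + n)) (seqc (save n KK (7 + n) (8 + n)) (erase_regs n KK.*2))))).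

Variables (x : n.-tuple U) (X : tape U).
Hypothesis hX : canonical_code x X.
Variable M : machine.
Local Notation wp := (@wp U M X n KK).

Definition loaded k (m0 m : mem) := [/\ heap m, forall j, ~ Open m j, forall i, i < k -> pt m (regs m (7 + i)) (nth empty x i),
  forall (c : nat) u, k <= c < n -> trees m c u = X (c, u) & tame n m0 m].

Lemma K32 : 32 < KK. Proof. by rewrite /KK; lia. Qed.

Lemma wp_loads k m0 D : k <= n -> loaded 0 m0 m0 -> wp (efft 7) (loads n KK (8 + n) k) (fun _ m => loaded k m0 m) D m0.
Proof.
move=> kn h0; elim: k kn => [|k ih] kn /=; first by apply: wp_ret.
apply: wp_seq; first by apply: ih; lia.
move=> _ m1 _ [hm1 no1 p1 t1 tm1].
have [_ marks codes] := hX; have [wf1 _ wf3 _] : well_formed n X by case: hX.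
have [t [f [_ _ ind]]] := codes (Ordinal kn); rewrite (tnth_nth empty) /= in ind.
have [dec [d0 hdec]] := induced_label ind.
have bc : basic_code (component X k) by case: ind.
apply: (wp_seq (Q1 := fun _ m2 => [/\ heap m2, ext m1 m2 /\ tame n m1 m2, pt m2 (regs m2 (8 + n + 2)) (nth empty x k), forall j, ~ Open m2 j &
   (forall (c : nat) u, c < n -> c <> k -> trees m2 c u = trees m1 c u) /\ forall i, i < k -> regs m2 (7 + i) = regs m1 (7 + i)])).
  apply: (wp_weak (@wp_load U M X n KK K32 k (8 + n) (component X k) dec kn _ _ (basic_shape bc) hdec m1 D hm1 no1 _ _)) => //.
  - by rewrite /KK; lia.
  - move=> u /=; rewrite t1; last by lia.
    by split=> [|h]; [case: (marks (k, u))|apply: NNPP].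
  - by case: bc.
  - split=> // r; rewrite /=; case: eqP => // _; case: ifP => // h; case: ifP => //; lia.
  move=> _ m2 s2 [h1 h2 h3 h4 [h5 h6]]; rewrite d0 in h3; split=> //; split=> // i ik.
  by apply: (mstepC s2); apply: efft_hi; lia.
move=> _ m2 _ [hm2 [he2 tm2] p2 no2 [t2 r2]].
apply: wp_copy; rewrite /KK; try lia; first by [].
split.
- exact: heap_setr.
- exact: no2.
- move=> i; rewrite ltnS leq_eqVlt => /orP[/eqP ->|ik]; apply/pt_setr; rewrite /=.
    by rewrite eqxx.
  have -> : (7 + i == 7 + k) = false by apply/eqP; lia.
  by rewrite r2 //; apply: pt_ext he2 (p1 i ik).
- by move=> c u hc /=; rewrite t2 ?t1 //; lia.
- exact: tame_trans tm1 tm2.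
Qed.

Lemma exec_whole : @exec U M X (fun _ => 0) (origin U) whole (origin U) X
  (fun _ h Y => h = origin U /\ exists y, [/\ F x = Some y, well_formed 1 Y & Decode (component Y 0) y]) (F x = None).
Proof.
have [[wf1 _ wf3 wf4] marks codes] := hX.
have blank c s : n <= c -> X (c, s) = mk0 by move=> nc; apply: NNPP; apply: wf4.
apply: (exec_seq (Q1 := fun _ h Y => h = origin U /\ Rep n KK (mem0 X) Y)).
  by apply: exec_setup; split=> //; apply: Rep_framed.
move=> _ _ Y0 _ [-> hY0].
have l0 : loaded 0 (mem0 X) (mem0 X).
  split=> //.
  - by move=> j [].
  - exact: tame_refl.
apply: (exec_seq (Q1 := fun _ h Y => h = origin U /\ exists m, Rep n KK m Y /\ loaded n (mem0 X) m)).
  apply: (exec_weak (wp_exec (wp_loads (F x = None) (leqnn n) l0) hY0)) => //.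
  by move=> v h Y _ [-> [m [h1 _ h2]]]; split=> //; exists m.
move=> _ _ Y1 _ [-> [m1 [hY1 [hm1 no1 p1 _ tm1]]]].
(* The input trees have served their purpose. The memory keeps its registers and tables but has
   empty trees from now on, which frees component 0 for the value. *)
pose m2 : mem := Mem (regs m1) (tabs m1) (fun _ _ => mk0).
apply: (exec_seq (Q1 := fun _ h Y => h = origin U /\ Rep n KK m2 Y)).
  have [u hr] := hY1; apply: (exec_erase_trees K32).
  - move=> i iN; have E s : Y1 (i, s) = trees m1 i s by apply: (raw_trees hr).
    have NE : (fun s => Y1 (i, s) <> mk0) = component X i.
      apply: predext => s; rewrite E /component.
      by case: (tm1 i s iN) => [->|[h1 h2 _]] //.
    have bc := wf3 i iN; split; first by rewrite NE; apply: basic_shape.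
      move=> s; rewrite E; case: (tm1 i s iN) => [->|[_ _] //] /=.
      by case: (marks (i, s)) => ->.
    have [_ h _ _ _] := bc; rewrite -NE in h; exact: h.
  - exact: (raw_base hr).
  - split=> //; exists u; apply: (raw_out hr) => c s hc; last by rewrite /= hc.
    by rewrite /= ltnNge hc.
move=> _ _ Y2 _ [-> hY2].
have hm2 : heap m2 by apply: (heap_tabs hm1) => //; apply: ole_refl.
have v2 : vals m2 (iota 7 n) x.
  split; first by rewrite size_iota size_tuple.
  move=> i; rewrite size_iota => iN; rewrite nth_iota //; apply/(pt_tabs (m := m1)) => //; exact: p1.
have ok : argsok (iota 7 n) (7 + n) (8 + n).
  split; [apply/allP => r|apply/negP|]; rewrite ?mem_iota; lia.
apply: (exec_seq (Q1 := fun _ h Y => h = origin U /\ exists m y, [/\ Rep n KK m Y, heap m, F x = Some y, pt m (regs m (7 + n)) y & trees m = fun _ _ => mk0])).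
  have szK : 8 + n + sz <= KK by rewrite /KK; lia.
  apply: (exec_weak (wp_exec (hF (M := M) (X0 := X) (B := n) K32 szK ok hm2 v2) hY2)) => //.
  move=> v h Y _ [-> [m3 [h1 [_ _ _ h5 _] [h2 h3 [y h4 h6]]]]]; split=> //; exists m3, y; split=> //; exact: h5.
move=> _ _ Y3 _ [-> [m3 [y [hY3 hm3 fy [ky py] t3]]]].
apply: (exec_seq (Q1 := fun _ h Y => h = origin U /\ exists m, [/\ Rep n KK m Y, forall u, trees m 0 u <> mk0 <-> otree m3 (regs m3 (7 + n)) u &
    forall (c : nat) u, 0 < c < n -> trees m c u = mk0])).
  apply: (exec_weak (wp_exec (@wp_save U M X n KK K32 (8 + n) (7 + n) m3 (F x = None) n0 _ _ _ hm3 ky _) hY3)) => //.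
  - by rewrite /KK; lia.
  - by lia.
  - by rewrite t3.
  - by move=> v h Y _ [-> [m4 [h1 _ [h2 h3]]]]; split=> //; exists m4; split=> // c u hc; rewrite h3 // t3.
move=> _ _ Y4 _ [-> [m4 [hY4 h4 h5]]].
apply: (@exec_erase_regs U M X n KK K32 m4 Y4 _ _ hY4); split=> //; exists y.
set Y : tape U := fun d => _.
have [bc dc] := otree_code hm3 ky; rewrite py in dc.
have YE : component Y 0 = otree m3 (regs m3 (7 + n)).
  by apply: predext => s; rewrite /component /Y /= n0; apply: h4.
have Y0' c s : 0 < c -> Y (c, s) = mk0.
  by move=> c0; rewrite /Y /=; case: ifP => // cn; rewrite h5 // c0.
split=> //; last by rewrite YE.
split=> //.
- apply: (@is_set_cells U _ 1) => [c s|[|c] // _].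
    by case: c => // c h; case: h; apply: Y0'.
  have -> : (fun s => Y (0, s) <> mk0) = otree m3 (regs m3 (7 + n)) by rewrite -YE.
  by case: bc.
- by case=> // _; rewrite YE.
- by move=> c c1 s h; apply: h; apply: Y0'.
Qed.

End Machine.

Lemma computes_TUR (U : zfc_universe) n (F : classfun U n) sz prog : 0 < n -> computes F sz prog -> TUR F.
Proof.
move=> n0 hF; split=> //; pose M := compile (whole n sz prog); exists M => x y.
have run X : canonical_code x X -> (F x = None /\ never M X (ozero U)) \/
    exists Y y', [/\ outputs M X Y, F x = Some y', well_formed 1 Y & Decode (component Y 0) y'].
  move=> hX; have em : emb M (whole n sz prog) 0 (fun _ => None) by apply: code_emb.
  have st : entry (whole n sz prog) 0 (fun _ => None) = Some 0 by case: (n) n0.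
  have := @exec_whole U n F sz prog n0 hF x X hX M 0 (fun _ => None) em (ozero U); rewrite st => /(_ (conf0 M X)).
  case=> [[? ?]|[a [v [h [Y [_ [r [hr er]] _ [eh [y' [h1 h2 h3]]]]]]]]]; first by left.
  right; exists Y, y'; split=> //; exists a, r; rewrite er /=; split=> //; by exists 1.
split=> [fy X hX|hM].
  case: (run X hX) => [[fn _]|[Y [y' [h1 fy' h2 h3]]]]; first by rewrite fy in fn.
  by exists Y; split=> //; rewrite fy in fy'; case: fy' => ->.
(* Without a code [machine_value] would hold vacuously of every [y]. *)
have [X hX] := canonical_ex x n0.
have [Y [[a [r [hr hs ht hh _]]] hw hd]] := hM X hX.
have ca : Conf M X a (r a) by exists r.
case: (run X hX) => [[_ nv]|[Y' [y' [[a' [r' [hr' hs' ht' hh' _]]] fy hw' hd']]]].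
  by case: (nv a (r a) (ole0 a) ca).
(* No step leads out of the halting state, so two halting runs on the same tape stop at the same
   time and with the same tape. *)
have halt b b' q q' : is_run M X b q -> c_state (q b) = None -> is_run M X b' q' -> ~ olt b b'.
  move=> hq e hq' lt; have [_ s _] := hq'; have [i [_ [es _] _ _ _]] := s b lt.
  have cb : Conf M X b (q b) by exists q.
  have cb' : Conf M X b (q' b) by exists q'; split=> //; apply: is_run_le hq' _; left.
  by rewrite -(conf_det cb cb') e in es.
have ea : a = a'.
  case: (olt_total a a') => // lt; first by case: (halt _ _ _ _ hr hs hr' lt).
  by case: (halt _ _ _ _ hr' hs' hr lt).
subst a'; have ca' : Conf M X a (r' a) by exists r'.
have eY : Y = Y' by rewrite -ht -ht' (conf_det ca ca').
rewrite fy; congr Some; subst Y'; have [_ _ bc _] := hw.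
by rewrite -eY in hd'; exact: (Decode_uniq (bc 0 isT) hd' hd).
Qed.

Theorem corollary31 (U : zfc_universe) (n : nat) (F : classfun U n)
    (hn : 0 < n) :
  REC F -> TUR F.
Proof. by move=> /REC_computes[sz [prog h]]; apply: (computes_TUR hn h). Qed.
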